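(* Let $D\in\{1,2,3\}$ and let $\mathcal W=\widehat W$ be given by formula (E3) of the context for $D=3$ (scalar setting), by (E2) for $D=2$, or by (E1) for $D=1$. Assume $M\equiv1$ and that the elastic moduli of the two phases are equal, $\alpha_1=\alpha_2$. For $D=2$, let $\det(\varepsilon_2^T-\varepsilon_1^T)\le0$, and let the standing conditions hold that (C1) $\beta^*(d,\varepsilon)$ is independent of $\varepsilon$ and (C2) $\alpha_i$ and $T$ commute whenever $\beta^*\in\{\gamma^*,\beta_{II}\}$. Let the initial data $a_0,b_0:\Omega\to\mathbb R$ satisfy $0\le a_0+b_0\le1$, $0\le a_0-b_0\le1$ and $\mathcal W(a_0+b_0,\varepsilon(\mathbf u(x,0)))<\infty$, where $\mathbf u(\cdot,0)$ is the solution of $\mathrm{div}\big(\partial_\varepsilon\mathcal W(a_0+b_0,\varepsilon(\mathbf u))\big)=\mathbf 0$ with $\partial_\varepsilon\mathcal W(a_0+b_0,\varepsilon(\mathbf u))\,\mathbf n=\sigma_{\rm ext}\mathbf n$ on $\partial\Omega$. Then the weak solution $(a,b,\mathbf u)$ of $$\partial_t a=\lambda\,\Delta\frac{\partial F}{\partial a},\qquad \partial_t b=-\frac{\partial F}{\partial b},\qquad \mathbf 0=\mathrm{div}\big(\partial_\varepsilon\mathcal W(a+b,\varepsilon(\mathbf u))\big)\quad\text{in }\Omega_{\mathcal T},$$ with the initial and boundary conditions given in the context, having the properties (i) $a,b\in C^{0,\frac14}([0,\mathcal T];L^2(\Omega))$, (ii) $\partial_t a\in L^2(0,\mathcal T;H^1(\Omega)^*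 )$, $\partial_t b\in L^2(\Omega_{\mathcal T})$, (iii) $\mathbf u\in L^\infty(0,\mathcal T;H^1(\Omega;\mathbb R^D))$, (iv) $0\le a+b\le1$ and $0\le a-b\le1$ in $\Omega_{\mathcal T}$, is unique in this class: any two weak solutions with the same initial data and with properties (i)–(iv) coincide.
   Context: **Setting.** $\Omega\subset\mathbb R^D$ is a bounded domain with Lipschitz boundary and outer unit normal $\mathbf n$; $\mathcal T>0$ and $\Omega_{\mathcal T}=\Omega\times(0,\mathcal T)$. $\lambda,\theta,\kappa_1,\kappa_2>0$ are constants. $\mathbb R^{D\times D}_{\rm sym}$ denotes symmetric matrices, $A:B=\mathrm{tr}(A^tB)$, and $\varepsilon(\mathbf u)=\frac12(\nabla\mathbf u+\nabla\mathbf u^t)$ for a displacement $\mathbf u$. $\sigma_{\rm ext}\in\mathbb R^{D\times D}_{\rm sym}$ is a constant applied stress. The order parameters $a,b$ are scalar and real-valued. The free energy is $$F(a,b,\mathbf u)=\int_\Omega\psi(a,b)+\frac\lambda2\big(|\nabla a|^2+|\nabla b|^2\big)+\mathcal W(a+b,\varepsilon(\mathbf u))-\varepsilon(\mathbf u):\sigma_{\rm ext}\,dx ,$$ with $\psi(a,b)=\frac{\theta}{2}\big(g(a+b)+g(a-b)\big)+\kappa_1a(1-a)-\kappa_2b^2$, $g(s)=s\ln s+(1-s)\ln(1-s)$ ($0\ln0=0$), and $\frac{\partial F}{\partial a},\frac{\partial F}{\partial b}$ are its variational derivatives. Initial conditions: $a(0)=a_0$, $b(0)=b_0$. Boundary conditions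 on $\partial\Omega$, $t>0$: $\nabla a\cdot\mathbf n=\nabla b\cdot\mathbf n=0$, $\nabla\frac{\partial F}{\partial a}\cdot\mathbf n=0$, $\sigma\mathbf n=\sigma_{\rm ext}\mathbf n$ with $\sigma=\partial_\varepsilon\mathcal W(a+b,\varepsilon(\mathbf u))$. **Weak solution** means: $a(0)=a_0$, $b(0)=b_0$, $a,b\in L^2(0,\mathcal T;H^1(\Omega))$, and there is $\mu\in L^2(0,\mathcal T;H^1(\Omega))$ such that all integrals below are well defined and $$\int_{\Omega_{\mathcal T}}-(a-a_0)\partial_t\xi+\lambda\nabla\mu\cdot\nabla\xi\,dx\,dt=0,$$ $$\int_{\Omega_{\mathcal T}}\mu\zeta\,dx\,dt=\int_{\Omega_{\mathcal T}}\Big[\tfrac\theta2\big(g'(a+b)+g'(a-b)\big)+\kappa_1(1-2a)+\partial_d\mathcal W(a+b,\varepsilon(\mathbf u))\Big]\zeta+\lambda\nabla a\cdot\nabla\zeta\,dx\,dt,$$ $$\int_{\Omega_{\mathcal T}}\Big[\partial_tb+\tfrac\theta2\big(g'(a+b)-g'(a-b)\big)-2\kappa_2b+\partial_d\mathcal W(a+b,\varepsilon(\mathbf u))\Big]\eta+\lambda\nabla b\cdot\nabla\eta\,dx\,dt=0,$$ $$\int_{\Omega_{\mathcal T}}\big(\partial_\varepsilon\mathcal W(a+b,\varepsilon(\mathbf u))-\sigma_{\rm ext}\big):\varepsilon(\mathbf v)\,dx\,dt=0$$ for all $\xi,\zeta,\eta\in L^2(0,\mathcal T;H^1(\Omega))\cap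 L^\infty(\Omega_{\mathcal T})$ with $\partial_t\xi\in L^2(\Omega_{\mathcal T})$, $\xi(\mathcal T)=0$, and all $\mathbf v\in L^2(0,\mathcal T;H^1(\Omega;\mathbb R^D))$. **Relaxed energies.** Write $d_1=d$, $d_2=1-d$, $d\in[0,1]$. For $D\le2$ and $i=1,2$ let $W_i(\varepsilon)=\frac12\alpha_i(\varepsilon-\varepsilon_i^T):(\varepsilon-\varepsilon_i^T)+w_i$ with constant symmetric positive definite elasticity tensors $\alpha_i$ on $\mathbb R^{D\times D}_{\rm sym}$, constant eigenstrains $\varepsilon_i^T\in\mathbb R^{D\times D}_{\rm sym}$ (superscript $T$ is a label) and $w_i\ge0$. (E1) $D=1$: $\widehat W(d,\varepsilon)=d_1W_1(\varepsilon_1^* )+d_2W_2(\varepsilon_2^* )$ with $\varepsilon_1^*=\frac{\alpha_2(\varepsilon-d_2\varepsilon_2^T)+d_2\alpha_1\varepsilon_1^T}{d_2\alpha_1+d_1\alpha_2}$, $\varepsilon_2^*=\frac{\alpha_1(\varepsilon-d_1\varepsilon_1^T)+d_1\alpha_2\varepsilon_2^T}{d_2\alpha_1+d_1\alpha_2}$. (E2) $D=2$: $\widehat W(d,\varepsilon)=d_1W_1(\varepsilon_1^* )+d_2W_2(\varepsilon_2^* )+\beta^*d_1d_2\det(\varepsilon_2^*-\varepsilon_1^* )$, where: $T:\mathbb R^{2\times2}_{\rm sym}\to\mathbb R^{2\times2}_{\rm sym}$, $T\varepsilon=\varepsilon-\mathrm{tr}(\varepsilon)\mathrm{Id}$; $\gamma_i$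 is the reciprocal of the largest eigenvalue of $\alpha_i^{-1/2}T\alpha_i^{-1/2}$, $\gamma^*=\min\{\gamma_1,\gamma_2\}>0$; $\alpha(\beta,d)=d_2\alpha_1+d_1\alpha_2-\beta T$; $e(\varepsilon)=\alpha_2(\varepsilon_2^T-\varepsilon)-\alpha_1(\varepsilon_1^T-\varepsilon)$; $\varphi(\beta,d,\varepsilon)=-\det[\alpha(\beta,d)^{-1}e(\varepsilon)]$; $$\beta^*(d,\varepsilon)=\begin{cases}0&\text{if }\varphi\equiv0\text{ (Regime 0)},\\0&\text{if }\varphi(0,d,\varepsilon)>0\text{ (Regime I)},\\ \beta_{II}&\text{if }\varphi(0,d,\varepsilon)\le0\text{ and }\varphi(\gamma^*,d,\varepsilon)\ge0\text{ (Regime II)},\\ \gamma^*&\text{if }\varphi(\gamma^*,d,\varepsilon)<0\text{ (Regime III)},\end{cases}$$ with $\beta_{II}=\beta_{II}(d,\varepsilon)$ the unique root in $[0,\gamma^*]$ of $\varphi(\cdot,d,\varepsilon)=0$; and $\varepsilon_1^*=\alpha(\beta^*,d)^{-1}[(\alpha_2-\beta^*T)\varepsilon-d_2(\alpha_2\varepsilon_2^T-\alpha_1\varepsilon_1^T)]$, $\varepsilon_2^*=\alpha(\beta^*,d)^{-1}[(\alpha_1-\beta^*T)\varepsilon+d_1(\alpha_2\varepsilon_2^T-\alpha_1\varepsilon_1^T)]$. (E3) $D=3$, scalar setting: the ansatz $\mathbf u(x_1,x_2,x_3)=(x_1,x_2,\eta(x_1,x_2))$ is made, with $\eta$ scalar;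 the strain variable $\varepsilon(\mathbf u)$ is replaced by $f=\nabla\eta\in\mathbb R^2$, and $\widehat W(d,f)=d_1W_1(\nabla\eta_1^* )+d_2W_2(\nabla\eta_2^* )$, where $W_i(f)=\frac12\alpha_i(f-f_i^T)\cdot(f-f_i^T)+w_i$ with constant positive definite $\alpha_i\in\mathbb R^{2\times2}$, $f_i^T\in\mathbb R^2$, $w_i\ge0$, and $\nabla\eta_1^*=(d_2\alpha_1+d_1\alpha_2)^{-1}[\alpha_2f-d_2(\alpha_2f_2^T-\alpha_1f_1^T)]$, $\nabla\eta_2^*=(d_2\alpha_1+d_1\alpha_2)^{-1}[\alpha_1f+d_1(\alpha_2f_2^T-\alpha_1f_1^T)]$. In this setting the problem is posed on a two-dimensional bounded Lipschitz cross-section $\Omega'$ (in place of $\Omega$) with fields $a,b,\eta$ depending on $(x_1,x_2)$; the elastic equation is $\mathrm{div}(\partial_f\widehat W(a+b,\nabla\eta))=0$ with $\partial_f\widehat W\cdot\mathbf n=s\cdot\mathbf n$ on $\partial\Omega'$, $s=((\sigma_{\rm ext})_{31},(\sigma_{\rm ext})_{32})$ (weakly: $\int(\partial_f\widehat W(a+b,\nabla\eta)-s)\cdot\nabla v=0$ for all $v\in L^2(0,\mathcal T;H^1(\Omega'))$), and (iii) concerns $\eta\in L^\infty(0,\mathcal T;H^1(\Omega'))$.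
   Formalization: Displacements are shown to coincide only up to a time-dependent infinitesimal rigid displacement (a constant in the scalar case), which the pure traction condition leaves undetermined; well-definedness of the integrals with g' is read as 0<a+b<1 and 0<a-b<1 almost everywhere. *)

(* Defs.v *)
(* World: MathComp with MathComp-Analysis. *)
From HB Require Import structures.
From mathcomp Require Import all_boot all_order all_algebra.
From mathcomp Require Import all_classical all_reals all_analysis.

Set Implicit Arguments.
Unset Strict Implicit.
Unset Printing Implicit Defensive.

Import Order.TTheory GRing.Theory Num.Theory.
Import numFieldNormedType.Exports.

Local Open Scope classical_set_scope.
Local Open Scope ring_scope.

(* Points of R^n are row vectors.  The local graph is taken in the orthonormal
   frame given by the rows of Q, centred at the boundary point p; the first
   coordinate is the one in which the boundary is a graph. *)
Definition lipschitz_domain (R : realType) (k : nat)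
    (O : set 'rV[R]_k.+1) : Prop :=
  [/\ O !=set0, open O, connected O, bounded_set O &
   forall p, (closure O `\` O) p ->
   exists (Q : 'M[R]_k.+1) (r h L : R) (gam : 'rV[R]_k -> R),
   [/\ Q *m Q^T = 1%:M, 0 < r, 0 < h,
       (forall y z, `|gam y - gam z| <= L * `|y - z|) &
       forall y : 'rV[R]_k.+1,
         `|y ord0 ord0| < h -> `|col' ord0 y| < r ->
         (O (p + y *m Q) <-> gam (col' ord0 y) < y ord0 ord0)]].

(* Test functions are C^1 with compact support in the open set O; replacing
   C^1 by C^oo gives the same weak derivatives. *)
Definition test_fun (R : realType) (V : normedModType R) (O : set V)
    (phi : V -> R) : Prop :=
  [/\ forall x, differentiable phi x,
      forall v, continuous (fun x => 'D_v phi x) &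
      exists K : set V,
        [/\ compact K, K `<=` O & forall x, ~ K x -> phi x = 0]].

Definition frob (R : realType) (m n : nat) (A B : 'M[R]_(m, n)) : R :=
  \tr (A^T *m B).

Definition symp (R : realType) (n : nat) (A : 'M[R]_n) : 'M[R]_n :=
  2^-1 *: (A + A^T).

(* MathComp-Analysis has Lebesgue measure on R and on products only, so
   Lebesgue measure on R^n = 'rV_n is the image of [leb], a measure on X, under
   the coordinate bijection [pos : X -> 'rV_n].  The instances used are X = R
   with [pos1] and X = R * R with [pos2]. *)
Definition pos1 (R : realType) (x : R) : 'rV[R]_1 := \row_(i < 1) x.

Definition pos2 (R : realType) (x : R * R) : 'rV[R]_2 :=
  \row_(i < 2) (if i == ord0 then x.1 else x.2).

(* The library's own sigma-finite instance on products is shadowed by the one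
   for subprobabilities, hence the explicit instance. *)
Section Lebesgue2.
Context {R : realType}.
Local Notation mR := (measurableTypeR R).

Definition lebesgue2 : set (mR * mR) -> \bar R :=
  (lebesgue_measure \x lebesgue_measure)%E.

HB.instance Definition _ := Measure.on lebesgue2.

Let lebesgue2_sigma_finite : sigma_finite setT lebesgue2.
Proof.
have /sigma_finiteP[F [TF ndF Foo]] := sigma_finiteT (@lebesgue_measure R).
exists (fun n => F n `*` F n).
  rewrite -setXTT TF predeqE => -[x y]; split.
    move=> [/= [n _ Fnx] [k _ Fky]]; exists (maxn n k) => //; split.
    - by move: x Fnx; exact/subsetPset/ndF/leq_maxl.
    - by move: y Fky; exact/subsetPset/ndF/leq_maxr.
  by move=> [n _ []/= ? ?]; split; exists n.
move=> k; have [? ?] := Foo k.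
split; first exact: measurableX.
by rewrite /lebesgue2 product_measure1E// lte_mul_pinfty// ge0_fin_numE.
Qed.

HB.instance Definition _ := @Measure_isSigmaFinite.Build _ _ _ lebesgue2
  lebesgue2_sigma_finite.
End Lebesgue2.

Section FunctionSpaces.
Context {R : realType} {n : nat} {dX : measure_display} {X : measurableType dX}.
Variables (leb : {sigma_finite_measure set X -> \bar R}) (pos : X -> 'rV[R]_n).
Variables (Omega : set 'rV[R]_n) (Tf : R).

Definition dom : set X := pos @^-1` Omega.

Local Notation RX := (measurableTypeR R * X)%type.

Definition cyl : set RX := `]0, Tf[%classic `*` dom.

Local Notation lebT := (lebesgue_measure \x leb)%E.

Definition on_cyl (T : Type) (F : R -> 'rV[R]_n -> T) (p : RX) : T :=
  F p.1 (pos p.2).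

Definition ae_dom (P : 'rV[R]_n -> Prop) : Prop :=
  {ae leb, forall x, dom x -> P (pos x)}.

Definition ae_time (P : R -> Prop) : Prop :=
  {ae lebesgue_measure, forall t : R, 0 < t < Tf -> P t}.

Definition ae_cyl (P : R -> 'rV[R]_n -> Prop) : Prop :=
  {ae lebT, forall p, cyl p -> P p.1 (pos p.2)}.

Definition int_dom (f : 'rV[R]_n -> R) : R :=
  \int[leb]_(x in dom) f (pos x).

Definition int_cyl (F : R -> 'rV[R]_n -> R) : R :=
  \int[lebT]_(p in cyl) on_cyl F p.

Definition integrable_dom (f : 'rV[R]_n -> R) : Prop :=
  leb.-integrable dom (fun x => (f (pos x))%:E).

Definition integrable_cyl (F : R -> 'rV[R]_n -> R) : Prop :=
  lebT.-integrable cyl (fun p => (on_cyl F p)%:E).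

Definition L2 (f : 'rV[R]_n -> R) : Prop :=
  measurable_fun dom (fun x => f (pos x)) /\
  (\int[leb]_(x in dom) ((f (pos x)) ^+ 2)%:E < +oo)%E.

Definition normL2 (f : 'rV[R]_n -> R) : R :=
  Num.sqrt (int_dom (fun x => f x ^+ 2)).

Definition L2T (F : R -> 'rV[R]_n -> R) : Prop :=
  measurable_fun cyl (on_cyl F) /\
  (\int[lebT]_(p in cyl) ((on_cyl F p) ^+ 2)%:E < +oo)%E.

Definition LinfT (F : R -> 'rV[R]_n -> R) : Prop :=
  exists C : R, ae_cyl (fun t x => `|F t x| <= C).

(* [H1 u Du]: u is in H^1(Omega) and Du is its weak gradient. *)
Definition H1 (u : 'rV[R]_n -> R) (Du : 'rV[R]_n -> 'rV[R]_n) : Prop :=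
  [/\ L2 u, forall i, L2 (fun x => Du x ord0 i) &
   forall phi, test_fun Omega phi -> forall i,
     int_dom (fun x => u x * 'D_(delta_mx ord0 i) phi x) =
     - int_dom (fun x => Du x ord0 i * phi x)].

Definition normH1 (u : 'rV[R]_n -> R) (Du : 'rV[R]_n -> 'rV[R]_n) : R :=
  Num.sqrt (int_dom (fun x => u x ^+ 2 + frob (Du x) (Du x))).

(* L^2(0,T;H^1), with Bochner measurability expressed by joint measurability
   and the Bochner norm computed on the cylinder. *)
Definition L2H1 (F : R -> 'rV[R]_n -> R) (DF : R -> 'rV[R]_n -> 'rV[R]_n)
    : Prop :=
  [/\ L2T F, forall i, L2T (fun t x => DF t x ord0 i) &
      ae_time (fun t => H1 (F t) (DF t))].

(* Row k of Du is the gradient of the k-th component of u. *)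
Definition H1v (m : nat) (u : 'rV[R]_n -> 'rV[R]_m)
    (Du : 'rV[R]_n -> 'M[R]_(m, n)) : Prop :=
  forall k, H1 (fun x => u x ord0 k) (fun x => row k (Du x)).

Definition L2H1v (m : nat) (F : R -> 'rV[R]_n -> 'rV[R]_m)
    (DF : R -> 'rV[R]_n -> 'M[R]_(m, n)) : Prop :=
  forall k, L2H1 (fun t x => F t x ord0 k) (fun t x => row k (DF t x)).

Definition H1v_path (m : nat) (F : R -> 'rV[R]_n -> 'rV[R]_m)
    (DF : R -> 'rV[R]_n -> 'M[R]_(m, n)) : Prop :=
  [/\ forall k, measurable_fun cyl (on_cyl (fun t x => F t x ord0 k)),
      forall k i, measurable_fun cyl (on_cyl (fun t x => DF t x k i)) &
      ae_time (fun t => H1v (F t) (DF t))].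

Definition LinfH1v (m : nat) (F : R -> 'rV[R]_n -> 'rV[R]_m) : Prop :=
  exists DF, H1v_path F DF /\
  exists C : R, ae_time (fun t => forall k,
    normH1 (fun x => F t x ord0 k) (fun x => row k (DF t x)) <= C).

(* [dt_weak F Ft]: Ft is the distributional time derivative of F. *)
Definition dt_weak (F Ft : R -> 'rV[R]_n -> R) : Prop :=
  [/\ integrable_cyl F, integrable_cyl Ft &
   forall phi : R * 'rV[R]_n -> R,
     test_fun (`]0, Tf[%classic `*` Omega) phi ->
     int_cyl (fun t x => F t x * 'D_((1, 0) : R * 'rV[R]_n) phi (t, x)) =
     - int_cyl (fun t x => Ft t x * phi (t, x))].

(* The distributional time derivative of F is in L^2(0,T;H^1(Omega)^* ).  It is
   represented by t |-> l t, a functional acting on (the functions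
   representing) elements of H^1, of dual norm at most N t. *)
Definition dt_in_L2H1dual (F : R -> 'rV[R]_n -> R) : Prop :=
  exists (l : R -> ('rV[R]_n -> R) -> R) (N : R -> R),
  [/\ measurable_fun `]0, Tf[%classic N,
      (\int[lebesgue_measure]_(t in `]0%R, Tf[%classic) ((N t) ^+ 2)%:E < +oo)%E,
      (forall v Dv, H1 v Dv -> measurable_fun `]0, Tf[%classic (l ^~ v)),
      ae_time (fun t =>
        (forall v Dv, H1 v Dv -> `|l t v| <= N t * normH1 v Dv) /\
        (forall c v Dv w Dw, H1 v Dv -> H1 w Dw ->
           l t (fun x => c * v x + w x) = c * l t v + l t w)) &
      forall v Dv, H1 v Dv ->
      forall phi : R -> R, test_fun `]0, Tf[%classic phi ->
        \int[lebesgue_measure]_(t in `]0, Tf[%classic)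
           (derive1 phi t * int_dom (fun x => F t x * v x)) =
        - \int[lebesgue_measure]_(t in `]0, Tf[%classic) (phi t * l t v)].

(* Elements of C([0,T];L^2) are given by their continuous representative, so
   that their value at each time is meaningful. *)
Definition contL2 (F : R -> 'rV[R]_n -> R) : Prop :=
  (forall t, 0 <= t <= Tf -> L2 (F t)) /\
  forall t, 0 <= t <= Tf -> forall e, 0 < e -> exists2 del, 0 < del &
    forall s, 0 <= s <= Tf -> `|s - t| < del ->
      normL2 (fun x => F s x - F t x) < e.

Definition holderL2 (gam : R) (F : R -> 'rV[R]_n -> R) : Prop :=
  (forall t, 0 <= t <= Tf -> L2 (F t)) /\
  exists C : R, forall s t, 0 <= s <= Tf -> 0 <= t <= Tf ->
    normL2 (fun x => F s x - F t x) <= C * (`|s - t| `^ gam).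

Definition test_xi (xi xit : R -> 'rV[R]_n -> R)
    (Dxi : R -> 'rV[R]_n -> 'rV[R]_n) : Prop :=
  [/\ L2H1 xi Dxi, LinfT xi, dt_weak xi xit, L2T xit &
      contL2 xi /\ ae_dom (fun x => xi Tf x = 0)].

Definition integral_eq0 (F : R -> 'rV[R]_n -> R) : Prop :=
  integrable_cyl F /\ int_cyl F = 0.

End FunctionSpaces.

Definition gent (R : realType) (s : R) : R := s * ln s + (1 - s) * ln (1 - s).

(* The strain variable attached to Du is P Du, where P is the symmetrisation
   for a vector-valued displacement and the identity for a scalar one; Wel d e
   is the elastic energy and sig the applied stress. *)
Section Model.
Context {R : realType} {n m : nat}.
Context {dX : measure_display} {X : measurableType dX}.
Variables (leb : {sigma_finite_measure set X -> \bar R}) (pos : X -> 'rV[R]_n).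
Variables (Omega : set 'rV[R]_n) (Tf : R).
Variables (lambda theta kappa1 kappa2 : R).
Variables (P : 'M[R]_(m, n) -> 'M[R]_(m, n)) (Wel : R -> 'M[R]_(m, n) -> R).
Variable sig : 'M[R]_(m, n).

Definition dWel (d : R) (e : 'M[R]_(m, n)) : R := derive1 (Wel^~ e) d.

(* The gradient of Wel d on the range of P, for the scalar product frob; for
   P = symp it is the symmetric matrix representing the differential of Wel d
   on symmetric matrices. *)
Definition eWel (d : R) (e : 'M[R]_(m, n)) : 'M[R]_(m, n) :=
  \matrix_(i, j) 'D_(P (delta_mx i j)) (Wel d) e.

Definition elastic_equilibrium (d : 'rV[R]_n -> R)
    (u : 'rV[R]_n -> 'rV[R]_m) (Du : 'rV[R]_n -> 'M[R]_(m, n)) : Prop :=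
  H1v leb pos Omega u Du /\
  forall v Dv, H1v leb pos Omega v Dv ->
    let f x := frob (eWel (d x) (P (Du x)) - sig) (P (Dv x)) in
    integrable_dom leb pos Omega f /\ int_dom leb pos Omega f = 0.

Definition initial_data (a0 b0 : 'rV[R]_n -> R) : Prop :=
  [/\ measurable_fun (dom pos Omega) (fun x => a0 (pos x)),
      measurable_fun (dom pos Omega) (fun x => b0 (pos x)),
      ae_dom leb pos Omega
        (fun x => 0 <= a0 x + b0 x <= 1 /\ 0 <= a0 x - b0 x <= 1) &
      exists u0 Du0, elastic_equilibrium (fun x => a0 x + b0 x) u0 Du0 /\
        (\int[leb]_(x in dom pos Omega)
           (Wel (a0 (pos x) + b0 (pos x)) (P (Du0 (pos x))))%:E < +oo)%E].

(* As g' exists only on the open interval ]0, 1[, the integrals involving it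
   are well defined only if a + b and a - b lie in ]0, 1[ a.e. *)
Definition weak_solution (a0 b0 : 'rV[R]_n -> R) (a b : R -> 'rV[R]_n -> R)
    (u : R -> 'rV[R]_n -> 'rV[R]_m) : Prop :=
  exists (Da Db Dmu : R -> 'rV[R]_n -> 'rV[R]_n)
         (Du : R -> 'rV[R]_n -> 'M[R]_(m, n)) (mu bt : R -> 'rV[R]_n -> R),
  let g' := derive1 (@gent R) in
  let int0 := integral_eq0 leb pos Omega Tf in
  let rhs t x zeta Dzeta :=
    (theta / 2 * (g' (a t x + b t x) + g' (a t x - b t x))
       + kappa1 * (1 - 2 * a t x)
       + dWel (a t x + b t x) (P (Du t x))) * zeta t x
    + lambda * frob (Da t x) (Dzeta t x) in
  [/\ ae_dom leb pos Omega (fun x => a 0 x = a0 x /\ b 0 x = b0 x),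
      [/\ L2H1 leb pos Omega Tf a Da, L2H1 leb pos Omega Tf b Db,
          L2H1 leb pos Omega Tf mu Dmu, H1v_path leb pos Omega Tf u Du &
          dt_weak leb pos Omega Tf b bt],
      ae_cyl leb pos Omega Tf
        (fun t x => 0 < a t x + b t x < 1 /\ 0 < a t x - b t x < 1) &
   [/\ forall xi xit Dxi, test_xi leb pos Omega Tf xi xit Dxi ->
         int0 (fun t x => - (a t x - a0 x) * xit t x
                          + lambda * frob (Dmu t x) (Dxi t x)),
       forall zeta Dzeta, L2H1 leb pos Omega Tf zeta Dzeta ->
         LinfT leb pos Omega Tf zeta ->
         [/\ integrable_cyl leb pos Omega Tf (fun t x => mu t x * zeta t x),
             integrable_cyl leb pos Omega Tf (fun t x => rhs t x zeta Dzeta) &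
             int_cyl leb pos Omega Tf (fun t x => mu t x * zeta t x) =
             int_cyl leb pos Omega Tf (fun t x => rhs t x zeta Dzeta)],
       forall eta Deta, L2H1 leb pos Omega Tf eta Deta ->
         LinfT leb pos Omega Tf eta ->
         int0 (fun t x =>
           (bt t x
            + theta / 2 * (g' (a t x + b t x) - g' (a t x - b t x))
            - 2 * kappa2 * b t x
            + dWel (a t x + b t x) (P (Du t x))) * eta t x
           + lambda * frob (Db t x) (Deta t x)) &
       forall v Dv, L2H1v leb pos Omega Tf v Dv ->
         int0 (fun t x =>
           frob (eWel (a t x + b t x) (P (Du t x)) - sig) (P (Dv t x)))]].

Definition solution_class (a b : R -> 'rV[R]_n -> R)
    (u : R -> 'rV[R]_n -> 'rV[R]_m) : Prop :=
  [/\ holderL2 leb pos Omega Tf 4^-1 a /\ holderL2 leb pos Omega Tf 4^-1 b,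
      dt_in_L2H1dual leb pos Omega Tf a /\
        (exists bt, dt_weak leb pos Omega Tf b bt /\ L2T leb pos Omega Tf bt),
      LinfH1v leb pos Omega Tf u &
      ae_cyl leb pos Omega Tf
        (fun t x => 0 <= a t x + b t x <= 1 /\ 0 <= a t x - b t x <= 1)].

(* All data of the pure traction problem are unchanged when a time-dependent
   field x |-> c + A x with P A = 0 (an infinitesimal rigid displacement, resp.
   a constant in the scalar setting) is added to u: displacements coincide when
   they differ by such a field. *)
Definition coincide (a1 b1 : R -> 'rV[R]_n -> R)
    (u1 : R -> 'rV[R]_n -> 'rV[R]_m) (a2 b2 : R -> 'rV[R]_n -> R)
    (u2 : R -> 'rV[R]_n -> 'rV[R]_m) : Prop :=
  (forall t, 0 <= t <= Tf ->
     ae_dom leb pos Omega (fun x => a1 t x = a2 t x /\ b1 t x = b2 t x)) /\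
  ae_time Tf (fun t => exists (A : 'M[R]_(m, n)) (c : 'rV[R]_m),
     P A = 0 /\
     ae_dom leb pos Omega (fun x => u1 t x - u2 t x = c + x *m A^T)).

Definition unique_weak_solution : Prop :=
  forall a0 b0, initial_data a0 b0 ->
  forall a1 b1 u1 a2 b2 u2,
    weak_solution a0 b0 a1 b1 u1 -> solution_class a1 b1 u1 ->
    weak_solution a0 b0 a2 b2 u2 -> solution_class a2 b2 u2 ->
    coincide a1 b1 u1 a2 b2 u2.

End Model.

Definition What1 (R : realType) (alpha1 alpha2 e1T e2T w1 w2 : R)
    (d e : R) : R :=
  let d1 := d in let d2 := 1 - d in
  let W alpha eT w x := 2^-1 * (alpha * (x - eT) * (x - eT)) + w in
  let den := d2 * alpha1 + d1 * alpha2 in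
  let e1 := (alpha2 * (e - d2 * e2T) + d2 * alpha1 * e1T) / den in
  let e2 := (alpha1 * (e - d1 * e1T) + d1 * alpha2 * e2T) / den in
  d1 * W alpha1 e1T w1 e1 + d2 * W alpha2 e2T w2 e2.

(* Elasticity tensors in dimension 2 are endomorphisms of the space of symmetric
   2 x 2 matrices, so that eigenvalues, square roots and inverses are taken on
   that space. *)
Definition sym2v (R : realType) : {vspace 'M[R]_2} :=
  fixedSpace (linfun (@trmx R 2 2)).

Notation Sym2 R := (subvs_of (sym2v R)).

Section Energy2.
Context {R : realType}.

Definition dot2 (x y : Sym2 R) : R := frob (vsval x) (vsval y).

Definition sym_posdef (f : 'End(Sym2 R)) : Prop :=
  (forall x y, dot2 (f x) y = dot2 x (f y)) /\
  (forall x, x != 0 -> 0 < dot2 (f x) x).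

Definition T2 : 'End(Sym2 R) :=
  linfun (fun x : Sym2 R =>
    vsproj (sym2v R) (vsval x - (\tr (vsval x))%:M)).

Definition inv_sqrt (f : 'End(Sym2 R)) : 'End(Sym2 R) :=
  xget 0 [set S | sym_posdef S /\ (S \o S = f^-1)%VF].

Definition largest_eigenvalue (f : 'End(Sym2 R)) : R :=
  sup [set x | passmx.leigenvalue f x].

Definition gamma (f : 'End(Sym2 R)) : R :=
  (largest_eigenvalue (inv_sqrt f \o T2 \o inv_sqrt f)%VF)^-1.

Variables (alpha1 alpha2 : 'End(Sym2 R)) (e1T e2T : Sym2 R) (w1 w2 : R).

Definition gamma_star : R := Num.min (gamma alpha1) (gamma alpha2).

Definition alpha_ (beta d : R) : 'End(Sym2 R) :=
  (1 - d) *: alpha1 + d *: alpha2 - beta *: T2.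

Definition evec (e : Sym2 R) : Sym2 R := alpha2 (e2T - e) - alpha1 (e1T - e).

Definition phi0 (beta d : R) (e : Sym2 R) : R :=
  - \det (vsval ((alpha_ beta d)^-1%VF (evec e))).

(* alpha_ gamma_star d may be singular (it is when alpha1 = alpha2); phi at
   beta = gamma_star is the limit from the left, possibly infinite.  It is the
   value of phi0 whenever alpha_ gamma_star d is invertible. *)
Definition phi (beta d : R) (e : Sym2 R) : \bar R :=
  if beta == gamma_star then
    lim ((phi0 b d e)%:E @[b --> gamma_star^'-])
  else (phi0 beta d e)%:E.

Definition regime0 (d : R) (e : Sym2 R) : Prop :=
  forall beta, 0 <= beta <= gamma_star -> phi beta d e = 0%E.

Definition regimeII (d : R) (e : Sym2 R) : Prop :=
  [/\ ~ regime0 d e, (phi 0 d e <= 0)%E & (0 <= phi gamma_star d e)%E].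

Definition regimeIII (d : R) (e : Sym2 R) : Prop :=
  [/\ ~ regime0 d e, (phi 0 d e <= 0)%E & (phi gamma_star d e < 0)%E].

Definition beta_II (d : R) (e : Sym2 R) : R :=
  xget 0 [set beta | 0 <= beta <= gamma_star /\ phi beta d e = 0%E].

Definition beta_star (d : R) (e : Sym2 R) : R :=
  if `[< regime0 d e >] then 0
  else if (0 < phi 0 d e)%E then 0
  else if (0 <= phi gamma_star d e)%E then beta_II d e
  else gamma_star.

Definition eps1_star (d : R) (e : Sym2 R) : Sym2 R :=
  let b := beta_star d e in
  (alpha_ b d)^-1%VF
    ((alpha2 - b *: T2) e - (1 - d) *: (alpha2 e2T - alpha1 e1T)).

Definition eps2_star (d : R) (e : Sym2 R) : Sym2 R :=
  let b := beta_star d e in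
  (alpha_ b d)^-1%VF
    ((alpha1 - b *: T2) e + d *: (alpha2 e2T - alpha1 e1T)).

Definition Wphase2 (alpha : 'End(Sym2 R)) (eT : Sym2 R) (w : R)
    (e : Sym2 R) : R := 2^-1 * dot2 (alpha (e - eT)) (e - eT) + w.

Definition What2 (d : R) (e : Sym2 R) : R :=
  d * Wphase2 alpha1 e1T w1 (eps1_star d e)
  + (1 - d) * Wphase2 alpha2 e2T w2 (eps2_star d e)
  + beta_star d e * d * (1 - d)
    * \det (vsval (eps2_star d e - eps1_star d e)).

Definition condC1 : Prop :=
  forall d, 0 <= d <= 1 -> forall e e', beta_star d e = beta_star d e'.

Definition condC2 : Prop :=
  forall d e, 0 <= d <= 1 -> regimeII d e \/ regimeIII d e ->
    (alpha1 \o T2 = T2 \o alpha1)%VF /\ (alpha2 \o T2 = T2 \o alpha2)%VF.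

End Energy2.

Definition posdef (R : realType) (n : nat) (A : 'M[R]_n) : Prop :=
  forall x : 'cV[R]_n, x != 0 -> 0 < frob (A *m x) x.

(* The argument f of What3 is the gradient of the scalar eta, as a column. *)
Definition What3 (R : realType) (alpha1 alpha2 : 'M[R]_2) (f1T f2T : 'cV[R]_2)
    (w1 w2 : R) (d : R) (f : 'cV[R]_2) : R :=
  let d1 := d in let d2 := 1 - d in
  let W alpha fT w x := 2^-1 * frob (alpha *m (x - fT)) (x - fT) + w in
  let inv := invmx (d2 *: alpha1 + d1 *: alpha2) in
  let df := alpha2 *m f2T - alpha1 *m f1T in
  let f1 := inv *m (alpha2 *m f - d2 *: df) in
  let f2 := inv *m (alpha1 *m f + d1 *: df) in
  d1 * W alpha1 f1T w1 f1 + d2 * W alpha2 f2T w2 f2.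

(* Main.v *)
(** Let [a], [b], [u], [mu] be the differences of two solutions with the same
    data, [e] the strain of [u] and [d = a + b].  With equal moduli the elastic
    energy is a quadratic form [bf] of [e - d dl] up to an affine function of
    [d], for a fixed [dl]; in dimension 2 this is because [beta_star] vanishes
    when [det (e2T - e1T) <= 0].  The elastic terms thus contribute
    [bf (e - d dl) (e - d dl) >= 0] when the equations are tested with [a], [b]
    and [u], and the logarithmic terms have a sign since [g'] is increasing.
    The first equation, integrated in time, reads
    [(a(t), v) = - lambda (G(t), grad v)] with [G(t) = int_0^t grad mu]; taking
    [v = mu(t)] turns [int_0^s (mu, a)] into [- lambda/2 |G(s)|^2], and taking
    [v = a(t)] bounds [|a|^2] by [lambda |G| |grad a|].  Altogether
      [lambda/2 |G(s)|^2 + 1/2 |b(s)|^2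
         + int_0^s (lambda/2 |grad a|^2 + bf (e - d dl) (e - d dl))
       <= C int_0^s (|G|^2 + |b|^2)],
    and Gronwall's lemma gives [G = 0] and [b = 0], hence [a = 0] and then
    [e = 0]; by rigidity [u(t)] is an infinitesimal rigid displacement. *)

Require Import Defs.
From HB Require Import structures.
From mathcomp Require Import all_boot all_order all_algebra.
From mathcomp Require Import all_classical all_reals all_analysis.
From mathcomp Require Import measurable_realfun.
From mathcomp Require Import ring lra.

Set Implicit Arguments.
Unset Strict Implicit.
Unset Printing Implicit Defensive.

Import Order.TTheory GRing.Theory Num.Theory.
Import numFieldNormedType.Exports.

Local Open Scope classical_set_scope.
Local Open Scope ring_scope.

Notation intg mu D f := (mu.-integrable D (EFin \o f)).

(** * Real-valued integrals *)

Section RealIntegral.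
Context {R : realType} {d : measure_display} {T : measurableType d}.
Context {mu : {measure set T -> \bar R}} {D : set T}.
Implicit Types (f g h : T -> R).

Lemma intg_measurable f : intg mu D f -> measurable_fun D f.
Proof. by move=> /(measurable_int mu)/measurable_EFinP. Qed.

Lemma eq_intg f g : (forall x, D x -> f x = g x) -> intg mu D f -> intg mu D g.
Proof.
move=> fg; move=> /integrableP[mf fi]; apply/integrableP; split.
  by apply: eq_measurable_fun mf => x /set_mem Dx /=; rewrite fg.
by move: fi; under eq_integral => x /set_mem Dx do rewrite /= fg//.
Qed.

Lemma eq_Rint f g : (forall x, D x -> f x = g x) ->
  \int[mu]_(x in D) f x = \int[mu]_(x in D) g x.
Proof. by move=> fg; apply: eq_Rintegral => x /set_mem; exact: fg. Qed.

Hypothesis mD : measurable D.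

Lemma intgD f g : intg mu D f -> intg mu D g -> intg mu D (fun x => f x + g x).
Proof. exact: integrableD. Qed.

Lemma intgB f g : intg mu D f -> intg mu D g -> intg mu D (fun x => f x - g x).
Proof. exact: integrableB. Qed.

Lemma intgZ k f : intg mu D f -> intg mu D (fun x => k * f x).
Proof. exact: integrableZl. Qed.

Lemma intgN f : intg mu D f -> intg mu D (fun x => - f x).
Proof. exact: integrableN. Qed.

Lemma intg0 : intg mu D (fun=> 0).
Proof. exact: integrable0. Qed.

Lemma intg_sum (I : Type) (s : seq I) (F : I -> T -> R) :
  (forall i, intg mu D (F i)) -> intg mu D (fun x => \sum_(i <- s) F i x).
Proof.
move=> iF; elim: s => [|i s ih].
  by apply: eq_intg intg0 => x _; rewrite big_nil.
by apply: eq_intg (intgD (iF i) ih) => x _; rewrite big_cons.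
Qed.

Lemma intg_norm f : intg mu D f -> intg mu D (fun x => `|f x|).
Proof. exact: integrable_norm. Qed.

Lemma le_intg f g : measurable_fun D f -> (forall x, D x -> `|f x| <= g x) ->
  intg mu D g -> intg mu D f.
Proof.
move=> mf fg; apply: le_integrable => //; first exact/measurable_EFinP.
by move=> x Dx /=; rewrite lee_fin (le_trans (fg _ Dx)) ?ler_norm.
Qed.

Lemma intg_Mb f h C : intg mu D f -> measurable_fun D h ->
  (forall x, D x -> `|h x| <= C) -> intg mu D (fun x => f x * h x).
Proof.
move=> fi mh hC; apply: (@le_intg _ (fun x => C * `|f x|)).
- by apply: measurable_funM => //; exact: intg_measurable.
- by move=> x Dx; rewrite normrM mulrC ler_wpM2r// hC.
- by apply: intgZ; exact: intg_norm.
Qed.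

Lemma intg_lty f : measurable_fun D f -> (forall x, D x -> 0 <= f x) ->
  (\int[mu]_(x in D) (f x)%:E < +oo)%E -> intg mu D f.
Proof.
move=> mf f0 fi; apply/integrableP; split; first exact/measurable_EFinP.
by under eq_integral => x /set_mem Dx do rewrite /= ger0_norm ?f0//.
Qed.

Lemma intg_sqM f g : measurable_fun D f -> measurable_fun D g ->
  intg mu D (fun x => f x ^+ 2) -> intg mu D (fun x => g x ^+ 2) ->
  intg mu D (fun x => f x * g x).
Proof.
move=> mf mg f2 g2; apply: (@le_intg _ (fun x => f x ^+ 2 + g x ^+ 2)).
- exact: measurable_funM.
- move=> x _; rewrite normrM -(real_normK (num_real (f x))).
  rewrite -(real_normK (num_real (g x))).
  by have := sqr_ge0 (`|f x| - `|g x|); nra.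
- exact: intgD.
Qed.

Lemma intg_sqD f g : measurable_fun D f -> measurable_fun D g ->
  intg mu D (fun x => f x ^+ 2) -> intg mu D (fun x => g x ^+ 2) ->
  intg mu D (fun x => (f x + g x) ^+ 2).
Proof.
move=> mf mg f2 g2.
apply: eq_intg (intgD (intgD f2 g2) (intgZ 2 (intg_sqM mf mg f2 g2))) => x _.
ring.
Qed.

Lemma Rint_EFin f : intg mu D f ->
  (\int[mu]_(x in D) f x)%:E = (\int[mu]_(x in D) (f x)%:E)%E.
Proof. by move=> fi; rewrite fineK//; exact: integrable_fin_num. Qed.

Lemma Rint_ae_eq f g : intg mu D f -> measurable_fun D g ->
  {ae mu, forall x, D x -> f x = g x} ->
  intg mu D g /\ \int[mu]_(x in D) f x = \int[mu]_(x in D) g x.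
Proof.
move=> fi mg fg; have mf := intg_measurable fi.
have fgE : ae_eq mu D (EFin \o f) (EFin \o g).
  by apply: filterS fg => x + Dx => /(_ Dx) /= ->.
split; last by congr fine; apply: ae_eq_integral => //; exact/measurable_EFinP.
apply/integrableP; split; first exact/measurable_EFinP.
case/integrableP: fi => _; apply: le_lt_trans.
rewrite (@ge0_ae_eq_integral _ _ _ mu D (fun x => `|(g x)%:E|%E)
  (fun x => `|(f x)%:E|%E))//.
- by apply: measurableT_comp => //; exact/measurable_EFinP.
- by apply: measurableT_comp => //; exact/measurable_EFinP.
- by apply: filterS fg => x + Dx => /(_ Dx) /= ->.
Qed.

Lemma Rint_ge0_eq0 f : intg mu D f -> {ae mu, forall x, D x -> 0 <= f x} ->
  \int[mu]_(x in D) f x <= 0 -> {ae mu, forall x, D x -> f x = 0}.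
Proof.
move=> fi f0 fle0; have mf := intg_measurable fi.
have fE : {ae mu, forall x, D x -> f x = `|f x|}.
  by apply: filterS f0 => x + Dx => /(_ Dx) h; rewrite ger0_norm.
have [ni fn] := Rint_ae_eq fi (intg_measurable (intg_norm fi)) fE.
have /(ae_eq_integral_abs mu mD) : measurable_fun D (EFin \o f).
  exact/measurable_EFinP.
move=> [h _]; have {h} : ae_eq mu D (EFin \o f) (cst 0%E).
  apply: h; rewrite -(Rint_EFin ni); congr EFin; apply/eqP.
  by rewrite eq_le -{1}fn fle0 Rintegral_ge0.
by apply: filterS => x + Dx => /(_ Dx) [].
Qed.

Lemma le_Rint f g : intg mu D f -> intg mu D g ->
  (forall x, D x -> f x <= g x) ->
  \int[mu]_(x in D) f x <= \int[mu]_(x in D) g x.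
Proof. exact: le_Rintegral. Qed.

Lemma le_Rint_ae f g : intg mu D f -> intg mu D g ->
  {ae mu, forall x, D x -> f x <= g x} ->
  \int[mu]_(x in D) f x <= \int[mu]_(x in D) g x.
Proof.
move=> fi gi fg.
have mm : measurable_fun D (fun x => Num.min (f x) (g x)).
  by apply: measurable_minr; exact: intg_measurable.
have fm : {ae mu, forall x, D x -> f x = Num.min (f x) (g x)}.
  by apply: filterS fg => x + Dx => /(_ Dx) h; rewrite min_l.
have [mi ->] := Rint_ae_eq fi mm fm.
by apply: le_Rint => // x Dx; rewrite ge_min lexx orbT.
Qed.

Lemma Rint0 : \int[mu]_(x in D) 0 = 0.
Proof. by rewrite /Rintegral integral0. Qed.

Lemma RintD f g : intg mu D f -> intg mu D g ->
  \int[mu]_(x in D) (f x + g x) =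
  \int[mu]_(x in D) f x + \int[mu]_(x in D) g x.
Proof. exact: RintegralD. Qed.

Lemma RintB f g : intg mu D f -> intg mu D g ->
  \int[mu]_(x in D) (f x - g x) =
  \int[mu]_(x in D) f x - \int[mu]_(x in D) g x.
Proof. exact: RintegralB. Qed.

Lemma RintZ k f : intg mu D f ->
  \int[mu]_(x in D) (k * f x) = k * \int[mu]_(x in D) f x.
Proof. exact: RintegralZl. Qed.

Lemma RintN f : intg mu D f ->
  \int[mu]_(x in D) (- f x) = - \int[mu]_(x in D) f x.
Proof.
by move=> fi; rewrite -mulN1r -RintZ//; apply: eq_Rint => x _; rewrite mulN1r.
Qed.

Lemma Rint_sum (I : Type) (s : seq I) (F : I -> T -> R) :
  (forall i, intg mu D (F i)) ->
  \int[mu]_(x in D) (\sum_(i <- s) F i x) = \sum_(i <- s) \int[mu]_(x in D) F i x.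
Proof.
move=> iF; elim: s => [|i s ih].
  by rewrite big_nil -[RHS]Rint0; apply: eq_Rint => x _; rewrite big_nil.
rewrite big_cons -ih -RintD//; last exact: intg_sum.
by apply: eq_Rint => x _; rewrite big_cons.
Qed.

Lemma Rint_dom (F : nat -> T -> R) f g :
  (forall n, measurable_fun D (F n)) ->
  (forall x, D x -> F ^~ x @ \oo --> f x) ->
  intg mu D g -> (forall n x, D x -> `|F n x| <= g x) ->
  intg mu D f /\ \int[mu]_(x in D) F n x @[n --> \oo] --> \int[mu]_(x in D) f x.
Proof.
move=> mF Ff gi Fg.
have [|||||fi _ lim] := @dominated_convergence _ _ _ mu D mD
  (fun n => EFin \o F n) (EFin \o f) (EFin \o g); rewrite ?/comp//.
- by move=> n; apply/measurable_EFinP.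
- exact/measurable_EFinP/(measurable_fun_cvg mF).
- by apply: aeW => x Dx; apply: cvg_EFin; [exact: nearW|exact: Ff].
- by apply: aeW => x Dx n; rewrite /= lee_fin Fg.
by split=> //; apply: fine_cvg; rewrite fineK//; exact: integrable_fin_num.
Qed.

Lemma intg_bounded f C : (mu D < +oo)%E -> measurable_fun D f ->
  (forall x, D x -> `|f x| <= C) -> intg mu D f.
Proof.
move=> Dfin mf fC; apply: measurable_bounded_integrable => //.
exists C; split; first exact: num_real.
by move=> y Cy x Dx; exact: (le_trans (fC _ Dx) (ltW Cy)).
Qed.

Lemma intg_of_sq f : (mu D < +oo)%E -> measurable_fun D f ->
  intg mu D (fun x => f x ^+ 2) -> intg mu D f.
Proof.
move=> Dfin mf f2; apply: (@le_intg _ (fun x => f x ^+ 2 + 1)) => //.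
  move=> x _; rewrite -(real_normK (num_real (f x))).
  by have := sqr_ge0 (`|f x| - 1); nra.
by apply: intgD => //; apply: (@intg_bounded _ 1) => // x _; rewrite normr1.
Qed.

Lemma ae_intg (f g : T -> R) : intg mu D f -> measurable_fun D g ->
  {ae mu, forall x, D x -> `|g x| <= f x} -> intg mu D g.
Proof.
move=> fi mg gf; have mf := intg_measurable fi.
pose k x := Num.min `|g x| (f x).
have mk : measurable_fun D k.
  by apply: measurable_minr => //; exact: measurableT_comp.
have ki : intg mu D k.
  apply: (@le_intg _ (fun x => `|f x|)) => //; last exact: intg_norm.
  move=> x _; rewrite /k; case: (leP `|g x| (f x)) => // h.
  by rewrite normr_id (le_trans h)// ler_norm.
have [] := @Rint_ae_eq k (fun x => `|g x|) ki.
- exact: measurableT_comp.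
- by apply: filterS gf => x + Dx => /(_ Dx) h; exact/min_idPl.
- by move=> ni _; apply: le_intg ni => // x _.
Qed.

End RealIntegral.

Lemma intgS {R : realType} {d : measure_display} {T : measurableType d}
    {mu : {measure set T -> \bar R}} (E D : set T) (f : T -> R) :
  measurable E -> measurable D -> D `<=` E -> intg mu E f -> intg mu D f.
Proof. exact: integrableS. Qed.

Lemma intg_patch {R : realType} {d : measure_display} {T : measurableType d}
    {mu : {measure set T -> \bar R}} (D : set T) (f : T -> R) :
  measurable D -> intg mu D f <-> intg mu setT (f \_ D).
Proof. by move=> mD; rewrite integrable_mkcond// restrict_EFin. Qed.

Section RealFubini.
Context {R : realType} {d1 d2 : measure_display}.
Context {X : measurableType d1} {Y : measurableType d2}.
Context {m1 : {sigma_finite_measure set X -> \bar R}}.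
Context {m2 : {sigma_finite_measure set Y -> \bar R}}.
Context {D1 : set X} {D2 : set Y}.
Hypotheses (mD1 : measurable D1) (mD2 : measurable D2).
Local Notation mm := (m1 \x m2)%E.

Let patchX (f : X * Y -> R) x y : D1 x ->
  (f \_ (D1 `*` D2)) (x, y) = ((fun y => f (x, y)) \_ D2) y.
Proof.
move=> D1x; rewrite !patchE; congr (if _ then _ else _).
by apply/idP/idP => /set_mem h; apply/mem_set => //; case: h.
Qed.

Let patchX0 (f : X * Y -> R) x y : ~ D1 x -> (f \_ (D1 `*` D2)) (x, y) = 0.
Proof. by move=> D1x; rewrite patchE memNset// => -[]. Qed.

Let patchY (f : X * Y -> R) x y : D2 y ->
  (f \_ (D1 `*` D2)) (x, y) = ((fun x => f (x, y)) \_ D1) x.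
Proof.
move=> D2x; rewrite !patchE; congr (if _ then _ else _).
by apply/idP/idP => /set_mem h; apply/mem_set => //; case: h.
Qed.

Let patchY0 (f : X * Y -> R) x y : ~ D2 y -> (f \_ (D1 `*` D2)) (x, y) = 0.
Proof. by move=> D1x; rewrite patchE memNset// => -[]. Qed.

Lemma RFubini1 (f : X * Y -> R) : intg mm (D1 `*` D2) f ->
  [/\ {ae m1, forall x, D1 x -> intg m2 D2 (fun y => f (x, y))},
      intg m1 D1 (fun x => \int[m2]_(y in D2) f (x, y)) &
      \int[mm]_(z in D1 `*` D2) f z =
      \int[m1]_(x in D1) \int[m2]_(y in D2) f (x, y)].
Proof.
move=> /(intg_patch _ (measurableX mD1 mD2)) fi; set g := f \_ _ in fi.
have gE x : D1 x -> (\int[m2]_y (g (x, y))%:E =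
    \int[m2]_(y in D2) (f (x, y))%:E)%E.
  move=> D1x; rewrite [RHS]integral_mkcond; apply: eq_integral => y _.
  by rewrite restrict_EFin/= /g patchX.
have g0 x : ~ D1 x -> (\int[m2]_y (g (x, y))%:E = 0)%E.
  move=> D1x; rewrite -[RHS](integral0 m2 setT); apply: eq_integral => y _.
  by rewrite /g patchX0.
have ae1 : {ae m1, forall x, D1 x -> intg m2 D2 (fun y => f (x, y))}.
  apply: filterS (ae_integrable1 fi) => x + D1x => hx.
  apply/(intg_patch _ mD2); apply: eq_intg hx => y _.
  by rewrite /g patchX.
have FE : (fun x => \int[m2]_y (g (x, y))%:E)%E = 
    (fun x => \int[m2]_(y in D2) (f (x, y))%:E)%E \_ D1.
  apply/funext => x; rewrite patchE; case: ifPn => [/set_mem|/negP h].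
    exact: gE.
  by apply: g0 => D1x; apply: h; exact/mem_set.
have iF : m1.-integrable D1 (fun x => \int[m2]_(y in D2) (f (x, y))%:E)%E.
  by apply/(integrable_mkcond _ mD1); rewrite -FE; exact: integrable_fubini_F fi.
have aeF : {ae m1, forall x, D1 x ->
    (\int[m2]_(y in D2) (f (x, y))%:E)%E = 
    (\int[m2]_(y in D2) f (x, y))%:E}.
  by apply: filterS ae1 => x + D1x => /(_ D1x) h; rewrite Rint_EFin.
have mF : measurable_fun D1 (fun x => \int[m2]_(y in D2) f (x, y)).
  by apply: (measurable_comp measurableT) => //; exact: measurable_int iF.
split => //.
  apply/integrableP; split; first exact/measurable_EFinP.
  case/integrableP: (iF) => mFi; apply: le_lt_trans.
  apply: ae_ge0_le_integral => //.
  - by apply: measurableT_comp => //; exact/measurable_EFinP.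
  - by apply: measurableT_comp.
  - by apply: filterS aeF => x + D1x => /(_ D1x) ->.
congr fine; rewrite integral_mkcond restrict_EFin -/g.
rewrite -(integral12_prod_meas1 fi) /fubini_F /comp FE -integral_mkcond.
apply: ae_eq_integral => //; first exact: measurable_int iF.
exact/measurable_EFinP.
Qed.

Lemma RFubini2 (f : X * Y -> R) : intg mm (D1 `*` D2) f ->
  [/\ {ae m2, forall y, D2 y -> intg m1 D1 (fun x => f (x, y))},
      intg m2 D2 (fun y => \int[m1]_(x in D1) f (x, y)) &
      \int[mm]_(z in D1 `*` D2) f z =
      \int[m2]_(y in D2) \int[m1]_(x in D1) f (x, y)].
Proof.
move=> /(intg_patch _ (measurableX mD1 mD2)) fi; set g := f \_ _ in fi.
have gE y : D2 y -> (\int[m1]_x (g (x, y))%:E =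
    \int[m1]_(x in D1) (f (x, y))%:E)%E.
  move=> D2y; rewrite [RHS]integral_mkcond; apply: eq_integral => x _.
  by rewrite restrict_EFin/= /g patchY.
have g0 y : ~ D2 y -> (\int[m1]_x (g (x, y))%:E = 0)%E.
  move=> D2y; rewrite -[RHS](integral0 m1 setT); apply: eq_integral => x _.
  by rewrite /g patchY0.
have ae1 : {ae m2, forall y, D2 y -> intg m1 D1 (fun x => f (x, y))}.
  apply: filterS (ae_integrable2 fi) => y + D2y => hx.
  apply/(intg_patch _ mD1); apply: eq_intg hx => x _.
  by rewrite /g patchY.
have FE : (fun y => \int[m1]_x (g (x, y))%:E)%E = 
    (fun y => \int[m1]_(x in D1) (f (x, y))%:E)%E \_ D2.
  apply/funext => y; rewrite patchE; case: ifPn => [/set_mem|/negP h].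
    exact: gE.
  by apply: g0 => D2y; apply: h; exact/mem_set.
have iF : m2.-integrable D2 (fun y => \int[m1]_(x in D1) (f (x, y))%:E)%E.
  apply/(integrable_mkcond _ mD2); rewrite -FE; apply/integrableP.
  have mg := measurable_int _ fi.
  have mna : measurable_fun setT (abse \o (EFin \o g)) by exact: measurableT_comp.
  split; first exact: measurable_fubini_G fi.
  apply: (le_lt_trans _ ((integrable21ltyP _ _ mg).1 fi)).
  apply: ge0_le_integral => //.
  - by apply: measurableT_comp => //; exact: measurable_fubini_G fi.
  - by apply: (measurable_fun_fubini_tonelli_G (abse \o (EFin \o g))) => // x; exact: abse_ge0.
  - move=> y _; apply: le_abse_integral => //.
    exact: (measurableT_comp mg (pair2_measurable y)).
have aeF : {ae m2, forall y, D2 y ->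
    (\int[m1]_(x in D1) (f (x, y))%:E)%E = 
    (\int[m1]_(x in D1) f (x, y))%:E}.
  by apply: filterS ae1 => y + D2y => /(_ D2y) h; rewrite Rint_EFin.
have mF : measurable_fun D2 (fun y => \int[m1]_(x in D1) f (x, y)).
  by apply: (measurable_comp measurableT) => //; exact: measurable_int iF.
split => //.
  apply/integrableP; split; first exact/measurable_EFinP.
  case/integrableP: (iF) => mFi; apply: le_lt_trans.
  apply: ae_ge0_le_integral => //.
  - by apply: measurableT_comp => //; exact/measurable_EFinP.
  - by apply: measurableT_comp.
  - by apply: filterS aeF => y + D2y => /(_ D2y) ->.
congr fine; rewrite integral_mkcond restrict_EFin -/g.
rewrite -(integral21_prod_meas1 fi) /fubini_G /comp FE -integral_mkcond.
apply: ae_eq_integral => //; first exact: measurable_int iF.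
exact/measurable_EFinP.
Qed.

Lemma Rint_swap (f : X * Y -> R) : intg mm (D1 `*` D2) f ->
  \int[m1]_(x in D1) \int[m2]_(y in D2) f (x, y) =
  \int[m2]_(y in D2) \int[m1]_(x in D1) f (x, y).
Proof. by move=> fi; have [_ _ <-] := RFubini1 fi; have [] := RFubini2 fi. Qed.

Lemma intg_prod_ltyP (f : X * Y -> R) : measurable_fun (D1 `*` D2) f ->
  (intg mm (D1 `*` D2) f <->
  (\int[m1]_(x in D1) \int[m2]_(y in D2) `|(f (x, y))%:E| < +oo)%E).
Proof.
move=> mf; rewrite (intg_patch _ (measurableX mD1 mD2)) integrable12ltyP.
  rewrite [X in _ <-> (X < _)%E]integral_mkcond.
  set A := (X in ((X < _)%E <-> _)); set B := (X in (_ <-> (X < _)%E)).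
  suff -> : A = B by [].
  apply: eq_integral => x _; rewrite patchE; case: ifPn => [/set_mem D1x|/negP h].
    rewrite [RHS]integral_mkcond; apply: eq_integral => y _.
    by rewrite /= patchX// !patchE; case: ifPn => //; rewrite normr0.
  rewrite -[RHS](integral0 m2 setT); apply: eq_integral => y _.
  by rewrite /= patchX0 ?normr0// => /mem_set.
by apply/measurable_EFinP/(measurable_restrictT _ _).1 => //; exact: measurableX.
Qed.

Lemma intg_prod_ltyP2 (f : X * Y -> R) : measurable_fun (D1 `*` D2) f ->
  (intg mm (D1 `*` D2) f <->
  (\int[m2]_(y in D2) \int[m1]_(x in D1) `|(f (x, y))%:E| < +oo)%E).
Proof.
move=> mf; rewrite (intg_patch _ (measurableX mD1 mD2)) integrable21ltyP.
  rewrite [X in _ <-> (X < _)%E]integral_mkcond.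
  set A := (X in ((X < _)%E <-> _)); set B := (X in (_ <-> (X < _)%E)).
  suff -> : A = B by [].
  apply: eq_integral => y _; rewrite patchE; case: ifPn => [/set_mem D2y|/negP h].
    rewrite [RHS]integral_mkcond; apply: eq_integral => x _.
    by rewrite /= patchY// !patchE; case: ifPn => //; rewrite normr0.
  rewrite -[RHS](integral0 m1 setT); apply: eq_integral => x _.
  by rewrite /= patchY0 ?normr0// => /mem_set.
by apply/measurable_EFinP/(measurable_restrictT _ _).1 => //; exact: measurableX.
Qed.

End RealFubini.

(** * Test functions and the fundamental lemma *)

Section C1Functions.
Context {R : realType} {V : normedModType R}.
Implicit Types (f g : V -> R).

Lemma is_derive_quad f x v l C :
  (forall h : R, `|f (x + h *: v) - f x - h * l| <= C * h ^+ 2) ->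
  is_derive x v f l.
Proof.
move=> fC.
have C0 : 0 <= C.
  by have := fC 1; rewrite expr1n mulr1; apply: le_trans; exact: normr_ge0.
have cv : h^-1 *: ((f \o shift x) (h *: v) - f x) @[h --> 0^'] --> l.
  apply/cvgrPdist_le => e e0.
  have d0 : 0 < e / (C + 1) by rewrite divr_gt0// ltr_wpDl.
  near=> h.
  have h0 : h != 0 by near: h; exact: nbhs_dnbhs_neq.
  have hd : `|h| <= e / (C + 1).
    by near: h; exact: dnbhs0_le.
  rewrite /= [_ *: v + x]addrC distrC.
  have -> : h^-1 *: (f (x + h *: v) - f x) - l =
      h^-1 * (f (x + h *: v) - f x - h * l).
    by rewrite mulrBr mulKf.
  rewrite normrM normfV ler_pdivrMl ?normr_gt0//.
  rewrite (le_trans (fC h))// -real_normK ?num_real// expr2 mulrC -mulrA.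
  rewrite ler_wpM2l// (le_trans (ler_wpM2r C0 hd))// mulrAC ler_pdivrMr.
    by rewrite ler_wpM2l ?ltW// ltrDl.
  by rewrite ltr_wpDl.
by apply: DeriveDef; [apply/cvg_ex; exists l|exact/cvg_lim].
Unshelve. all: by end_near. Qed.

Definition C1 f := (forall x, differentiable f x) /\
  forall v, continuous (fun x => 'D_v f x).

Lemma C1_continuous f : C1 f -> continuous f.
Proof. by move=> [df _] x; exact: differentiable_continuous. Qed.

Lemma C1_cst c : C1 (fun=> c).
Proof.
split=> [x|v]; first exact: differentiable_cst.
have -> : (fun x : V => 'D_v (cst c) x) = cst 0.
  by apply/funext => x; exact: derive_cst.
exact: cst_continuous.
Qed.

Lemma C1M f g : C1 f -> C1 g -> C1 (f * g).
Proof.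
move=> [df cf] [dg cg]; split=> [x|v]; first exact: differentiableM.
have -> : (fun x => 'D_v (f * g) x) = (fun x => f x * 'D_v g x + g x * 'D_v f x).
  by apply/funext => x; rewrite deriveM//; exact: diff_derivable.
move=> x; apply: cvgD; apply: cvgM => //.
- exact: differentiable_continuous.
- exact: cg.
- exact: differentiable_continuous.
- exact: cf.
Qed.

Lemma C1_prod (I : Type) (s : seq I) (F : I -> V -> R) :
  (forall i, C1 (F i)) -> C1 (fun x => \prod_(i <- s) F i x).
Proof.
move=> CF; elim: s => [|i s ih].
  rewrite (_ : (fun x => _) = (fun=> 1)); first exact: C1_cst.
  by apply/funext => x; rewrite big_nil.
rewrite (_ : (fun x => _) = F i * (fun x => \prod_(i <- s) F i x)).
  exact: C1M.
by apply/funext => x; rewrite big_cons.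
Qed.

Lemma derive_comp1 (g g' : R -> R) f x v :
  (forall y : R, is_derive y (1 : R) g (g' y)) -> differentiable f x ->
  'D_v (g \o f) x = g' (f x) * 'D_v f x.
Proof.
move=> dg df.
have dgy y : differentiable g y by apply/derivable1_diffP; have [] := dg y.
rewrite deriveE; last exact: differentiable_comp.
by rewrite diff_comp//= diff1E// deriveE// derive1E derive_val mulrC.
Qed.

Lemma C1_comp (g g' : R -> R) f : (forall y : R, is_derive y (1 : R) g (g' y)) ->
  continuous g' -> C1 f -> C1 (g \o f).
Proof.
move=> dg cg' [df cf].
have dgy y : differentiable g y by apply/derivable1_diffP; have [] := dg y.
split=> [x|v]; first exact: differentiable_comp.
rewrite (_ : (fun x => _) = (fun x => g' (f x) * 'D_v f x)); last first.
  by apply/funext => x; exact: derive_comp1.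
move=> x; apply: cvgM; last exact: cf.
by apply: continuous_comp; [exact: differentiable_continuous|exact: cg'].
Qed.

Lemma C1_translate f w : C1 f ->
  C1 (fun x => f (x + w)) /\
  forall v x, 'D_v (fun x => f (x + w)) x = 'D_v f (x + w).
Proof.
move=> [df cf].
have dE v x : 'D_v (fun x => f (x + w)) x = 'D_v f (x + w).
  congr (lim _); apply/funext => /= A; congr (nbhs _ _); apply/funext => h /=.
  by rewrite addrA.
split=> //; split=> [x|v].
  exact: (@differentiable_comp _ _ _ _ (shift w) f).
rewrite (_ : (fun x => _) = (fun x => 'D_v f x) \o (shift w)); last first.
  by apply/funext => x; rewrite dE.
move=> x; apply: continuous_comp; last exact: cf.
by apply: cvgD; [exact: cvg_id|exact: cvg_cst].
Qed.

End C1Functions.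

Section Bumps.
Context {R : realType}.

Definition sqpos (s : R) : R := Num.max 0 s ^+ 2.

Lemma is_derive_sqpos (s : R) : is_derive s (1 : R) sqpos (2 * Num.max 0 s).
Proof.
apply: (@is_derive_quad _ _ _ _ _ _ 1) => h; rewrite /sqpos [h%:A]mulr1 mul1r.
case: (leP 0 s) => s0; case: (leP 0 (s + h)) => sh0; rewrite ler_norml; nra.
Qed.

Lemma sqpos_ge0 s : 0 <= sqpos s. Proof. exact: sqr_ge0. Qed.

Lemma sqpos_gt0 s : 0 < sqpos s <-> 0 < s.
Proof.
rewrite /sqpos; case: (leP 0 s) => s0; last by rewrite expr0n/= ltxx lt_gtF.
by rewrite exprn_even_gt0//= lt_def s0 andbT.
Qed.

Lemma continuous_max0 : continuous (fun s : R => 2 * Num.max 0 s).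
Proof.
move=> s; apply: cvgM; first exact: cvg_cst.
by apply: continuous_max => //; exact: cvg_cst.
Qed.

Context {n : nat}.
Implicit Types a b x : 'rV[R]_n.

Definition box a b : set 'rV[R]_n :=
  [set x | forall i, a ord0 i < x ord0 i < b ord0 i].

Definition cbox a b : set 'rV[R]_n :=
  [set x | forall i, a ord0 i <= x ord0 i <= b ord0 i].

Lemma box_cbox a b : box a b `<=` cbox a b.
Proof. by move=> x abx i; have /andP[/ltW -> /ltW ->] := abx i. Qed.

Lemma cbox_compact a b : compact (cbox a b).
Proof.
rewrite (_ : cbox a b =
    [set v | forall i, `[a ord0 i, b ord0 i]%classic (v ord0 i)]).
  by apply: (@rV_compact _ _ (fun i => `[a ord0 i, b ord0 i]%classic)) => i;
    exact: segment_compact.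
by apply/seteqP; split=> x + i => /(_ i); rewrite /= in_itv.
Qed.

Lemma boxI a b c e : box a b `&` box c e =
  box (\row_i Num.max (a ord0 i) (c ord0 i)) (\row_i Num.min (b ord0 i) (e ord0 i)).
Proof.
apply/seteqP; split=> x /=.
  move=> [ab ce] i; rewrite !mxE gt_max lt_min.
  by have /andP[-> ->] := ab i; have /andP[-> ->] := ce i.
by move=> h; split=> i; have := h i; rewrite !mxE gt_max lt_min;
  move=> /andP[/andP[h1 h2] /andP[h3 h4]]; apply/andP.
Qed.

Lemma box_open a b : open (box a b).
Proof.
rewrite openE => x abx; apply: (@filter_forall _ _ (fun i => [set y : 'rV[R]_n |
  a ord0 i < y ord0 i < b ord0 i]) (nbhs x)) => i.
have : nbhs (x ord0 i) `]a ord0 i, b ord0 i[%classic.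
  by apply: open_nbhs_nbhs; split => //=; rewrite in_itv/=; exact: abx.
move/(@coord_continuous R 1 n ord0 i x); rewrite /nbhs/=.
by apply: (@filterS _ (nbhs x)) => y /=; rewrite in_itv.
Qed.

Definition bump0 a b x : R :=
  \prod_(i < n) (sqpos (x ord0 i - a ord0 i) * sqpos (b ord0 i - x ord0 i)).

Lemma C1_coord i : C1 (fun x : 'rV[R]_n => x ord0 i).
Proof.
split=> [x|v]; first exact: differentiable_coord.
have -> : (fun x => 'D_v (fun x : 'rV[R]_n => x ord0 i) x) = cst (v ord0 i).
  apply/funext => x; apply: derive_val.
  apply: (@is_derive_quad _ _ _ _ _ _ 0) => h.
  by rewrite /cst !mxE mul0r (_ : _ - _ - _ = 0) ?normr0//; ring.
exact: cst_continuous.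
Qed.

Lemma C1_bump0 a b : C1 (bump0 a b).
Proof.
apply: (@C1_prod _ _ _ _ (fun i x =>
  sqpos (x ord0 i - a ord0 i) * sqpos (b ord0 i - x ord0 i))) => i.
have h k c : C1 (fun x : 'rV[R]_n => sqpos (k * x ord0 i + c)).
  apply: (@C1_comp _ _ (fun y => sqpos (k * y + c))
    (fun y => k * (2 * Num.max 0 (k * y + c)))) (C1_coord i).
  - move=> y; apply: (@is_derive_quad _ _ _ _ _ _ (k ^+ 2)) => t.
    rewrite /sqpos [t%:A]mulr1.
    case: (leP 0 (k * y + c)) => s0; case: (leP 0 (k * (y + t) + c)) => sh0;
      rewrite ler_norml; nra.
  - move=> y; apply: cvgM; first exact: cvg_cst.
    apply: (@continuous_comp _ _ _ (fun y => k * y + c)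
      (fun s => 2 * Num.max 0 s)); last exact: continuous_max0.
    apply: cvgD; last exact: cvg_cst.
    by apply: cvgM; [exact: cvg_cst|exact: cvg_id].
apply: C1M.
  by have := h 1 (- a ord0 i); under eq_fun do rewrite mul1r.
by have := h (-1) (b ord0 i); under eq_fun do rewrite mulN1r addrC.
Qed.

Lemma bump0_ge0 a b x : 0 <= bump0 a b x.
Proof. by apply: prodr_ge0 => i _; apply: mulr_ge0; exact: sqpos_ge0. Qed.

Lemma bump0_gt0 a b x : 0 < bump0 a b x <-> box a b x.
Proof.
split=> [h i|h]; last first.
  apply: prodr_gt0 => i _; have /andP[h1 h2] := h i.
  by apply: mulr_gt0; apply/sqpos_gt0; rewrite subr_gt0.
move: h; rewrite /bump0 (bigD1 i)//=; set u := sqpos _; set v := sqpos _.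
set w := \prod_(_ | _) _ => uvw.
have u0 : 0 <= u by exact: sqpos_ge0.
have v0 : 0 <= v by exact: sqpos_ge0.
have uv : u * v != 0 by apply: contraTneq uvw => ->; rewrite mul0r ltxx.
move: uv; rewrite mulf_eq0 negb_or => /andP[un vn].
by rewrite -subr_gt0 -[X in _ && X]subr_gt0; apply/andP; split;
  apply/sqpos_gt0; rewrite lt_def ?un ?vn.
Qed.

(* Increases to the indicator of the box as [k] tends to infinity. *)
Definition bump a b k x : R := 1 - expR (- (k * bump0 a b x)).

Lemma C1_bump a b k : C1 (bump a b k).
Proof.
apply: (@C1_comp _ _ (fun y => 1 - expR (- (k * y)))
  (fun y => k * expR (- (k * y)))) (C1_bump0 a b).
- move=> y.
  have d1 : is_derive y (1 : R) (fun y => - (k * y)) (- k).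
    apply: (@is_derive_quad _ _ _ _ _ _ 0) => h.
    by rewrite [h%:A]mulr1 mul0r (_ : _ - _ - _ = 0) ?normr0//; ring.
  have d2 : is_derive y (1 : R) (expR \o (fun y => - (k * y))) (- k * expR (- (k * y))).
    by rewrite mulrC; exact: is_derive1_comp.
  have -> : (fun y => 1 - expR (- (k * y))) =
            cst 1 - (expR \o (fun y => - (k * y))) by [].
  by apply: is_derive_eq; rewrite sub0r mulNr opprK.
- move=> y; apply: cvgM; first exact: cvg_cst.
  apply: (@continuous_comp _ _ _ (fun y => - (k * y)) expR).
    by apply: cvgN; apply: cvgM; [exact: cvg_cst|exact: cvg_id].
  exact: continuous_expR.
Qed.

Lemma bump_itv a b k x : 0 <= k -> 0 <= bump a b k x <= 1.
Proof.
move=> k0; rewrite /bump subr_ge0 -expR0 ler_expR oppr_le0.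
by rewrite mulr_ge0 ?bump0_ge0// expR0 lerBlDr lerDl expR_ge0.
Qed.

Lemma bump_out a b k x : ~ box a b x -> bump a b k x = 0.
Proof.
move=> h; have -> : bump a b k x = 1 - expR (- (k * 0)); last first.
  by rewrite mulr0 oppr0 expR0 subrr.
rewrite /bump; suff -> : bump0 a b x = 0 by [].
apply/eqP/negPn/negP => h0; apply: h; apply/bump0_gt0.
by rewrite lt_def h0 bump0_ge0.
Qed.

Lemma bump_cvg a b x : box a b x -> bump a b m%:R x @[m --> \oo] --> (1 : R).
Proof.
move=> /bump0_gt0 h; rewrite -[X in _ --> X]subr0; apply: cvgB.
  exact: cvg_cst.
apply/cvgrPdist_le => e e0; near=> m.
rewrite sub0r normrN ger0_norm ?expR_ge0// expRN invf_ple ?posrE ?expR_gt0//.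
apply: le_trans (expR_ge1Dx _); rewrite -lerBlDl -ler_pdivrMr//.
by near: m; exact: nbhs_infty_ger.
Unshelve. all: by end_near. Qed.

Lemma test_fun_bump (O : set 'rV[R]_n) a b k :
  cbox a b `<=` O -> test_fun O (bump a b k).
Proof.
move=> abO; have [df cf] := C1_bump a b k; split => //.
exists (cbox a b); split => //; first exact: cbox_compact.
by move=> x h; apply: bump_out => /box_cbox.
Qed.

End Bumps.

Section FundamentalLemma.
Context {R : realType} {n : nat} {dX : measure_display} {X : measurableType dX}.
Context {leb : {sigma_finite_measure set X -> \bar R}} {pos : X -> 'rV[R]_n}.
Hypothesis ch_open : forall O, open O -> measurable (pos @^-1` O).
Hypothesis ch_gen :
  @measurable dX X = <<s [set pos @^-1` (box ab.1 ab.2) | ab in [set: 'rV[R]_n * 'rV[R]_n]] >>.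

Lemma pos_measurable (f : 'rV[R]_n -> R) : continuous f ->
  measurable_fun setT (fun x => f (pos x)).
Proof.
move=> cf; apply: (measurability _ (RGenOpens.measurableE R)) => //.
move=> _ [_ [a [b ->]] <-]; rewrite setTI.
apply: (ch_open (O := f @^-1` `]a, b[%classic)).
by apply: open_comp => //; exact: interval_open.
Qed.

Let box_zero (O : set 'rV[R]_n) (f : X -> R) a b : open O ->
  intg leb (pos @^-1` O) f ->
  (forall phi, test_fun O phi ->
    \int[leb]_(x in pos @^-1` O) (f x * phi (pos x)) = 0) ->
  cbox a b `<=` O -> \int[leb]_(x in pos @^-1` (box a b)) f x = 0.
Proof.
move=> oO fi f0 abO; have mO := ch_open oO; have mf := intg_measurable fi.
have bO : box a b `<=` O by move=> x /box_cbox /abO.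
have [||||_ lim] := @Rint_dom _ _ _ leb _ mO
    (fun m x => f x * bump a b m%:R (pos x)) (fun x => f x * \1_(box a b) (pos x))
    (fun x => `|f x|).
- move=> m; apply: measurable_funM => //; apply: measurable_funTS.
  by apply: pos_measurable; exact/C1_continuous/C1_bump.
- move=> x _; apply: cvgM; first exact: cvg_cst.
  rewrite indicE; case: (pselect (box a b (pos x))) => abx.
    by rewrite mem_set//; exact: bump_cvg.
  rewrite memNset//; under eq_fun do rewrite bump_out//.
  exact: cvg_cst.
- exact: intg_norm.
- move=> m x _; rewrite normrM ler_piMr// ger0_norm;
    by have /andP[] := @bump_itv _ _ a b m%:R (pos x) (ler0n _ _).
have z m : \int[leb]_(x in pos @^-1` O) (f x * bump a b m%:R (pos x)) = 0.
  by apply: f0; exact: test_fun_bump.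
have {}lim : \int[leb]_(x in pos @^-1` O) (f x * \1_(box a b) (pos x)) = 0.
  move: lim; under eq_fun do rewrite z.
  by move=> lim; apply/esym/(cvg_unique _ _ lim) => //; exact: cvg_cst.
rewrite -{}lim (_ : pos @^-1` box a b = pos @^-1` O `&` pos @^-1` box a b).
  rewrite Rintegral_mkcondr; apply: eq_Rint => x _; rewrite patchE indicE.
  have -> : (x \in pos @^-1` box a b) = (pos x \in box a b).
    by apply/idP/idP => /set_mem h; exact/mem_set.
  by case: ifP; rewrite ?mulr1 ?mulr0.
by apply/esym/setIidr => x /bO.
Qed.

Let box_ae (O : set 'rV[R]_n) (f : X -> R) a b : open O ->
  intg leb (pos @^-1` O) f ->
  (forall phi, test_fun O phi ->
    \int[leb]_(x in pos @^-1` O) (f x * phi (pos x)) = 0) ->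
  cbox a b `<=` O -> {ae leb, forall x, box a b (pos x) -> f x = 0}.
Proof.
move=> oO fi f0 abO; set B := pos @^-1` box a b.
have mO := ch_open oO; have mB : measurable B by apply: ch_open; exact: box_open.
have BO : B `<=` pos @^-1` O by move=> x /box_cbox /abO.
have fB : intg leb B f by exact: (intgS mO mB BO fi).
have fBA A : measurable A -> intg leb (A `&` B) f.
  move=> mA; apply: (intgS mB) fB; first exact: measurableI.
  exact: subIsetr.
have P A : measurable A -> (\int[leb]_(x in A `&` B) (f x)%:E = 0)%E.
  rewrite ch_gen; move: A; apply: dynkin_induction.
  - exact: ch_gen.
  - move=> _ _ [[a1 b1] _ <-] [[a2 b2] _ <-]; rewrite -preimage_setI boxI.
    by eexists (_, _).
  - rewrite setTI -Rint_EFin//; congr EFin.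
    exact: box_zero f0 abO.
  - move=> _ [[a1 b1] _ <-] /=.
    have m1 : measurable (pos @^-1` box a1 b1) by apply: ch_open; exact: box_open.
    rewrite -Rint_EFin; [|exact: measurableI|exact: fBA].
    congr EFin; rewrite -preimage_setI boxI; apply: box_zero f0 _ => //.
    apply: subset_trans abO => x h i; have := h i; rewrite !mxE.
    by rewrite ge_max le_min => /andP[/andP[_ ->] /andP[_ ->]].
  - move=> S mS SB.
    have : (\int[leb]_(x in B) (f x)%:E = 0)%E.
      rewrite -Rint_EFin//; congr EFin; exact: box_zero f0 abO.
    have {1}-> : B = (S `&` B) `|` (~` S `&` B) by rewrite -setIUl setUCr setTI.
    rewrite integral_setU_EFin//.
    + by rewrite SB add0e.
    + exact: measurableI.
    + by apply: measurableI => //; exact: measurableC.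
    + by rewrite -setIUl setUCr setTI; exact: intg_measurable fB.
    + by apply/disj_setPS => x [[? _] []].
  - move=> F mF tF F0; rewrite setI_bigcupl integral_bigcup.
    + by apply: eseries0 => k _ _; exact: F0.
    + exact: trivIset_setIr.
    + by move=> k; exact: measurableI.
    + by rewrite -setI_bigcupl; apply: fBA; exact: bigcupT_measurable.
have := @integral_ae_eq _ _ _ leb B mB (cst 0%E) (EFin \o f) fB.
move=> /(_ (measurable_cst _)) []; last first.
  by move=> N [mN N0 h]; exists N; split=> // x h1; apply: h => /= h2;
    apply: h1 => /h2 [].
move=> E EB mE; rewrite integral_cst// mul0e.
by rewrite -(P E mE); congr (\int[_]_(x in _) _)%E; exact/esym/setIidl.
Qed.

Lemma rat_box (O : set 'rV[R]_n) p : open O -> O p ->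
  exists ab : 'rV[rat]_n * 'rV[rat]_n,
    let a := \row_i ratr (ab.1 ord0 i) in let b := \row_i ratr (ab.2 ord0 i) in
    box a b p /\ cbox a b `<=` O.
Proof.
rewrite openE => oO /oO; rewrite /interior -nbhs_ballE => -[e e0 eO].
have ex_a i : exists q : rat, p ord0 i - e < ratr q < p ord0 i.
  have [//|q] := @rat_in_itvoo R (p ord0 i - e) (p ord0 i).
    by rewrite ltrBlDr ltrDl.
  by rewrite in_itv => h; exists q.
have ex_b i : exists q : rat, p ord0 i < ratr q < p ord0 i + e.
  have [//|q] := @rat_in_itvoo R (p ord0 i) (p ord0 i + e).
    by rewrite ltrDl.
  by rewrite in_itv => h; exists q.
have [qa qaP] := choice ex_a; have [qb qbP] := choice ex_b.
exists (\row_i qa i, \row_i qb i) => /=; split.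
  by move=> i; rewrite !mxE; have /andP[_ ->] := qaP i; have /andP[-> _] := qbP i.
move=> x h; apply: eO; split=> // i j; rewrite (ord1 i).
have := h j; rewrite !mxE => /andP[h1 h2].
have /andP[h3 h4] := qaP j; have /andP[h5 h6] := qbP j.
rewrite /ball/= ltr_norml; apply/andP; split.
  by rewrite ltrBrDr; move: h2 h6; lra.
by move: h1 h3; lra.
Qed.

Lemma ae_open (O : set 'rV[R]_n) (P : X -> Prop) : open O ->
  (forall a b, cbox a b `<=` O -> {ae leb, forall x, box a b (pos x) -> P x}) ->
  {ae leb, forall x, O (pos x) -> P x}.
Proof.
move=> oO h.
pose Q k x := match @unpickle ('rV[rat]_n * 'rV[rat]_n)%type k with
  | Some ab => let a := \row_i ratr (ab.1 ord0 i) in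
      let b := \row_i ratr (ab.2 ord0 i) in
      cbox a b `<=` O -> box a b (pos x) -> P x
  | None => True end.
have /ae_foralln : forall k, {ae leb, forall x, Q k x}.
  move=> k; rewrite /Q; case: unpickle => [ab|]; last exact: aeW.
  case: (pselect (cbox (\row_i ratr (ab.1 ord0 i) : 'rV[R]_n)
    (\row_i ratr (ab.2 ord0 i)) `<=` O)) => abO.
    by apply: filterS (h _ _ abO) => x hx _.
  exact: aeW.
apply: filterS => x Qx Ox; have [ab [h1 h2]] := rat_box oO Ox.
by have := Qx (pickle ab); rewrite /Q pickleK; apply.
Qed.

Lemma flcv (O : set 'rV[R]_n) (f : X -> R) : open O ->
  intg leb (pos @^-1` O) f ->
  (forall phi, test_fun O phi ->
    \int[leb]_(x in pos @^-1` O) (f x * phi (pos x)) = 0) ->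
  {ae leb, forall x, O (pos x) -> f x = 0}.
Proof. by move=> oO fi f0; apply: ae_open => // a b; exact: box_ae f0. Qed.

End FundamentalLemma.

(** * Absolutely continuous functions of one variable *)

Section Interval.
Context {R : realType}.
Notation leb := (@lebesgue_measure R).
Notation mR := (measurableTypeR R).
Implicit Types (f g F G q : R -> R).

Lemma itvoo_measurable (a b : R) : measurable (`]a, b[%classic : set mR).
Proof. exact: measurable_itv. Qed.
#[local] Hint Resolve itvoo_measurable : core.

Lemma itvoo_fin (a b : R) : (leb `]a, b[%classic < +oo)%E.
Proof.
rewrite lebesgue_measure_itv/=; case: ifP => // _.
by rewrite -EFinB ltry.
Qed.

Lemma itvooP (a b t : R) : `]a, b[%classic t <-> a < t < b.
Proof. by rewrite /= in_itv. Qed.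

Lemma near_dist (x e : R) : 0 < e -> \forall y \near x, `|y - x| < e.
Proof.
by move=> e0; apply/nbhs_ballP; exists e => //= y; rewrite /ball/= distrC.
Qed.

Lemma intg_continuous f (a b : R) : continuous f -> intg leb `]a, b[ f.
Proof.
move=> cf; apply: (@intgS _ _ mR leb `[a, b]%classic `]a, b[%classic) => //.
  exact: subset_itv_oo_cc.
apply: continuous_compact_integrable; first exact: segment_compact.
exact: continuous_subspaceT.
Qed.

Lemma Rint_oc f (a b : R) : intg leb `]a, b[ f ->
  \int[leb]_(t in `]a, b[) f t = \int[leb]_(t in `]a, b]) f t.
Proof. exact: Rintegral_itv_bndo_bndc. Qed.

Lemma Rint_cc f (a b : R) : intg leb `]a, b] f ->
  \int[leb]_(t in `]a, b]) f t = \int[leb]_(t in `[a, b]) f t.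
Proof. exact: Rintegral_itv_obnd_cbnd. Qed.

Lemma FTC_C1 F f (a b : R) : (forall x : R, is_derive x (1 : R) F (f x)) ->
  continuous f -> a <= b -> \int[leb]_(t in `]a, b[) f t = F b - F a.
Proof.
move=> dF cf; rewrite le_eqVlt => /predU1P[->|ab].
  by rewrite set_itvoo0 Rintegral_set0 subrr.
have fi := intg_continuous a b cf.
have fcc : intg leb `[a, b] f.
  apply: continuous_compact_integrable; first exact: segment_compact.
  exact: continuous_subspaceT.
rewrite Rint_oc// Rint_cc; last first.
  by apply: (intgS _ _ _ fcc) => //; apply: subset_itvr; rewrite bnd_simp.
have cF : continuous F.
  move=> x; apply/differentiable_continuous/derivable1_diffP.
  by have [] := dF x.
rewrite /Rintegral (@continuous_FTC2 _ f F)//.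
- exact: continuous_subspaceT.
- split=> [x _||]; first by have [] := dF x.
    by apply: cvg_at_right_filter; exact: cF.
  by apply: cvg_at_left_filter; exact: cF.
- by move=> x _; rewrite derive1E derive_val.
Qed.

Lemma primitive_derive q (a x : R) : continuous q -> a < x ->
  is_derive x (1 : R) (fun y => \int[leb]_(t in `[a, y]) q t) (q x).
Proof.
move=> cq ax.
have qi : intg leb `[a, x + 1] q.
  apply: continuous_compact_integrable; first exact: segment_compact.
  exact: continuous_subspaceT.
have [|d1 d2] := @continuous_FTC1_closed _ q a x (x + 1) _ qi ax (cq x).
  by rewrite ltrDl.
by apply: DeriveDef; [exact: d1|rewrite -derive1E; exact: d2].
Qed.

Section Cumulative.
Context {T : R} {f : R -> R}.
Hypothesis fi : intg leb `]0, T[ f.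

Lemma intg_sub (s t : R) : 0 <= s -> t <= T -> intg leb `]s, t[ f.
Proof.
move=> s0 tT; apply: (intgS _ _ _ fi) => //.
by move=> x /itvooP /andP[sx xt]; apply/itvooP;
  rewrite (le_lt_trans s0)// (lt_le_trans xt).
Qed.

Lemma Rint_split (r s t : R) : 0 <= r -> r <= s <= t -> t <= T ->
  \int[leb]_(x in `]r, t[) f x =
  \int[leb]_(x in `]r, s[) f x + \int[leb]_(x in `]s, t[) f x.
Proof.
move=> r0 /andP[rs]; rewrite le_eqVlt => /predU1P[<- _|st tT].
  by rewrite [`]s, s[%classic]set_itvoo0 Rintegral_set0 addr0.
have := @Rintegral_itvB _ f (BRight r) (BLeft t) s.
rewrite !bnd_simp => /(_ (intg_sub r0 tT) rs st) <-.
rewrite -Rint_oc; first by rewrite addrC subrK.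
by apply: intg_sub => //; rewrite (le_trans (ltW st)).
Qed.

Lemma cumul_abs_cont (e : R) : 0 < e -> exists2 del, 0 < del &
  forall s t, 0 <= s -> s <= t -> t <= T -> t - s < del ->
    \int[leb]_(x in `]s, t[) `|f x| < e.
Proof.
move=> e0; have fp := (@intg_patch _ _ mR leb _ f (itvoo_measurable 0 T)).1 fi.
have [del [del0 h]] := integral_normr_continuous fp e0.
exists del => // s t s0 st tT tsd.
have lst : (leb `]s, t[%classic < del%:E)%E.
  by rewrite lebesgue_measure_itv/=; case: ifP; rewrite ?lte_fin.
have := h _ (itvoo_measurable s t) lst.
have -> : \int[leb]_(x in `]s, t[) `|(f \_ `]0, T[) x| =
          \int[leb]_(x in `]s, t[) `|f x|.
  apply: eq_Rint => x /itvooP /andP[sx xt]; rewrite patchE mem_set//.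
  by apply/itvooP; rewrite (le_lt_trans s0)// (lt_le_trans xt).
by [].
Qed.

Lemma cumul_le (s t : R) : 0 <= s -> s <= t -> t <= T ->
  `|\int[leb]_(x in `]s, t[) f x| <= \int[leb]_(x in `]s, t[) `|f x|.
Proof. by move=> s0 st tT; apply: le_normr_Rintegral => //; exact: intg_sub. Qed.

Lemma cumul_dist (s t : R) : 0 <= s -> s <= t -> t <= T ->
  `|\int[leb]_(x in `]0, t[) f x - \int[leb]_(x in `]0, s[) f x| <=
  \int[leb]_(x in `]s, t[) `|f x|.
Proof.
move=> s0 st tT; rewrite (@Rint_split 0 s t) ?s0//.
by rewrite addrAC subrr add0r cumul_le.
Qed.

Lemma cumul_cont (e : R) : 0 < e -> exists2 del, 0 < del &
  forall s t, 0 <= s <= T -> 0 <= t <= T -> `|t - s| < del ->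
  `|\int[leb]_(x in `]0, t[) f x - \int[leb]_(x in `]0, s[) f x| < e.
Proof.
move=> e0; have [del d0 h] := cumul_abs_cont e0; exists del => // s t.
move=> /andP[s0 sT] /andP[t0 tT]; case: (leP s t) => st.
  rewrite (@ger0_norm _ (t - s)) ?subr_ge0// => hd; apply: le_lt_trans (h s t s0 st tT hd).
  exact: cumul_dist.
rewrite (@ltr0_norm _ (t - s)) ?subr_lt0// opprB => hd.
apply: le_lt_trans (h t s t0 (ltW st) sT hd).
by rewrite distrC; apply: cumul_dist => //; exact: ltW.
Qed.

Lemma cumul_measurable (g : R -> R) c : continuous g ->
  measurable_fun `]0, T[ (fun t => g (c + \int[leb]_(x in `]0, t[) f x)).
Proof.
move=> cg; apply: open_continuous_measurable_fun => // t /set_mem/itvooP.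
move=> /andP[t0 tT].
apply: (@continuous_comp R R R (fun t => c + \int[leb]_(x in `]0, t[) f x) g);
  last exact: cg.
apply: cvgD; first exact: cvg_cst.
apply/cvgrPdist_lt => e e0; have [del d0 h] := cumul_cont e0.
near=> s; apply: h.
- have : 0 < s < T.
    near: s; apply: (@near_in_itvoo _ 0 T); by rewrite in_itv/= t0.
  by move=> /andP[/ltW -> /ltW ->].
- by rewrite (ltW t0) ltW.
- by rewrite distrC; near: s; exact: near_dist.
Unshelve. all: by end_near. Qed.

End Cumulative.

Section ChainRule.
Context {T : R} {f : R -> R}.
Hypothesis fi : intg leb `]0, T[ f.
Context {G G' : R -> R} {c L : R}.
Hypothesis GL : forall x y, `|G y - G x - G' x * (y - x)| <= L * (y - x) ^+ 2.

Let w t := c + \int[leb]_(x in `]0, t[) f x.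

Let L0 : 0 <= L.
Proof. by apply: le_trans (normr_ge0 _) _; rewrite -[leRHS]mulr1
  (_ : L * 1 = L * (1 - 0) ^+ 2) ?GL// subr0 expr1n. Qed.

Let G'lip x y : `|G' y - G' x| <= 2 * L * `|y - x|.
Proof.
have [->|xy] := eqVneq x y; first by rewrite !subrr normr0 mulr0.
have yx0 : 0 < `|y - x| by rewrite normr_gt0 subr_eq0 eq_sym.
rewrite -(ler_pM2r yx0) -normrM.
rewrite (_ : _ * `|y - x| = 2 * L * (y - x) ^+ 2); last first.
  by rewrite -real_normK ?num_real//; ring.
have := lerD (GL x y) (GL y x); rewrite -[X in _ <= _ + L * X]sqrrN opprB => h.
have -> : 2 * L * (y - x) ^+ 2 = L * (y - x) ^+ 2 + L * (y - x) ^+ 2 by ring.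
apply: le_trans h; apply: le_trans (ler_normD _ _).
set u := (X in `|X| <= _); set v := (X in _ <= `|X|).
by have -> : u = v by rewrite /u /v; ring.
Qed.

Let G'cont : continuous G'.
Proof.
move=> x; apply/cvgrPdist_lt => e e0.
have d0 : 0 < e / (2 * L + 1) by rewrite divr_gt0// ltr_wpDl// mulr_ge0.
near=> y; rewrite distrC (le_lt_trans (G'lip x y))//.
have xy : `|y - x| < e / (2 * L + 1).
  by near: y; exact: near_dist.
apply: (@le_lt_trans _ _ ((2 * L + 1) * `|y - x|)).
  by rewrite ler_wpM2r// lerDl.
by rewrite mulrC -ltr_pdivlMr// ltr_wpDl// mulr_ge0.
Unshelve. all: by end_near. Qed.

Let w_bound t : 0 <= t <= T -> `|w t| <= `|c| + \int[leb]_(x in `]0, T[) `|f x|.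
Proof.
move=> /andP[t0 tT]; rewrite (le_trans (ler_normD _ _))// lerD2l.
rewrite (le_trans (cumul_le fi (lexx 0) t0 tT))//.
have ni : intg leb `]0, T[ (fun x => `|f x|) := intg_norm fi.
rewrite [leRHS](_ : _ = \int[leb]_(x in `]0, t[) `|f x| +
  \int[leb]_(x in `]t, T[) `|f x|); last first.
  have := @Rintegral_itvB _ (fun x => `|f x|) (BRight 0) (BLeft T) t.
  move: (tT); rewrite le_eqVlt => /predU1P[->|tT'].
    by move=> _; rewrite [`]T, T[%classic]set_itvoo0 Rintegral_set0 addr0.
  rewrite !bnd_simp => /(_ ni t0 tT') <-.
  rewrite -Rint_oc; first by rewrite addrC subrK.
  exact: (intg_norm (intg_sub fi (lexx 0) tT)).
by rewrite lerDl Rintegral_ge0.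
Qed.

Lemma ac_chain_intg : intg leb `]0, T[ (fun t => G' (w t) * f t).
Proof.
pose B := `|c| + \int[leb]_(x in `]0, T[) `|f x|.
suff : intg leb `]0, T[ (fun t => f t * G' (w t)).
  by apply: eq_intg => t _; rewrite mulrC.
apply: (@intg_Mb _ _ _ _ _ _ _ _ (`|G' 0| + 2 * L * B)) => //.
  exact: (cumul_measurable fi c G'cont).
move=> t /itvooP /andP[t0 tT].
rewrite -[G' (w t)](subrK (G' 0)) addrC (le_trans (ler_normD _ _))// lerD2l.
rewrite (le_trans (G'lip _ _))// subr0 ler_wpM2l ?mulr_ge0//.
by apply: w_bound; rewrite !ltW.
Qed.

(* The defect of the formula over [s, u] is at most [3 L (int_s^u |f|)^2], so it
   vanishes by subdivision; no a.e. differentiability is needed. *)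
Lemma ac_chain t : 0 <= t <= T ->
  G (w t) - G c = \int[leb]_(s in `]0, t[) (G' (w s) * f s).
Proof.
move=> /andP[t0 tT]; have gi := ac_chain_intg.
pose Phi t := G (w t) - G c - \int[leb]_(s in `]0, t[) (G' (w s) * f s).
pose om s t := \int[leb]_(x in `]s, t[) `|f x|.
have om0 s u : 0 <= om s u by exact: Rintegral_ge0.
have ni : intg leb `]0, T[ (fun x => `|f x|) := intg_norm fi.
have step s u : 0 <= s -> s <= u -> u <= T ->
    `|Phi u - Phi s| <= 3 * L * om s u ^+ 2.
  move=> s0 su uT.
  have wd x : s <= x -> x <= u -> `|w x - w s| <= om s u.
    move=> sx xu; rewrite /w opprD addrACA subrr add0r.
    have xT := le_trans xu uT.
    rewrite (le_trans (cumul_dist fi s0 sx xT))//.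
    have -> : om s u = om s x + om x u.
      by apply: (@Rint_split T _ ni) => //; rewrite sx.
    by rewrite lerDl; exact: om0.
  have sT := le_trans su uT.
  have -> : Phi u - Phi s = (G (w u) - G (w s) - G' (w s) * (w u - w s)) -
     \int[leb]_(x in `]s, u[) ((G' (w x) - G' (w s)) * f x).
    have -> : \int[leb]_(x in `]s, u[) ((G' (w x) - G' (w s)) * f x) =
       \int[leb]_(x in `]s, u[) (G' (w x) * f x) -
       G' (w s) * \int[leb]_(x in `]s, u[) f x.
      have f2 := intg_sub fi s0 uT.
      rewrite -RintZ// -RintB//.
      - by apply: eq_Rint => x _; rewrite mulrBl.
      - exact: (intg_sub gi).
      - exact: intgZ.
    have e1 := @Rint_split T _ gi 0 s u (lexx 0).
    have e2 := @Rint_split T _ fi 0 s u (lexx 0).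
    rewrite s0 su /= in e1 e2.
    rewrite /Phi e1// /w e2//; ring.
  apply: le_trans (ler_normB _ _) _.
  have -> : 3 * L * om s u ^+ 2 = L * om s u ^+ 2 + 2 * L * om s u * om s u by ring.
  apply: lerD.
    apply: le_trans (GL _ _) _; rewrite ler_wpM2l//.
    rewrite -[leLHS]real_normK ?num_real// lerXn2r ?nnegrE ?normr_ge0 ?om0//.
    exact: wd.
  have gsi : intg leb `]s, u[ (fun x => (G' (w x) - G' (w s)) * f x).
    have := intgB (itvoo_measurable s u) (intg_sub gi s0 uT)
      (intgZ (itvoo_measurable s u) (G' (w s)) (intg_sub fi s0 uT)).
    by apply: eq_intg => x _; rewrite mulrBl.
  apply: le_trans (le_normr_Rintegral _ gsi) _ => //.
  have nfi : intg leb `]s, u[ (fun x => `|f x|) := intg_norm (intg_sub fi s0 uT).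
  rewrite -RintZ//.
  apply: le_Rint => //.
  - exact: intg_norm.
  - exact: intgZ.
  - move=> x /itvooP /andP[sx xu]; rewrite normrM ler_wpM2r//.
    apply: le_trans (G'lip _ _) _; rewrite ler_wpM2l ?mulr_ge0//.
    by apply: wd; exact: ltW.
have main e : 0 < e -> `|Phi t| <= e * (3 * L * om 0 t).
  move=> e0; have [del d0 hd] := cumul_abs_cont fi e0.
  have [N hN] : exists N : nat, t / del < N%:R.
    by have := archimedean.Num.Theory.truncnS_gt (t / del); eexists; eassumption.
  have N0 : (0 : R) < N%:R by apply: le_lt_trans hN; rewrite divr_ge0// ltW.
  pose p k : R := k%:R * (t / N%:R).
  have tN : 0 <= t / N%:R by rewrite divr_ge0// ltW.
  have pN : p N = t by rewrite /p mulrC divfK// gt_eqF.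
  have p0 k : 0 <= p k by rewrite mulr_ge0.
  have pS k : p k.+1 = p k + t / N%:R by rewrite /p -natr1 mulrDl mul1r.
  have tNd : t / N%:R < del by rewrite ltr_pdivrMr// mulrC -ltr_pdivrMr.
  have ind k : (k <= N)%N -> `|Phi (p k)| <= e * (3 * L * om 0 (p k)).
    elim: k => [_|k ih kN].
      rewrite /p mul0r /Phi /w !set_itvoo0 !Rintegral_set0 addr0 !subrr normr0.
      by rewrite !mulr_ge0// ltW.
    have pkT : p k.+1 <= T.
      by apply: le_trans tT; rewrite -pN /p ler_wpM2r// ler_nat.
    have kS : p k <= p k.+1 by rewrite pS lerDl.
    rewrite -[Phi _](subrK (Phi (p k))) addrC.
    apply: le_trans (ler_normD _ _) _.
    have -> : om 0 (p k.+1) = om 0 (p k) + om (p k) (p k.+1).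
      by apply: (@Rint_split T (fun x => `|f x|) ni) => //; rewrite p0.
    rewrite !mulrDr; apply: lerD; first exact/ih/ltnW.
    apply: le_trans (step _ _ (p0 k) kS pkT) _.
    rewrite expr2 [leRHS]mulrC -!mulrA ler_wpM2l// ler_wpM2l//.
    rewrite ler_wpM2l//; apply/ltW/hd => //.
    by rewrite pS addrAC subrr add0r.
  by have := ind N (leqnn N); rewrite pN.
suff : Phi t = 0 by move/eqP; rewrite subr_eq0 => /eqP.
apply/eqP; rewrite -normr_le0; apply/ler_addgt0Pl => e e0; rewrite addr0.
have C0 : 0 < 3 * L * om 0 t + 1 by rewrite ltr_wpDl// !mulr_ge0.
apply: le_trans (main (e / (3 * L * om 0 t + 1)) _) _; first exact: divr_gt0.
by rewrite mulrAC ler_pdivrMr// ler_wpM2l ?ltW// ltrDl.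
Qed.

End ChainRule.
End Interval.

Section Time.
Context {R : realType}.
Notation leb := (@lebesgue_measure R).
Notation mR := (measurableTypeR R).
#[local] Hint Resolve itvoo_measurable : core.
Implicit Types (f g F p q y : R -> R) (s t T : R).

Lemma lebesgue_itvoo (a b : R) : a <= b -> leb `]a, b[%classic = (b - a)%:E.
Proof.
move=> ab; rewrite lebesgue_measure_itv/= lte_fin.
move: ab; rewrite le_eqVlt => /predU1P[->|->]; last by rewrite EFinB.
by rewrite ltxx subrr.
Qed.

Lemma Rint_itv_cst (a b c : R) : a <= b ->
  \int[leb]_(x in `]a, b[) c = c * (b - a).
Proof.
move=> ab; rewrite Rintegral_cst//; congr (_ * _).
exact: (congr1 fine (lebesgue_itvoo ab)).
Qed.

Lemma gronwall T K y : 0 <= K -> intg leb `]0, T[ y ->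
  (forall t, 0 < t < T -> 0 <= y t <= K * \int[leb]_(s in `]0, t[) y s) ->
  forall t, 0 <= t <= T -> \int[leb]_(s in `]0, t[) y s = 0.
Proof.
move=> K0 yi yK t /andP[t0 tT]; pose Phi t := \int[leb]_(s in `]0, t[) y s.
have y0 s : 0 < s < T -> 0 <= y s by move=> /yK /andP[].
have split s u : 0 <= s -> s <= u -> u <= T ->
    Phi u = Phi s + \int[leb]_(x in `]s, u[) y x.
  by move=> s0 su uT; apply: (@Rint_split _ T) => //; rewrite s0.
have mono s u : 0 <= s -> s <= u -> u <= T -> Phi s <= Phi u.
  move=> s0 su uT; rewrite (split s u)// lerDl; apply: Rintegral_ge0 => x.
  move=> /itvooP /andP[sx xu]; apply: y0.
  by rewrite (le_lt_trans s0 sx) (lt_le_trans xu uT).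
have step s u : 0 <= s -> s <= u -> u <= T ->
    Phi u - Phi s <= K * (u - s) * Phi u.
  move=> s0 su uT; rewrite (split s u)// addrAC subrr add0r.
  rewrite mulrAC -Rint_itv_cst//; apply: le_Rint => //.
  - exact: (intg_sub yi).
  - apply: (@intg_bounded _ _ _ _ _ _ _ `|K * (Phi s + \int[leb]_(x in `]s, u[) y x)|) => //.
    exact: itvoo_fin.
  - move=> x /itvooP /andP[sx xu]; have x0 : 0 < x < T.
      by rewrite (le_lt_trans s0 sx) (lt_le_trans xu uT).
    have /andP[_ h] := yK x x0; apply: (le_trans h).
    rewrite ler_wpM2l// -split//; apply: mono => //; last exact: ltW.
    by case/andP: x0 => /ltW.
have [N hN] : exists N : nat, 2 * (K * t) < N%:R.
  have := archimedean.Num.Theory.truncnS_gt (2 * (K * t)).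
  by eexists; eassumption.
have N0 : (0 : R) < N%:R by apply: le_lt_trans hN; rewrite !mulr_ge0.
pose p k : R := k%:R * (t / N%:R).
have tN : 0 <= t / N%:R by rewrite divr_ge0// ltW.
have pN : p N = t by rewrite /p mulrC divfK// gt_eqF.
have p0 k : 0 <= p k by rewrite mulr_ge0.
have pS k : p k.+1 = p k + t / N%:R by rewrite /p -natr1 mulrDl mul1r.
have KtN : 2 * (K * (t / N%:R)) < 1.
  by rewrite !mulrA ltr_pdivrMr// mul1r -mulrA.
have Phi0 s : 0 <= s -> s <= T -> 0 <= Phi s.
  move=> s0 sT; have := mono 0 s (lexx _) s0 sT.
  by rewrite {1}/Phi set_itvoo0 Rintegral_set0.
have ind k : (k <= N)%N -> Phi (p k) = 0.
  elim: k => [_|k ih kN]; first by rewrite /p mul0r /Phi set_itvoo0 Rintegral_set0.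
  have pkT : p k.+1 <= T.
    by apply: le_trans tT; rewrite -pN /p ler_wpM2r// ler_nat.
  have kS : p k <= p k.+1 by rewrite pS lerDl.
  have h := step (p k) (p k.+1) (p0 k) kS pkT; have ihk := ih (ltnW kN).
  have e : p k.+1 - p k = t / N%:R by rewrite pS addrAC subrr add0r.
  rewrite ihk subr0 e in h.
  have := Phi0 (p k.+1) (p0 k.+1) pkT; move: h KtN.
  move: (Phi (p k.+1)) (K * _) => u v h1 h2 h3; apply/eqP; rewrite eq_le h3 andbT.
  by nra.
by have := ind N (leqnn N); rewrite pN.
Qed.

Lemma cumul_sqr T f t : intg leb `]0, T[ f -> 0 <= t <= T ->
  (\int[leb]_(s in `]0, t[) f s) ^+ 2 =
  \int[leb]_(s in `]0, t[) (2 * (\int[leb]_(r in `]0, s[) f r) * f s).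
Proof.
move=> fi tT.
have GL (x y : R) : `|y ^+ 2 - x ^+ 2 - 2 * x * (y - x)| <= 1 * (y - x) ^+ 2.
  rewrite mul1r (_ : _ - _ - _ = (y - x) ^+ 2); last by ring.
  by rewrite ger0_norm// sqr_ge0.
have := @ac_chain _ _ _ fi (fun x => x ^+ 2) (fun x => 2 * x) 0 1 GL t tT.
rewrite add0r expr0n/= subr0 => ->; apply: eq_Rint => s _.
by rewrite add0r.
Qed.

Lemma cumul_sqr_intg T f : intg leb `]0, T[ f ->
  intg leb `]0, T[ (fun s => (\int[leb]_(r in `]0, s[) f r) * f s).
Proof.
move=> fi.
have GL (x y : R) : `|y ^+ 2 - x ^+ 2 - 2 * x * (y - x)| <= 1 * (y - x) ^+ 2.
  rewrite mul1r (_ : _ - _ - _ = (y - x) ^+ 2); last by ring.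
  by rewrite ger0_norm// sqr_ge0.
have h := @ac_chain_intg _ _ _ fi (fun x => x ^+ 2) (fun x => 2 * x) 0 1 GL.
apply: eq_intg (intgZ (itvoo_measurable 0 T) 2^-1 h) => s _.
by rewrite /= add0r -mulrA mulKf.
Qed.

Lemma cumul_mul_intg T f g : intg leb `]0, T[ f -> intg leb `]0, T[ g ->
  intg leb `]0, T[ (fun s => (\int[leb]_(r in `]0, s[) f r) * g s).
Proof.
move=> fi gi.
suff : intg leb `]0, T[ (fun s => g s * (\int[leb]_(r in `]0, s[) f r)).
  by apply: eq_intg => t _; rewrite mulrC.
apply: (@intg_Mb _ _ _ _ _ _ _ _ (\int[leb]_(r in `]0, T[) `|f r|)) => //.
  have := cumul_measurable fi 0 (fun x => @cvg_id _ (nbhs (x : R))).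
  by apply: eq_measurable_fun => s _ /=; rewrite add0r.
move=> t /itvooP /andP[t0 tT]; apply: le_trans (cumul_le fi _ _ _) _ => //.
- exact: ltW.
- exact: ltW.
- have -> : \int[leb]_(r in `]0, T[) `|f r| =
      \int[leb]_(r in `]0, t[) `|f r| + \int[leb]_(r in `]t, T[) `|f r|.
    by apply: (@Rint_split _ T _ (intg_norm fi)) => //; rewrite !ltW.
  by rewrite lerDl Rintegral_ge0.
Qed.

Lemma cumul_mul T f g t : intg leb `]0, T[ f -> intg leb `]0, T[ g ->
  0 <= t <= T ->
  (\int[leb]_(s in `]0, t[) f s) * (\int[leb]_(s in `]0, t[) g s) =
  \int[leb]_(s in `]0, t[) ((\int[leb]_(r in `]0, s[) f r) * g s) +
  \int[leb]_(s in `]0, t[) ((\int[leb]_(r in `]0, s[) g r) * f s).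
Proof.
move=> fi gi /andP[t0 tT]; have tT' : 0 <= t <= T by rewrite t0.
have fgi := intgD (itvoo_measurable 0 T) fi gi.
have sub h : intg leb `]0, T[ h -> intg leb `]0, t[ h by move=> /intg_sub; exact.
have e0 : \int[leb]_(s in `]0, t[) (f s + g s) =
    \int[leb]_(s in `]0, t[) f s + \int[leb]_(s in `]0, t[) g s.
  by rewrite RintD//; exact: sub.
have := cumul_sqr fgi tT'; rewrite e0.
have -> : \int[leb]_(s in `]0, t[)
    (2 * \int[leb]_(r in `]0, s[) (f r + g r) * (f s + g s)) =
    \int[leb]_(s in `]0, t[) (2 * (\int[leb]_(r in `]0, s[) f r) * f s) +
    \int[leb]_(s in `]0, t[) (2 * (\int[leb]_(r in `]0, s[) g r) * g s) +
    2 * (\int[leb]_(s in `]0, t[) ((\int[leb]_(r in `]0, s[) f r) * g s) +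
  \int[leb]_(s in `]0, t[) ((\int[leb]_(r in `]0, s[) g r) * f s)).
  have i1 := sub _ (cumul_sqr_intg fi); have i2 := sub _ (cumul_sqr_intg gi).
  have i3 := sub _ (cumul_mul_intg fi gi); have i4 := sub _ (cumul_mul_intg gi fi).
  have mt := itvoo_measurable 0 t.
  have i1' : intg leb `]0, t[ (fun s => 2 * (\int[leb]_(r in `]0, s[) f r) * f s).
    by apply: eq_intg (intgZ mt 2 i1) => s _; rewrite mulrA.
  have i2' : intg leb `]0, t[ (fun s => 2 * (\int[leb]_(r in `]0, s[) g r) * g s).
    by apply: eq_intg (intgZ mt 2 i2) => s _; rewrite mulrA.
  rewrite -(RintD mt i3 i4) -(RintZ mt 2 (intgD mt i3 i4)) -(RintD mt i1' i2').
  rewrite -(RintD mt (intgD mt i1' i2') (intgZ mt 2 (intgD mt i3 i4))).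
  apply: eq_Rint => s /itvooP /andP[s0 st].
  have sT := le_trans (ltW st) tT.
  have ms := itvoo_measurable 0 s.
  rewrite (RintD ms (intg_sub fi (lexx 0) sT) (intg_sub gi (lexx 0) sT)).
  by ring.
rewrite -(cumul_sqr fi tT') -(cumul_sqr gi tT').
set A := \int[leb]_(s in _) f s; set B := \int[leb]_(s in _) g s.
set C := (X in _ + _ + 2 * X) => h.
have : 2 * (A * B) = 2 * C by move: h; nra.
by move/(mulfI _); apply.
Qed.

Lemma ae_itv_ex (a b : R) (P : R -> Prop) : a < b ->
  {ae leb, forall t, a < t < b -> P t} -> exists2 t, a < t < b & P t.
Proof.
move=> ab [N [mN N0 h]]; apply: contrapT => /forall2NP nP.
have : (leb `]a, b[%classic <= leb N)%E.
  apply: le_measure; rewrite ?inE//.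
  move=> t /itvooP abt; apply: h => /= Pt; have [] := nP t => // h'.
  exact: h' (Pt abt).
rewrite [X in (_ <= X)%E]N0 lebesgue_measure_itv/= lte_fin ab -EFinB lee_fin.
by rewrite subr_le0 leNgt ab.
Qed.

Lemma ae_continuous0 (a b : R) f : continuous f ->
  {ae leb, forall t, a < t < b -> f t = 0} -> forall t, a < t < b -> f t = 0.
Proof.
move=> cf f0 t /andP[at_ tb]; apply/eqP; apply: contraT => ft.
have ft0 : 0 < `|f t| by rewrite normr_gt0.
have : \forall s \near t, `|f s - f t| < `|f t|.
  by have /cvgrPdist_lt/(_ _ ft0) := cf t; apply: filterS => s; rewrite distrC.
move/nbhs_ballP => [d /= d0 hd].
have [||s /andP[h1 h2] fs0] := @ae_itv_ex (Num.max a (t - d)) (Num.min b (t + d))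
  (fun t => f t = 0).
- rewrite gt_max !lt_min (lt_trans at_ tb)/=.
  by apply/andP; split; [|apply/andP; split]; move: d0 at_ tb; lra.
- apply: (@filterS _ _ (ae_filter_ringOfSetsType leb) _ _ _ f0) => s h /andP[].
  rewrite gt_max lt_min.
  by move=> /andP[h1 _] /andP[h2 _]; apply: h; rewrite h1.
move: h1 h2; rewrite gt_max lt_min => /andP[_ h1] /andP[_ h2].
have := hd s; rewrite /ball/= fs0 sub0r normrN ltxx; apply.
by rewrite ltr_norml; apply/andP; split; move: h1 h2; lra.
Qed.

Definition clamp T t : R := Num.max 0 (Num.min t T).

Lemma clamp_id T t : 0 <= t <= T -> clamp T t = t.
Proof. by move=> /andP[t0 tT]; rewrite /clamp min_l// max_r. Qed.

Lemma clamp_itv T t : 0 <= T -> 0 <= clamp T t <= T.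
Proof. by move=> T0; rewrite /clamp le_max lexx ge_max T0 ge_min lexx orbT. Qed.

Lemma clamp_lip T s t : `|clamp T s - clamp T t| <= `|s - t|.
Proof.
have h (x y c : R) : `|Num.min x c - Num.min y c| <= `|x - y|.
  wlog xy : x y / x <= y => [hw|].
    by case: (leP x y) => [/hw//|/ltW/hw]; rewrite distrC [leRHS]distrC.
  rewrite distrC [leRHS]distrC !ger0_norm ?subr_ge0 ?le_min2//.
  by case: (leP x c) => xc; case: (leP y c) => yc; lra.
have h' (x y : R) : `|Num.max 0 x - Num.max 0 y| <= `|x - y|.
  wlog xy : x y / x <= y => [hw|].
    by case: (leP x y) => [/hw//|/ltW/hw]; rewrite distrC [leRHS]distrC.
  rewrite distrC [leRHS]distrC !ger0_norm ?subr_ge0 ?le_max2//.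
  by case: (leP 0 x) => xc; case: (leP 0 y) => yc; lra.
exact: le_trans (h' _ _) (h _ _ _).
Qed.

Lemma continuous_of_modulus T f :
  (forall e, 0 < e -> exists2 del, 0 < del & forall s t, 0 <= s <= T ->
     0 <= t <= T -> `|t - s| < del -> `|f t - f s| < e) -> 0 <= T ->
  continuous (fun t => f (clamp T t)).
Proof.
move=> h T0 t; apply/cvgrPdist_lt => e e0; have [del d0 hd] := h e e0.
near=> s; rewrite distrC; apply: hd; rewrite ?clamp_itv//.
by apply: le_lt_trans (clamp_lip _ _ _) _; near: s; exact: near_dist.
Unshelve. all: by end_near. Qed.

Lemma weak_primitive T F g : 0 < T -> continuous F -> intg leb `]0, T[ g ->
  (forall p, test_fun (`]0, T[%classic : set R) p ->
     \int[leb]_(t in `]0, T[) (F t * 'D_1 p t) =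
     - \int[leb]_(t in `]0, T[) (g t * p t)) ->
  forall t, 0 <= t <= T -> F t = F 0 + \int[leb]_(s in `]0, t[) g s.
Proof.
move=> T0 cF gi weak; have T0' := ltW T0.
pose Gam t := \int[leb]_(s in `]0, t[) g s.
pose H t := F t - Gam (clamp T t).
have cH : continuous H.
  move=> t; apply: cvgB; first exact: cF.
  exact: (continuous_of_modulus (cumul_cont gi) T0').
have mT := itvoo_measurable 0 T.
have core e : 0 < e -> e < T - e -> exists c, forall t, e < t < T - e -> H t = c.
  move=> e0 eT; pose w t := sqpos (t - e) * sqpos (T - e - t).
  have csq : continuous (@sqpos R).
    move=> t; apply/differentiable_continuous/derivable1_diffP.
    by have [] := is_derive_sqpos t.
  have cw : continuous w.
    move=> t; apply: cvgM.
      apply: (@continuous_comp R R R (fun t => t - e) sqpos); last exact: csq.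
      by apply: cvgB; [exact: cvg_id|exact: cvg_cst].
    apply: (@continuous_comp R R R (fun t => T - e - t) sqpos); last exact: csq.
    by apply: cvgB; [exact: cvg_cst|exact: cvg_id].
  have w0 t : 0 <= w t by rewrite mulr_ge0 ?sqpos_ge0.
  have wgt t : e < t < T - e -> 0 < w t.
    by move=> /andP[h1 h2]; apply: mulr_gt0; apply/sqpos_gt0; rewrite subr_gt0.
  have wout t : t <= e \/ T - e <= t -> w t = 0.
    rewrite /w /sqpos => -[h|h].
      by rewrite (@max_l _ _ 0 (t - e)) ?subr_le0// expr0n/= mul0r.
    by rewrite (@max_l _ _ 0 (T - e - t)) ?subr_le0// expr0n/= mulr0.
  have wi := intg_continuous 0 T cw.
  have Iw : \int[leb]_(t in `]0, T[) w t != 0.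
    apply/negP => /eqP Iw0.
    have := Rint_ge0_eq0 mT wi (aeW leb (fun t _ => w0 t)).
    rewrite Iw0 => /(_ (lexx _)) ae0.
    have [|t het wt0] := @ae_itv_ex e (T - e) (fun t => w t = 0) eT.
      apply: filterS ae0 => t h /andP[h1 h2]; apply: h; apply/itvooP.
      by move: e0 h1 h2; lra.
    by have := wgt t het; rewrite wt0 ltxx.
  pose c := (\int[leb]_(t in `]0, T[) (H t * w t)) / \int[leb]_(t in `]0, T[) w t.
  pose q t := (H t - c) * w t.
  have cq : continuous q.
    move=> t; apply: cvgM; last exact: cw.
    by apply: cvgB; [exact: cH|exact: cvg_cst].
  have qi := intg_continuous 0 T cq.
  have Hwi : intg leb `]0, T[ (fun t => H t * w t).
    by apply: intg_continuous => t; apply: cvgM; [exact: cH|exact: cw].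
  have q0 : \int[leb]_(t in `]0, T[) q t = 0.
    rewrite (_ : \int[leb]_(t in `]0, T[) q t =
      \int[leb]_(t in `]0, T[) (H t * w t - c * w t)); last first.
      by apply: eq_Rint => t _; rewrite /q mulrBl.
    rewrite RintB//; last exact: intgZ.
    by rewrite RintZ// /c divfK// subrr.
  pose P x := \int[leb]_(t in `[-1, x]) q t.
  have qout t : t <= e \/ T - e <= t -> q t = 0.
    by move=> h; rewrite /q wout ?mulr0.
  have P0 x : x <= e -> P x = 0.
    move=> xe; rewrite /P -[RHS](@Rint0 R _ mR leb `[-1, x]%classic).
    apply: eq_Rint => t; rewrite /= in_itv/= => /andP[_ tx].
    by rewrite qout//; left; exact: le_trans xe.
  have qcc u v : intg leb `[u, v] q.
    apply: continuous_compact_integrable; first exact: segment_compact.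
    exact: continuous_subspaceT.
  have PE x : 0 <= x -> P x = \int[leb]_(t in `]0, x[) q t.
    move=> x0; have qo u v := intg_continuous u v cq.
    rewrite /P -Rint_cc; last first.
      by apply: intgS (qcc (-1) x) => //; apply: subset_itvr; rewrite bnd_simp.
    rewrite -Rint_oc//.
    have -> : \int[leb]_(t in `]-1, x[) q t = \int[leb]_(t in `]-1, x[ `&` `]0, x[) q t.
      rewrite Rintegral_mkcondr; apply: eq_Rint => t /itvooP /andP[_ tx].
      rewrite patchE; case: ifPn => // /negP h; apply: qout; left.
      rewrite leNgt; apply/negP => et; apply: h; apply/mem_set/itvooP.
      by rewrite (lt_trans e0 et).
    congr (\int[_]_(x in _) _); apply/setIidr => t /itvooP /andP[t0 tx].
    by apply/itvooP; rewrite tx andbT (lt_trans _ t0).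
  have dP x : is_derive x (1 : R) P (q x).
    case: (ltP (-1) x) => x1; first exact: primitive_derive.
    have xe : x < e by apply: le_lt_trans x1 _; rewrite (lt_trans _ e0).
    rewrite qout; last by left; exact: ltW.
    apply: (@near_eq_is_derive _ _ _ (cst 0)) => //.
    near=> y; rewrite P0//; apply/ltW.
    have : `|y - x| < e - x by near: y; apply: near_dist; rewrite subr_gt0.
    by rewrite ltr_norml => /andP[_]; lra.
  have tP : test_fun (`]0, T[%classic : set R) P.
    have dfP x : differentiable P x.
      by apply/derivable1_diffP; have [] := dP x.
    split=> [//|v|].
      have -> : (fun x => 'D_v P x) = (fun x => v * q x).
        apply/funext => x; rewrite deriveE// diff1E//= derive1E.
        by congr (_ * _); exact: derive_val.
      by move=> x; apply: cvgM; [exact: cvg_cst|exact: cq].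
    exists `[e, T - e]%classic; split.
    - exact: segment_compact.
    - move=> x /=; rewrite !in_itv/= => /andP[h1 h2].
      by move: e0 h1 h2; lra.
    - move=> x h; case: (leP x e) => [|ex]; first exact: P0.
      have Tx : T - e < x.
        by rewrite ltNge; apply/negP => xT; apply: h; rewrite /= in_itv/= xT ltW.
      have x0 : 0 <= x by rewrite ltW// (lt_trans e0).
      rewrite PE//.
      case: (leP x T) => xT.
        move: q0; rewrite (@Rint_split _ T _ qi 0 x T)// ?x0//.
        rewrite [X in _ + X](_ : _ = 0) ?addr0//.
        rewrite -[RHS](@Rint0 R _ mR leb `]x, T[%classic); apply: eq_Rint => t.
        move=> /itvooP /andP[xt _]; apply: qout; right.
        by rewrite ltW// (lt_trans Tx).
      rewrite (@Rint_split _ x _ (intg_continuous 0 x cq) 0 T x)// ?T0' ?ltW//.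
      rewrite q0 add0r -[RHS](@Rint0 R _ mR leb `]T, x[%classic).
      apply: eq_Rint => t /itvooP /andP[Tt _]; apply: qout; right.
      by rewrite ltW// (le_lt_trans _ Tt)// lerBlDr lerDl ltW.
  have PT : P T = 0.
    by rewrite PE.
  have FPi : intg leb `]0, T[ (fun t => F t * q t).
    by apply: intg_continuous => t; apply: cvgM; [exact: cF|exact: cq].
  have e1 : \int[leb]_(t in `]0, T[) (F t * q t) = - \int[leb]_(t in `]0, T[) (g t * P t).
    rewrite -weak//; apply: eq_Rint => t _; congr (_ * _).
    by apply/esym; exact: derive_val.
  have TT : 0 <= T <= T by rewrite T0' lexx.
  have := cumul_mul gi qi TT; rewrite q0 mulr0.
  have -> : \int[leb]_(s in `]0, T[) (\int[leb]_(r in `]0, s[) q r * g s) =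
    \int[leb]_(t in `]0, T[) (g t * P t).
    apply: eq_Rint => t /itvooP /andP[t0 _]; rewrite PE ?ltW//.
    by rewrite mulrC.
  move=> e2.
  have Hq : \int[leb]_(t in `]0, T[) (H t * q t) = 0.
    rewrite (_ : \int[leb]_(t in `]0, T[) (H t * q t) = 
     \int[leb]_(t in `]0, T[) (F t * q t - (\int[leb]_(r in `]0, t[) g r) * q t)).
      rewrite RintB//; last exact: cumul_mul_intg.
      by move: e1 e2; lra.
    apply: eq_Rint => t /itvooP /andP[t0 tT].
    by rewrite /H clamp_id ?mulrBl// !ltW.
  have Hq2 : \int[leb]_(t in `]0, T[) ((H t - c) * q t) = 0.
    have Hqi : intg leb `]0, T[ (fun t => H t * q t).
      by apply: intg_continuous => t; apply: cvgM; [exact: cH|exact: cq].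
    rewrite (_ : \int[leb]_(t in `]0, T[) ((H t - c) * q t) = 
     \int[leb]_(t in `]0, T[) (H t * q t - c * q t)).
      rewrite RintB//; last exact: intgZ.
      by rewrite RintZ// Hq q0 mulr0 subrr.
    by apply: eq_Rint => t _; rewrite mulrBl.
  exists c => t het.
  have cHq : continuous (fun t => (H t - c) * q t).
    move=> u; apply: cvgM; last exact: cq.
    by apply: cvgB; [exact: cH|exact: cvg_cst].
  have := Rint_ge0_eq0 mT (intg_continuous 0 T cHq) (aeW leb _).
  rewrite Hq2 => /(_ _ (lexx _)) h.
  have /(@ae_continuous0 0 T _ cHq)/(_ t) : {ae leb, forall t, 0 < t < T ->
      (H t - c) * q t = 0}.
    have h' : forall x, `]0, T[%classic x -> 0 <= (H x - c) * q x.
      by move=> x _; rewrite /q mulrA -expr2 mulr_ge0 ?sqr_ge0.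
    by apply: filterS (h h') => x hx x0; apply: hx; apply/itvooP.
  have /andP[h1 h2] := het.
  have t0T : 0 < t < T by move: e0 h1 h2; lra.
  move=> /(_ t0T)/eqP; rewrite /q mulrA mulf_eq0 (gt_eqF (wgt t het)) orbF.
  by rewrite -expr2 sqrf_eq0 subr_eq0 => /eqP.
have Hc t : 0 < t < T -> H t = H (T / 2).
  move=> /andP[t0 tT]; pose e := Num.min (T / 4) (Num.min (t / 2) ((T - t) / 2)).
  have e0 : 0 < e by rewrite !lt_min; lra.
  have he : e <= T / 4 /\ e <= t / 2 /\ e <= (T - t) / 2.
    by rewrite !ge_min !lexx !orbT.
  have [h1 [h2 h3]] := he.
  have [|c hc] := core e e0; first lra.
  by rewrite (hc t) ?(hc (T / 2))//; lra.
have H0 : H 0 = H (T / 2).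
  apply/eqP; rewrite -subr_eq0 -normr_le0; apply/ler_addgt0Pl => e e0.
  rewrite addr0; have /cvgrPdist_lt/(_ _ e0) := cH 0.
  move/nbhs_ballP => [d /= d0 hd].
  have := hd (Num.min (d / 2) (T / 2)).
  rewrite (Hc (Num.min (d / 2) (T / 2))); last first.
    by rewrite lt_min gt_min; apply/andP; split; [lra|apply/orP; right; lra].
  move=> h; apply/ltW/h; rewrite /ball/= sub0r normrN ger0_norm; last first.
    by rewrite le_min; lra.
  by rewrite gt_min; apply/orP; left; lra.
have HT : H T = H (T / 2).
  apply/eqP; rewrite -subr_eq0 -normr_le0; apply/ler_addgt0Pl => e e0.
  rewrite addr0; have /cvgrPdist_lt/(_ _ e0) := cH T.
  move/nbhs_ballP => [d /= d0 hd].
  have m1 : Num.min (d / 2) (T / 2) <= d / 2 by rewrite ge_min lexx.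
  have m2 : Num.min (d / 2) (T / 2) <= T / 2 by rewrite ge_min lexx orbT.
  have m0 : 0 < Num.min (d / 2) (T / 2) by rewrite lt_min; lra.
  have := hd (T - Num.min (d / 2) (T / 2)).
  rewrite (Hc (T - Num.min (d / 2) (T / 2))); last by lra.
  move=> h; apply/ltW/h; rewrite /ball/= opprB addrC subrK ger0_norm ?ltW//.
  by rewrite gt_min; apply/orP; left; lra.
move=> t /andP[t0 tT]; have tT' : 0 <= t <= T by rewrite t0.
have : H t = H 0.
  rewrite H0; move: t0; rewrite le_eqVlt => /predU1P[<-//|t0].
  by move: tT; rewrite le_eqVlt => /predU1P[->//|tT]; apply: Hc; rewrite t0.
rewrite /H !clamp_id ?lexx// /Gam set_itvoo0 Rintegral_set0 subr0 => <-.
by rewrite subrK.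
Unshelve. all: by end_near. Qed.

End Time.

(** * Weak derivatives *)

Lemma measurable_Rint_param {R : realType} {d1 d2 : measure_display}
    {X : measurableType d1} {Y : measurableType d2}
    {m2 : {sigma_finite_measure set Y -> \bar R}} (k : X * Y -> R) :
  measurable_fun setT k -> measurable_fun setT (fun x => \int[m2]_y k (x, y)).
Proof.
move=> mk; have mk' : measurable_fun setT (EFin \o k) by exact/measurable_EFinP.
apply: (@measurable_comp _ _ _ _ _ _ setT) => //=.
rewrite (_ : (fun x => \int[m2]_y (k (x, y))%:E)%E = fun x =>
  (\int[m2]_y ((EFin \o k)^\+ (x, y)) - \int[m2]_y ((EFin \o k)^\- (x, y)))%E).
  apply: emeasurable_funB.
    by apply: measurable_fun_fubini_tonelli_F => //; exact: measurable_funepos.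
  by apply: measurable_fun_fubini_tonelli_F => //; exact: measurable_funeneg.
apply/funext => x; rewrite integralE.
by congr (_ - _)%E; apply: eq_integral => y _; rewrite ?funeposE ?funenegE.
Qed.

Lemma ae_swap {R : realType} {d1 d2 : measure_display}
    {X : measurableType d1} {Y : measurableType d2}
    {m1 : {sigma_finite_measure set X -> \bar R}}
    {m2 : {sigma_finite_measure set Y -> \bar R}}
    (D1 : set X) (D2 : set Y) (A : X * Y -> R) :
  measurable D1 -> measurable D2 -> measurable_fun (D1 `*` D2) A ->
  {ae m2, forall y, D2 y -> {ae m1, forall x, D1 x -> A (x, y) = 0}} ->
  {ae m1, forall x, D1 x -> {ae m2, forall y, D2 y -> A (x, y) = 0}}.
Proof.
move=> mD1 mD2 mA A0.
have mAy y : D2 y -> measurable_fun D1 (fun x => A (x, y)).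
  move=> D2y; apply: (measurable_comp (measurableX mD1 mD2) _ mA).
    by move=> _ [x D1x <-]; split.
  exact: measurable_funTS (pair2_measurable y).
have A00 : {ae m2, forall y, D2 y -> (\int[m1]_(x in D1) `|(A (x, y))%:E| = 0)%E}.
  apply: filterS A0 => y + D2y => /(_ D2y) h.
  apply/(ae_eq_integral_abs m1 mD1); first by apply/measurable_EFinP; exact: mAy.
  by apply: filterS h => x + D1x => /(_ D1x) /= ->.
have nA : measurable_fun (D1 `*` D2) (fun p => `|A p|) by exact: measurableT_comp.
have Ai : intg (m1 \x m2)%E (D1 `*` D2) (fun p => `|A p|).
  apply/(intg_prod_ltyP2 mD1 mD2 nA).
  rewrite (_ : (\int[m2]_(y in D2) _)%E = 0%E) ?ltry//.
  rewrite -[RHS](integral0 m2 D2).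
  have [N [mN N0 hN]] := A00.
  have -> : (\int[m2]_(y in D2) \int[m1]_(x in D1) `|(`|A (x, y)|)%:E| =
    \int[m2]_(y in D2) (fun y => \int[m1]_(x in D1) `|(A (x, y))%:E|) y)%E.
    by apply: eq_integral => y _; apply: eq_integral => x _; rewrite /= normr_id.
  apply: ge0_ae_eq_integral => //.
  - have mA' : measurable_fun setT (fun p => `|((A \_ (D1 `*` D2)) p)%:E|%E).
      apply: measurableT_comp => //; apply/measurable_EFinP.
      by apply/(measurable_restrictT _ _).1 => //; exact: measurableX.
    have := @measurable_fun_fubini_tonelli_G _ _ _ _ _ m1 _ mA' (fun _ => abse_ge0 _).
    move/(measurable_funTS (D := D2)); apply: eq_measurable_fun => y /set_mem D2y.
    rewrite /fubini_G [RHS]integral_mkcond; apply: eq_integral => x _.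
    rewrite !patchE /=; case: ifPn => [/set_mem [D1x _]|/negP h].
      by rewrite mem_set.
    rewrite memNset ?normr0// => D1x; apply: h; exact/mem_set.
  - by move=> y _; exact: integral_ge0.
have [_ i2 e2] := RFubini2 mD1 mD2 Ai; have [s1 i1 e1] := RFubini1 mD1 mD2 Ai.
have z : \int[m1]_(x in D1) \int[m2]_(y in D2) `|A (x, y)| = 0.
  rewrite -e1 e2 -[RHS](@Rint0 R _ _ m2 D2).
  have [||_ ->//] := @Rint_ae_eq _ _ _ m2 _ mD2 _ (fun=> 0) i2.
    exact: measurable_cst.
  apply: filterS A00 => y + D2y => /(_ D2y) /=.
  rewrite /Rintegral; under [X in _ -> fine X = _]eq_integral do rewrite -abse_EFin.
  by move=> ->.
have nn : {ae m1, forall x, D1 x -> 0 <= \int[m2]_(y in D2) `|A (x, y)|}.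
  by apply: aeW => x _; exact: Rintegral_ge0.
have h := Rint_ge0_eq0 mD1 i1 nn; rewrite z in h; have {}h := h (lexx _).
apply: filterS2 s1 h => x sx hx D1x.
have nny : {ae m2, forall y, D2 y -> 0 <= `|A (x, y)|} by apply: aeW.
have h0 := Rint_ge0_eq0 mD2 (sx D1x) nny; rewrite (hx D1x) in h0.
apply: filterS (h0 (lexx _)) => y + D2y => /(_ D2y) /eqP.
by rewrite normr_eq0 => /eqP.
Qed.

(* What is used of Lebesgue measure seen through [pos]; [tr i h] is the
   translation by [h] along the [i]-th axis. *)
Record chart {R : realType} {n : nat} {dX : measure_display}
  {X : measurableType dX} (leb : {sigma_finite_measure set X -> \bar R})
  (pos : X -> 'rV[R]_n) (tr : 'I_n -> R -> X -> X) : Prop := Chart {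
  ch_open : forall O, open O -> measurable (pos @^-1` O);
  ch_gen : @measurable dX X =
    <<s [set pos @^-1` (box ab.1 ab.2) | ab in [set: 'rV[R]_n * 'rV[R]_n]] >>;
  ch_fin : forall a b, (leb (pos @^-1` box a b) < +oo)%E;
  ch_pos : forall a b : 'rV[R]_n, (forall i, a ord0 i < b ord0 i) ->
    (0 < leb (pos @^-1` box a b))%E;
  ch_tr : forall i h x, pos (tr i h x) = pos x + h *: delta_mx ord0 i;
  ch_trm : forall i, measurable_fun setT
    (fun p : X * measurableTypeR R => tr i p.2 p.1);
  ch_inv : forall i h A, measurable A -> leb (tr i h @^-1` A) = leb A }.

Section Translation.
Context {R : realType} {n : nat} {dX : measure_display} {X : measurableType dX}.
Context {leb : {sigma_finite_measure set X -> \bar R}} {pos : X -> 'rV[R]_n}.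
Context {tr : 'I_n -> R -> X -> X}.
Hypothesis ch : chart leb pos tr.
Implicit Types (i : 'I_n) (f g v : X -> R).
Notation leb1 := (@lebesgue_measure R).

Lemma tr_measurable i h : measurable_fun setT (tr i h).
Proof.
exact: (measurableT_comp (ch_trm ch i) (pair2_measurable (h : measurableTypeR R))).
Qed.

Lemma ge0_integral_tr i h (f : X -> \bar R) : measurable_fun setT f ->
  (forall x, 0 <= f x)%E -> (\int[leb]_x f (tr i h x) = \int[leb]_x f x)%E.
Proof.
move=> mf f0; have := @ge0_integral_pushforward _ _ _ _ _ _ (tr_measurable i h)
  leb setT f measurableT.
rewrite preimage_setT /comp => <- //.
apply: eq_measure_integral; first exact: tr_measurable.
by move=> mt A mA _; exact: (ch_inv ch i h mA).
Qed.

Lemma intg_tr i h f : intg leb setT f -> intg leb setT (fun x => f (tr i h x)).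
Proof.
move=> /integrableP[/measurable_EFinP mf fi]; apply/integrableP; split.
  by apply/measurable_EFinP; apply: measurableT_comp => //; exact: tr_measurable.
rewrite (ge0_integral_tr i h (f := fun x => `|(f x)%:E|%E))//.
by apply: measurableT_comp => //; exact/measurable_EFinP.
Qed.

Lemma Rint_tr i h f : intg leb setT f ->
  \int[leb]_x f (tr i h x) = \int[leb]_x f x.
Proof.
move=> fi; have /measurable_int mf := fi.
congr fine; rewrite integralE [RHS]integralE; congr (_ - _)%E.
  rewrite -(ge0_integral_tr i h (f := (fun x => (f x)%:E)^\+%E)) => //; last first.
    exact: measurable_funepos.
  by apply: eq_integral => x _; rewrite !funeposE.
rewrite -(ge0_integral_tr i h (f := (fun x => (f x)%:E)^\-%E)) => //; last first.
  exact: measurable_funeneg.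
by apply: eq_integral => x _; rewrite !funenegE.
Qed.

Lemma intg_tr_prod i f (h : R) : intg leb setT f ->
  intg (leb \x leb1)%E (setT `*` `]0, h[%classic) (fun p => f (tr i p.2 p.1)).
Proof.
move=> fi; have mf := intg_measurable fi.
have mp : measurable_fun (setT `*` `]0, h[%classic)
    (fun p : X * measurableTypeR R => f (tr i p.2 p.1)).
  apply: measurable_funTS.
  exact: (measurableT_comp mf (ch_trm ch i)).
apply/(intg_prod_ltyP2 measurableT (itvoo_measurable 0 h) mp).
have -> : (\int[leb1]_(y in `]0%R, h[) \int[leb]_x `|(f (tr i y x))%:E| =
    \int[leb1]_(y in `]0%R, h[) (cst (\int[leb]_x `|(f x)%:E|)) y)%E.
  apply: eq_integral => y _ /=.
  rewrite (ge0_integral_tr i y (f := fun x => `|(f x)%:E|%E))//.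
  by apply: measurableT_comp => //; exact/measurable_EFinP.
rewrite integral_cst; last exact: itvoo_measurable.
have /integrableP[_ lty] := fi.
apply: lte_mul_pinfty => //; first exact: integral_ge0.
  by rewrite ge0_fin_numE//; exact: integral_ge0.
exact: itvoo_fin.
Qed.

Lemma pos_cont_measurable (f : 'rV[R]_n -> R) : continuous f ->
  measurable_fun setT (fun x => f (pos x)).
Proof. exact: pos_measurable (ch_open ch) f. Qed.

Lemma bounded_dom_fin (O : set 'rV[R]_n) : open O -> bounded_set O ->
  (leb (pos @^-1` O) < +oo)%E.
Proof.
move=> oO [M [_ hM]]; pose a : 'rV[R]_n := const_mx (- (`|M| + 2)).
pose b : 'rV[R]_n := const_mx (`|M| + 2).
apply: le_lt_trans (ch_fin ch a b); apply: le_measure; rewrite ?inE.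
- exact: ch_open ch _ oO.
- by apply: (ch_open ch); exact: box_open.
- move=> x Ox i; rewrite !mxE -ltr_norml.
  apply: (@le_lt_trans _ _ `|pos x|).
    rewrite [leRHS]/Num.norm/= mx_normrE.
    exact: (le_bigmax _ (fun ij => `|pos x ij.1 ij.2|) (ord0, i)).
  apply: (@le_lt_trans _ _ (`|M| + 1)); last by rewrite ltrD2l ltr1n.
  by apply: hM Ox; rewrite (le_lt_trans (ler_norm _))// ltrDl.
Qed.

End Translation.

Section TestFunctions.
Context {R : realType} {V : normedModType R}.
Implicit Types (O : set V) (phi : V -> R).

Lemma test_fun_C1 O phi : test_fun O phi -> C1 phi.
Proof. by move=> []. Qed.

Lemma test_fun_bounded O phi : test_fun O phi ->
  exists2 C, 0 <= C & forall x, `|phi x| <= C.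
Proof.
move=> tphi; have cphi := C1_continuous (test_fun_C1 tphi).
have [_ _ [K [cK KO K0]]] := tphi.
have [K00|/set0P [x0 Kx0]] := eqVneq K set0.
  by exists 0 => // x; rewrite K0 ?normr0// K00.
have cn : continuous (fun x => `|phi x|).
  by move=> x; apply: cvg_norm; exact: cphi.
have [x Kx hx] := compact_EVT_max (ex_intro _ x0 Kx0) cK (continuous_subspaceT cn).
exists `|phi x| => // y; have [Ky|nKy] := pselect (K y).
  by apply: hx; exact/mem_set.
by rewrite K0// normr0.
Qed.

Lemma test_derive_out O phi : test_fun O phi -> forall v x,
  ~ O x -> 'D_v phi x = 0.
Proof.
move=> [df cf [K [cK KO K0]]] v x nOx.
have cl : closed K by apply: compact_closed => //; exact: norm_hausdorff.
rewrite (@near_eq_derive _ _ _ _ (cst 0)); first exact: derive_cst.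
have : open_nbhs x (~` K).
  by split; [exact: closed_openC|move=> /KO].
by move/open_nbhs_nbhs; apply: filterS => y /K0.
Qed.

Lemma test_derive_bounded O phi v : test_fun O phi ->
  exists2 C, 0 <= C & forall x, `|'D_v phi x| <= C.
Proof.
move=> [df cf [K [cK KO K0]]].
have cl : closed K by apply: compact_closed => //; exact: norm_hausdorff.
have out x : ~ K x -> 'D_v phi x = 0.
  move=> nKx; rewrite (@near_eq_derive _ _ _ _ (cst 0)); first exact: derive_cst.
  have : open_nbhs x (~` K) by split => //; exact: closed_openC.
  by move/open_nbhs_nbhs; apply: filterS => y /K0.
have [K00|/set0P [x0 Kx0]] := eqVneq K set0.
  by exists 0 => // x; rewrite out ?normr0// K00.
have cn : continuous (fun x => `|'D_v phi x|).
  by move=> x; apply: cvg_norm; exact: cf.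
have [x Kx hx] := compact_EVT_max (ex_intro _ x0 Kx0) cK (continuous_subspaceT cn).
exists `|'D_v phi x| => // y; have [Ky|nKy] := pselect (K y).
  by apply: hx; exact/mem_set.
by rewrite out// normr0.
Qed.

Lemma test_fun_out O phi x : test_fun O phi -> ~ O x -> phi x = 0.
Proof. by move=> [_ _ [K [_ KO K0]]] nOx; apply: K0 => /KO. Qed.

Lemma test_fun_translate O O' phi w : test_fun O' phi ->
  (forall x, O' x -> O (x - w)) -> test_fun O (fun x => phi (x + w)).
Proof.
move=> [df cf [K [cK KO K0]]] OO'.
have [[df' cf'] _] := @C1_translate _ _ phi w (conj df cf).
split => //; exists [set x - w | x in K]; split.
- apply: (@continuous_compact _ _ (fun x => x - w)) => //.
  apply: continuous_subspaceT => x.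
  by apply: cvgB; [exact: cvg_id|exact: cvg_cst].
- by move=> _ [x Kx <-]; apply: OO'; exact: KO.
- move=> x h; apply: K0 => Kx; apply: h; exists (x + w) => //.
  by rewrite addrK.
Qed.

Lemma compact_nbhd O (K : set V) : open O -> compact K -> K `<=` O ->
  exists O' (del : R), [/\ open O', K `<=` O', 0 < del &
    forall x w, O' x -> `|w| <= del -> O (x + w)].
Proof.
move=> oO cK KO.
have [K00|/set0P [x0 Kx0]] := eqVneq K set0.
  exists set0, 1; split => //; first exact: open0.
  by rewrite K00.
have [del del0 hd] : exists2 del : R, 0 < del &
    forall x w, K x -> `|w| < del -> O (x + w).
  apply: contrapT => hn.
  have sq m : exists xw : V * V,
      [/\ K xw.1, `|xw.2| < m.+1%:R^-1 & ~ O (xw.1 + xw.2)].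
    apply: contrapT => h; apply: hn; exists m.+1%:R^-1.
      by rewrite invr_gt0.
    move=> x w Kx wm; apply: contrapT => nO; apply: h.
    by exists (x, w).
  have [xw xwP] := choice sq.
  pose F : set_system V := (fun m => (xw m).1) @ \oo.
  have FK : F K by exists 0%N => // m _ /=; have [] := xwP m.
  have [p [Kp clp]] := cK F _ FK.
  move: (oO); rewrite openE => /(_ _ (KO _ Kp)).
  rewrite /interior -nbhs_ballE => -[e /= e0 eO].
  have : F [set y | exists m : nat, m.+1%:R^-1 < e / 2 /\ y = (xw m).1].
    have : \forall m \near \oo, m.+1%:R^-1 < e / 2.
      exact: (near_infty_natSinv_lt (PosNum (divr_gt0 e0 (ltr0n _ 2)))).
    by apply: filterS => m hm; exists m.
  have Bp : nbhs p (ball p (e / 2)).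
    by rewrite -nbhs_ballE; exists (e / 2) => //=; rewrite divr_gt0.
  move=> /clp/(_ Bp) [_ [[m [hm ->]] hb]].
  have [_ h2 h3] := xwP m; apply: h3; apply: eO.
  move: hb; rewrite -!ball_normE/= => hb.
  rewrite opprD addrA (le_lt_trans (ler_normB _ _))// [ltRHS]splitr.
  by apply: ltrD => //; exact: lt_trans hm.
exists (\bigcup_(x in K) ball x (del / 2)), (del / 3); split.
- by apply: bigcup_open => x _; exact: ball_open.
- by move=> x Kx; exists x => //; apply: ballxx; rewrite divr_gt0.
- by rewrite divr_gt0.
- move=> y w [x Kx]; rewrite -ball_normE/= => xy wd.
  have -> : y + w = x + ((y - x) + w) by rewrite addrA addrCA subrr addr0.
  apply: hd => //; rewrite (le_lt_trans (ler_normD _ _))// -[y - x]opprB normrN.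
  by move: xy wd del0; lra.
Qed.

End TestFunctions.

Section LineDerivative.
Context {R : realType} {V : normedModType R}.

Lemma is_derive_line (phi : V -> R) (p e : V) (s : R) :
  differentiable phi (p + s *: e) ->
  is_derive s (1 : R) (fun s => phi (p + s *: e)) ('D_e phi (p + s *: e)).
Proof.
move=> df; have := @diff_derivable _ _ _ _ _ e df.
have E : (fun h : R => h^-1 *: (((fun s => phi (p + s *: e)) \o shift s) (h *: (1 : R))
      - phi (p + s *: e))) =
    (fun h : R => h^-1 *: ((phi \o shift (p + s *: e)) (h *: e) - phi (p + s *: e))).
  apply/funext => h /=; congr (_ *: (phi _ - _)).
  by rewrite [h%:A]mulr1 scalerDl addrCA.
move=> dphi; apply: DeriveDef; first by rewrite /derivable E.
by rewrite /derive E.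
Qed.

End LineDerivative.

Section Directional.
Context {R : realType} {n : nat} {dX : measure_display} {X : measurableType dX}.
Context {leb : {sigma_finite_measure set X -> \bar R}} {pos : X -> 'rV[R]_n}.
Context {tr : 'I_n -> R -> X -> X}.
Hypothesis ch : chart leb pos tr.
Context (Om : set 'rV[R]_n) (i : 'I_n).
Hypothesis oOm : open Om.
Local Notation D := (pos @^-1` Om).
Local Notation e := (delta_mx ord0 i : 'rV[R]_n).
Notation leb1 := (@lebesgue_measure R).
Notation mR := (measurableTypeR R).
#[local] Hint Resolve itvoo_measurable : core.

Definition wder (v g : X -> R) := forall phi, test_fun Om phi ->
  \int[leb]_(x in D) (v x * 'D_e phi (pos x)) =
  - \int[leb]_(x in D) (g x * phi (pos x)).

Let mD : measurable D. Proof. exact: (ch_open ch). Qed.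

Lemma shift_measurable (psi : 'rV[R]_n -> R) : continuous psi ->
  measurable_fun setT (fun p : X * mR => psi (pos p.1 + (- p.2) *: e)).
Proof.
move=> cpsi.
rewrite (_ : (fun p => _) = (fun x => psi (pos x)) \o
  (fun p : X * mR => tr i (- p.2) p.1)); last first.
  by apply/funext => p /=; rewrite (ch_tr ch).
apply: measurableT_comp; first exact: (pos_cont_measurable ch).
apply: (measurableT_comp (ch_trm ch i)
  (g := fun p : X * mR => (p.1, (- p.2) : mR))).
apply: measurable_fun_pair => //=.
by apply: (measurableT_comp (f := -%R : mR -> mR)).
Qed.

Lemma shift_cont (psi : 'rV[R]_n -> R) p : continuous psi ->
  continuous (fun s : R => psi (p + (- s) *: e)).
Proof.
move=> cpsi s; apply: continuous_comp; last exact: cpsi.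
apply: cvgD; first exact: cvg_cst.
by apply: cvgZr_tmp; apply: cvgN; exact: cvg_id.
Qed.

Lemma shift_intg (k : X -> R) (psi : 'rV[R]_n -> R) C s : intg leb D k ->
  continuous psi -> (forall x, `|psi x| <= C) ->
  intg leb D (fun x => k x * psi (pos x + (- s) *: e)).
Proof.
move=> ki cpsi psiC; apply: (intg_Mb mD ki (C := C)) => //.
apply: measurable_funTS.
exact: (measurableT_comp (shift_measurable cpsi) (pair2_measurable (s : mR))).
Qed.

Lemma shift_prod_intg (k : X -> R) (psi : 'rV[R]_n -> R) C h : intg leb D k ->
  continuous psi -> (forall x, `|psi x| <= C) ->
  intg (leb \x leb1)%E (D `*` `]0, h[%classic)
    (fun p => k p.1 * psi (pos p.1 + (- p.2) *: e)).
Proof.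
move=> ki cpsi psiC; have mDh := measurableX mD (itvoo_measurable 0 h).
have mk := intg_measurable ki.
have mk1 : measurable_fun (D `*` `]0, h[%classic) (fun p : X * mR => k p.1).
  apply: (measurable_comp mD _ mk) => //; first by move=> _ [p [Dp _] <-].
  exact: measurable_funTS.
apply: (intg_Mb mDh (C := C)) => //; last first.
  exact: (measurable_funTS (shift_measurable cpsi)).
apply/(intg_prod_ltyP mD (itvoo_measurable 0 h) mk1).
have -> : (\int[leb]_(x in D) \int[leb1]_(y in `]0%R, h[) `|(k (x, y).1)%:E| =
   \int[leb]_(x in D) (`|(k x)%:E| * leb1 `]0%R, h[))%E.
  apply: eq_integral => x _.
  exact: (integral_cst leb1 (itvoo_measurable 0 h) `|(k x)%:E|%E).
rewrite ge0_integralZr//; last first.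
  by apply: measurableT_comp => //; exact/measurable_EFinP.
have /integrableP[_ kfin] := ki.
apply: lte_mul_pinfty; [exact: integral_ge0| |exact: itvoo_fin].
by rewrite ge0_fin_numE//; exact: integral_ge0.
Qed.

Lemma shift_int_cont (k : X -> R) (psi : 'rV[R]_n -> R) C : intg leb D k ->
  continuous psi -> (forall x, `|psi x| <= C) ->
  continuous (fun s : R => \int[leb]_(x in D) (k x * psi (pos x + (- s) *: e))).
Proof.
move=> ki cpsi psiC s.
have := @continuity_under_integral R _ X leb
  (fun (s : R) x => k x * psi (pos x + (- s) *: e)) D mD (s - 1) (s + 1) _ _
  (fun x => C * `|k x|).
apply.
- by move=> t _; exact: shift_intg psiC.
- apply: aeW => x _ t _; apply: cvgM; first exact: cvg_cst.
  exact: shift_cont.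
- by apply: intgZ => //; exact: intg_norm.
- by move=> t _; apply: aeW => x _; rewrite normrM mulrC ler_wpM2r.
- by apply/mem_set; rewrite /= in_itv/=; apply/andP; split; lra.
Qed.

Section Neighbourhood.
Context (O : set 'rV[R]_n) (del : R).
Hypothesis oO : open O.
Hypothesis del0 : 0 < del.
Hypothesis OOm : forall x s, O x -> 0 <= s <= del -> Om (x + s *: e).
Local Notation D' := (pos @^-1` O).

Let mD' : measurable D'. Proof. exact: (ch_open ch). Qed.

Let OsubOm : O `<=` Om.
Proof.
move=> x Ox; have := OOm Ox (s := 0).
by rewrite scale0r addr0; apply; rewrite lexx ltW.
Qed.

Lemma shift_test phi s : test_fun O phi -> 0 <= s <= del ->
  test_fun Om (fun x => phi (x + (- s) *: e)).
Proof.
move=> tphi s0; apply: (test_fun_translate tphi) => x Ox.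
by rewrite scaleNr opprK; exact: OOm.
Qed.

Lemma shift_Rint_out (k : X -> R) (psi : 'rV[R]_n -> R) C s : intg leb setT k ->
  continuous psi -> (forall x, `|psi x| <= C) -> (forall x, ~ O x -> psi x = 0) ->
  0 <= s <= del ->
  \int[leb]_(x in D') (k (tr i s x) * psi (pos x)) =
  \int[leb]_(x in D) (k x * psi (pos x + (- s) *: e)).
Proof.
move=> ki cpsi hC psi0 sdel.
have kDi : intg leb D k := intgS measurableT mD (@subsetT _ _) ki.
have h := (intg_patch _ mD).1 (shift_intg s kDi cpsi hC).
rewrite [RHS]Rintegral_mkcond -(Rint_tr ch i s h) [LHS]Rintegral_mkcond.
apply: eq_Rint => x _; rewrite !patchE (ch_tr ch) scaleNr addrK.
case: ifPn => [/set_mem xD'|/negP xD'].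
  by rewrite mem_set//= (ch_tr ch); exact: OOm.
by case: ifP => // _; rewrite psi0 ?mulr0// => /mem_set.
Qed.

Lemma shift_Rint (k : X -> R) phi s : intg leb setT k -> test_fun O phi ->
  0 <= s <= del ->
  \int[leb]_(x in D') (k (tr i s x) * phi (pos x)) =
  \int[leb]_(x in D) (k x * phi (pos x + (- s) *: e)).
Proof.
move=> ki tphi; have [C _ hC] := test_fun_bounded tphi.
apply: (shift_Rint_out ki (C1_continuous (test_fun_C1 tphi)) hC) => x.
exact: test_fun_out.
Qed.

Lemma tr_intg_O (g : X -> R) h : intg leb setT g ->
  intg (leb \x leb1)%E (D' `*` `]0, h[%classic) (fun p => g (tr i p.2 p.1)).
Proof.
move=> gi; apply: intgS (intg_tr_prod ch i h gi).
- exact: measurableX.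
- exact: measurableX.
- by move=> p [].
Qed.

Lemma line_int_test (g : X -> R) phi h : intg leb setT g -> test_fun O phi ->
  0 <= h <= del ->
  \int[leb]_(x in D') ((\int[leb1]_(s in `]0, h[) g (tr i s x)) * phi (pos x)) =
  \int[leb1]_(s in `]0, h[) \int[leb]_(x in D) (g x * phi (pos x + (- s) *: e)).
Proof.
move=> gi tphi /andP[h0 hdel]; have [C C0 hC] := test_fun_bounded tphi.
have cphi := C1_continuous (test_fun_C1 tphi).
have gO := tr_intg_O h gi.
have mh := itvoo_measurable 0 h.
have gphi : intg (leb \x leb1)%E (D' `*` `]0, h[%classic)
    (fun p => g (tr i p.2 p.1) * phi (pos p.1)).
  apply: (intg_Mb (measurableX mD' mh) gO (C := C)) => //.
  apply: measurable_funTS.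
  exact: (measurableT_comp (pos_cont_measurable ch cphi)).
have [sl _ _] := RFubini1 mD' mh gO.
have [_ gi1 e1] := RFubini1 mD' mh gphi.
transitivity (\int[leb]_(x in D') \int[leb1]_(s in `]0, h[) (g (tr i s x) * phi (pos x))).
  apply: esym; have [||_ -> //] := @Rint_ae_eq _ _ _ leb D' mD' _
    (fun x => (\int[leb1]_(s in `]0, h[) g (tr i s x)) * phi (pos x)) gi1.
    apply: measurable_funM.
      by have [_ /intg_measurable] := RFubini1 mD' mh gO.
    exact/measurable_funTS/(pos_cont_measurable ch).
  apply: filterS sl => x + xD' => /(_ xD') hx.
  exact: (RintegralZr (phi (pos x)) mh hx).
rewrite (Rint_swap mD' mh gphi); apply: eq_Rint => s /itvooP /andP[s0 sh].
by apply: shift_Rint => //; rewrite ltW// (le_trans (ltW sh)).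
Qed.

Lemma diff_int_test (v : X -> R) phi h : intg leb setT v -> test_fun O phi ->
  0 <= h <= del ->
  \int[leb]_(x in D') ((v (tr i h x) - v x) * phi (pos x)) =
  - \int[leb1]_(s in `]0, h[)
     \int[leb]_(x in D) (v x * 'D_e phi (pos x + (- s) *: e)).
Proof.
move=> vi tphi hd; have /andP[h0 hdel] := hd.
have [C C0 hC] := test_fun_bounded tphi.
have [C' C'0 hC'] := test_derive_bounded e tphi.
have cphi := C1_continuous (test_fun_C1 tphi).
have [df /(_ e) cdphi] := test_fun_C1 tphi.
have vDi : intg leb D v := intgS measurableT mD (@subsetT _ _) vi.
have mh := itvoo_measurable 0 h.
have mphi : measurable_fun D' (fun x => phi (pos x)).
  exact/measurable_funTS/(pos_cont_measurable ch).
have vtr : intg leb D' (fun x => v (tr i h x) * phi (pos x)).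
  apply: (intg_Mb mD' (C := C)) => //.
  exact: (intgS measurableT mD' (@subsetT _ _) (intg_tr ch i h vi)).
have vphi : intg leb D' (fun x => v x * phi (pos x)).
  apply: (intg_Mb mD' (C := C)) => //.
  exact: (intgS measurableT mD' (@subsetT _ _) vi).
have vphiD : intg leb D (fun x => v x * phi (pos x)).
  apply: (intg_Mb mD (C := C)) => //.
  exact/measurable_funTS/(pos_cont_measurable ch).
have E : \int[leb]_(x in D') (v x * phi (pos x)) =
    \int[leb]_(x in D) (v x * phi (pos x)).
  rewrite [LHS]Rintegral_mkcond [RHS]Rintegral_mkcond; apply: eq_Rint => x _.
  rewrite !patchE; case: ifPn => [/set_mem xD'|/negP xD'].
    by rewrite mem_set//; exact: OsubOm.
  by case: ifP => // _; rewrite (test_fun_out tphi) ?mulr0// => /mem_set.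
have FT p : \int[leb1]_(s in `]0, h[) ('D_e phi (p + (- s) *: e)) =
    - (phi (p + (- h) *: e) - phi p).
  have d0 (s : R) : is_derive s (1 : R) (fun s : R => - phi (p + (- s) *: e))
      ('D_e phi (p + (- s) *: e)).
    have d1 := is_derive_line (df (p + (- s) *: e)).
    have d2 : is_derive s (1 : R) (-%R : R -> R) (-1) by apply: is_deriveNid.
    have d3 := @is_derive1_comp _ (fun s : R => phi (p + s *: e)) (-%R : R -> R) s _ _ d1 d2.
    by have := is_deriveN d3; rewrite mulrN1 opprK.
  rewrite (FTC_C1 d0 (shift_cont (p := p) cdphi) h0) oppr0 scale0r addr0.
  by ring.
transitivity (\int[leb]_(x in D) (v x * phi (pos x + (- h) *: e) - v x * phi (pos x))).
  rewrite RintB//; last exact: shift_intg hC.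
  rewrite -E -shift_Rint// -RintB//.
  by apply: eq_Rint => x _; rewrite mulrBl.
rewrite -(Rint_swap mD mh (shift_prod_intg h vDi cdphi hC')).
rewrite -(RintN (mu := leb) (D := D)) //; last first.
  by have [] := RFubini1 mD mh (shift_prod_intg h vDi cdphi hC').
apply: eq_Rint => x _ /=; rewrite RintegralZl//; last first.
  exact: (intg_continuous 0 h (shift_cont (p := pos x) cdphi)).
by rewrite FT; ring.
Qed.

Lemma dq_ftc (v g : X -> R) h : intg leb setT v -> intg leb setT g ->
  wder v g -> 0 <= h <= del ->
  {ae leb, forall x, O (pos x) ->
    v (tr i h x) = v x + \int[leb1]_(s in `]0, h[) g (tr i s x)}.
Proof.
move=> vi gi vg hdel; have /andP[h0 hd] := hdel.
have mh := itvoo_measurable 0 h.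
have [_ i3 _] := RFubini1 mD' mh (tr_intg_O h gi).
have i1 : intg leb D' (fun x => v (tr i h x)).
  exact: (intgS measurableT mD' (@subsetT _ _) (intg_tr ch i h vi)).
have i2 : intg leb D' v by exact: (intgS measurableT mD' (@subsetT _ _) vi).
have i12 := intgB mD' i1 i2.
have := @flcv _ _ _ _ leb pos (ch_open ch) (ch_gen ch) O
  (fun x => v (tr i h x) - v x - \int[leb1]_(s in `]0, h[) g (tr i s x)) oO
  (intgB mD' i12 i3).
move=> H; have {H} : {ae leb, forall x, O (pos x) ->
    v (tr i h x) - v x - \int[leb1]_(s in `]0, h[) g (tr i s x) = 0}.
  apply: H => phi tphi; have [C C0 hC] := test_fun_bounded tphi.
  have cphi := C1_continuous (test_fun_C1 tphi).
  have mphi : measurable_fun D' (fun x => phi (pos x)).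
    exact/measurable_funTS/(pos_cont_measurable ch).
  rewrite (_ : \int[leb]_(x in D') _ = \int[leb]_(x in D')
     ((v (tr i h x) - v x) * phi (pos x) -
     (\int[leb1]_(s in `]0, h[) g (tr i s x)) * phi (pos x))); last first.
    by apply: eq_Rint => x _; rewrite mulrBl.
  have mb (k : X -> R) : intg leb D' k -> intg leb D' (fun x => k x * phi (pos x)).
    by move=> ki; exact: (intg_Mb mD' ki mphi (fun x _ => hC (pos x))).
  rewrite (RintB mD' (mb _ i12) (mb _ i3)).
  rewrite diff_int_test// line_int_test//.
  rewrite (_ : \int[leb1]_(s in `]0, h[) _ = - \int[leb1]_(s in `]0, h[)
    \int[leb]_(x in D) (g x * phi (pos x + (- s) *: e))); first by ring.
  have gDi : intg leb D g := intgS measurableT mD (@subsetT _ _) gi.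
  rewrite -RintN//; last first.
    by have [] := RFubini2 mD mh (shift_prod_intg h gDi cphi hC).
  apply: eq_Rint => s /itvooP /andP[s0 sh].
  have sdel : 0 <= s <= del by rewrite ltW// (le_trans (ltW sh)).
  rewrite -(vg _ (shift_test tphi sdel)); apply: eq_Rint => x _.
  by have [_ ->] := @C1_translate _ _ phi ((- s) *: e) (test_fun_C1 tphi).
apply: filterS => x + Ox => /(_ Ox) /eqP.
by rewrite subr_eq0 subr_eq => /eqP ->; rewrite addrC.
Qed.

End Neighbourhood.
End Directional.

Section ChainRule.
Context {R : realType} {n : nat} {dX : measure_display} {X : measurableType dX}.
Context {leb : {sigma_finite_measure set X -> \bar R}} {pos : X -> 'rV[R]_n}.
Context {tr : 'I_n -> R -> X -> X}.
Hypothesis ch : chart leb pos tr.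
Context (Om : set 'rV[R]_n) (i : 'I_n).
Hypothesis oOm : open Om.
Local Notation D := (pos @^-1` Om).
Local Notation e := (delta_mx ord0 i : 'rV[R]_n).
Notation leb1 := (@lebesgue_measure R).
Notation mR := (measurableTypeR R).
Local Notation wder := (@wder R n dX X leb pos Om i).
#[local] Hint Resolve itvoo_measurable : core.

Let mD : measurable D. Proof. exact: (ch_open ch). Qed.

#[local] Instance leb1_filter : Filter (nbhs (almost_everywhere leb1)) :=
  ae_filter_ringOfSetsType leb1.

(* A weak derivative is characterised by the fundamental theorem of calculus on
   almost every segment; the chain rule is then one-dimensional. *)
Definition line_nbhd (O : set 'rV[R]_n) (del : R) :=
  [/\ open O, 0 < del & forall x s, O x -> 0 <= s <= del -> Om (x + s *: e)].

Definition line_ftc (v g : X -> R) (O : set 'rV[R]_n) (del : R) :=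
  {ae leb, forall x, (pos @^-1` O) x -> {ae leb1, forall h : R, `]0, del[%classic h ->
    v (tr i h x) = v x + \int[leb1]_(s in `]0, h[) g (tr i s x)}}.

Let defect (v g : X -> R) (p : X * mR) : R := v (tr i p.2 p.1) - v p.1 -
  \int[leb1]_(s in `]0, p.2[) g (tr i s p.1).

Let defect_measurable v g (E : set (X * mR)) : measurable E ->
  measurable_fun setT v -> measurable_fun setT g -> measurable_fun E (defect v g).
Proof.
move=> mE mv mg; apply: measurable_funTS.
apply: measurable_funB.
  apply: measurable_funB; first exact: (measurableT_comp mv (ch_trm ch i)).
  exact: (measurableT_comp mv).
have -> : (fun p : X * mR => \int[leb1]_(s in `]0, p.2[) g (tr i s p.1)) =
  fun p => \int[leb1]_s (fun q : (X * mR) * mR =>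
     \1_[set q : (X * mR) * mR | 0 < q.2 < q.1.2] q * g (tr i q.2 q.1.1)) (p, s).
  apply/funext => p; rewrite Rintegral_mkcond; apply: eq_Rint => s _ /=.
  rewrite patchE indicE; case: ifPn => [/set_mem/itvooP h|/negP h].
    by rewrite mem_set ?mul1r.
  by rewrite memNset ?mul0r// => h'; apply: h; apply/mem_set/itvooP.
apply: (@measurable_Rint_param _ _ _ _ _ leb1 (fun q : (X * mR) * mR =>
  \1_[set q : (X * mR) * mR | 0 < q.2 < q.1.2] q * g (tr i q.2 q.1.1))).
apply: measurable_funM; last first.
  have m1 : measurable_fun setT (fun q : (X * mR) * mR => (q.1.1, q.2)).
    apply: measurable_fun_pair => //=.
    by apply: measurableT_comp.
  exact: (measurableT_comp (measurableT_comp mg (ch_trm ch i)) m1).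
apply: measurable_indic.
rewrite (_ : [set q | _] = [set q | 0 < q.2] `&` [set q : (X * mR) * mR | q.2 < q.1.2]).
  apply: measurableI.
    rewrite -[X in measurable X]setTI.
    exact: (@measurable_fun_ltr _ _ _ setT (cst 0) (fun q : (X * mR) * mR => q.2)
      (measurable_cst _) measurable_snd measurableT [set true] I).
  rewrite -[X in measurable X]setTI.
  have m12 : measurable_fun setT (fun q : (X * mR) * mR => q.1.2).
    exact: (measurableT_comp measurable_snd measurable_fst).
  exact: (@measurable_fun_ltr _ _ _ setT (fun q : (X * mR) * mR => q.2)
    (fun q : (X * mR) * mR => q.1.2)
    measurable_snd m12 measurableT [set true] I).
by apply/seteqP; split=> q /=; [move/andP|move=> [-> ->]].
Qed.

Lemma line_ftcP v g O del : measurable_fun setT v -> measurable_fun setT g ->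
  measurable (pos @^-1` O) ->
  line_ftc v g O del <->
  {ae leb1, forall h : R, `]0, del[%classic h -> {ae leb, forall x, (pos @^-1` O) x ->
    v (tr i h x) = v x + \int[leb1]_(s in `]0, h[) g (tr i s x)}}.
Proof.
move=> mv mg mO; have mE := measurableX mO (itvoo_measurable 0 del).
have md := defect_measurable mE mv mg.
have dP x h : defect v g (x, h) = 0 <->
    v (tr i h x) = v x + \int[leb1]_(s in `]0, h[) g (tr i s x).
  rewrite /defect/=; split => [/eqP|->]; last by ring.
  by rewrite subr_eq0 subr_eq => /eqP ->; rewrite addrC.
split => H.
  have md' : measurable_fun ((`]0, del[%classic : set mR) `*` pos @^-1` O)
      (fun p : mR * X => defect v g (p.2, p.1)).
    apply: (measurable_comp mE _ md).
      by move=> _ [p [p1 p2] <-]; split.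
    by apply/measurable_funTS/measurable_fun_pair; [exact: measurable_snd|exact: measurable_fst].
  have H' := @ae_swap R _ _ mR X leb1 leb `]0, del[%classic (pos @^-1` O)
     (fun p => defect v g (p.2, p.1)) (itvoo_measurable 0 del) mO md'.
  have H1 : {ae leb, forall x, (pos @^-1` O) x -> {ae leb1, forall h, `]0, del[%classic h ->
      defect v g (x, h) = 0}}.
    apply: filterS H => x + xO => /(_ xO); apply: filterS => h + hh => /(_ hh).
    by move/dP.
  apply: filterS (H' H1) => h + hh => /(_ hh); apply: filterS => x + xO => /(_ xO).
  by move/dP.
have := @ae_swap R _ _ X mR leb leb1 (pos @^-1` O) `]0, del[%classic
  (defect v g) mO (itvoo_measurable 0 del) md.
move=> H'.
have H1 : {ae leb1, forall h, `]0, del[%classic h -> {ae leb, forall x, (pos @^-1` O) x ->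
    defect v g (x, h) = 0}}.
  apply: filterS H => h + hh => /(_ hh); apply: filterS => x + xO => /(_ xO).
  by move/dP.
apply: filterS (H' H1) => x + xO => /(_ xO); apply: filterS => h + hh => /(_ hh).
by move/dP.
Qed.

Lemma wder_line_ftc v g O del : intg leb setT v -> intg leb setT g ->
  wder v g -> line_nbhd O del -> line_ftc v g O del.
Proof.
move=> vi gi vg [oO del0 hO]; apply/line_ftcP.
- exact: intg_measurable vi.
- exact: intg_measurable gi.
- exact: (ch_open ch).
- apply: aeW => h /itvooP /andP[h0 hd].
  by apply: (dq_ftc ch oOm oO del0 hO vi gi vg); rewrite !ltW.
Qed.

Lemma line_ftc_wder v g : intg leb setT v -> intg leb setT g ->
  (forall O del, line_nbhd O del -> line_ftc v g O del) -> wder v g.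
Proof.
move=> vi gi H phi tphi; have [_ _ [K [cK KO K0]]] := tphi.
have [ O [del [oO KOO del0 hO]]] := compact_nbhd oOm cK KO.
have e1 : `|e| <= 1.
  rewrite [leLHS]/Num.norm/= mx_normrE; apply: bigmax_le => // ij _.
  by rewrite mxE; case: (_ && _); rewrite ?normr1 ?normr0.
have hO' x s : O x -> 0 <= s <= del -> Om (x + s *: e).
  move=> Ox /andP[s0 sd]; apply: hO => //; rewrite normrZ ger0_norm//.
  by rewrite (le_trans _ sd)// ler_piMr.
have nb : line_nbhd O del by [].
have [df cf _] := tphi.
have tphiO : test_fun O phi by split => //; exists K.
have mv := intg_measurable vi; have mg := intg_measurable gi.
have mO : measurable (pos @^-1` O) by exact: (ch_open ch).
have /(line_ftcP _ mv mg mO) {}H := H O del nb.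
have [C C0 hC] := test_fun_bounded tphi.
have [C' C'0 hC'] := test_derive_bounded e tphi.
have cphi := C1_continuous (test_fun_C1 tphi).
have cdphi := cf e.
have vDi : intg leb D v := intgS measurableT mD (@subsetT _ _) vi.
have gDi : intg leb D g := intgS measurableT mD (@subsetT _ _) gi.
pose Rf s := \int[leb]_(x in D) (g x * phi (pos x + (- s) *: e)).
pose Sf s := \int[leb]_(x in D) (v x * 'D_e phi (pos x + (- s) *: e)).
have cR : continuous Rf by exact: (shift_int_cont ch oOm gDi cphi hC).
have cS : continuous Sf by exact: (shift_int_cont ch oOm vDi cdphi hC').
pose Q s := Rf s + Sf s.
have cQ : continuous Q by move=> s; apply: cvgD; [exact: cR|exact: cS].
have E : {ae leb1, forall h, 0 < h < del -> \int[leb1]_(s in `]0, h[) Q s = 0}.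
  apply: filterS H => h Hh h0; have /Hh {}Hh : `]0, del[%classic h by apply/itvooP.
  have hdel : 0 <= h <= del by case/andP: h0 => /ltW -> /ltW ->.
  have := line_int_test ch oOm oO hO' gi tphiO hdel.
  have := diff_int_test ch oOm oO del0 hO' vi tphiO hdel.
  rewrite -/Rf -/Sf => e2 e3.
  rewrite RintD//; [|exact: intg_continuous|exact: intg_continuous].
  rewrite -[\int[leb1]_(s in _) Rf s]e3.
  have -> : \int[leb1]_(s in `]0, h[) Sf s =
    - \int[leb]_(x in pos @^-1` O) ((v (tr i h x) - v x) * phi (pos x)).
    by rewrite e2 opprK.
  have mphi : measurable_fun (pos @^-1` O) (fun x => phi (pos x)).
    exact/measurable_funTS/(pos_cont_measurable ch).
  have i1 : intg leb (pos @^-1` O) (fun x => (v (tr i h x) - v x) * phi (pos x)).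
    apply: (intg_Mb mO _ mphi (fun x _ => hC (pos x))).
    apply: (intgB mO); apply: (intgS measurableT mO (@subsetT _ _)) => //.
    exact: (intg_tr ch i h vi).
  have [_ i3 _] := RFubini1 mO (itvoo_measurable 0 h) (tr_intg_O ch i oO h gi).
  have [||_ ->] := Rint_ae_eq mO i1 (g := fun x =>
     (\int[leb1]_(s in `]0, h[) g (tr i s x)) * phi (pos x)).
  - by apply: measurable_funM => //; exact: intg_measurable i3.
  - by apply: filterS Hh => x + xO => /(_ xO) ->; congr (_ * _); ring.
  - by rewrite subrr.
have Q0 : Q 0 = 0.
  clearbody Q.
  apply/eqP; apply: contraT => Qn; have Qgt : 0 < `|Q 0| / 2 by rewrite divr_gt0 ?normr_gt0.
  have /cvgrPdist_lt/(_ _ Qgt)/nbhs_ballP[d /= d0 hd] := cQ 0.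
  have [||h /andP[h0]] := @ae_itv_ex _ 0 (Num.min d del)
    (fun h => \int[leb1]_(s in `]0, h[) Q s = 0).
  - by rewrite lt_min d0.
  - apply: filterS E => h hE /andP[h0]; rewrite lt_min => /andP[_ hdel].
    by apply: hE; rewrite h0.
  rewrite lt_min => /andP[hd' _] int0.
  have mh := itvoo_measurable 0 h.
  have qi := intg_continuous 0 h cQ.
  have ci : intg leb1 `]0, h[ (fun=> Q 0) by apply: intg_continuous => s; exact: cvg_cst.
  have : `|\int[leb1]_(s in `]0, h[) (Q 0 - Q s)| <= \int[leb1]_(s in `]0, h[) (`|Q 0| / 2).
    apply: le_trans (le_normr_Rintegral mh (intgB mh ci qi)) _.
    apply: (le_Rint mh).
    - exact: (intg_norm (intgB mh ci qi)).
    - by apply: intg_continuous => s; exact: cvg_cst.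
    - move=> s /itvooP /andP[s0 sh]; apply/ltW/hd; rewrite /ball/= sub0r normrN.
      by rewrite ger0_norm ?ltW// (lt_trans sh).
  have -> : \int[leb1]_(s in `]0, h[) (Q 0 - Q s) = Q 0 * (h - 0).
    transitivity ((\int[leb1]_(s in `]0, h[) Q 0) - (\int[leb1]_(s in `]0, h[) Q s)).
      exact: RintB.
    by rewrite int0 subr0; apply: Rint_itv_cst; exact: ltW.
  have -> : \int[leb1]_(s in `]0, h[) (`|Q 0| / 2) = `|Q 0| / 2 * (h - 0).
    by apply: Rint_itv_cst; exact: ltW.
  rewrite subr0 normrM (gtr0_norm h0) ler_pM2r//.
  by move: Qgt; set q := `|_|; move=> ? ?; lra.
move: Q0; rewrite /Q /Rf /Sf oppr0.
under eq_Rint => x _ do rewrite scale0r addr0.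
under [X in _ + X = _]eq_Rint => x _ do rewrite scale0r addr0.
by move=> h; move: h; set a := Rintegral _ _ _; set b := Rintegral _ _ _; lra.
Qed.

Lemma eq_wder v g v' g' : (forall x, D x -> v x = v' x /\ g x = g' x) ->
  wder v g -> wder v' g'.
Proof.
move=> h vg phi tphi; have := vg phi tphi.
rewrite (_ : \int[leb]_(x in D) (v x * _) = \int[leb]_(x in D) (v' x * 'D_e phi (pos x))).
  move=> ->; congr (- _); apply: eq_Rint => x Dx.
  by have [_ ->] := h x Dx.
by apply: eq_Rint => x Dx; have [-> _] := h x Dx.
Qed.

Lemma chain_wder v g (G G' : R -> R) (L : R) : intg leb D v -> intg leb D g ->
  (forall x y, `|G y - G x - G' x * (y - x)| <= L * (y - x) ^+ 2) ->
  continuous G' ->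
  intg leb D (fun x => G (v x)) -> intg leb D (fun x => G' (v x) * g x) ->
  wder v g -> wder (fun x => G (v x)) (fun x => G' (v x) * g x).
Proof.
move=> vi gi GL cG' Gvi G'gi vg.
have vE : wder (v \_ D) (g \_ D).
  by apply: eq_wder vg => x Dx; rewrite !patchE mem_set.
have H : wder ((fun x => G (v x)) \_ D) ((fun x => G' (v x) * g x) \_ D); last first.
  by apply: eq_wder H => x Dx; rewrite !patchE mem_set.
have {}vi := (intg_patch _ mD).1 vi; have {}gi := (intg_patch _ mD).1 gi.
have {}Gvi := (intg_patch _ mD).1 Gvi; have {}G'gi := (intg_patch _ mD).1 G'gi.
apply: (line_ftc_wder Gvi G'gi) => O del nb; have [oO del0 hO] := nb.
have mO : measurable (pos @^-1` O) by exact: (ch_open ch).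
have := wder_line_ftc vi gi vE nb.
have [sl _ _] := RFubini1 mO (itvoo_measurable 0 del) (tr_intg_O ch i oO del gi).
have [sl2 _ _] := RFubini1 mO (itvoo_measurable 0 del) (tr_intg_O ch i oO del G'gi).
apply: filterS3 sl sl2 => x + + + xO => /(_ xO) gx /(_ xO) g'x /(_ xO) hx.
have OD s : 0 <= s <= del -> D (tr i s x).
  by move=> hs; rewrite /= (ch_tr ch); exact: hO.
have x0 : D x by have := OD 0; rewrite /= (ch_tr ch) scale0r addr0; apply; rewrite lexx ltW.
have gx' : intg leb1 `]0, del[ (fun s => (g \_ D) (tr i s x)) by [].
have AC := @ac_chain R del (fun s => (g \_ D) (tr i s x)) gx' G G' ((v \_ D) x) L GL.
apply: filterS (hx) => h hx' hh; have hv := hx' hh.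
move/itvooP: hh => /andP[h0 hd].
have hdel : 0 <= h <= del by rewrite !ltW.
have := AC h hdel; rewrite -hv.
have hD : D (tr i h x) by exact: OD.
rewrite !patchE !mem_set// => Eh.
apply/eqP; rewrite addrC -subr_eq Eh; apply/eqP.
have mh := itvoo_measurable 0 h.
have hsub : (`]0, h[%classic : set mR) `<=` `]0, del[%classic.
  by move=> s /itvooP/andP[s0 sh]; apply/itvooP; rewrite s0 (lt_trans sh).
have mdel := itvoo_measurable 0 del.
have g'h := @intgS R _ mR leb1 _ _ _ mdel mh hsub g'x.
have aeE : {ae leb1, forall s, `]0, h[%classic s ->
    ((fun x => G' (v x) * g x) \_ D) (tr i s x) =
    G' ((v \_ D) x + \int[leb1]_(s0 in `]0, s[) (g \_ D) (tr i s0 x)) * (g \_ D) (tr i s x)}.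
  apply: filterS hx => s + hs => /(_ (hsub _ hs)) <-.
  have sD : D (tr i s x) by apply: OD; move/itvooP: hs => /andP[/ltW -> sh]/=; rewrite ltW// (lt_trans sh).
  by rewrite !patchE mem_set.
have i0 := @intgS R _ mR leb1 _ _ _ mdel mh hsub gx'.
have i1 := @ac_chain_intg R h _ i0 G G' ((v \_ D) x) L GL.
have vx : (v \_ D) x = v x by rewrite patchE mem_set.
have [||_] := Rint_ae_eq mh i1 (g := fun s => ((fun x => G' (v x) * g x) \_ D) (tr i s x)).
- exact: intg_measurable g'h.
- apply: filterS aeE => s + hs => /(_ hs) ->.
  by [].
- by rewrite vx => ->.
Qed.

End ChainRule.

Section BoxGeneration.
Context {R : realType} {n : nat} {T : pointedType} (pos : T -> 'rV[R]_n).
Notation boxes :=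
  [set pos @^-1` (box ab.1 ab.2) | ab in [set: 'rV[R]_n * 'rV[R]_n]].
Notation mR := (measurableTypeR R).

Let half_gen i (t : R) : (<<s boxes >>) [set x | t < pos x ord0 i].
Proof.
pose a k : 'rV[R]_n := \row_j (if j == i then t else - k%:R).
pose b k : 'rV[R]_n := \row_j k%:R.
have -> : [set x | t < pos x ord0 i] = \bigcup_k (pos @^-1` box (a k) (b k)).
  apply/seteqP; split => x /=; last first.
    by move=> [k _ /(_ i)]; rewrite !mxE eqxx => /andP[].
  move=> tx; pose M := \sum_j `|pos x ord0 j|.
  have [k Mk] : exists k : nat, M < k%:R.
    by exists (Num.truncn M).+1; rewrite truncnS_gt.
  exists k => // j; rewrite !mxE.
  have jM : `|pos x ord0 j| < k%:R.
    by apply: le_lt_trans Mk; rewrite /M (bigD1 j)//= lerDl sumr_ge0.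
  by move: jM; rewrite ltr_norml => /andP[h1 ->]; case: eqP => [->|_]; rewrite ?tx ?h1.
apply: sigma_algebra_bigcup => k.
by apply: sub_sigma_algebra; exists (a k, b k).
Qed.

Lemma coord_gen i (B : set mR) : measurable B ->
  (<<s boxes >>) ((fun x => pos x ord0 i) @^-1` B).
Proof.
have : @measurable_fun _ _ (g_sigma_algebraType boxes) mR setT (fun x => pos x ord0 i).
  apply: (@measurability _ _ _ _ setT _ (@RGenOInfty.G R)).
    exact: RGenOInfty.measurableE.
  move=> _ [_ [t ->] <-]; rewrite setTI.
  rewrite (_ : _ @^-1` _ = [set x | t < pos x ord0 i]); first exact: half_gen.
  by apply/seteqP; split => x /=; rewrite in_itv/= andbT.
by move=> h mB; have := h measurableT B mB; rewrite setTI.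
Qed.

End BoxGeneration.

Lemma open_of_box {R : realType} {n : nat} {d} {X : measurableType d}
    (pos : X -> 'rV[R]_n) :
  (forall a b, measurable (pos @^-1` box a b)) ->
  forall O, open O -> measurable (pos @^-1` O).
Proof.
move=> mb O oO; pose Q k : set X :=
  match @unpickle ('rV[rat]_n * 'rV[rat]_n)%type k with
  | Some ab => let a := \row_i ratr (ab.1 ord0 i) in
      let b := \row_i ratr (ab.2 ord0 i) in
      if `[< cbox a b `<=` O >] then pos @^-1` box a b else set0
  | None => set0 end.
have -> : pos @^-1` O = \bigcup_k Q k.
  apply/seteqP; split => x /=.
    move=> /(rat_box oO)[ab [h1 h2]]; exists (pickle ab) => //.
    by rewrite /Q pickleK; case: asboolP.
  move=> [k _]; rewrite /Q; case: unpickle => //= ab.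
  by case: asboolP => // h /box_cbox /h.
apply: bigcup_measurable => k _; rewrite /Q; case: unpickle => //= ab.
by case: asboolP.
Qed.

Section Chart1.
Context {R : realType}.
Notation mR := (measurableTypeR R).
Notation leb1 := (@lebesgue_measure R).

Definition tr1 (i : 'I_1) (h : R) (x : mR) : mR := x + h.

Let pos1_box a b : @pos1 R @^-1` box a b = `]a ord0 ord0, b ord0 ord0[%classic.
Proof.
apply/seteqP; split => x /=; rewrite /box/= in_itv/=.
  by move=> /(_ ord0); rewrite mxE.
by move=> h j; rewrite mxE !ord1.
Qed.

Lemma lebesgue_shift (h : R) (A : set mR) : measurable A ->
  leb1 ((fun x : mR => (x : R) + h : mR) @^-1` A) = leb1 A.
Proof.
have mf : measurable_fun setT (fun x : mR => (x : R) + h : mR).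
  exact: measurable_funD.
pose m := measure_function_pushforward__canonical__measure_function_Measure leb1 mf.
move=> mA; apply/esym/(@lebesgue_measure_unique R m) => //= _ [[a b]] _ <-.
rewrite /pushforward (_ : _ @^-1` _ = `]a - h, b - h]%classic).
  rewrite !lebesgue_measure_itv/= !lte_fin ltrD2r; case: ifP => // _.
  by rewrite -!EFinB; congr EFin; ring.
by apply/seteqP; split => x /=; rewrite !in_itv/= ltrBlDr lerBrDr.
Qed.

Lemma chart1 : chart leb1 (@pos1 R) tr1.
Proof.
have mb a b : measurable (@pos1 R @^-1` box a b : set mR).
  by rewrite pos1_box; exact: measurable_itv.
split.
- exact: open_of_box.
- apply/seteqP; split => [A mA|]; last first.
    apply: smallest_sub; first exact: sigma_algebra_measurable.
    by move=> _ [ab _ <-].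
  have := @coord_gen R 1 mR (@pos1 R) ord0 A mA.
  congr (_ _); apply/seteqP; split => x /=; by rewrite mxE.
- move=> a b; rewrite pos1_box [X in (X < _)%E]lebesgue_measure_itv/=.
  by case: ifP => // _; rewrite -EFinB ltry.
- move=> a b h; rewrite pos1_box [X in (_ < X)%E]lebesgue_measure_itv/= lte_fin h.
  by rewrite -EFinB lte_fin subr_gt0.
- by move=> i h x; apply/rowP => j; rewrite !mxE !ord1 !eqxx mulr1.
- by move=> i; exact: measurable_funD.
- by move=> i h A mA; exact: lebesgue_shift.
Qed.

End Chart1.

Section Chart2.
Context {R : realType}.
Notation mR := (measurableTypeR R).
Notation leb1 := (@lebesgue_measure R).
Notation leb2 := (@lebesgue2 R).

Definition tr2 (i : 'I_2) (h : R) (x : mR * mR) : mR * mR :=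
  if i == ord0 then (tr1 ord0 h x.1, x.2) else (x.1, tr1 ord0 h x.2).

Let o1 : 'I_2 := lift ord0 ord0.

Let pos2_box a b : @pos2 R @^-1` box a b =
  (`]a ord0 ord0, b ord0 ord0[%classic `*` `]a ord0 o1, b ord0 o1[%classic).
Proof.
apply/seteqP; split => -[x y] /=; rewrite /box/= !in_itv/=.
  by move=> h; have := h ord0; have := h o1; rewrite !mxE/=.
move=> [h1 h2] j; rewrite !mxE/=; case: eqP => [->//|/eqP jn].
by have -> : j = o1; first by apply/val_inj; case: j jn => [[|[]]].
Qed.

Let leb2E (A B : set mR) : measurable A -> measurable B ->
  leb2 (A `*` B) = (leb1 A * leb1 B)%E.
Proof. by move=> mA mB; rewrite /lebesgue2 product_measure1E. Qed.

Lemma chart2 : chart leb2 (@pos2 R) tr2.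
Proof.
have mb a b : measurable (@pos2 R @^-1` box a b : set (mR * mR)).
  by rewrite pos2_box; apply: measurableX; exact: measurable_itv.
have mtr i : measurable_fun setT (fun p : (mR * mR) * mR => tr2 i p.2 p.1).
  have m11 : measurable_fun setT (fun p : (mR * mR) * mR => p.1.1).
    exact: (measurableT_comp measurable_fst measurable_fst).
  have m12 : measurable_fun setT (fun p : (mR * mR) * mR => p.1.2).
    exact: (measurableT_comp measurable_snd measurable_fst).
  rewrite /tr2; case: (i == ord0); apply: measurable_fun_pair => //.
    exact: measurable_funD.
  exact: measurable_funD.
split.
- exact: open_of_box.
- apply/seteqP; split => [A mA|]; last first.
    apply: smallest_sub; first exact: sigma_algebra_measurable.
    by move=> _ [ab _ <-].
  move: A mA; rewrite measurable_prod_measurableType.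
  apply: smallest_sub; first exact: smallest_sigma_algebra.
  move=> _ [A mA [B mB <-]].
  have hA := @coord_gen R 2 (mR * mR)%type (@pos2 R) ord0 A mA.
  have hB := @coord_gen R 2 (mR * mR)%type (@pos2 R) o1 B mB.
  rewrite (_ : A `*` B = (fun x => pos2 x ord0 ord0) @^-1` A `&`
     (fun x => pos2 x ord0 o1) @^-1` B); first exact: (@measurableI _ (g_sigma_algebraType
    [set (@pos2 R) @^-1` (box ab.1 ab.2) | ab in [set: 'rV[R]_2 * 'rV[R]_2]])).
  by apply/seteqP; split => -[x y] /=; rewrite !mxE/=.
- move=> a b; rewrite pos2_box [X in (X < _)%E](leb2E (measurable_itv _) (measurable_itv _)).
  rewrite !lebesgue_measure_itv/= -!EFinB.
  by apply: lte_mul_pinfty; case: ifP => // h; rewrite ?ltry ?lee_fin// subr_ge0 ltW// -lte_fin.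
- move=> a b h; rewrite pos2_box [X in (_ < X)%E](leb2E (measurable_itv _) (measurable_itv _)).
  rewrite !lebesgue_measure_itv/= !lte_fin !h -!EFinB.
  by apply: mule_gt0; rewrite lte_fin subr_gt0.
- move=> i h [x y]; apply/rowP => j; rewrite /tr2 !mxE.
  case: i => [[|[|//]] i2]; case: j => [[|[|//]] j2] /=; rewrite ?mxE/= ?(mulr1, mulr0, addr0)//.
- by [].
- move=> i h A mA.
  have mf : measurable_fun setT (tr2 i h).
    have mp : measurable_fun setT (fun x : mR * mR => (x, h : mR)).
      exact: measurable_fun_pair.
    exact: (measurableT_comp (mtr i) mp).
  pose m := measure_function_pushforward__canonical__measure_function_Measure leb2 mf.
  apply/esym/(@product_measure_unique _ _ mR mR R leb1 leb1 m) => //= B C mB mC.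
  rewrite /m /= /pushforward.
  have mt (E : set mR) : measurable E -> measurable (tr1 ord0 h @^-1` E).
    move=> mE; rewrite -[X in measurable X]setTI; apply: (_ : measurable_fun setT (tr1 ord0 h)) => //.
    exact: measurable_funD.
  rewrite /tr2; case: (i == ord0).
    rewrite (_ : _ @^-1` _ = (tr1 ord0 h @^-1` B) `*` C) //.
    by rewrite [LHS](leb2E (mt _ mB) mC); congr (_ * _)%E; exact: lebesgue_shift.
  rewrite (_ : _ @^-1` _ = B `*` (tr1 ord0 h @^-1` C)) //.
  by rewrite [LHS](leb2E mB (mt _ mC)); congr (_ * _)%E; exact: lebesgue_shift.
Qed.

End Chart2.

(** * Square-integrable functions and H^1 *)

Lemma ae_finite {R : realType} {d : measure_display} {T : measurableType d}
    {mu : {measure set T -> \bar R}} (I : finType) (P : I -> T -> Prop) :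
  (forall i, {ae mu, forall x, P i x}) -> {ae mu, forall x, forall i, P i x}.
Proof. exact: filter_forall. Qed.

Section SquareIntegrable.
Context {R : realType} {d : measure_display} {T : measurableType d}.
Context {mu : {measure set T -> \bar R}} {D : set T}.
Implicit Types (f g h : T -> R).

Definition sqi (m : {measure set T -> \bar R}) (E : set T) f :=
  measurable_fun E f /\ intg m E (fun x => f x ^+ 2).

Lemma eq_sqi f g : (forall x, D x -> f x = g x) -> sqi mu D f -> sqi mu D g.
Proof.
move=> h [mf i]; split.
  by apply: eq_measurable_fun mf => x /set_mem; exact: h.
by apply: eq_intg i => x Dx; rewrite h.
Qed.

Hypothesis mD : measurable D.

Lemma sqi_lty f : (measurable_fun D f /\
  (\int[mu]_(x in D) ((f x) ^+ 2)%:E < +oo)%E) <-> sqi mu D f.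
Proof.
split=> -[mf i]; split => //.
  by apply: intg_lty => //; [exact: measurable_funX|move=> x _; exact: sqr_ge0].
by rewrite -Rint_EFin ?ltry.
Qed.

Lemma sqiD f g : sqi mu D f -> sqi mu D g -> sqi mu D (fun x => f x + g x).
Proof.
move=> [mf fi] [mg gi]; split; first exact: measurable_funD.
exact: intg_sqD.
Qed.

Lemma sqiZ k f : sqi mu D f -> sqi mu D (fun x => k * f x).
Proof.
move=> [mf fi]; split; first by apply: measurable_funM => //; exact: measurable_cst.
by under [X in intg _ _ X]eq_fun do rewrite exprMn; apply: intgZ.
Qed.

Lemma sqi_lin k f g : sqi mu D f -> sqi mu D g -> sqi mu D (fun x => k * f x + g x).
Proof. by move=> fi gi; apply: sqiD => //; apply: sqiZ. Qed.

Lemma sqiB f g : sqi mu D f -> sqi mu D g -> sqi mu D (fun x => f x - g x).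
Proof.
move=> fi gi; apply: eq_sqi (sqi_lin (-1) gi fi) => x _.
by rewrite mulN1r addrC.
Qed.

Lemma sqi0 : sqi mu D (fun=> 0).
Proof.
split; first exact: measurable_cst.
by under [X in intg _ _ X]eq_fun do rewrite expr0n; apply: intg0.
Qed.

Lemma sqi_sum (I : Type) (s : seq I) (F : I -> T -> R) :
  (forall i, sqi mu D (F i)) -> sqi mu D (fun x => \sum_(i <- s) F i x).
Proof.
move=> Fi; elim: s => [|i s IH].
  by apply: eq_sqi sqi0 => x _; rewrite big_nil.
by apply: eq_sqi (sqiD (Fi i) IH) => x _; rewrite big_cons.
Qed.

Lemma sqiM f g : sqi mu D f -> sqi mu D g -> intg mu D (fun x => f x * g x).
Proof. by move=> [mf fi] [mg gi]; exact: intg_sqM. Qed.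

Lemma ae_sqi f g : sqi mu D f -> measurable_fun D g ->
  {ae mu, forall x, D x -> `|g x| <= `|f x|} -> sqi mu D g.
Proof.
move=> [mf fi] mg h; split => //.
apply: (ae_intg mD fi (measurable_funX _ mg)).
apply: filterS h => x + Dx => /(_ Dx) h.
by rewrite normrX -[leRHS]real_normK ?num_real// lerXn2r ?nnegrE.
Qed.

Lemma le_sqi f g : sqi mu D f -> measurable_fun D g ->
  (forall x, D x -> `|g x| <= `|f x|) -> sqi mu D g.
Proof. by move=> fi mg h; apply: (ae_sqi fi mg); exact: aeW. Qed.

Lemma sqi_Mb f h C : sqi mu D f -> measurable_fun D h ->
  (forall x, D x -> `|h x| <= C) -> sqi mu D (fun x => h x * f x).
Proof.
move=> fi mh hC; apply: (le_sqi (sqiZ C fi)).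
  by apply: measurable_funM => //; exact: fi.1.
move=> x Dx; rewrite !normrM ler_wpM2r//; apply: le_trans (hC x Dx) _.
exact: ler_norm.
Qed.

Hypothesis finD : (mu D < +oo)%E.

Lemma sqi_intg f : sqi mu D f -> intg mu D f.
Proof. by move=> [mf fi]; exact: intg_of_sq. Qed.

Lemma sqi_bounded f C : measurable_fun D f ->
  {ae mu, forall x, D x -> `|f x| <= C} -> sqi mu D f.
Proof.
move=> mf h; have ci : sqi mu D (fun=> C).
  split; first exact: measurable_cst.
  by apply: (@intg_bounded _ _ _ _ _ _ _ (`|C ^+ 2|)) => //; exact: measurable_cst.
apply: (ae_sqi ci mf); apply: filterS h => x + Dx => /(_ Dx) h.
by apply: le_trans h _; exact: ler_norm.
Qed.

End SquareIntegrable.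

Section Truncation.
Context {R : realType}.
Implicit Types (k x y : R).

(* Bounded, with [|dtrunc k| <= 1]: makes any element of H^1 a limit of
   admissible (bounded) test functions. *)
Definition trunc k x : R := x / (1 + (x / k) ^+ 2).

Definition dtrunc k x : R := (1 - (x / k) ^+ 2) / (1 + (x / k) ^+ 2) ^+ 2.

Let den k x : 1 <= 1 + (x / k) ^+ 2.
Proof. by rewrite lerDl sqr_ge0. Qed.

Let den0 k x : 0 < 1 + (x / k) ^+ 2.
Proof. exact: lt_le_trans (den k x). Qed.

Lemma trunc_le k x : `|trunc k x| <= `|x|.
Proof.
rewrite /trunc normrM ler_piMr// normfV gtr0_norm ?den0//.
by rewrite invf_le1 ?den0.
Qed.

Lemma trunc_bounded k x : 0 < k -> `|trunc k x| <= k.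
Proof.
move=> k0; rewrite /trunc normrM normfV (gtr0_norm (den0 _ _)) ler_pdivrMr ?den0//.
have -> : `|x| = k * `|x / k|.
  by rewrite normrM normfV (gtr0_norm k0); field; rewrite gt_eqF.
rewrite ler_wpM2l ?(ltW k0)// -(@real_normK _ (x / k)) ?num_real//.
by set y := `|_|; have := sqr_ge0 (y - 2^-1); nra.
Qed.

Lemma dtrunc_le k x : `|dtrunc k x| <= 1.
Proof.
rewrite /dtrunc normrM normfV (@ger0_norm _ (_ ^+ 2)) ?sqr_ge0//.
rewrite ler_pdivrMr ?exprn_gt0// mul1r; have := sqr_ge0 (x / k).
by set y := _ ^+ 2 => y0; rewrite ler_norml; apply/andP; split; nra.
Qed.

Lemma trunc_quad k : 0 < k -> forall x y,
  `|trunc k y - trunc k x - dtrunc k x * (y - x)| <= 2 / k * (y - x) ^+ 2.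
Proof.
move=> k0 x y; have kn : k != 0 by rewrite gt_eqF.
pose p := x / k; pose q := y / k.
have -> : x = k * p by rewrite /p; field.
have -> : y = k * q by rewrite /q; field.
rewrite /trunc /dtrunc.
have kK (s : R) : k * s / k = s by field.
rewrite !kK.
have p1 : 1 + p ^+ 2 != 0 by rewrite gt_eqF// ltr_wpDr// sqr_ge0.
have q1 : 1 + q ^+ 2 != 0 by rewrite gt_eqF// ltr_wpDr// sqr_ge0.
have -> : k * q / (1 + q ^+ 2) - k * p / (1 + p ^+ 2) -
   (1 - p ^+ 2) / (1 + p ^+ 2) ^+ 2 * (k * q - k * p) =
   k * (q - p) ^+ 2 * ((p ^+ 2 * q - 2 * p - q) / ((1 + q ^+ 2) * (1 + p ^+ 2) ^+ 2)).
  by field; apply/andP.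
have -> : 2 / k * (k * q - k * p) ^+ 2 = k * (q - p) ^+ 2 * 2 by field.
have kpq : 0 <= k * (q - p) ^+ 2 by rewrite mulr_ge0 ?sqr_ge0 ?(ltW k0).
rewrite normrM (ger0_norm kpq) ler_wpM2l//.
have P : 0 < 1 + p ^+ 2 by rewrite ltr_wpDr// sqr_ge0.
have Q : 0 < 1 + q ^+ 2 by rewrite ltr_wpDr// sqr_ge0.
rewrite normrM normfV (gtr0_norm (mulr_gt0 _ _)) ?exprn_gt0//.
rewrite ler_pdivrMr ?mulr_gt0 ?exprn_gt0//.
have hq : `|q| <= (1 + q ^+ 2) / 2.
  by rewrite ler_norml; have := sqr_ge0 (q - 1); have := sqr_ge0 (q + 1); nra.
have hp : `|p| <= (1 + p ^+ 2) / 2.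
  by rewrite ler_norml; have := sqr_ge0 (p - 1); have := sqr_ge0 (p + 1); nra.
have p2 := sqr_ge0 p.
have p2M : 1 + p ^+ 2 <= (1 + p ^+ 2) ^+ 2 by nra.
have h1 : `|p ^+ 2 * q| <= (1 + p ^+ 2) ^+ 2 * ((1 + q ^+ 2) / 2).
  rewrite normrM (ger0_norm p2); apply: ler_pM => //; nra.
have h2 : `|2 * p| <= (1 + q ^+ 2) * (1 + p ^+ 2) ^+ 2.
  rewrite normrM ger0_norm//; apply: (@le_trans _ _ (1 + p ^+ 2)); first by lra.
  by apply: (le_trans p2M); rewrite ler_peMl ?sqr_ge0//; have := sqr_ge0 q; lra.
have h3 : `|q| <= (1 + q ^+ 2) * (1 + p ^+ 2) ^+ 2 / 2.
  apply: le_trans hq _; rewrite ler_wpM2r// ler_peMr ?(ltW Q)//; nra.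
have := ler_normB (p ^+ 2 * q - 2 * p) q.
have := ler_normB (p ^+ 2 * q) (2 * p).
move: h1 h2 h3; set A := `|p ^+ 2 * q|; set B := `|2 * p|; set C := `|q|.
set E := `|p ^+ 2 * q - 2 * p - q|; set F := `|p ^+ 2 * q - 2 * p|.
set S := (1 + p ^+ 2) ^+ 2; set T := 1 + q ^+ 2.
by move=> h1 h2 h3 h4 h5; nra.
Qed.

Let sqr_cvg (T : Type) (F : set_system T) (FF : Filter F) (f : T -> R) (c : R) :
  f @ F --> c -> f x ^+ 2 @[x --> F] --> c ^+ 2.
Proof. by move=> h; rewrite expr2; under eq_fun do rewrite expr2; exact: cvgM. Qed.

Let cden k : continuous (fun x => 1 + (x / k) ^+ 2).
Proof.
move=> x; apply: cvgD; first exact: cvg_cst.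
by apply: sqr_cvg; apply: cvgMr_tmp; exact: cvg_id.
Qed.

Lemma trunc_continuous k : continuous (trunc k).
Proof.
move=> x; apply: cvgM; first exact: cvg_id.
by apply: cvgV; [rewrite gt_eqF|exact: cden].
Qed.

Lemma dtrunc_continuous k : continuous (dtrunc k).
Proof.
move=> x; apply: cvgM.
  apply: cvgB; first exact: cvg_cst.
  by apply: sqr_cvg; apply: cvgMr_tmp; exact: cvg_id.
apply: cvgV; first by rewrite gt_eqF// exprn_gt0.
by apply: sqr_cvg; exact: cden.
Qed.

Let quot_cvg x : (x / k.+1%:R : R) @[k --> \oo] --> (0 : R).
Proof.
by rewrite -[X in _ --> X](mulr0 x); apply: cvgMl_tmp; exact: cvg_harmonic.
Qed.

Let den_cvg x : (1 + (x / k.+1%:R) ^+ 2 : R) @[k --> \oo] --> (1 : R).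
Proof.
rewrite -[X in _ --> X](_ : 1 + 0 ^+ 2 = 1); last by rewrite expr0n addr0.
by apply: cvgD; [exact: cvg_cst|apply: sqr_cvg; exact: quot_cvg].
Qed.

Lemma trunc_cvg x : (trunc k.+1%:R x : R) @[k --> \oo] --> x.
Proof.
rewrite -[X in _ --> X]divr1 /trunc; apply: cvgMl_tmp.
by apply: cvgV; [exact: oner_neq0|exact: den_cvg].
Qed.

Lemma dtrunc_cvg x : (dtrunc k.+1%:R x : R) @[k --> \oo] --> (1 : R).
Proof.
rewrite -[X in _ --> X](_ : (1 - 0 ^+ 2) / 1 ^+ 2 = 1); last by rewrite expr0n subr0 expr1n divr1.
apply: cvgM.
  by apply: cvgB; [exact: cvg_cst|apply: sqr_cvg; exact: quot_cvg].
apply: cvgV; first by rewrite expr1n oner_neq0.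
by apply: sqr_cvg; exact: den_cvg.
Qed.

End Truncation.

Section Sobolev.
Context {R : realType} {n : nat} {dX : measure_display} {X : measurableType dX}.
Context {leb : {sigma_finite_measure set X -> \bar R}} {pos : X -> 'rV[R]_n}.
Context {tr : 'I_n -> R -> X -> X}.
Hypothesis ch : chart leb pos tr.
Context {Om : set 'rV[R]_n}.
Hypotheses (oOm : open Om) (bOm : bounded_set Om).
Local Notation D := (pos @^-1` Om).
Local Notation H1 := (H1 leb pos Om).
Local Notation L2 := (L2 leb pos Om).

Lemma dom_measurable : measurable D. Proof. exact: (ch_open ch). Qed.
Let mD := dom_measurable.

Lemma dom_fin : (leb D < +oo)%E. Proof. exact: (bounded_dom_fin ch). Qed.
Let fD := dom_fin.

Lemma L2P f : L2 f <-> sqi leb D (fun x => f (pos x)).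
Proof. exact: sqi_lty. Qed.

Lemma test_intg f phi : intg leb D (fun x => f (pos x)) -> test_fun Om phi ->
  intg leb D (fun x => f (pos x) * phi (pos x)) /\
  forall v, intg leb D (fun x => f (pos x) * 'D_v phi (pos x)).
Proof.
move=> fi tphi; split=> [|v].
  have [C _ hC] := test_fun_bounded tphi.
  apply: (intg_Mb mD fi _ (fun x _ => hC (pos x))).
  by apply/measurable_funTS/(pos_cont_measurable ch)/C1_continuous/(test_fun_C1 tphi).
have [C _ hC] := test_derive_bounded v tphi.
apply: (intg_Mb mD fi _ (fun x _ => hC (pos x))).
by have [_ cf _] := tphi; exact/measurable_funTS/(pos_cont_measurable ch (cf v)).
Qed.

Lemma H1_lin c u Du v Dv : H1 u Du -> H1 v Dv ->
  H1 (fun x => c * u x + v x) (fun x => c *: Du x + Dv x).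
Proof.
move=> [/L2P ui Dui wu] [/L2P vi Dvi wv]; split.
- by apply/L2P; exact: sqi_lin.
- move=> i; apply/L2P; move/L2P: (Dui i) => ?; move/L2P: (Dvi i) => ?.
  by under [X in sqi _ _ X]eq_fun do rewrite !mxE; exact: sqi_lin.
- move=> phi tphi i; move/L2P: (Dui i) => Di; move/L2P: (Dvi i) => D'i.
  have := wv phi tphi i; have := wu phi tphi i; rewrite /int_dom /dom => e1 e2.
  have [_ /(_ (delta_mx ord0 i)) u2] := test_intg (sqi_intg mD fD ui) tphi.
  have [_ /(_ (delta_mx ord0 i)) v2] := test_intg (sqi_intg mD fD vi) tphi.
  have [u1 _] := @test_intg (fun x => Du x ord0 i) phi (sqi_intg mD fD Di) tphi.
  have [v1 _] := @test_intg (fun x => Dv x ord0 i) phi (sqi_intg mD fD D'i) tphi.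
  transitivity (c * \int[leb]_(x in D) (u (pos x) * 'D_(delta_mx ord0 i) phi (pos x)) +
     \int[leb]_(x in D) (v (pos x) * 'D_(delta_mx ord0 i) phi (pos x))).
    rewrite -(RintZ mD) // -RintD//; last exact: intgZ.
    by apply: eq_Rint => x _; ring.
  rewrite e1 e2 mulrN -opprD; congr (- _).
  rewrite -(RintZ mD) // -RintD//; last exact: intgZ.
  by apply: eq_Rint => x _; rewrite !mxE; ring.
Qed.

Lemma eq_H1 u Du v Dv : (forall x, Om x -> u x = v x /\ Du x = Dv x) ->
  H1 u Du -> H1 v Dv.
Proof.
move=> h [/L2P ui Dui wu]; split.
- by apply/L2P; apply: eq_sqi ui => x Dx; have [] := h _ Dx.
- move=> i; apply/L2P; move/L2P: (Dui i); apply: eq_sqi => x Dx.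
  by have [_ ->] := h _ Dx.
- move=> phi tphi i; have := wu phi tphi i; rewrite /int_dom /dom.
  rewrite (@eq_Rint _ _ _ _ _ _ (fun x => v (pos x) * 'D_(delta_mx ord0 i) phi (pos x))).
    move=> ->; congr (- _); apply: eq_Rint => x Dx; by have [_ ->] := h _ Dx.
  by move=> x Dx; have [->] := h _ Dx.
Qed.

Lemma H10 : H1 (fun=> 0) (fun=> 0).
Proof.
have s0 : sqi leb D (fun=> 0) by exact: sqi0.
split; first exact/L2P.
  by move=> i; apply/L2P; under [X in sqi _ _ X]eq_fun do rewrite mxE.
move=> phi _ i; rewrite /int_dom.
under eq_Rint => x _ do rewrite mul0r.
under [in RHS]eq_Rint => x _ do rewrite mxE mul0r.
by rewrite Rint0 oppr0.
Qed.

Lemma H1Z c u Du : H1 u Du -> H1 (fun x => c * u x) (fun x => c *: Du x).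
Proof.
move=> h; have := H1_lin c h H10; apply: eq_H1 => x _.
by rewrite !addr0.
Qed.

Lemma H1B u Du v Dv : H1 u Du -> H1 v Dv ->
  H1 (fun x => u x - v x) (fun x => Du x - Dv x).
Proof.
move=> hu hv; have := H1_lin (-1) hv hu; apply: eq_H1 => x _.
by rewrite mulN1r scaleN1r !(addrC (- _)).
Qed.

Lemma H1_wder u Du i : H1 u Du ->
  @wder R n dX X leb pos Om i (fun x => u (pos x)) (fun x => Du (pos x) ord0 i).
Proof. by move=> [_ _ h] phi tphi; exact: h. Qed.

Lemma H1_gradient_ae u Du Du' : H1 u Du -> H1 u Du' ->
  {ae leb, forall x, D x -> Du (pos x) = Du' (pos x)}.
Proof.
move=> hu hu'; have [_ D0 w0] := H1B hu hu'.
have h i : {ae leb, forall x, D x -> (Du (pos x) - Du' (pos x)) ord0 i = 0}.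
  move/L2P: (D0 i) => Di.
  apply: (@flcv _ _ _ _ leb pos (ch_open ch) (ch_gen ch) Om
    (fun x => (Du (pos x) - Du' (pos x)) ord0 i) oOm (sqi_intg mD fD Di)).
  move=> phi tphi; have := w0 phi tphi i; rewrite /int_dom /dom.
  under eq_Rint => x _ do rewrite subrr mul0r.
  by rewrite Rint0 => /eqP; rewrite eq_sym oppr_eq0 => /eqP.
apply: filterS (ae_finite h) => x hx Dx; apply/rowP => i.
by apply/eqP; rewrite -subr_eq0; have := hx i Dx; rewrite !mxE => ->.
Qed.

Lemma H1_trunc k u Du : 0 < k -> H1 u Du ->
  H1 (fun x => trunc k (u x)) (fun x => dtrunc k (u x) *: Du x).
Proof.
move=> k0 hu; have [/L2P ui Dui _] := hu.
have mt : measurable_fun D (fun x => trunc k (u (pos x))).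
  by apply: measurableT_comp ui.1; apply: continuous_measurable_fun; exact: trunc_continuous.
have mdt : measurable_fun D (fun x => dtrunc k (u (pos x))).
  by apply: measurableT_comp ui.1; apply: continuous_measurable_fun; exact: dtrunc_continuous.
have ti : sqi leb D (fun x => trunc k (u (pos x))).
  by apply: (le_sqi mD ui mt) => x _; exact: trunc_le.
have dti i : sqi leb D (fun x => dtrunc k (u (pos x)) * Du (pos x) ord0 i).
  by move/L2P: (Dui i) => Di; apply: (sqi_Mb mD Di mdt) => x _; exact: dtrunc_le.
split.
- exact/L2P.
- by move=> i; apply/L2P; apply: eq_sqi (dti i) => x _; rewrite mxE.
- move=> phi tphi i; move/L2P: (Dui i) => Di.
  have := chain_wder ch oOm (sqi_intg mD fD ui) (sqi_intg mD fD Di)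
    (trunc_quad k0) (@dtrunc_continuous _ k) (sqi_intg mD fD ti)
    (sqi_intg mD fD (dti i)) (H1_wder i hu) tphi.
  rewrite /int_dom /dom => ->; congr (- _); apply: eq_Rint => x _.
  by rewrite mxE.
Qed.

End Sobolev.

(** * Functions of time and space *)

Section ProductNull.
Context {R : realType} {d1 d2 : measure_display}.
Context {X : measurableType d1} {Y : measurableType d2}.
Context {m1 : {sigma_finite_measure set X -> \bar R}}.
Context {m2 : {sigma_finite_measure set Y -> \bar R}}.
Local Notation mm := (m1 \x m2)%E.

Lemma ae_slices (P : X * Y -> Prop) : {ae mm, forall p, P p} ->
  {ae m1, forall x, {ae m2, forall y, P (x, y)}}.
Proof.
move=> [N [mN N0 hN]].
have mx : measurable_fun setT (fun x => m2 (xsection N x)).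
  exact: measurable_fun_xsection.
have : {ae m1, forall x, setT x -> m2 (xsection N x) = 0%E}.
  apply/(ae_eq_integral_abs m1 measurableT mx); rewrite -[RHS]N0.
  by apply: eq_integral => x _; rewrite gee0_abs.
apply: filterS => x /(_ I) N0x; exists (xsection N x); split => //.
  exact: measurable_xsection.
by move=> y hy; rewrite /xsection/=; apply/mem_set/hN.
Qed.

Lemma slices_ae (D1 : set X) (D2 : set Y) (A : X * Y -> R) :
  measurable D1 -> measurable D2 -> measurable_fun (D1 `*` D2) A ->
  {ae m1, forall x, D1 x -> {ae m2, forall y, D2 y -> A (x, y) = 0}} ->
  {ae mm, forall p, (D1 `*` D2) p -> A p = 0}.
Proof.
move=> mD1 mD2 mA hA.
pose N := (D1 `*` D2) `&` A @^-1` (~` [set 0]).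
have mN : measurable N.
  by apply: mA; [exact: measurableX|exact: measurableC].
exists N; split => //; last first.
  move=> p /= h; split; first by apply: contrapT => h'; apply: h => /h'.
  by move=> h'; apply: h.
transitivity (\int[m1]_x 0)%E; last exact: integral0.
apply: ge0_ae_eq_integral => //.
- exact: measurable_fun_xsection.
apply: filterS hA => x hx _; case: (pselect (D1 x)) => [D1x|nD1x]; last first.
  rewrite /= (_ : xsection N x = set0) ?measure0//.
  by apply/seteqP; split => y //; rewrite /xsection/= => /set_mem [[]].
have mS : measurable (xsection N x) by exact: measurable_xsection.
have [M [mM M0 hM]] := hx D1x.
apply/eqP; rewrite eq_le measure_ge0 andbT -M0; apply: le_measure.
- by rewrite inE.
- by rewrite inE.
- move=> y; rewrite /xsection/= => /set_mem [[_ D2y] h]; apply: hM => /= h'.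
  by apply: h; exact: h'.
Qed.

Context {D1 : set X} {D2 : set Y}.
Hypotheses (mD1 : measurable D1) (mD2 : measurable D2).

Lemma measurable_fun_pr1 (f : X -> R) : measurable_fun D1 f ->
  measurable_fun (D1 `*` D2) (fun p => f p.1).
Proof.
move=> mf; apply: (measurable_comp mD1 _ mf); last exact: measurable_funTS.
by move=> _ [p [h _] <-].
Qed.

Lemma measurable_fun_pr2 (f : Y -> R) : measurable_fun D2 f ->
  measurable_fun (D1 `*` D2) (fun p => f p.2).
Proof.
move=> mf; apply: (measurable_comp mD2 _ mf); last exact: measurable_funTS.
by move=> _ [p [_ h] <-].
Qed.

Lemma measurable_slice (f : X * Y -> R) x : D1 x -> measurable_fun (D1 `*` D2) f ->
  measurable_fun D2 (fun y => f (x, y)).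
Proof.
move=> D1x mf; apply: (measurable_comp (measurableX mD1 mD2) _ mf).
  by move=> _ [y D2y <-]; split.
exact: measurable_funTS (pair1_measurable x).
Qed.

Lemma intg_tensor f g : intg m1 D1 f -> intg m2 D2 g ->
  intg mm (D1 `*` D2) (fun p => f p.1 * g p.2).
Proof.
move=> fi gi; have mf := intg_measurable fi; have mg := intg_measurable gi.
apply/(intg_prod_ltyP mD1 mD2).
  by apply: measurable_funM; [exact: measurable_fun_pr1|exact: measurable_fun_pr2].
rewrite (eq_integral (fun x => `|(f x)%:E| * \int[m2]_(y in D2) `|(g y)%:E|)%E).
  have [_ gf] := integrableP _ _ _ gi; have [_ ff] := integrableP _ _ _ fi.
  have g0 : (0 <= \int[m2]_(y in D2) `|(g y)%:E|)%E by exact: integral_ge0.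
  rewrite ge0_integralZr//.
  - by apply: lte_mul_pinfty => //; [exact: integral_ge0|rewrite ge0_fin_numE//; exact: integral_ge0].
  - by apply: measurableT_comp => //; exact/measurable_EFinP.
move=> x _; rewrite -ge0_integralZl//.
- by apply: eq_integral => y _; rewrite -abseM -EFinM.
- by apply: measurableT_comp => //; exact/measurable_EFinP.
Qed.

Lemma sqi_tensor f g : sqi m1 D1 f -> sqi m2 D2 g ->
  sqi mm (D1 `*` D2) (fun p => f p.1 * g p.2).
Proof.
move=> [mf fi] [mg gi]; split.
  by apply: measurable_funM; [exact: measurable_fun_pr1|exact: measurable_fun_pr2].
by apply: eq_intg (intg_tensor fi gi) => p _; rewrite exprMn.
Qed.

End ProductNull.

Section CauchySchwarz.
Context {R : realType} {d : measure_display} {T : measurableType d}.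
Context {mu : {measure set T -> \bar R}} {D : set T}.
Hypothesis mD : measurable D.

Lemma cauchy_schwarz f g : sqi mu D f -> sqi mu D g ->
  (\int[mu]_(x in D) (f x * g x)) ^+ 2 <=
  \int[mu]_(x in D) (f x ^+ 2) * \int[mu]_(x in D) (g x ^+ 2).
Proof.
move=> fi gi; have fgi := sqiM mD fi gi.
set I := \int[mu]_(x in D) (f x * g x).
set A := \int[mu]_(x in D) (f x ^+ 2); set B := \int[mu]_(x in D) (g x ^+ 2).
have q k : 0 <= k ^+ 2 * A + 2 * k * I + B.
  have -> : k ^+ 2 * A + 2 * k * I + B = \int[mu]_(x in D) ((k * f x + g x) ^+ 2).
    have i1 := intgZ mD (k ^+ 2) fi.2; have i2 := intgZ mD (2 * k) fgi.
    rewrite -(RintZ mD _ fi.2) -(RintZ mD _ fgi) -(RintD mD i1 i2).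
    rewrite -(RintD mD (intgD mD i1 i2) gi.2).
    by apply: eq_Rint => x _; ring.
  by apply: Rintegral_ge0 => x _; exact: sqr_ge0.
have A0 : 0 <= A by apply: Rintegral_ge0 => x _; exact: sqr_ge0.
have [A00|An0] := eqVneq A 0.
  rewrite A00 mul0r; have [->|In0] := eqVneq I 0; first by rewrite expr0n.
  have := q (- (B + 1) / (2 * I)); rewrite A00 mulr0 add0r.
  have -> : 2 * (- (B + 1) / (2 * I)) * I + B = - 1 by field.
  by rewrite oppr_ge0 ler10.
have Ap : 0 < A by rewrite lt_neqAle eq_sym An0.
have := q (- I / A).
have -> : (- I / A) ^+ 2 * A + 2 * (- I / A) * I + B = B - I ^+ 2 / A by field.
by rewrite subr_ge0 ler_pdivrMr// mulrC.
Qed.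

End CauchySchwarz.

Section Cumulative2.
Context {R : realType} {dX : measure_display} {X : measurableType dX}.
Context {leb : {sigma_finite_measure set X -> \bar R}}.
Context {D : set X} {T : R}.
Hypothesis mD : measurable D.
Hypothesis fD : (leb D < +oo)%E.
Notation leb1 := (@lebesgue_measure R).
Notation mR := (measurableTypeR R).
Local Notation I := (`]0, T[%classic : set mR).
Local Notation lebT := (leb1 \x leb)%E.
Let mI : measurable I. Proof. exact: itvoo_measurable. Qed.
Implicit Types (f : mR * X -> R) (t : R).

Definition cumul f t x := \int[leb1]_(s in `]0, t[) f (s, x).

Lemma cumul_measurable2 f : measurable_fun (I `*` D) f ->
  measurable_fun (I `*` D) (fun p => cumul f p.1 p.2).
Proof.
move=> mf; have mf' := (measurable_restrictT _ (measurableX mI mD)).1 mf.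
apply: (@eq_measurable_fun _ _ _ _ _ (fun p => \int[leb1]_s (fun q : (mR * X) * mR =>
     \1_[set q : (mR * X) * mR | 0 < q.2 < q.1.1] q * (f \_ (I `*` D)) (q.2, q.1.2)) (p, s))).
  move=> [t x] /set_mem [/= It Dx]; rewrite /cumul /= [RHS]Rintegral_mkcond.
  apply: eq_Rint => s _; rewrite patchE indicE.
  have [Is|nIs] := boolP (s \in `]0, t[%classic).
    have /itvooP/andP[s0 st] := set_mem Is; have /itvooP/andP[_ tT] := It.
    rewrite mem_set/= ?s0// mul1r patchE mem_set//.
    by split=> //; apply/itvooP; rewrite s0 (lt_trans st).
  rewrite memNset ?mul0r// => /= h; move/negP: nIs; apply.
  by apply/mem_set/itvooP.
apply: measurable_funTS.
apply: (@measurable_Rint_param _ _ _ _ _ leb1 (fun q : (mR * X) * mR =>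
     \1_[set q : (mR * X) * mR | 0 < q.2 < q.1.1] q * (f \_ (I `*` D)) (q.2, q.1.2))).
apply: measurable_funM; last first.
  have m1 : measurable_fun setT (fun q : (mR * X) * mR => (q.2, q.1.2)).
    by apply: measurable_fun_pair => //; apply: measurableT_comp.
  exact: (measurableT_comp mf' m1).
apply: measurable_indic.
rewrite (_ : [set q | _] = [set q | 0 < q.2] `&` [set q : (mR * X) * mR | q.2 < q.1.1]).
  apply: measurableI.
    rewrite -[X in measurable X]setTI.
    exact: (@measurable_fun_ltr _ _ _ setT (cst 0) (fun q : (mR * X) * mR => q.2)
      (measurable_cst _) measurable_snd measurableT [set true] Logic.I).
  rewrite -[X in measurable X]setTI.
  have m11 : measurable_fun setT (fun q : (mR * X) * mR => q.1.1).
    exact: (measurableT_comp measurable_fst measurable_fst).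
  exact: (@measurable_fun_ltr _ _ _ setT (fun q : (mR * X) * mR => q.2)
    (fun q : (mR * X) * mR => q.1.1) measurable_snd m11 measurableT [set true] Logic.I).
by apply/seteqP; split=> q /=; [move/andP|move=> [-> ->]].
Qed.

Lemma intg_cyl_sub f t : t <= T -> intg lebT (I `*` D) f ->
  intg lebT ((`]0, t[%classic : set mR) `*` D) f.
Proof.
move=> tT; have mt := itvoo_measurable 0 t.
apply: intgS; [exact: measurableX|exact: measurableX|].
move=> [s x] [/itvooP/andP[s0 st] Dx]; split => //; apply/itvooP.
by rewrite s0 (lt_le_trans st).
Qed.

Lemma cumul_intg f t : t <= T -> intg lebT (I `*` D) f -> intg leb D (cumul f t).
Proof.
move=> tT fi.
by have [_ h _] := RFubini2 (itvoo_measurable 0 t) mD (intg_cyl_sub tT fi).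
Qed.

Lemma cumul_pair f v t : 0 <= t <= T -> intg lebT (I `*` D) f ->
  intg lebT (I `*` D) (fun p => f p * v p.2) -> measurable_fun D v ->
  intg leb D (fun x => cumul f t x * v x) /\
  \int[leb]_(x in D) (cumul f t x * v x) =
  \int[leb1]_(s in `]0, t[) \int[leb]_(x in D) (f (s, x) * v x).
Proof.
move=> /andP[t0 tT] fi fvi mv; have mt := itvoo_measurable 0 t.
have fvi' := intg_cyl_sub tT fvi; have fi' := intg_cyl_sub tT fi.
rewrite (Rint_swap mt mD fvi').
have [s i _] := RFubini2 mt mD fvi'; have [s' i' _] := RFubini2 mt mD fi'.
have [||] := Rint_ae_eq mD i (g := fun x => cumul f t x * v x) => //.
- by apply: measurable_funM => //; exact: intg_measurable i'.
- apply: filterS2 s s' => x hx hx' Dx.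
  rewrite /cumul -[RHS]mulrC -(RintZ mt _ (hx' Dx)).
  by apply: eq_Rint => ? _; rewrite mulrC.
Qed.

Lemma cumul_sqr_le (g : R -> R) t : 0 <= t <= T -> sqi leb1 I g ->
  (\int[leb1]_(s in `]0, t[) g s) ^+ 2 <= T * \int[leb1]_(s in I) (g s ^+ 2).
Proof.
move=> /andP[t0 tT] [mg gi]; have mt := itvoo_measurable 0 t.
have sub : (`]0, t[%classic : set mR) `<=` I.
  by move=> s /itvooP/andP[s0 st]; apply/itvooP; rewrite s0 (lt_le_trans st).
have gt : sqi leb1 (`]0, t[%classic : set mR) g.
  by split; [exact: measurable_funS mg|exact: intgS gi].
have o : sqi leb1 (`]0, t[%classic : set mR) (fun=> 1).
  split; first exact: measurable_cst.
  under [X in intg _ _ X]eq_fun do rewrite expr1n.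
  by apply: intg_continuous => ?; exact: cvg_cst.
have := cauchy_schwarz mt o gt.
under eq_Rint do rewrite mul1r.
rewrite (@eq_Rint _ _ _ _ _ (fun=> 1 ^+ 2) (fun=> 1)); last by move=> s _; rewrite expr1n.
rewrite Rint_itv_cst// subr0 mul1r => /le_trans; apply.
apply: ler_pM => //; first by apply: Rintegral_ge0 => s _; exact: sqr_ge0.
rewrite (@Rint_split _ T _ gi 0 t T)//; last by rewrite t0.
by rewrite lerDl; apply: Rintegral_ge0 => s _; exact: sqr_ge0.
Qed.

Lemma cumul_sqi f t : 0 <= t <= T -> sqi lebT (I `*` D) f -> sqi leb D (cumul f t).
Proof.
move=> t0T fi; have /andP[t0 tT] := t0T; have [mf f2] := fi.
have fIi := sqi_intg (measurableX mI mD) _ fi.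
have fin : (lebT (I `*` D) < +oo)%E.
  rewrite product_measure1E//; apply: lte_mul_pinfty => //.
  by rewrite ge0_fin_numE//; exact: itvoo_fin.
have mc := intg_measurable (cumul_intg tT (fIi fin)); split => //.
have [s i _] := RFubini2 mI mD f2.
apply: (ae_intg mD (intgZ mD T i) (measurable_funX _ mc)).
have mf2 : measurable_fun (D `*` I) (fun p => f (p.2, p.1)).
  apply: (measurable_comp (measurableX mI mD) _ mf).
    by move=> _ [p [p1 p2] <-]; split.
  by apply/measurable_funTS/measurable_fun_pair; [exact: measurable_snd|exact: measurable_fst].
apply: filterS s => x + Dx => /(_ Dx) h; rewrite ger0_norm ?sqr_ge0//.
apply: cumul_sqr_le => //; split => //.
exact: (measurable_slice mD mI Dx mf2).
Qed.

Lemma cumul_sqi2 f : sqi lebT (I `*` D) f ->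
  sqi lebT (I `*` D) (fun p => cumul f p.1 p.2).
Proof.
move=> fi; have [mf f2] := fi; split; first exact: cumul_measurable2.
have [s i _] := RFubini2 mI mD f2.
have o : intg leb1 I (fun=> T) by apply: intg_continuous => ?; exact: cvg_cst.
have mID := measurableX mI mD.
apply: (ae_intg mID (intg_tensor mI mD o i)).
  exact: (measurable_funX 2 (cumul_measurable2 mf)).
have mf2 : measurable_fun (D `*` I) (fun p => f (p.2, p.1)).
  apply: (measurable_comp mID _ mf).
    by move=> _ [p [p1 p2] <-]; split.
  by apply/measurable_funTS/measurable_fun_pair; [exact: measurable_snd|exact: measurable_fst].
have [N [mN N0 hN]] := s.
exists (setT `*` N); split; first exact: measurableX.
  transitivity (leb1 setT * leb N)%E; first exact: product_measure1E.
  by rewrite N0 mule0.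
move=> [t x] /= h; split => //; apply: hN => /= h'; apply: h => -[It Dx] /=.
rewrite ger0_norm ?sqr_ge0//; apply: cumul_sqr_le.
  by move/itvooP: It => /andP[/ltW -> /ltW ->].
split; last exact: h'.
exact: (measurable_slice mD mI Dx mf2).
Qed.

End Cumulative2.

Section ProductTest.
Context {R : realType} {U V : normedModType R}.

Lemma C1_pr1 (f : U -> R) : C1 f ->
  C1 (fun q : U * V => f q.1) /\ forall v q, 'D_v (fun q : U * V => f q.1) q = 'D_v.1 f q.1.
Proof.
move=> [df cf].
have cfst : continuous (fst : U * V -> U) by move=> q; exact: cvg_fst.
have dfst q : differentiable (fst : U * V -> U) q.
  exact: (@linear_differentiable R (U * V)%type U fst).
have dE v q : 'D_v (fun q : U * V => f q.1) q = 'D_v.1 f q.1.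
  rewrite deriveE; last exact: differentiable_comp.
  rewrite (diff_comp (f := fst) (g := f))//= deriveE//.
  by rewrite (@diff_lin R (U * V)%type U fst).
split => //; split=> [q|v]; first exact: differentiable_comp.
have -> : 'D_v (fun q : U * V => f q.1) = (fun q => 'D_v.1 f q.1).
  by apply/funext => q; exact: dE.
by move=> q; apply: (@continuous_comp _ _ _ fst ('D_v.1 f)); [exact: cfst|exact: cf].
Qed.

Lemma C1_pr2 (f : V -> R) : C1 f ->
  C1 (fun q : U * V => f q.2) /\ forall v q, 'D_v (fun q : U * V => f q.2) q = 'D_v.2 f q.2.
Proof.
move=> [df cf].
have cfst : continuous (snd : U * V -> V) by move=> q; exact: cvg_snd.
have dfst q : differentiable (snd : U * V -> V) q.
  exact: (@linear_differentiable R (U * V)%type V snd).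
have dE v q : 'D_v (fun q : U * V => f q.2) q = 'D_v.2 f q.2.
  rewrite deriveE; last exact: differentiable_comp.
  rewrite (diff_comp (f := snd) (g := f))//= deriveE//.
  by rewrite (@diff_lin R (U * V)%type V snd).
split => //; split=> [q|v]; first exact: differentiable_comp.
have -> : 'D_v (fun q : U * V => f q.2) = (fun q => 'D_v.2 f q.2).
  by apply/funext => q; exact: dE.
by move=> q; apply: (@continuous_comp _ _ _ snd ('D_v.2 f)); [exact: cfst|exact: cf].
Qed.

Lemma test_fun_tensor (A : set U) (B : set V) p psi : test_fun A p -> test_fun B psi ->
  test_fun (A `*` B) (fun q : U * V => p q.1 * psi q.2) /\
  forall u q, 'D_(u, 0) (fun q : U * V => p q.1 * psi q.2) q = 'D_u p q.1 * psi q.2.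
Proof.
move=> tp tpsi; have [P dP] := C1_pr1 (test_fun_C1 tp).
have [Q dQ] := C1_pr2 (test_fun_C1 tpsi).
have PQ := C1M P Q; split.
  have [dPQ cPQ] := PQ; split => //.
  have [_ _ [K [cK KA K0]]] := tp; have [_ _ [L [cL LB L0]]] := tpsi.
  exists (K `*` L); split; first exact: compact_setX.
    by move=> [x y] [/KA ? /LB ?].
  move=> [x y] h /=; case: (pselect (K x)) => Kx; last by rewrite K0// mul0r.
  by rewrite [psi _]L0 ?mulr0// => Ly; apply: h.
move=> u q; have dp : derivable (fun q : U * V => p q.1) q (u, 0).
  by apply: diff_derivable; case: P => h _; exact: h.
have dq : derivable (fun q : U * V => psi q.2) q (u, 0).
  by apply: diff_derivable; case: Q => h _; exact: h.
have -> : (fun q : U * V => p q.1 * psi q.2) = (fun q => p q.1) * (fun q => psi q.2).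
  by [].
rewrite deriveM//= dP dQ/=.
have -> : 'D_0 psi q.2 = 0 by rewrite deriveE ?linear0//; case: tpsi.
by rewrite scaler0 add0r /GRing.scale/= mulrC.
Qed.

End ProductTest.

Section WeakContinuity.
Context {R : realType} {n : nat} {dX : measure_display} {X : measurableType dX}.
Context {leb : {sigma_finite_measure set X -> \bar R}} {pos : X -> 'rV[R]_n}.
Context {tr : 'I_n -> R -> X -> X}.
Hypothesis ch : chart leb pos tr.
Context {Om : set 'rV[R]_n}.
Hypotheses (oOm : open Om) (bOm : bounded_set Om).
Context {T : R}.
Hypothesis T0 : 0 < T.
Local Notation D := (pos @^-1` Om).
Notation leb1 := (@lebesgue_measure R).
Notation mR := (measurableTypeR R).
Local Notation I := (`]0, T[%classic : set mR).
Local Notation lebT := (leb1 \x leb)%E.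
Implicit Types (F G : R -> 'rV[R]_n -> R).

#[local] Instance leb1_filter2 : Filter (nbhs (almost_everywhere leb1)) :=
  ae_filter_ringOfSetsType leb1.

Let mI : measurable I. Proof. exact: itvoo_measurable. Qed.
Let mD : measurable D. Proof. exact: (dom_measurable ch oOm). Qed.
Let fD : (leb D < +oo)%E. Proof. exact: (dom_fin ch oOm bOm). Qed.

Lemma L2TP F : L2T leb pos Om T F <-> sqi lebT (I `*` D) (on_cyl pos F).
Proof. exact: (sqi_lty (measurableX mI mD)). Qed.

Definition wcont F :=
  (forall t, 0 <= t <= T -> sqi leb D (fun x => F t (pos x))) /\
  forall v, sqi leb D v -> exists2 c : R -> R, continuous c &
    forall t, 0 <= t <= T -> \int[leb]_(x in D) (F t (pos x) * v x) = c t.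

Lemma wcontB F G : wcont F -> wcont G -> wcont (fun t x => F t x - G t x).
Proof.
move=> [Fi Fc] [Gi Gc]; split=> [t tT|v vi].
  exact: (sqiB mD (Fi t tT) (Gi t tT)).
have [c cc cE] := Fc v vi; have [c' cc' cE'] := Gc v vi.
exists (fun t => c t - c' t) => [t|t tT]; first by apply: cvgB; [exact: cc|exact: cc'].
rewrite -cE// -cE'// -RintB//; [|exact: (sqiM mD (Fi t tT) vi)|exact: (sqiM mD (Gi t tT) vi)].
by apply: eq_Rint => x _; rewrite mulrBl.
Qed.

Lemma holder_wcont (gam : R) F : 0 < gam -> holderL2 leb pos Om T gam F -> wcont F.
Proof.
move=> g0 [Fi [C hC]].
have FiP t : 0 <= t <= T -> sqi leb D (fun x => F t (pos x)).
  by move=> h; apply/(L2P ch oOm); exact: Fi.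
split => // v vi.
pose f t := \int[leb]_(x in D) (F t (pos x) * v x).
pose K := (`|C| + 1) * (Num.sqrt (\int[leb]_(x in D) (v x ^+ 2)) + 1).
have sB : 0 <= Num.sqrt (\int[leb]_(x in D) (v x ^+ 2)) by exact: sqrtr_ge0.
have K0 : 0 < K by rewrite mulr_gt0// ltr_wpDl.
exists (fun t => f (clamp T t)); last by move=> t tT; rewrite clamp_id.
apply: continuous_of_modulus (ltW T0) => e e0.
exists ((e / K) `^ gam^-1); first by rewrite powR_gt0// divr_gt0.
move=> s t sT tT st.
have dFi : sqi leb D (fun x => F t (pos x) - F s (pos x)).
  exact: (sqiB mD (FiP t tT) (FiP s sT)).
have -> : f t - f s = \int[leb]_(x in D) ((F t (pos x) - F s (pos x)) * v x).
  rewrite /f -RintB//; [|exact: (sqiM mD (FiP t tT) vi)|exact: (sqiM mD (FiP s sT) vi)].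
  by apply: eq_Rint => x _; rewrite mulrBl.
have A0 : 0 <= \int[leb]_(x in D) ((F t (pos x) - F s (pos x)) ^+ 2).
  by apply: Rintegral_ge0 => x _; exact: sqr_ge0.
have := cauchy_schwarz mD dFi vi.
rewrite -ler_sqrt ?sqrtr_sqr ?mulr_ge0// ?sqrtrM//; last first.
  by apply: Rintegral_ge0 => x _; exact: sqr_ge0.
move=> /le_lt_trans; apply.
have := hC t s tT sT; rewrite /normL2 /int_dom /dom.
set N := Num.sqrt _ => hN.
have lt : `|t - s| `^ gam < e / K.
  rewrite -[ltRHS](_ : ((e / K) `^ gam^-1) `^ gam = _).
    by rewrite gt0_ltr_powR// ?nnegrE ?powR_ge0.
  by rewrite -powRrM mulVf ?gt_eqF// powRr1// ltW// divr_gt0.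
have CK : N <= (`|C| + 1) * `|t - s| `^ gam.
  apply: le_trans hN _; rewrite ler_wpM2r ?powR_ge0//.
  by have := ler_norm C; lra.
apply: (@le_lt_trans _ _ ((`|C| + 1) * `|t - s| `^ gam *
   (Num.sqrt (\int[leb]_(x in D) (v x ^+ 2)) + 1))).
  apply: ler_pM => //; [exact: sqrtr_ge0|by lra].
by rewrite mulrAC -/K -ltr_pdivlMl// mulrC.
Qed.

Lemma ae_continuous0_closed (c : R -> R) : continuous c ->
  {ae leb1, forall t, 0 < t < T -> c t = 0} -> forall t, 0 <= t <= T -> c t = 0.
Proof.
move=> cc c0.
have cI := ae_continuous0 cc c0.
have end0 : c 0 = 0.
  apply: contrapT => /eqP cn; have /cvgrPdist_lt/(_ `|c 0|) := cc 0.
  rewrite normr_gt0 => /(_ cn)/nbhs_ballP[d /= d0 hd].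
  have m0 : 0 < Num.min d T / 2 by rewrite divr_gt0// lt_min d0.
  have [md mT] : Num.min d T <= d /\ Num.min d T <= T by rewrite !ge_min !lexx orbT.
  have : ball 0 d (Num.min d T / 2).
    by rewrite /ball/= sub0r normrN gtr0_norm//; move: md m0; set m := Num.min _ _; lra.
  move/hd; rewrite (cI (_ / 2)) ?subr0 ?ltxx//.
  by move: mT m0; set m := Num.min _ _; move=> ? ?; apply/andP; split; lra.
have endT : c T = 0.
  apply: contrapT => /eqP cn; have /cvgrPdist_lt/(_ `|c T|) := cc T.
  rewrite normr_gt0 => /(_ cn)/nbhs_ballP[d /= d0 hd].
  have m0 : 0 < Num.min d T / 2 by rewrite divr_gt0// lt_min d0.
  have [md mT] : Num.min d T <= d /\ Num.min d T <= T by rewrite !ge_min !lexx orbT.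
  have : ball T d (T - Num.min d T / 2).
    by rewrite /ball/= opprB addrC subrK gtr0_norm//; move: md m0; set m := Num.min _ _; lra.
  move/hd; rewrite (cI (_ - _)) ?subr0 ?ltxx//.
  by move: mT m0; set m := Num.min _ _; move=> ? ?; apply/andP; split; lra.
move=> t /andP[]; rewrite !le_eqVlt => /orP[/eqP<-//|t0] /orP[/eqP->//|tT].
by rewrite cI// t0.
Qed.

Lemma wcont_pair0 F v : wcont F -> sqi leb D v ->
  {ae leb1, forall t, 0 < t < T -> \int[leb]_(x in D) (F t (pos x) * v x) = 0} ->
  forall t, 0 <= t <= T -> \int[leb]_(x in D) (F t (pos x) * v x) = 0.
Proof.
move=> [Fi Fc] vi F0; have [c cc cE] := Fc v vi.
move=> t tT; have c0 : {ae leb1, forall t, 0 < t < T -> c t = 0}.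
  apply: filterS F0 => s h /andP[s0 sT]; rewrite -cE ?(ltW s0) ?(ltW sT)//.
  by apply: h; rewrite s0.
by rewrite cE// (ae_continuous0_closed cc c0).
Qed.

Lemma dt_weak_primitive F Ft : wcont F -> dt_weak leb pos Om T F Ft ->
  {ae leb, forall x, D x -> F 0 (pos x) = 0} ->
  forall t, 0 <= t <= T ->
    {ae leb, forall x, D x -> F t (pos x) = cumul (on_cyl pos Ft) t x}.
Proof.
move=> wF [Fi Fti hF] F0 t tT; have [Fs Fc] := wF.
have mID := measurableX mI mD.
have ci : intg leb D (cumul (on_cyl pos Ft) t).
  by case/andP: tT => _ tT; exact: (cumul_intg mD tT Fti).
have di : intg leb D (fun x => F t (pos x) - cumul (on_cyl pos Ft) t x).
  by apply: (intgB mD) ci; exact: (sqi_intg mD fD (Fs t tT)).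
suff h psi : test_fun Om psi ->
    \int[leb]_(x in D) ((F t (pos x) - cumul (on_cyl pos Ft) t x) * psi (pos x)) = 0.
  have := @flcv _ _ _ _ leb pos (ch_open ch) (ch_gen ch) Om _ oOm di h.
  by apply: filterS => x + Dx => /(_ Dx) /eqP; rewrite subr_eq0 => /eqP.
move=> tpsi; have [C C0 hC] := test_fun_bounded tpsi.
have mpsi : measurable_fun D (fun x => psi (pos x)).
  exact/measurable_funTS/(pos_cont_measurable ch)/C1_continuous/(test_fun_C1 tpsi).
have psii : sqi leb D (fun x => psi (pos x)).
  by apply: (sqi_bounded mD fD mpsi (C := C)); apply: aeW => x _; exact: hC.
have mpsi2 : measurable_fun (I `*` D) (fun p => psi (pos p.2)).
  exact: (measurable_fun_pr2 mD mpsi).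
have Ftpsi : intg lebT (I `*` D) (fun p => on_cyl pos Ft p * psi (pos p.2)).
  by apply: (intg_Mb mID Fti mpsi2 (C := C)) => p _; exact: hC.
have Fpsi : intg lebT (I `*` D) (fun p => on_cyl pos F p * psi (pos p.2)).
  by apply: (intg_Mb mID Fi mpsi2 (C := C)) => p _; exact: hC.
have [c cc cE] := Fc _ psii.
pose g s := \int[leb]_(x in D) (Ft s (pos x) * psi (pos x)).
have gi : intg leb1 I g by have [] := RFubini1 mI mD Ftpsi.
have wp : forall p, test_fun (`]0, T[%classic : set R) p ->
     \int[leb1]_(s in `]0, T[) (c s * 'D_1 p s) =
     - \int[leb1]_(s in `]0, T[) (g s * p s).
  move=> p tp; have [tt dt] := test_fun_tensor tp tpsi.
  have [P P0 hP] := test_fun_bounded tp; have [P' P'0 hP'] := test_derive_bounded (1 : R) tp.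
  have mp : measurable_fun I p.
    apply: measurable_funTS; apply: continuous_measurable_fun.
    exact: (C1_continuous (test_fun_C1 tp)).
  have mp' : measurable_fun I ('D_1 p).
    apply: measurable_funTS; apply: continuous_measurable_fun.
    by have [_ cp' _] := tp; exact: cp'.
  have mp2 : measurable_fun (I `*` D) (fun q : mR * X => p q.1) by exact: (measurable_fun_pr1 mI mp).
  have mp2' : measurable_fun (I `*` D) (fun q : mR * X => 'D_1 p q.1).
    exact: (measurable_fun_pr1 mI mp').
  have i1 : intg lebT (I `*` D) (fun q => (on_cyl pos Ft q * psi (pos q.2)) * p q.1).
    by apply: (intg_Mb mID Ftpsi mp2 (C := P)) => q _; exact: hP.
  have i2 : intg lebT (I `*` D) (fun q => (on_cyl pos F q * psi (pos q.2)) * 'D_1 p q.1).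
    by apply: (intg_Mb mID Fpsi mp2' (C := P')) => q _; exact: hP'.
  have := hF _ tt; rewrite /int_cyl /cyl /dom /on_cyl /=.
  rewrite (@eq_Rint _ _ _ _ _ _ (fun q => (on_cyl pos F q * psi (pos q.2)) * 'D_1 p q.1)); last first.
    by move=> q _; rewrite dt /on_cyl/=; ring.
  rewrite [in X in _ = X -> _](@eq_Rint _ _ _ _ _ _ (fun q => (on_cyl pos Ft q * psi (pos q.2)) * p q.1)); last first.
    by move=> q _; rewrite /on_cyl/=; ring.
  have [s1 _ ->] := RFubini1 mI mD i1; have [s2 _ ->] := RFubini1 mI mD i2.
  have [s3 _ _] := RFubini1 mI mD Ftpsi; have [s4 _ _] := RFubini1 mI mD Fpsi.
  move=> e; have e1 : \int[leb1]_(s in I) (c s * 'D_1 p s) =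
     \int[leb1]_(s in I) \int[leb]_(x in D) (on_cyl pos F (s, x) * psi (pos x) * 'D_1 p s).
    apply: eq_Rint => s /itvooP/andP[s0 sT]; rewrite -cE ?(ltW s0) ?(ltW sT)//.
    rewrite mulrC -(RintZ mD); last by apply: sqiM => //; apply: Fs; rewrite !ltW.
    by apply: eq_Rint => x _; rewrite mulrC.
  rewrite e1 e; congr (- _).
  have [_ i3 _] := RFubini1 mI mD i1.
  have [||] := Rint_ae_eq mI i3 (g := fun s => g s * p s) => //.
    by apply: measurable_funM => //; exact: intg_measurable gi.
  apply: filterS s3 => s hs /hs his /=.
  rewrite /g mulrC -(RintZ mD)//; by apply: eq_Rint => x _; rewrite mulrC.
have := weak_primitive T0 cc gi wp tT.
have <- := cE t tT; have <- : \int[leb]_(x in D) (F 0 (pos x) * psi (pos x)) = c 0.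
  by apply: cE; rewrite lexx ltW.
have -> : \int[leb]_(x in D) (F 0 (pos x) * psi (pos x)) = 0.
  have i0 : intg leb D (fun x => F 0 (pos x) * psi (pos x)).
    by apply: sqiM => //; apply: Fs; rewrite lexx ltW.
  rewrite -[RHS](@Rint0 R _ _ leb D).
  have [||_ ->//] := Rint_ae_eq mD i0 (g := fun=> 0); first exact: measurable_cst.
  by apply: filterS F0 => x + Dx => /(_ Dx) ->; rewrite mul0r.
rewrite add0r => e.
have [i4 e4] := cumul_pair mD tT Fti Ftpsi mpsi.
rewrite (@eq_Rint _ _ _ _ _ _ (fun x => F t (pos x) * psi (pos x) - cumul (on_cyl pos Ft) t x * psi (pos x))).
  by rewrite RintB//; [rewrite e e4 subrr|exact: (sqiM mD (Fs t tT) psii)].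
by move=> x _; rewrite mulrBl.
Qed.

End WeakContinuity.

Section JointMeasurability.
Context {R : realType} {n : nat} {dX : measure_display} {X : measurableType dX}.
Context {pos : X -> 'rV[R]_n}.
Hypothesis mpos : forall O, open O -> measurable (pos @^-1` O).
Notation mR := (measurableTypeR R).

Lemma measurable_pair_cont (f : R * 'rV[R]_n -> R) : continuous f ->
  measurable_fun setT (fun p : mR * X => f (p.1, pos p.2)).
Proof.
move=> cf; apply: (@measurability _ _ _ _ setT _ (@RGenOInfty.G R)).
  exact: RGenOInfty.measurableE.
move=> _ [_ [r ->] <-]; rewrite setTI.
pose I (k : rat * rat * ('rV[rat]_n * 'rV[rat]_n)) : set mR := `](ratr k.1.1 : R), ratr k.1.2[%classic.
pose B (k : rat * rat * ('rV[rat]_n * 'rV[rat]_n)) : set 'rV[R]_n :=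
  box (\row_i ratr (k.2.1 ord0 i)) (\row_i ratr (k.2.2 ord0 i)).
pose Q k : set (mR * X) := match unpickle k with
  | Some q => if `[< forall t x, I q t -> B q x -> r < f (t, x) >]
      then I q `*` (pos @^-1` (B q)) else set0
  | None => set0 end.
have -> : (fun p : mR * X => f (p.1, pos p.2)) @^-1` `]r, +oo[%classic = \bigcup_k Q k.
  apply/seteqP; split => -[t x] /=; last first.
    move=> [k _]; rewrite /Q; case: unpickle => //= q; case: asboolP => // h [It Bx].
    by rewrite in_itv/= andbT; exact: h.
  rewrite in_itv/= andbT => rf.
  have : nbhs (t, pos x) (f @^-1` `]r, +oo[%classic).
    apply: cf; apply: open_nbhs_nbhs; split; first exact: rray_open.
    by rewrite /= in_itv/= rf.
  move=> /nbhs_ballP[e /= e0 he].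
  have [//|q1] := @rat_in_itvoo R (t - e) t; first by rewrite ltrBlDr ltrDl.
  rewrite in_itv/= => /andP[q11 q12].
  have [//|q2] := @rat_in_itvoo R t (t + e); first by rewrite ltrDl.
  rewrite in_itv/= => /andP[q21 q22].
  have [ab [h1 h2]] := @rat_box R n (ball (pos x) e) (pos x) (ball_open _ _) (ballxx _ e0).
  have [k kE] : exists k, unpickle k = Some ((q1, q2), ab).
    by exists (pickle ((q1, q2), ab)); rewrite pickleK.
  exists k; first by [].
  rewrite /Q kE; case: asboolP => [_|]; first by split => //=; rewrite /I/= in_itv/= q12.
  case => s y Is By; have : ball (t, pos x) e (s, y).
    split => /=; last by apply: h2; exact: box_cbox.
    move: Is; rewrite /I/= in_itv/= => /andP[s1 s2].
    by rewrite /ball/= ltr_norml; apply/andP; split; lra.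
  by move/he; rewrite /= in_itv/= andbT.
apply: bigcup_measurable => k _; rewrite /Q; case: unpickle => //= q.
case: asboolP => // _; apply: measurableX; first exact: itvoo_measurable.
by apply: mpos; exact: box_open.
Qed.

End JointMeasurability.

Lemma frobE {R : realType} {m n : nat} (A B : 'M[R]_(m, n)) :
  frob A B = \sum_j \sum_i A i j * B i j.
Proof.
rewrite /frob /mxtrace; apply: eq_bigr => j _; rewrite mxE.
by apply: eq_bigr => i _; rewrite mxE.
Qed.

Lemma frob_row {R : realType} {n : nat} (A B : 'rV[R]_n) :
  frob A B = \sum_j A ord0 j * B ord0 j.
Proof. by rewrite frobE; apply: eq_bigr => j _; rewrite big_ord1. Qed.

Section CumulativeEnergy.
Context {R : realType} {dX : measure_display} {X : measurableType dX}.
Context {leb : {sigma_finite_measure set X -> \bar R}} {D : set X} {T : R}.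
Hypothesis mD : measurable D.
Notation leb1 := (@lebesgue_measure R).
Notation mR := (measurableTypeR R).
Local Notation I := (`]0, T[%classic : set mR).
Local Notation lebT := (leb1 \x leb)%E.
Let mI : measurable I. Proof. exact: itvoo_measurable. Qed.

Lemma cumul_energy (f : mR * X -> R) t : 0 <= t <= T -> intg lebT (I `*` D) f ->
  intg lebT (I `*` D) (fun p => cumul f p.1 p.2 * f p) ->
  intg leb D (fun x => cumul f t x ^+ 2) /\
  \int[lebT]_(p in (`]0, t[%classic : set mR) `*` D) (cumul f p.1 p.2 * f p) =
  2^-1 * \int[leb]_(x in D) (cumul f t x ^+ 2).
Proof.
move=> t0T fi cfi; have /andP[t0 tT] := t0T; have mt := itvoo_measurable 0 t.
have [s _ _] := RFubini2 mI mD fi.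
have [_ i e] := RFubini2 mt mD (intg_cyl_sub mD tT cfi).
have mc := intg_measurable (cumul_intg mD tT fi).
have i2 := intgZ mD 2 i.
have [||i3 e3] := Rint_ae_eq mD i2 (g := fun x => cumul f t x ^+ 2).
- exact: measurable_funX.
- apply: filterS s => x + Dx => /(_ Dx) h.
  rewrite [RHS](cumul_sqr h t0T) -(RintZ mt).
    by apply: eq_Rint => r _; rewrite /cumul/= mulrA.
  exact: (intg_sub (cumul_sqr_intg h) (lexx 0) tT).
split; first by [].
by rewrite e -e3 (RintZ mD 2 i) mulrA mulVf ?mul1r ?pnatr_eq0.
Qed.

End CumulativeEnergy.

(** * The energy estimate *)

Section MassBalance.
Context {R : realType} {n : nat} {dX : measure_display} {X : measurableType dX}.
Context {leb : {sigma_finite_measure set X -> \bar R}} {pos : X -> 'rV[R]_n}.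
Context {tr : 'I_n -> R -> X -> X}.
Hypothesis ch : chart leb pos tr.
Context {Om : set 'rV[R]_n}.
Hypotheses (oOm : open Om) (bOm : bounded_set Om).
Context {T lambda : R}.
Hypothesis T0 : 0 < T.
Local Notation D := (pos @^-1` Om).
Notation leb1 := (@lebesgue_measure R).
Notation mR := (measurableTypeR R).
Local Notation I := (`]0, T[%classic : set mR).
Local Notation lebT := (leb1 \x leb)%E.
Local Notation H1 := (H1 leb pos Om).

Let mI : measurable I. Proof. exact: itvoo_measurable. Qed.
Let mD : measurable D. Proof. exact: (dom_measurable ch oOm). Qed.
Let fD : (leb D < +oo)%E. Proof. exact: (dom_fin ch oOm bOm). Qed.
Let mID := measurableX mI mD.
Let fID : (lebT (I `*` D) < +oo)%E.
Proof.
rewrite product_measure1E//; apply: lte_mul_pinfty => //.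
by rewrite ge0_fin_numE//; exact: itvoo_fin.
Qed.

#[local] Instance leb1_filter3 : Filter (nbhs (almost_everywhere leb1)) :=
  ae_filter_ringOfSetsType leb1.

Context {a : R -> 'rV[R]_n -> R} {G : R -> 'rV[R]_n -> 'rV[R]_n}.
Hypothesis wa : wcont (leb := leb) (pos := pos) (Om := Om) (T := T) a.
Hypothesis a2 : sqi lebT (I `*` D) (on_cyl pos a).
Local Notation Gi i := (on_cyl pos (fun t x => G t x ord0 i)).
Hypothesis G2 : forall i, sqi lebT (I `*` D) (Gi i).
Hypothesis eq1 : forall xi xit Dxi, test_xi leb pos Om T xi xit Dxi ->
  int_cyl leb pos Om T (fun t x =>
    - a t x * xit t x + lambda * frob (G t x) (Dxi t x)) = 0.

Definition pairing t (v : 'rV[R]_n -> R) (Dv : 'rV[R]_n -> 'rV[R]_n) : R :=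
  \int[leb]_(x in D) (a t (pos x) * v (pos x)) +
  lambda * \sum_i \int[leb]_(x in D) (cumul (Gi i) t x * Dv (pos x) ord0 i).

Section Bounded.
Context {v : 'rV[R]_n -> R} {Dv : 'rV[R]_n -> 'rV[R]_n} {C : R}.
Hypothesis hv : H1 v Dv.
Hypothesis vC : forall x, `|v x| <= C.

Let v2 : sqi leb D (fun x => v (pos x)).
Proof. by have [/(L2P ch oOm)] := hv. Qed.

Let Dv2 i : sqi leb D (fun x => Dv (pos x) ord0 i).
Proof. by have [_ /(_ i)/(L2P ch oOm)] := hv. Qed.

Let h t := \sum_i \int[leb]_(x in D) (G t (pos x) ord0 i * Dv (pos x) ord0 i).

Let GDv i : intg lebT (I `*` D) (fun p => Gi i p * Dv (pos p.2) ord0 i).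
Proof.
apply: (sqiM mID (G2 i)).
have o : sqi leb1 I (fun=> 1).
  split; first exact: measurable_cst.
  by apply: intg_continuous => ?; exact: cvg_cst.
by apply: eq_sqi (sqi_tensor mI mD o (Dv2 i)) => p _; rewrite mul1r.
Qed.

Let hi : intg leb1 I h.
Proof. by apply: (intg_sum mI) => i; have [] := RFubini1 mI mD (GDv i). Qed.

Let H t := \int[leb1]_(s in `]0, t[) h s.

Let HE t : 0 <= t <= T ->
  H t = \sum_i \int[leb]_(x in D) (cumul (Gi i) t x * Dv (pos x) ord0 i).
Proof.
move=> tT; have /andP[_ tT'] := tT; rewrite /H (Rint_sum (itvoo_measurable 0 t)).
  apply: eq_bigr => i _.
  by have [_ ->//] := cumul_pair mD tT (sqi_intg mID fID (G2 i)) (GDv i) (Dv2 i).1.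
move=> i; apply: (@intg_sub _ T _ _ 0 t) => //.
by have [] := RFubini1 mI mD (GDv i).
Qed.

Let Bex : exists2 B : R -> R, continuous B & forall t, 0 <= t <= T -> B t = pairing t v Dv.
Proof.
have [c cc cE] := wa.2 _ v2.
exists (fun t => c t + lambda * H (clamp T t)).
  move=> t; apply: cvgD; first exact: cc.
  apply: cvgMl_tmp; apply: (continuous_of_modulus (f := H)); last exact: ltW.
  move=> e e0; have [del d0 hd] := cumul_cont hi e0; by exists del.
by move=> t tT; rewrite clamp_id// HE// /pairing cE.
Qed.

Let dt_xi (B : R -> R) phi : continuous B -> test_fun (`]0, T[%classic `*` Om) phi ->
  let Xi t := \int[leb1]_(s in `]0, t[) B s in
  \int[lebT]_(p in I `*` D) ((Xi T - Xi p.1) * v (pos p.2) *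
     'D_((1, 0) : R * 'rV[R]_n) phi (p.1, pos p.2)) =
  - \int[lebT]_(p in I `*` D) (- B p.1 * v (pos p.2) * phi (p.1, pos p.2)).
Proof.
move=> cB tphi Xi; have [_ [K K0 hK]] := (true, test_fun_bounded tphi).
have [K' K'0 hK'] := test_derive_bounded ((1, 0) : R * 'rV[R]_n) tphi.
have Bi : intg leb1 I B by exact: intg_continuous.
have [dphi cphi' _] := tphi; have cphi := C1_continuous (test_fun_C1 tphi).
have mphi := measurable_pair_cont (ch_open ch) cphi.
have mphi' := measurable_pair_cont (ch_open ch) (cphi' (1, 0)).
have cXi (g : R -> R) : continuous g -> measurable_fun I (fun t => g (Xi t)).
  move=> cg; have := cumul_measurable Bi 0 cg.
  by apply: eq_measurable_fun => t _; rewrite add0r.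
have XiB t : 0 <= t <= T -> `|Xi t| <= \int[leb1]_(s in I) `|B s|.
  move=> /andP[t0 tT]; apply: le_trans (cumul_le Bi (lexx 0) t0 tT) _.
  rewrite (@Rint_split _ T _ (intg_norm Bi) 0 t T)// ?t0//.
  by rewrite lerDl; apply: Rintegral_ge0.
have Ifin := @itvoo_fin R 0 T.
have ltI t : I t -> 0 <= t <= T by move=> /itvooP/andP[/ltW -> /ltW ->].
have chii : intg leb1 I (fun t => Xi T - Xi t).
  apply: (intgB mI); first by apply: intg_continuous => ?; exact: cvg_cst.
  apply: (intg_bounded mI Ifin (cXi idfun (fun=> cvg_id)) (C := \int[leb1]_(s in I) `|B s|)).
  by move=> t /ltI; exact: XiB.
have vi := sqi_intg mD fD v2.
have k1 : intg lebT (I `*` D) (fun p => (Xi T - Xi p.1) * v (pos p.2) *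
     'D_((1, 0) : R * 'rV[R]_n) phi (p.1, pos p.2)).
  apply: (intg_Mb mID (intg_tensor mI mD chii vi) (measurable_funTS mphi') (C := K')).
  by move=> p _; exact: hK'.
have k2 : intg lebT (I `*` D) (fun p => - B p.1 * v (pos p.2) * phi (p.1, pos p.2)).
  have Ni : intg leb1 I (fun t : R => - B t) := intgN Bi.
  apply: (@intg_Mb _ _ _ _ _ mID (fun p => - B p.1 * v (pos p.2)) _ K
    (intg_tensor mI mD Ni vi) (measurable_funTS mphi)).
  by move=> p _; exact: hK.
have [_ _ ->] := RFubini2 mI mD k1; have [_ k3 ->] := RFubini2 mI mD k2.
rewrite -(RintN mD k3); apply: eq_Rint => x Dx /=.
pose f t := 'D_((1, 0) : R * 'rV[R]_n) phi (t, pos x).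
pose F t := phi (t, pos x).
have lineE (t : R) : ((0, pos x) : R * 'rV[R]_n) + t *: ((1, 0) : R * 'rV[R]_n) = (t, pos x).
  by rewrite [LHS]surjective_pairing; congr pair;
    rewrite /= ?scaler0 ?addr0// add0r /GRing.scale/= mulr1.
have ctx : continuous (fun t : R => (t, pos x) : R * 'rV[R]_n).
  have -> : (fun t : R => (t, pos x) : R * 'rV[R]_n) =
      fun t : R => ((0, pos x) : R * 'rV[R]_n) + t *: ((1, 0) : R * 'rV[R]_n).
    by apply/funext => t; rewrite lineE.
  by move=> t; apply: cvgD; [exact: cvg_cst|apply: cvgZr_tmp; exact: cvg_id].
have cf : continuous f.
  move=> t; apply: (@continuous_comp _ _ _ (fun t : R => (t, pos x) : R * 'rV[R]_n)
    ('D_((1, 0) : R * 'rV[R]_n) phi)); [exact: ctx|exact: cphi'].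
have cF : continuous F.
  move=> t; apply: (@continuous_comp _ _ _ (fun t : R => (t, pos x) : R * 'rV[R]_n) phi);
    [exact: ctx|exact: cphi].
have dF (t : R) : is_derive t (1 : R) F (f t).
  have -> : F = fun s : R => phi (((0, pos x) : R * 'rV[R]_n) + s *: ((1, 0) : R * 'rV[R]_n)).
    by apply/funext => s; rewrite lineE.
  have -> : f t = 'D_((1, 0) : R * 'rV[R]_n) phi
      (((0, pos x) : R * 'rV[R]_n) + t *: ((1, 0) : R * 'rV[R]_n)) by rewrite lineE.
  exact: is_derive_line.
have FT : F T = 0 by apply: (test_fun_out tphi) => -[/itvooP]; rewrite ltxx andbF.
have F0 : F 0 = 0 by apply: (test_fun_out tphi) => -[/itvooP]; rewrite ltxx.
have fi : intg leb1 I f by exact: intg_continuous.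
have If t : 0 <= t -> \int[leb1]_(s in `]0, t[) f s = F t.
  by move=> t0; rewrite (FTC_C1 dF cf t0) F0 subr0.
have tT : 0 <= T <= T by rewrite lexx ltW.
have := cumul_mul Bi fi tT; rewrite (If T (ltW T0)) FT mulr0.
have iXf := cumul_mul_intg Bi fi; have ifB := cumul_mul_intg fi Bi.
set A := \int[leb1]_(s in _) _; set A' := \int[leb1]_(s in _) _ => AA'.
have eA : \int[leb1]_(t in I) ((Xi T - Xi t) * v (pos x) * f t) = v (pos x) * - A.
  transitivity (\int[leb1]_(t in I) (v (pos x) * (Xi T * f t - Xi t * f t))).
    by apply: eq_Rint => t _; ring.
  rewrite (RintZ mI); last by apply: (intgB mI) => //; exact: (intgZ mI).
  rewrite (RintB mI (intgZ mI _ fi) iXf) (RintZ mI _ fi) (If T (ltW T0)) FT mulr0 sub0r.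
  by [].
have qi : intg leb1 I (fun t : R => - B t * v (pos x) * phi (t, pos x)).
  have := intgN (intgZ mI (v (pos x)) ifB).
  by apply: eq_intg => t /ltI/andP[t0 _]; rewrite If// /F; ring.
have eA' : - (\int[leb1]_(t in I) (- B t * v (pos x) * phi (t, pos x))) = v (pos x) * A'.
  rewrite -(RintN mI qi) -(RintZ mI _ ifB).
  by apply: eq_Rint => t /ltI/andP[t0 _]; rewrite If// /F; ring.
rewrite [LHS]eA [RHS]eA'.
by have -> : A' = - A by move: AA'; lra.
Qed.

(* Tested with [xi(t, x) = v x * int_t^T B], where [B] is the pairing itself,
   the first equation gives [int_0^T B^2 = 0]. *)
Lemma mass_balance_bounded t : 0 <= t <= T -> pairing t v Dv = 0.
Proof.
have [B cB BE] := Bex; move=> tT; rewrite -BE//; move: t tT.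
apply: (ae_continuous0_closed T0 cB).
pose Xi t := \int[leb1]_(s in `]0, t[) B s.
have Bi : intg leb1 I B by exact: intg_continuous.
pose chi t := Xi T - Xi t.
have chiT : chi T = 0 by rewrite /chi subrr.
have chi_cont e : 0 < e -> exists2 del, 0 < del & forall s t, 0 <= s <= T ->
    0 <= t <= T -> `|t - s| < del -> `|chi t - chi s| < e.
  move=> e0; have [del d0 hd] := cumul_cont Bi e0; exists del => // s t sT tT st.
  have := hd s t sT tT st; rewrite distrC; congr (`|_| < _); rewrite /chi /Xi; ring.
have mchi : measurable_fun I chi.
  have : measurable_fun I (fun t => Xi T - (0 + Xi t)).
    apply: (@cumul_measurable _ T B Bi (fun r => Xi T - r) 0) => r.
    by apply: cvgB; [exact: cvg_cst|exact: cvg_id].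
  by apply: eq_measurable_fun => t _; rewrite add0r.
have chiB t : 0 <= t <= T -> `|chi t| <= \int[leb1]_(s in I) `|B s|.
  move=> /andP[t0 tT]; apply: le_trans (cumul_dist Bi t0 tT (lexx T)) _.
  rewrite (@Rint_split _ T _ (intg_norm Bi) 0 t T)// ?t0//.
  by rewrite lerDr; apply: Rintegral_ge0.
have Ifin := @itvoo_fin R 0 T.
have ltI t : I t -> 0 <= t <= T by move=> /itvooP/andP[/ltW -> /ltW ->].
have chi2 : sqi leb1 I chi.
  by apply: (sqi_bounded mI Ifin mchi); apply: aeW => t /ltI; exact: chiB.
have B2 : sqi leb1 I B.
  split; first by apply: measurable_funTS; exact: continuous_measurable_fun.
  apply: intg_continuous => t; under eq_fun do rewrite expr2.
  by apply: cvgM; exact: cB.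
pose xi t x := chi t * v x.
pose xit t x := - B t * v x.
pose Dxi t x := chi t *: Dv x.
have xi2 : sqi lebT (I `*` D) (on_cyl pos xi) by exact: (sqi_tensor mI mD chi2 v2).
have xit2 : sqi lebT (I `*` D) (on_cyl pos xit).
  apply: (@eq_sqi _ _ _ lebT (I `*` D) _ _ _ (sqi_tensor mI mD (sqiZ mI (-1) B2) v2)) => p _.
  by rewrite /on_cyl /xit mulN1r.
have Dxi2 i : sqi lebT (I `*` D) (on_cyl pos (fun t x => Dxi t x ord0 i)).
  apply: eq_sqi (sqi_tensor mI mD chi2 (Dv2 i)) => p _.
  by rewrite /on_cyl /Dxi mxE.
have txi : test_xi leb pos Om T xi xit Dxi.
  split.
  - split; first exact/(L2TP ch oOm).
      by move=> i; apply/(L2TP ch oOm).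
    by apply: aeW => t _; exact: (H1Z ch oOm bOm).
  - exists ((\int[leb1]_(s in I) `|B s|) * C); apply: aeW => -[t x] [/= It Dx].
    by rewrite normrM ler_pM//; exact/chiB/ltI.
  - split; [exact: (sqi_intg mID fID xi2)|exact: (sqi_intg mID fID xit2)|].
    move=> phi tphi; rewrite /int_cyl /cyl /dom /on_cyl /=.
    exact: dt_xi.
  - exact/(L2TP ch oOm).
  - split; last by apply: aeW => x _; rewrite /xi chiT mul0r.
    split=> [t tT|t tT e e0]; first by apply/(L2P ch oOm); exact: (sqiZ mD).
    pose N := \int[leb]_(x in D) (v (pos x) ^+ 2).
    have sN : 0 <= Num.sqrt N by exact: sqrtr_ge0.
    have N1 : 0 < Num.sqrt N + 1 by rewrite ltr_wpDl.
    have [del d0 hd] := chi_cont _ (divr_gt0 e0 N1).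
    exists del => // s sT st; rewrite /normL2 /int_dom /dom.
    rewrite (@eq_Rint _ _ _ _ _ _ (fun x => (chi s - chi t) ^+ 2 * v (pos x) ^+ 2)); last first.
      by move=> x _; rewrite /xi; ring.
    rewrite (RintZ mD _ v2.2) sqrtrM ?sqr_ge0// sqrtr_sqr -/N.
    apply: (@le_lt_trans _ _ (`|chi s - chi t| * (Num.sqrt N + 1))).
      by rewrite ler_wpM2l// lerDl.
    by rewrite -ltr_pdivlMr//; apply: hd.
have := eq1 txi; rewrite /int_cyl /cyl /dom /on_cyl /=.
pose c t := \int[leb]_(x in D) (a t (pos x) * v (pos x)).
have j1 : intg lebT (I `*` D) (fun p => on_cyl pos a p * on_cyl pos xit p).
  exact: (sqiM mID a2 xit2).
have j2 i : intg lebT (I `*` D) (fun p => Gi i p * on_cyl pos (fun t x => Dxi t x ord0 i) p).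
  exact: (sqiM mID (G2 i) (Dxi2 i)).
have js := intg_sum mID (index_enum 'I_n) j2.
rewrite (@eq_Rint _ _ _ _ _ _ (fun p => (-1) * (on_cyl pos a p * on_cyl pos xit p) +
    lambda * \sum_i (Gi i p * on_cyl pos (fun t x => Dxi t x ord0 i) p))); last first.
  by move=> p _; rewrite /on_cyl/= frob_row mulN1r mulNr.
rewrite (RintD mID (intgZ mID _ j1) (intgZ mID _ js)) (RintZ mID _ j1) (RintZ mID _ js).
rewrite (Rint_sum mID _ j2).
pose h' i t := \int[leb]_(x in D) (G t (pos x) ord0 i * Dv (pos x) ord0 i).
have h'i i : intg leb1 I (h' i) by have [] := RFubini1 mI mD (GDv i).
have e1 : \int[lebT]_(p in I `*` D) (on_cyl pos a p * on_cyl pos xit p) =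
    \int[leb1]_(t in I) (- (B t * c t)) /\ intg leb1 I (fun t => - (B t * c t)).
  have [_ k1 ->] := RFubini1 mI mD j1.
  have E t : I t -> \int[leb]_(x in D) (on_cyl pos a (t, x) * on_cyl pos xit (t, x)) = - (B t * c t).
    move=> It; rewrite /on_cyl /xit /c -mulNr -(RintZ mD).
      by apply: eq_Rint => x _ /=; ring.
    by apply: (sqiM mD) v2; exact/wa.1/ltI.
  by split; [exact: eq_Rint|exact: (eq_intg E k1)].
have e2 i : \int[lebT]_(p in I `*` D) (Gi i p * on_cyl pos (fun t x => Dxi t x ord0 i) p) =
    \int[leb1]_(t in I) (chi t * h' i t) /\ intg leb1 I (fun t => chi t * h' i t).
  have [_ k1 ->] := RFubini1 mI mD (j2 i); have [s3 _ _] := RFubini1 mI mD (GDv i).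
  have mh : measurable_fun I (fun t => chi t * h' i t).
    by apply: measurable_funM => //; exact: intg_measurable (h'i i).
  have [|? ->//] := Rint_ae_eq mI k1 mh.
  apply: filterS s3 => t ht It; rewrite /h' -(RintZ mD _ (ht It)).
  by apply: eq_Rint => x _; rewrite /on_cyl /Dxi mxE/=; ring.
rewrite e1.1 (eq_bigr _ (fun i _ => (e2 i).1)) -(Rint_sum mI _ (fun i => (e2 i).2)).
rewrite [X in _ + lambda * X](_ : _ = \int[leb1]_(t in I) (chi t * h t)); last first.
  by apply: eq_Rint => t _; rewrite mulr_sumr.
have chihi : intg leb1 I (fun t => chi t * h t).
  apply: (eq_intg _ (intg_sum mI (index_enum 'I_n) (fun i => (e2 i).2))) => t _.
  by rewrite mulr_sumr.
have tT : 0 <= T <= T by rewrite lexx ltW.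
have Xh := cumul_mul_intg Bi hi; have HB := cumul_mul_intg hi Bi.
have eh : \int[leb1]_(t in I) (chi t * h t) = \int[leb1]_(t in I) (H t * B t).
  transitivity (Xi T * H T - \int[leb1]_(t in I) (Xi t * h t)).
    rewrite /H -(RintZ mI _ hi) -RintB//; last exact: (intgZ mI).
    by apply: eq_Rint => t _; rewrite mulrBl.
  by rewrite /Xi /H (cumul_mul Bi hi tT) addrC addKr.
rewrite eh (RintN mI) ?mulN1r ?opprK; last first.
  by apply: eq_intg (intgN e1.2) => t _; rewrite opprK.
have Bci : intg leb1 I (fun t => B t * c t).
  by apply: eq_intg (intgN e1.2) => t _; rewrite opprK.
rewrite -(RintZ mI _ HB) -(RintD mI Bci (intgZ mI _ HB)).
rewrite [X in X = 0 -> _](_ : _ = \int[leb1]_(t in I) (B t ^+ 2)) => [E|]; last first.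
  apply: eq_Rint => t It; have bt := BE t (ltI t It).
  rewrite /pairing -/(c t) -(HE (ltI t It)) in bt.
  by rewrite expr2 [X in _ = _ * X]bt /H; ring.
have nn : {ae leb1, forall t, I t -> 0 <= B t ^+ 2} by apply: aeW => t _; exact: sqr_ge0.
have := Rint_ge0_eq0 mI B2.2 nn; rewrite E => /(_ (lexx _)).
apply: filterS => t h0 tI; apply/eqP; rewrite -sqrf_eq0; apply/eqP/h0.
exact/itvooP.
Qed.

End Bounded.

Lemma mass_balance v Dv : H1 v Dv -> forall t, 0 <= t <= T -> pairing t v Dv = 0.
Proof.
move=> hv t tT; have [/(L2P ch oOm) v2 Dv2' _] := hv.
have Dv2 i : sqi leb D (fun x => Dv (pos x) ord0 i) by move: (Dv2' i) => /(L2P ch oOm).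
have p0 k : pairing t (fun x => trunc k.+1%:R (v x))
    (fun x => dtrunc k.+1%:R (v x) *: Dv x) = 0.
  apply: (mass_balance_bounded (C := k.+1%:R)) => //.
    by apply: (H1_trunc ch oOm bOm) hv.
  by move=> x; exact: trunc_bounded.
have mt (g : R -> R) : continuous g -> measurable_fun D (fun x => g (v (pos x))).
  by move=> cg; apply: measurableT_comp v2.1; exact: continuous_measurable_fun.
have a2t := wa.1 _ tT.
have c2 i := cumul_sqi mD fD tT (G2 i).
have l1 : \int[leb]_(x in D) (a t (pos x) * trunc k.+1%:R (v (pos x))) @[k --> \oo] -->
    \int[leb]_(x in D) (a t (pos x) * v (pos x)).
  apply: (Rint_dom mD _ _ (intg_norm (sqiM mD a2t v2)) _).2.
  - move=> k; apply: measurable_funM; first exact: a2t.1.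
    exact: (mt _ (@trunc_continuous _ _)).
  - by move=> x _; apply: cvgMl_tmp; exact: trunc_cvg.
  - by move=> k x _; rewrite normrM [leRHS]normrM ler_wpM2l//; exact: trunc_le.
have l2 i : \int[leb]_(x in D) (cumul (Gi i) t x * (dtrunc k.+1%:R (v (pos x)) *: Dv (pos x)) ord0 i)
    @[k --> \oo] --> \int[leb]_(x in D) (cumul (Gi i) t x * Dv (pos x) ord0 i).
  apply: (Rint_dom mD _ _ (intg_norm (sqiM mD (c2 i) (Dv2 i))) _).2.
  - move=> k; apply: measurable_funM; first exact: (c2 i).1.
    under eq_fun do rewrite mxE; apply: measurable_funM; last exact: (Dv2 i).1.
    exact: (mt _ (@dtrunc_continuous _ _)).
  - move=> x _; apply: cvgMl_tmp; under eq_fun do rewrite mxE.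
    have := cvgMr_tmp (b := Dv (pos x) ord0 i) (dtrunc_cvg (v (pos x))).
    by rewrite mul1r; apply; exact: _.
  - move=> k x _; rewrite mxE normrM [leRHS]normrM ler_wpM2l// normrM ler_piMl//.
    exact: dtrunc_le.
have : pairing t (fun x => trunc k.+1%:R (v x)) (fun x => dtrunc k.+1%:R (v x) *: Dv x)
   @[k --> \oo] --> pairing t v Dv.
  apply: cvgD; first exact: l1.
  by apply: cvgMl_tmp; apply: cvg_big => [|i _]; [exact: add_continuous|exact: l2].
under eq_fun do rewrite p0.
by move=> h; rewrite -(cvg_lim (@Rhausdorff R) h) lim_cst.
Qed.

End MassBalance.

Section EnergyEstimate.
Context {R : realType} {n : nat} {dX : measure_display} {X : measurableType dX}.
Context {leb : {sigma_finite_measure set X -> \bar R}} {pos : X -> 'rV[R]_n}.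
Context {tr : 'I_n -> R -> X -> X}.
Hypothesis ch : chart leb pos tr.
Context {Om : set 'rV[R]_n}.
Hypotheses (oOm : open Om) (bOm : bounded_set Om).
Context {T lambda kappa1 kappa2 : R}.
Hypotheses (T0 : 0 < T) (lam0 : 0 < lambda) (k10 : 0 <= kappa1) (k20 : 0 <= kappa2).
Local Notation D := (pos @^-1` Om).
Notation leb1 := (@lebesgue_measure R).
Notation mR := (measurableTypeR R).
Local Notation I := (`]0, T[%classic : set mR).
Local Notation It t := (`]0, t[%classic : set mR).
Local Notation lebT := (leb1 \x leb)%E.
Local Notation H1 := (H1 leb pos Om).

Let mI : measurable I. Proof. exact: itvoo_measurable. Qed.
Let mIt t : measurable (It t). Proof. exact: itvoo_measurable. Qed.
Let mD : measurable D. Proof. exact: (dom_measurable ch oOm). Qed.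
Let fD : (leb D < +oo)%E. Proof. exact: (dom_fin ch oOm bOm). Qed.
Let mID := measurableX mI mD.
Let mItD t := measurableX (mIt t) mD.

#[local] Instance leb1_filter4 : Filter (nbhs (almost_everywhere leb1)) :=
  ae_filter_ringOfSetsType leb1.

Lemma cyl_fin : (lebT (I `*` D) < +oo)%E.
Proof.
rewrite product_measure1E//; apply: lte_mul_pinfty => //.
by rewrite ge0_fin_numE//; exact: itvoo_fin.
Qed.
Let fID := cyl_fin.

Let ltI t : I t -> 0 <= t <= T.
Proof. by move=> /itvooP/andP[/ltW -> /ltW ->]. Qed.

Lemma sqi_zero (f : X -> R) : sqi leb D f -> \int[leb]_(x in D) (f x ^+ 2) <= 0 ->
  {ae leb, forall x, D x -> f x = 0}.
Proof.
move=> [mf fi] h; have nn : {ae leb, forall x, D x -> 0 <= f x ^+ 2}.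
  by apply: aeW => x _; exact: sqr_ge0.
apply: filterS (Rint_ge0_eq0 mD fi nn h) => x + Dx => /(_ Dx)/eqP.
by rewrite sqrf_eq0 => /eqP.
Qed.

Lemma Rint_cyl_sub (f : mR * X -> R) t : t <= T -> intg lebT (I `*` D) f ->
  \int[lebT]_(p in It t `*` D) f p = \int[leb1]_(s in It t) \int[leb]_(x in D) f (s, x).
Proof.
by move=> tT fi; have [_ _] := RFubini1 (mIt t) mD (intg_cyl_sub mD tT fi).
Qed.

Lemma It_sub t : t <= T -> It t `<=` I.
Proof. by move=> tT s /itvooP/andP[s0 st]; apply/itvooP; rewrite s0 (lt_le_trans st). Qed.

Context {a b M bt : R -> 'rV[R]_n -> R} {Da G : R -> 'rV[R]_n -> 'rV[R]_n}.
Context {E : mR * X -> R}.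
Hypotheses (wa : wcont (leb := leb) (pos := pos) (Om := Om) (T := T) a)
           (wb : wcont (leb := leb) (pos := pos) (Om := Om) (T := T) b).
Hypotheses (a2 : sqi lebT (I `*` D) (on_cyl pos a))
           (b2 : sqi lebT (I `*` D) (on_cyl pos b))
           (M2 : sqi lebT (I `*` D) (on_cyl pos M)).
Local Notation Gi i := (on_cyl pos (fun t x => G t x ord0 i)).
Local Notation Ai i := (on_cyl pos (fun t x => Da t x ord0 i)).
Hypothesis G2 : forall i, sqi lebT (I `*` D) (Gi i).
Hypothesis A2 : forall i, sqi lebT (I `*` D) (Ai i).
Hypothesis hM : ae_time T (fun t => H1 (M t) (G t)).
Hypothesis ha : ae_time T (fun t => H1 (a t) (Da t)).
Hypothesis eq1 : forall xi xit Dxi, test_xi leb pos Om T xi xit Dxi ->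
  int_cyl leb pos Om T (fun t x =>
    - a t x * xit t x + lambda * frob (G t x) (Dxi t x)) = 0.
Hypothesis b0 : {ae leb, forall x, D x -> b 0 (pos x) = 0}.
Hypothesis bC : {ae lebT, forall p, (I `*` D) p -> `|on_cyl pos b p| <= 1}.
Hypothesis hbt : dt_weak leb pos Om T b bt.
Hypothesis Ei : intg lebT (I `*` D) E.
Hypothesis E0 : {ae lebT, forall p, (I `*` D) p -> 0 <= E p}.
Hypothesis ineq : forall t, 0 < t <= T ->
  \int[lebT]_(p in It t `*` D) (on_cyl pos bt p * on_cyl pos b p + E p +
    lambda * (\sum_i Ai i p ^+ 2) - 2 * kappa1 * on_cyl pos a p ^+ 2
    - 2 * kappa2 * on_cyl pos b p ^+ 2) <=
  \int[lebT]_(p in It t `*` D) (on_cyl pos M p * on_cyl pos a p).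

Let C i := cumul (Gi i).

Let C2 i t : 0 <= t <= T -> sqi leb D (C i t).
Proof. by move=> h; exact: (cumul_sqi mD fD h (G2 i)). Qed.

Let CC2 i : sqi lebT (I `*` D) (fun p => C i p.1 p.2).
Proof. exact: cumul_sqi2. Qed.

Let bti : intg lebT (I `*` D) (on_cyl pos bt). Proof. by case: hbt. Qed.

Let bE t : 0 <= t <= T ->
  {ae leb, forall x, D x -> b t (pos x) = cumul (on_cyl pos bt) t x}.
Proof. by move=> tT; exact: (dt_weak_primitive ch oOm bOm T0 wb hbt b0 tT). Qed.

Let btbi : intg lebT (I `*` D) (fun p => on_cyl pos bt p * on_cyl pos b p).
Proof.
apply: (ae_intg mID (intg_norm bti)).
  by apply: measurable_funM; [exact: intg_measurable bti|exact: b2.1].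
apply: filterS bC => p h Dp; rewrite normrM -[leRHS]mulr1.
by rewrite ler_wpM2l//; exact: h.
Qed.

Let bJ : {ae lebT, forall p, (I `*` D) p ->
  on_cyl pos b p = cumul (on_cyl pos bt) p.1 p.2}.
Proof.
have mc := cumul_measurable2 mD (intg_measurable bti).
have mA : measurable_fun (I `*` D) (fun p => on_cyl pos b p - cumul (on_cyl pos bt) p.1 p.2).
  by apply: measurable_funB => //; exact: b2.1.
have h : {ae leb1, forall t, I t -> {ae leb, forall x, D x ->
    on_cyl pos b (t, x) - cumul (on_cyl pos bt) (t, x).1 (t, x).2 = 0}}.
  apply: aeW => t /ltI /bE; apply: filterS => x + Dx => /(_ Dx) h.
  by rewrite /on_cyl/= h subrr.
apply: filterS (slices_ae mI mD mA h) => p + Dp => /(_ Dp) /eqP.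
by rewrite subr_eq0 => /eqP.
Qed.

Let cumul_bti : intg lebT (I `*` D)
  (fun p => cumul (on_cyl pos bt) p.1 p.2 * on_cyl pos bt p).
Proof.
have mc := cumul_measurable2 mD (intg_measurable bti).
apply: (Rint_ae_eq mID btbi _ _).1.
  by apply: measurable_funM => //; exact: intg_measurable bti.
by apply: filterS bJ => p + Dp => /(_ Dp) <-; rewrite mulrC.
Qed.

Let energy_b t : 0 <= t <= T ->
  \int[lebT]_(p in It t `*` D) (on_cyl pos bt p * on_cyl pos b p) =
  2^-1 * \int[leb]_(x in D) (b t (pos x) ^+ 2).
Proof.
move=> tT; have /andP[_ tT'] := tT.
have [ci e] := cumul_energy mD tT bti cumul_bti.
have [|_ <-] := Rint_ae_eq mD ci (measurable_funX 2 (wb.1 t tT).1).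
  by apply: filterS (bE tT) => x + Dx => /(_ Dx) ->.
rewrite -e; apply: (Rint_ae_eq (mItD t) (intg_cyl_sub mD tT' btbi) _ _).2.
  exact: intg_measurable (intg_cyl_sub mD tT' cumul_bti).
apply: filterS bJ => p h [tp Dp]; rewrite h; first by rewrite mulrC.
by split => //; exact: (It_sub tT').
Qed.

Let pair_int (v : R -> 'rV[R]_n -> R) (Dv : R -> 'rV[R]_n -> 'rV[R]_n) t :
  sqi lebT (I `*` D) (on_cyl pos v) ->
  (forall i, sqi lebT (I `*` D) (on_cyl pos (fun t x => Dv t x ord0 i))) ->
  ae_time T (fun t => H1 (v t) (Dv t)) -> 0 <= t <= T ->
  \int[lebT]_(p in It t `*` D) (on_cyl pos v p * on_cyl pos a p) =
  - lambda * \sum_i \int[lebT]_(p in It t `*` D)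
      (C i p.1 p.2 * on_cyl pos (fun t x => Dv t x ord0 i) p).
Proof.
move=> v2 Dv2 hv /andP[t0 tT].
have vi := sqiM mID v2 a2; have Ci i := sqiM mID (CC2 i) (Dv2 i).
pose g i s := \int[leb]_(x in D) (C i s x * Dv s (pos x) ord0 i).
have gi i : intg leb1 (It t) (g i).
  by have [] := RFubini1 (mIt t) mD (intg_cyl_sub mD tT (Ci i)).
rewrite (Rint_cyl_sub tT vi).
rewrite (eq_bigr (fun i => \int[leb1]_(s in It t) g i s)); last first.
  by move=> i _; rewrite (Rint_cyl_sub tT (Ci i)).
rewrite -(Rint_sum (mIt t) _ gi) -(RintZ (mIt t)); last exact: (intg_sum (mIt t)).
have [_ i1 _] := RFubini1 (mIt t) mD (intg_cyl_sub mD tT vi).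
apply: (Rint_ae_eq (mIt t) i1 _ _).2.
  apply: intg_measurable; apply: (intgZ (mIt t)); exact: (intg_sum (mIt t)).
move: hv; rewrite /ae_time; apply: filterS => s hs st; have /itvooP/andP[s0 sT] := It_sub tT st.
have := mass_balance ch oOm bOm T0 wa a2 G2 eq1 (hs _) (ltI (It_sub tT st)).
rewrite s0 sT => /(_ isT) /eqP; rewrite /pairing addr_eq0 -mulNr => /eqP <-.
by apply: eq_Rint => x _; rewrite mulrC.
Qed.

Let Y t := 2^-1 * \int[leb]_(x in D) (b t (pos x) ^+ 2) +
  lambda / 2 * \sum_i \int[leb]_(x in D) (C i t x ^+ 2).

Let Y0 t : 0 <= Y t.
Proof.
rewrite addr_ge0// mulr_ge0 ?invr_ge0 ?(ltW lam0)//.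
- by apply: Rintegral_ge0 => x _; exact: sqr_ge0.
- by rewrite divr_ge0// ltW.
- by apply: sumr_ge0 => i _; apply: Rintegral_ge0 => x _; exact: sqr_ge0.
Qed.

Let sub (f : mR * X -> R) t : t <= T -> intg lebT (I `*` D) f ->
  intg lebT (It t `*` D) f.
Proof. exact: intg_cyl_sub. Qed.

Let sumC2i : intg lebT (I `*` D) (fun p => \sum_i C i p.1 p.2 ^+ 2).
Proof. by apply: (intg_sum mID) => i; have [] := CC2 i. Qed.

Let sumA2i : intg lebT (I `*` D) (fun p => \sum_i Ai i p ^+ 2).
Proof. by apply: (intg_sum mID) => i; have [] := A2 i. Qed.

Let estimate t : 0 < t <= T ->
  Y t + \int[lebT]_(p in It t `*` D) E p <=
  2 * kappa1 ^+ 2 * lambda * (\int[lebT]_(p in It t `*` D) \sum_i C i p.1 p.2 ^+ 2) +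
  2 * kappa2 * \int[lebT]_(p in It t `*` D) (on_cyl pos b p ^+ 2).
Proof.
move=> t0T; have /andP[t0 tT] := t0T; have tT0 : 0 <= t <= T by rewrite ltW.
have mm := mItD t; have i1 := sub tT btbi; have i2 := sub tT Ei.
have i3 := sub tT sumA2i; have i4 := sub tT a2.2; have i5 := sub tT b2.2.
have i6 := sub tT sumC2i.
have CA i := sqiM mID (CC2 i) (A2 i); have CG i := sqiM mID (CC2 i) (G2 i).
have i7 := sub tT (intg_sum mID (index_enum 'I_n) CA).
have := ineq t0T; rewrite (pair_int M2 G2 hM tT0).
have -> : \sum_i \int[lebT]_(p in It t `*` D) (C i p.1 p.2 * Gi i p) =
    2^-1 * \sum_i \int[leb]_(x in D) (C i t x ^+ 2).
  rewrite mulr_sumr; apply: eq_bigr => i _.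
  by have [_ ->] := cumul_energy mD tT0 (sqi_intg mID fID (G2 i)) (CG i).
have ea := pair_int a2 A2 ha tT0.
rewrite -(Rint_sum mm _ (fun i => sub tT (CA i))) in ea.
have j3 := intgZ mm lambda i3; have j4 := intgZ mm (2 * kappa1) i4.
have j5 := intgZ mm (2 * kappa2) i5.
have k1 := intgD mm i1 i2; have k2 := intgD mm k1 j3; have k3 := intgB mm k2 j4.
rewrite (RintB mm k3 j5) (RintB mm k2 j4) (RintD mm k1 j3) (RintD mm i1 i2).
rewrite (RintZ mm _ i3) (RintZ mm _ i4) (RintZ mm _ i5) (energy_b tT0) /Y.
have : 0 <= \int[lebT]_(p in It t `*` D) (lambda / 2 * (\sum_i Ai i p ^+ 2) +
   (2 * kappa1 * lambda * (\sum_i C i p.1 p.2 * Ai i p) +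
    2 * kappa1 ^+ 2 * lambda * \sum_i C i p.1 p.2 ^+ 2)).
  apply: Rintegral_ge0 => p _; rewrite !mulr_sumr -!big_split/=.
  apply: sumr_ge0 => i _; set u := Ai i p; set v := C i p.1 p.2.
  rewrite (_ : _ + _ = lambda / 2 * (u + 2 * kappa1 * v) ^+ 2); last by field.
  by rewrite mulr_ge0 ?sqr_ge0// divr_ge0// ltW.
rewrite RintD//; [|exact: (intgZ mm)|by apply: (intgD mm); exact: (intgZ mm)].
rewrite RintD//; [|exact: (intgZ mm)|exact: (intgZ mm)].
rewrite (RintZ mm _ i3) (RintZ mm _ i7) (RintZ mm _ i6).
have -> : \int[lebT]_(p in It t `*` D) on_cyl pos a p ^+ 2 =
  \int[lebT]_(p in It t `*` D) (on_cyl pos a p * on_cyl pos a p) by [].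
rewrite ea.
have A0 : 0 <= \int[lebT]_(p in It t `*` D) \sum_i Ai i p ^+ 2.
  by apply: Rintegral_ge0 => p _; apply: sumr_ge0 => i _; exact: sqr_ge0.
move: A0; set iA := Rintegral _ _ _; set iCA := Rintegral _ _ _.
set iCC := Rintegral _ _ _; set iB := Rintegral _ _ _; set iE := Rintegral _ _ _.
set ib := Rintegral _ _ _; set sC := \sum_i _.
move=> A0 h1 h2; have : 0 <= lambda * iA by rewrite mulr_ge0// ltW.
by move=> h3; lra.
Qed.

Let Ki : 0 <= 4 * kappa1 ^+ 2 + 4 * kappa2.
Proof. by rewrite addr_ge0 ?mulr_ge0 ?sqr_ge0. Qed.

Let Yi : intg leb1 I Y.
Proof.
apply: (intgD mI); apply: (intgZ mI).
  by have [] := RFubini1 mI mD b2.2.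
by apply: (intg_sum mI) => i; have [] := RFubini1 mI mD (CC2 i).2.
Qed.

Let Y_bound t : 0 < t <= T ->
  Y t + \int[lebT]_(p in It t `*` D) E p <=
  (4 * kappa1 ^+ 2 + 4 * kappa2) * \int[leb1]_(s in It t) Y s.
Proof.
move=> t0T; have /andP[t0 tT] := t0T.
apply: le_trans (estimate t0T) _.
rewrite (Rint_cyl_sub tT b2.2) (Rint_sum (mItD t) _ (fun i => sub tT (CC2 i).2)).
rewrite (eq_bigr (fun i => \int[leb1]_(s in It t) \int[leb]_(x in D) (C i s x ^+ 2))); last first.
  by move=> i _; rewrite (Rint_cyl_sub tT (CC2 i).2).
have bi : intg leb1 (It t) (fun s => \int[leb]_(x in D) (b s (pos x) ^+ 2)).
  by have [] := RFubini1 (mIt t) mD (sub tT b2.2).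
have ci i : intg leb1 (It t) (fun s => \int[leb]_(x in D) (C i s x ^+ 2)).
  by have [] := RFubini1 (mIt t) mD (sub tT (CC2 i).2).
have sci := intg_sum (mIt t) (index_enum 'I_n) ci.
rewrite (RintD (mIt t) (intgZ (mIt t) _ bi) (intgZ (mIt t) _ sci)).
rewrite (RintZ (mIt t) _ bi) (RintZ (mIt t) _ sci) (Rint_sum (mIt t) _ ci).
have B0 : 0 <= \int[leb1]_(s in It t) \int[leb]_(x in D) (b s (pos x) ^+ 2).
  by apply: Rintegral_ge0 => s _; apply: Rintegral_ge0 => x _; exact: sqr_ge0.
have S0 : 0 <= \sum_i \int[leb1]_(s in It t) \int[leb]_(x in D) (C i s x ^+ 2).
  apply: sumr_ge0 => i _.
  by apply: Rintegral_ge0 => s _; apply: Rintegral_ge0 => x _; exact: sqr_ge0.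
move: B0 S0; rewrite /on_cyl/=; set u := Rintegral _ _ _; set v := \sum_i _ => u0 v0.
rewrite -subr_ge0.
rewrite (_ : _ - _ = 2 * kappa1 ^+ 2 * u + 2 * kappa2 * lambda * v); last by field.
by rewrite addr_ge0// !mulr_ge0 ?sqr_ge0// ltW.
Qed.

Let intE0 t : 0 <= t <= T -> 0 <= \int[lebT]_(p in It t `*` D) E p.
Proof.
move=> /andP[_ tT]; rewrite -[leLHS](@Rint0 R _ _ lebT (It t `*` D)).
apply: (le_Rint_ae (mItD t) _ (sub tT Ei)); first exact: intg0.
apply: filterS E0 => p h [tp Dp]; by apply: h; split => //; exact: (It_sub tT).
Qed.

Let Y_zero t : 0 < t <= T -> Y t = 0 /\ \int[lebT]_(p in It t `*` D) E p = 0.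
Proof.
move=> t0T; have /andP[t0 tT] := t0T; have tT0 : 0 <= t <= T by rewrite ltW.
have g := @gronwall R T _ Y Ki Yi _ t tT0.
have := Y_bound t0T; rewrite g ?mulr0; last first.
  move=> s /andP[s0 sT]; rewrite Y0/=; have sT0 : 0 < s <= T by rewrite s0 ltW.
  apply: le_trans (Y_bound sT0); rewrite lerDl; apply: intE0.
  by rewrite !ltW.
by have := Y0 t; have := intE0 tT0; split; lra.
Qed.

Theorem energy_zero :
  [/\ forall t, 0 <= t <= T -> {ae leb, forall x, D x -> a t (pos x) = 0},
      forall t, 0 <= t <= T -> {ae leb, forall x, D x -> b t (pos x) = 0} &
      {ae lebT, forall p, (I `*` D) p -> E p = 0}].
Proof.
have parts t : 0 < t <= T -> {ae leb, forall x, D x -> b t (pos x) = 0} /\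
    forall i, {ae leb, forall x, D x -> C i t x = 0}.
  move=> t0T; have /andP[t0 tT] := t0T; have tT0 : 0 <= t <= T by rewrite ltW.
  have [Yt _] := Y_zero t0T.
  have bp : 0 <= \int[leb]_(x in D) (b t (pos x) ^+ 2).
    by apply: Rintegral_ge0 => x _; exact: sqr_ge0.
  have cp i : 0 <= \int[leb]_(x in D) (C i t x ^+ 2).
    by apply: Rintegral_ge0 => x _; exact: sqr_ge0.
  have sp : 0 <= \sum_i \int[leb]_(x in D) (C i t x ^+ 2) by exact: sumr_ge0.
  have lsp : 0 <= lambda / 2 * \sum_i \int[leb]_(x in D) (C i t x ^+ 2).
    by rewrite mulr_ge0// divr_ge0// ltW.
  split.
    apply: sqi_zero; first exact: wb.1.
    by move: Yt lsp; rewrite /Y; lra.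
  have s0 : \sum_i \int[leb]_(x in D) (C i t x ^+ 2) = 0.
    apply/eqP; rewrite eq_le sp andbT; apply: contraT; rewrite -ltNge => gt0.
    have : 0 < lambda / 2 * \sum_i \int[leb]_(x in D) (C i t x ^+ 2).
      by rewrite mulr_gt0// divr_gt0.
    by move: Yt bp; rewrite /Y; lra.
  move=> i; apply: sqi_zero; first exact: C2.
  have /eqP := s0; rewrite psumr_eq0// => /allP/(_ i); rewrite mem_index_enum.
  by move=> /(_ isT)/eqP ->.
split.
- have a0 : {ae leb1, forall t, 0 < t < T -> {ae leb, forall x, D x -> a t (pos x) = 0}}.
    move: (ha); rewrite /ae_time; apply: filterS => t h t0T; have hv := h t0T; have /andP[t0 tT] := t0T.
    have tT0 : 0 <= t <= T by rewrite !ltW.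
    have := mass_balance ch oOm bOm T0 wa a2 G2 eq1 hv tT0; rewrite /pairing.
    rewrite big1 ?mulr0 ?addr0 => [e|i _].
      by apply: sqi_zero; [exact: wa.1|rewrite (_ : \int[leb]_(x in D) _ = 0)].
    have [_ /(_ i) c0] := parts t (introT andP (conj t0 (ltW tT))).
    rewrite -[RHS](@Rint0 R _ _ leb D).
    have [_ /(_ i)/(L2P ch oOm) Dv2 _] := hv.
    apply: (Rint_ae_eq mD (sqiM mD (C2 i tT0) Dv2) (measurable_cst _) _).2.
    by apply: filterS c0 => x + Dx => /(_ Dx) cx; rewrite -/(C i t x) cx mul0r.
  move=> t tT; apply: sqi_zero; first exact: wa.1.
  have -> : \int[leb]_(x in D) (a t (pos x) ^+ 2) = \int[leb]_(x in D) (a t (pos x) * a t (pos x)).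
    by apply: eq_Rint => x _; rewrite expr2.
  rewrite (wcont_pair0 T0 wa (wa.1 t tT))//.
  apply: filterS a0 => s h s0T; have /andP[s0 sT] := s0T.
  have sT0 : 0 <= s <= T by rewrite !ltW.
  rewrite -[RHS](@Rint0 R _ _ leb D).
  apply: (Rint_ae_eq mD (sqiM mD (wa.1 s sT0) (wa.1 t tT)) (measurable_cst _) _).2.
  by apply: filterS (h s0T) => x + Dx => /(_ Dx) ->; rewrite mul0r.
- move=> t /andP[]; rewrite le_eqVlt => /orP[/eqP <- _|t0 tT]; first exact: b0.
  by apply: (parts t _).1; rewrite t0.
- have TT : 0 < T <= T by rewrite T0/=.
  have [_ e] := Y_zero TT; apply: (Rint_ge0_eq0 mID Ei E0).
  by rewrite e.
Qed.

End EnergyEstimate.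

(* Outside the range of [P], where the strains live, [bf] may be degenerate. *)
Record quadratic_energy {R : realType} {m n : nat}
    (P : 'M[R]_(m, n) -> 'M[R]_(m, n)) (Wel : R -> 'M[R]_(m, n) -> R)
    (bf : 'M[R]_(m, n) -> 'M[R]_(m, n) -> R) (e0 dl : 'M[R]_(m, n))
    (c0 c1 : R) : Prop := QuadraticEnergy {
  qe_lin : forall k A B, P (k *: A + B) = k *: P A + P B;
  qe_idem : forall A, P (P A) = P A;
  qe_bflin : forall k x y z, bf (k *: x + y) z = k * bf x z + bf y z;
  qe_sym : forall x y, bf x y = bf y x;
  qe_ge0 : forall x, 0 <= bf x x;
  qe_eq0 : forall A, bf (P A) (P A) = 0 -> P A = 0;
  qe_W : forall d A, Wel d (P A) =
    2^-1 * bf (P A - e0 - d *: dl) (P A - e0 - d *: dl) + (c0 + c1 * d) }.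

Section QuadraticEnergyTheory.
Context {R : realType} {m n : nat}.
Context {P : 'M[R]_(m, n) -> 'M[R]_(m, n)} {Wel : R -> 'M[R]_(m, n) -> R}.
Context {bf : 'M[R]_(m, n) -> 'M[R]_(m, n) -> R} {e0 dl : 'M[R]_(m, n)} {c0 c1 : R}.
Hypothesis qe : quadratic_energy P Wel bf e0 dl c0 c1.
Implicit Types (A B x y z : 'M[R]_(m, n)) (k d : R).

Lemma bfZl k x z : bf (k *: x) z = k * bf x z.
Proof.
have b0 : bf 0 z = 0.
  by have := qe_bflin qe 1 0 0 z; rewrite scaler0 add0r mul1r; lra.
by have := qe_bflin qe k x 0 z; rewrite addr0 b0 addr0.
Qed.

Lemma bfDl x y z : bf (x + y) z = bf x z + bf y z.
Proof. by have := qe_bflin qe 1 x y z; rewrite scale1r mul1r. Qed.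

Lemma bfBl x y z : bf (x - y) z = bf x z - bf y z.
Proof. by rewrite bfDl -scaleN1r bfZl mulN1r. Qed.

Lemma bfZr k x z : bf z (k *: x) = k * bf z x.
Proof. by rewrite !(qe_sym qe z) bfZl. Qed.

Lemma bfDr x y z : bf z (x + y) = bf z x + bf z y.
Proof. by rewrite !(qe_sym qe z) bfDl. Qed.

Lemma bfBr x y z : bf z (x - y) = bf z x - bf z y.
Proof. by rewrite !(qe_sym qe z) bfBl. Qed.

Lemma bf_sumr (J : Type) (s : seq J) (F : J -> 'M[R]_(m, n)) z :
  bf z (\sum_(j <- s) F j) = \sum_(j <- s) bf z (F j).
Proof.
elim: s => [|j s IH]; last by rewrite !big_cons bfDr IH.
by rewrite !big_nil; have := bfZr 0 0 z; rewrite scale0r mul0r.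
Qed.

Lemma bf_quad x v h : 2^-1 * bf (x + h *: v) (x + h *: v) =
  2^-1 * bf x x + h * bf x v + 2^-1 * bf v v * h ^+ 2.
Proof. by rewrite !(bfDl, bfDr, bfZl, bfZr) (qe_sym qe v x); field. Qed.

Lemma qe_PZ k A : P (k *: A) = k *: P A.
Proof.
have P0 : P 0 = 0.
  have := qe_lin qe 1 0 0; rewrite !scale1r addr0 => /eqP.
  by rewrite -subr_eq0 opprD addrA subrr sub0r oppr_eq0 => /eqP.
by have := qe_lin qe k A 0; rewrite !addr0 P0 addr0.
Qed.

Lemma qe_PD A B : P (A + B) = P A + P B.
Proof. by have := qe_lin qe 1 A B; rewrite !scale1r. Qed.

Lemma qe_PB A B : P (A - B) = P A - P B.
Proof. by rewrite qe_PD -scaleN1r qe_PZ scaleN1r. Qed.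

Lemma qe_Psum (J : Type) (s : seq J) (F : J -> 'M[R]_(m, n)) :
  P (\sum_(j <- s) F j) = \sum_(j <- s) P (F j).
Proof.
elim: s => [|j s IH]; last by rewrite !big_cons qe_PD IH.
by rewrite !big_nil; have := qe_PZ 0 0; rewrite !scale0r.
Qed.

Lemma qe_PE A : P A = \sum_i \sum_j A i j *: P (delta_mx i j).
Proof.
rewrite {1}(matrix_sum_delta A) qe_Psum; apply: eq_bigr => i _.
by rewrite qe_Psum; apply: eq_bigr => j _; rewrite qe_PZ.
Qed.

Lemma qe_dWel d A : dWel Wel d (P A) = - bf (P A - e0 - d *: dl) dl + c1.
Proof.
rewrite /dWel derive1E; set q := P A - e0 - d *: dl.
have : is_derive d (1 : R) (Wel^~ (P A)) (- bf q dl + c1).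
  apply: (is_derive_quad (C := 2^-1 * bf dl dl)) => h; rewrite !(qe_W qe).
  have -> : P A - e0 - (d + h *: 1) *: dl = q + h *: (- dl).
    by rewrite /q scalerDl opprD addrA scalerN /GRing.scale/= mulr1.
  rewrite bf_quad -(scaleN1r dl) !(bfZl, bfZr) /GRing.scale/= -/q.
  rewrite [X in `|X|](_ : _ = 2^-1 * bf dl dl * h ^+ 2); last by field.
  by rewrite ger0_norm// mulr_ge0 ?sqr_ge0// mulr_ge0 ?(qe_ge0 qe)// invr_ge0.
by move=> dv; exact: derive_val.
Qed.

Lemma qe_eWel d A B :
  frob (eWel P Wel d (P A)) (P B) = bf (P A - e0 - d *: dl) (P B).
Proof.
set q := P A - e0 - d *: dl.
have dE i j : eWel P Wel d (P A) i j = bf q (P (delta_mx i j)).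
  rewrite mxE; set v := P (delta_mx i j).
  have : is_derive (P A) v (Wel d) (bf q v).
    apply: (is_derive_quad (C := 2^-1 * bf v v)) => h.
    rewrite -qe_PZ -qe_PD !(qe_W qe) qe_PD qe_PZ -/v.
    have -> : P A + h *: v - e0 - d *: dl = q + h *: v.
      by rewrite /q -!addrA; congr (_ + _); rewrite addrC -!addrA.
    rewrite bf_quad -/q [X in `|X|](_ : _ = 2^-1 * bf v v * h ^+ 2); last by ring.
    by rewrite ger0_norm// mulr_ge0 ?sqr_ge0// mulr_ge0 ?(qe_ge0 qe)// invr_ge0.
  by move=> dv; exact: derive_val.
rewrite -[in RHS](qe_idem qe) [in RHS]qe_PE frobE exchange_big bf_sumr/=.
apply: eq_bigr => i _; rewrite bf_sumr; apply: eq_bigr => j _.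
by rewrite dE bfZr mulrC.
Qed.

Lemma bfE x y : bf x y = \sum_i \sum_j \sum_k \sum_l
  x i j * y k l * bf (delta_mx i j) (delta_mx k l).
Proof.
rewrite (qe_sym qe) {1}(matrix_sum_delta x) bf_sumr; apply: eq_bigr => i _.
rewrite bf_sumr; apply: eq_bigr => j _; rewrite bfZr (qe_sym qe).
rewrite {1}(matrix_sum_delta y) bf_sumr mulr_sumr; apply: eq_bigr => k _.
rewrite bf_sumr mulr_sumr; apply: eq_bigr => l _.
by rewrite bfZr mulrA.
Qed.

Section Integrability.
Context {d : measure_display} {X : measurableType d} {mu : {measure set X -> \bar R}}.
Context {D : set X}.
Hypothesis mD : measurable D.
Implicit Types (F G : X -> 'M[R]_(m, n)).

Lemma intg_bf F G : (forall i j, sqi mu D (fun t => F t i j)) ->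
  (forall i j, sqi mu D (fun t => G t i j)) ->
  intg mu D (fun t => bf (F t) (G t)).
Proof.
move=> Fi Gi.
apply: (@eq_intg _ _ _ _ _ (fun t => \sum_i \sum_j \sum_k \sum_l
  bf (delta_mx i j) (delta_mx k l) * (F t i j * G t k l))).
  move=> t _; rewrite bfE; apply: eq_bigr => i _; apply: eq_bigr => j _.
  by apply: eq_bigr => k _; apply: eq_bigr => l _; rewrite mulrC.
apply: (intg_sum mD) => i; apply: (intg_sum mD) => j.
apply: (intg_sum mD) => k; apply: (intg_sum mD) => l.
by apply: (intgZ mD); exact: sqiM.
Qed.

Lemma sqi_P F : (forall i j, sqi mu D (fun t => F t i j)) ->
  forall i j, sqi mu D (fun t => P (F t) i j).
Proof.
move=> Fi i j; apply: (@eq_sqi _ _ _ _ _ (fun t => \sum_k \sum_l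
  P (delta_mx k l) i j * F t k l)).
  move=> t _; rewrite [in RHS]qe_PE summxE; apply: eq_bigr => k _.
  by rewrite summxE; apply: eq_bigr => l _; rewrite mxE mulrC.
by apply: (sqi_sum mD) => k; apply: (sqi_sum mD) => l; apply: (sqiZ mD).
Qed.

End Integrability.
End QuadraticEnergyTheory.

Section EntropyDerivative.
Context {R : realType}.

Lemma derive_gent (s : R) : 0 < s < 1 -> derive1 (@gent R) s = ln s - ln (1 - s).
Proof.
move=> /andP[s0 s1]; rewrite derive1E.
have d1 : is_derive s (1 : R) (fun s : R => 1 - s) (- 1).
  by rewrite -[X in is_derive _ _ _ X]sub0r; exact: is_deriveB.
have d2 : is_derive s (1 : R) (@ln R) s^-1 by exact: is_derive1_ln.
have d3 : is_derive s (1 : R) (@ln R \o (fun s => 1 - s)) ((1 - s)^-1 * - 1).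
  apply: is_derive1_comp; apply: is_derive1_ln; by rewrite subr_gt0.
have d4 : is_derive s (1 : R) (@gent R)
   (s *: s^-1 + ln s *: 1 + ((1 - s) *: ((1 - s)^-1 * - 1) + ln (1 - s) *: (- 1))).
  apply: is_deriveD; exact: is_deriveM.
rewrite derive_val /GRing.scale/=.
by field; rewrite !gt_eqF ?subr_gt0.
Qed.

Lemma gent_monotone (x y : R) : 0 < x < 1 -> 0 < y < 1 ->
  0 <= (derive1 (@gent R) x - derive1 (@gent R) y) * (x - y).
Proof.
move=> hx hy; rewrite !derive_gent//; move: hx hy => /andP[x0 x1] /andP[y0 y1].
wlog xy : x y x0 x1 y0 y1 / y <= x => [H|].
  have [/H|/ltW/H h] := leP y x; first exact.
  by have := h y0 y1 x0 x1; lra.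
rewrite mulr_ge0// ?subr_ge0//.
have := @ler_ln R y x; rewrite !posrE => /(_ y0 x0); rewrite xy => h1.
have := @ler_ln R (1 - x) (1 - y); rewrite !posrE !subr_gt0 => /(_ x1 y1).
rewrite lerD2l lerN2 xy => h2.
by rewrite lerB.
Qed.

End EntropyDerivative.

Lemma Rint_indic_sub {R : realType} {d : measure_display} {X : measurableType d}
    {mu : {measure set X -> \bar R}} (D A E : set X) (f : X -> R) : D `&` A = E ->
  \int[mu]_(x in D) (\1_A x * f x) = \int[mu]_(x in E) f x.
Proof.
move=> <-; rewrite Rintegral_mkcondr; apply: eq_Rint => x _.
by rewrite patchE indicE; case: ifP => _; rewrite ?mul1r ?mul0r.
Qed.

Lemma intg_indic {R : realType} {d : measure_display} {X : measurableType d}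
    {mu : {measure set X -> \bar R}} (D A : set X) (f : X -> R) :
  measurable D -> measurable A -> intg mu D f -> intg mu D (fun x => \1_A x * f x).
Proof.
move=> mD mA fi; apply: (@eq_intg _ _ _ _ _ (fun x => f x * \1_A x)).
  by move=> x _; rewrite mulrC.
apply: (intg_Mb mD fi (C := 1)); first exact: measurable_indic.
by move=> x _; rewrite indicE; case: (_ \in _); rewrite ?normr1 ?normr0.
Qed.

Section Slices.
Context {R : realType} {n : nat} {dX : measure_display} {X : measurableType dX}.
Context {leb : {sigma_finite_measure set X -> \bar R}} {pos : X -> 'rV[R]_n}.
Context {tr : 'I_n -> R -> X -> X}.
Hypothesis ch : chart leb pos tr.
Context {Om : set 'rV[R]_n}.
Hypotheses (oOm : open Om) (bOm : bounded_set Om).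
Context {T : R}.
Hypothesis T0 : 0 < T.
Local Notation D := (pos @^-1` Om).
Notation leb1 := (@lebesgue_measure R).
Notation mR := (measurableTypeR R).
Local Notation I := (`]0, T[%classic : set mR).
Local Notation lebT := (leb1 \x leb)%E.
Local Notation H1 := (H1 leb pos Om).

Let mI : measurable I. Proof. exact: itvoo_measurable. Qed.
Let mD : measurable D. Proof. exact: (dom_measurable ch oOm). Qed.
Let fD : (leb D < +oo)%E. Proof. exact: (dom_fin ch oOm bOm). Qed.
Let mID := measurableX mI mD.
Let fID := cyl_fin ch oOm bOm (T := T).

#[local] Instance leb1_filter5 : Filter (nbhs (almost_everywhere leb1)) :=
  ae_filter_ringOfSetsType leb1.

Lemma sqi_of_slices (F : mR * X -> R) (C : R) : measurable_fun (I `*` D) F ->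
  {ae leb1, forall t, I t -> sqi leb D (fun x => F (t, x)) /\
     \int[leb]_(x in D) (F (t, x) ^+ 2) <= C} -> sqi lebT (I `*` D) F.
Proof.
move=> mF h; split => //.
have mF2 : measurable_fun (I `*` D) (fun p => F p ^+ 2) by exact: measurable_funX.
apply/(intg_prod_ltyP mI mD mF2).
apply: (@le_lt_trans _ _ (\int[leb1]_(t in I) (`|C|)%:E)%E); last first.
  have e : (leb1 I = T%:E) by rewrite [LHS](lebesgue_itvoo (ltW T0)) subr0.
  by rewrite integral_cst// [X in (_ * X)%E]e -EFinM ltry.
have mF3 : measurable_fun setT (fun p => `|(((fun p => F p ^+ 2) \_ (I `*` D)) p)%:E|%E).
  apply: measurableT_comp => //; apply/measurable_EFinP.
  by apply/(measurable_restrictT _ _).1.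
apply: ae_ge0_le_integral => //.
- by move=> t _; exact: integral_ge0.
- have := @measurable_fun_fubini_tonelli_F _ _ _ _ _ leb _ mF3 (fun _ => abse_ge0 _).
  move/(measurable_funTS (D := I)); apply: eq_measurable_fun => t /set_mem It.
  rewrite /fubini_F [RHS]integral_mkcond; apply: eq_integral => x _.
  rewrite !patchE /=; case: ifPn => [/set_mem [_ Dx]|/negP h'].
    by rewrite mem_set.
  by rewrite memNset ?normr0// => Dx; apply: h'; exact/mem_set.
- apply: filterS h => t + It => /(_ It) [[_ ti] tC].
  rewrite (_ : (\int[leb]_(y in D) _)%E = (\int[leb]_(y in D) (F (t, y) ^+ 2))%:E).
    by rewrite lee_fin (le_trans tC)// ler_norm.
  rewrite (Rint_EFin mD ti); apply: eq_integral => x _.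
  by rewrite gee0_abs// lee_fin sqr_ge0.
Qed.

Lemma Linf_sqi {m : nat} (u : R -> 'rV[R]_n -> 'rV[R]_m) Du :
  H1v_path leb pos Om T u Du -> LinfH1v leb pos Om T u ->
  (forall k, sqi lebT (I `*` D) (on_cyl pos (fun t x => u t x ord0 k))) /\
  (forall k i, sqi lebT (I `*` D) (on_cyl pos (fun t x => Du t x k i))).
Proof.
move=> [mu mDu hDu] [DF [[_ mDF hDF] [C hC]]].
have key : {ae leb1, forall t, I t -> forall k,
   (sqi leb D (fun x => u t (pos x) ord0 k) /\
    \int[leb]_(x in D) (u t (pos x) ord0 k ^+ 2) <= C ^+ 2) /\
   forall i, sqi leb D (fun x => Du t (pos x) k i) /\
    \int[leb]_(x in D) (Du t (pos x) k i ^+ 2) <= C ^+ 2}.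
  move: hDu hDF hC; rewrite /ae_time; apply: filterS3 => t h1 h2 h3 /itvooP It k.
  have hD := h1 It k; have hF := h2 It k; have := h3 It k.
  have [/(L2P ch oOm) u2 _ _] := hD.
  have [_ F2' _] := hF.
  have F2 i : sqi leb D (fun x => DF t (pos x) k i).
    by move: (F2' i) => /(L2P ch oOm); apply: eq_sqi => x _; rewrite mxE.
  have D2 i : sqi leb D (fun x => Du t (pos x) k i).
    have [_ /(_ i)/(L2P ch oOm) + _] := hD; apply: eq_sqi => x _; by rewrite mxE.
  have sF : intg leb D (fun x => \sum_i DF t (pos x) k i ^+ 2).
    by apply: (intg_sum mD) => i; exact: (F2 i).2.
  rewrite /normH1 /int_dom /dom.
  rewrite (@eq_Rint _ _ _ _ _ _ (fun x => u t (pos x) ord0 k ^+ 2 +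
    \sum_i DF t (pos x) k i ^+ 2)); last first.
    move=> x _; rewrite frob_row; congr (_ + _); apply: eq_bigr => i _.
    by rewrite !mxE expr2.
  rewrite (RintD mD u2.2 sF) (Rint_sum mD _ (fun i => (F2 i).2)) => hs.
  have p1 : 0 <= \int[leb]_(x in D) (u t (pos x) ord0 k ^+ 2).
    by apply: Rintegral_ge0 => x _; exact: sqr_ge0.
  have p2 i : 0 <= \int[leb]_(x in D) (DF t (pos x) k i ^+ 2).
    by apply: Rintegral_ge0 => x _; exact: sqr_ge0.
  have tot : \int[leb]_(x in D) (u t (pos x) ord0 k ^+ 2) +
      \sum_i \int[leb]_(x in D) (DF t (pos x) k i ^+ 2) <= C ^+ 2.
    have sp : 0 <= \sum_i \int[leb]_(x in D) (DF t (pos x) k i ^+ 2) by exact: sumr_ge0.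
    have s0 := addr_ge0 p1 sp.
    rewrite -(sqr_sqrtr s0) lerXn2r ?nnegrE ?sqrtr_ge0//.
    exact: le_trans (sqrtr_ge0 _) hs.
  have sp : 0 <= \sum_i \int[leb]_(x in D) (DF t (pos x) k i ^+ 2) by exact: sumr_ge0.
  split; first by split => //; move: tot sp; lra.
  move=> i; split => //.
  have e : {ae leb, forall x, D x -> DF t (pos x) k i ^+ 2 = Du t (pos x) k i ^+ 2}.
    apply: filterS (H1_gradient_ae ch oOm bOm hF hD) => x + Dx => /(_ Dx) h.
    by have := congr1 (fun r : 'rV[R]_n => r ord0 i) h; rewrite !mxE => ->.
  have [_ <-] := Rint_ae_eq mD (F2 i).2 (intg_measurable (D2 i).2) e.
  have : \int[leb]_(x in D) (DF t (pos x) k i ^+ 2) <=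
    \sum_i \int[leb]_(x in D) (DF t (pos x) k i ^+ 2).
    by rewrite [leRHS](bigD1 i)//= lerDl sumr_ge0.
  by move: tot p1; lra.
split => [k|k i]; apply: (sqi_of_slices (C := C ^+ 2)) => //.
- by apply: filterS key => t h It; have [] := h It k.
- by apply: filterS key => t h It; have [_ /(_ i)] := h It k.
Qed.

End Slices.

Section Frobenius.
Context {R : realType} {m n : nat}.
Implicit Types (A B C : 'M[R]_(m, n)).

Lemma frobBl A B C : frob (A - B) C = frob A C - frob B C.
Proof.
rewrite !frobE -sumrB; apply: eq_bigr => j _; rewrite -sumrB; apply: eq_bigr => i _.
by rewrite !mxE mulrBl.
Qed.

Lemma frobZr k A B : frob A (k *: B) = k * frob A B.
Proof.
rewrite !frobE mulr_sumr; apply: eq_bigr => j _; rewrite mulr_sumr.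
by apply: eq_bigr => i _; rewrite !mxE mulrCA.
Qed.

Lemma frob_ge0 A : 0 <= frob A A.
Proof.
by rewrite frobE; apply: sumr_ge0 => j _; apply: sumr_ge0 => i _; rewrite -expr2 sqr_ge0.
Qed.

End Frobenius.

Section Algebra.
Context {R : realType}.
Implicit Types (x y : R).

Lemma order_parameters_bounded (x y x' y' : R) :
  0 <= x + y <= 1 /\ 0 <= x - y <= 1 -> 0 <= x' + y' <= 1 /\ 0 <= x' - y' <= 1 ->
  `|x - x'| <= 1 /\ `|y - y'| <= 1.
Proof.
move=> [/andP[? ?] /andP[? ?]] [/andP[? ?] /andP[? ?]].
by rewrite !ler_norml; split; apply/andP; split; lra.
Qed.

Lemma energy_density_le (th k1 k2 l c a1 a2 b1 b2 gs1 gs2 gr1 gr2 bt1 bt2 c1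
    Q1d Q2d Q1u Q2u A1 A2 B1 B2 SA SB qq : R) :
  0 <= c -> 0 <= th -> 0 <= l -> 0 <= SB -> A1 - A2 = SA -> B1 - B2 = SB ->
  0 <= (gs1 - gs2) * ((a1 + b1) - (a2 + b2)) ->
  0 <= (gr1 - gr2) * ((a1 - b1) - (a2 - b2)) ->
  qq = (Q1u - Q2u) - ((a1 - a2) + (b1 - b2)) * (Q1d - Q2d) ->
  c * ((bt1 - bt2) * (b1 - b2) + qq + l * SA - 2 * k1 * (a1 - a2) ^+ 2
    - 2 * k2 * (b1 - b2) ^+ 2) <=
  (((th / 2 * (gs1 + gr1) + k1 * (1 - 2 * a1) + (- Q1d + c1)) * (c * (a1 - a2)) + l * (c * A1)) -
   ((th / 2 * (gs2 + gr2) + k1 * (1 - 2 * a2) + (- Q2d + c1)) * (c * (a1 - a2)) + l * (c * A2))) +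
  (((bt1 + th / 2 * (gs1 - gr1) - 2 * k2 * b1 + (- Q1d + c1)) * (c * (b1 - b2)) + l * (c * B1)) -
   ((bt2 + th / 2 * (gs2 - gr2) - 2 * k2 * b2 + (- Q2d + c1)) * (c * (b1 - b2)) + l * (c * B2))) +
  (c * Q1u - c * Q2u).
Proof.
move=> c0 th0 l0 SB0 <- eB hs hr ->; rewrite -subr_ge0.
rewrite (_ : _ - _ = c * (th / 2 * ((gs1 - gs2) * ((a1 + b1) - (a2 + b2))) +
   th / 2 * ((gr1 - gr2) * ((a1 - b1) - (a2 - b2))) + l * SB)); last first.
  by rewrite -eB; field.
by rewrite mulr_ge0// !addr_ge0// mulr_ge0// divr_ge0.
Qed.

End Algebra.

Section Uniqueness.
Context {R : realType} {m n : nat} {dX : measure_display} {X : measurableType dX}.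
Context {leb : {sigma_finite_measure set X -> \bar R}} {pos : X -> 'rV[R]_n}.
Context {tr : 'I_n -> R -> X -> X}.
Hypothesis ch : chart leb pos tr.
Context {Om : set 'rV[R]_n}.
Hypotheses (oOm : open Om) (bOm : bounded_set Om).
Context {T lambda theta kappa1 kappa2 : R}.
Hypotheses (T0 : 0 < T) (lam0 : 0 < lambda) (th0 : 0 < theta)
  (k10 : 0 < kappa1) (k20 : 0 < kappa2).
Context {P : 'M[R]_(m, n) -> 'M[R]_(m, n)} {Wel : R -> 'M[R]_(m, n) -> R}.
Context {bf : 'M[R]_(m, n) -> 'M[R]_(m, n) -> R} {e0 dl : 'M[R]_(m, n)} {c0 c1 : R}.
Context {sig : 'M[R]_(m, n)}.
Hypothesis qe : quadratic_energy P Wel bf e0 dl c0 c1.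
Local Notation D := (pos @^-1` Om).
Notation leb1 := (@lebesgue_measure R).
Notation mR := (measurableTypeR R).
Local Notation I := (`]0, T[%classic : set mR).
Local Notation It t := (`]0, t[%classic : set mR).
Local Notation lebT := (leb1 \x leb)%E.
Local Notation H1 := (H1 leb pos Om).
Local Notation L2H1 := (L2H1 leb pos Om T).

Let mI : measurable I. Proof. exact: itvoo_measurable. Qed.
Let mD : measurable D. Proof. exact: (dom_measurable ch oOm). Qed.
Let fD : (leb D < +oo)%E. Proof. exact: (dom_fin ch oOm bOm). Qed.
Let mID := measurableX mI mD.
Let fID := cyl_fin ch oOm bOm (T := T).

#[local] Instance leb1_filter6 : Filter (nbhs (almost_everywhere leb1)) :=
  ae_filter_ringOfSetsType leb1.

Lemma dt_weakB F Ft G Gt : dt_weak leb pos Om T F Ft -> dt_weak leb pos Om T G Gt ->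
  dt_weak leb pos Om T (fun t x => F t x - G t x) (fun t x => Ft t x - Gt t x).
Proof.
move=> [Fi Fti hF] [Gi Gti hG]; split.
- exact: (intgB mID Fi Gi).
- exact: (intgB mID Fti Gti).
move=> phi tphi; have := hF _ tphi; have := hG _ tphi.
rewrite /int_cyl /cyl /dom /on_cyl/=.
have mphi := measurable_pair_cont (ch_open ch) (C1_continuous (test_fun_C1 tphi)).
have [_ cphi' _] := tphi.
have mphi' := measurable_pair_cont (ch_open ch) (cphi' (1, 0)).
have [K _ hK] := test_fun_bounded tphi.
have [K' _ hK'] := test_derive_bounded ((1, 0) : R * 'rV[R]_n) tphi.
have Mb f : intg lebT (I `*` D) f ->
  intg lebT (I `*` D) (fun p => f p * phi (p.1, pos p.2)) /\
  intg lebT (I `*` D) (fun p => f p * 'D_((1, 0) : R * 'rV[R]_n) phi (p.1, pos p.2)).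
  move=> fi; split.
    by apply: (intg_Mb mID fi (measurable_funTS mphi) (C := K)) => p _; exact: hK.
  by apply: (intg_Mb mID fi (measurable_funTS mphi') (C := K')) => p _; exact: hK'.
have [f1 f2] := Mb _ Fi; have [g1 g2] := Mb _ Gi.
have [f3 f4] := Mb _ Fti; have [g3 g4] := Mb _ Gti.
move=> eG eF.
rewrite (@eq_Rint _ _ _ _ _ _ (fun p => on_cyl pos F p * 'D_((1, 0) : R * 'rV[R]_n) phi (p.1, pos p.2)
  - on_cyl pos G p * 'D_((1, 0) : R * 'rV[R]_n) phi (p.1, pos p.2))); last first.
  by move=> p _; rewrite mulrBl.
rewrite (RintB mID f2 g2) [X in X - _]eF [X in _ - X]eG.
rewrite -opprD -(RintB mID f3 g3); congr (- _); apply: eq_Rint => p _.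
by rewrite mulrBl.
Qed.

Definition cutoff t (s : R) : R := \1_(It t) s.

Lemma L2H1_cutoff (F : R -> 'rV[R]_n -> R) (DF : R -> 'rV[R]_n -> 'rV[R]_n) t :
  sqi lebT (I `*` D) (on_cyl pos F) ->
  (forall i, sqi lebT (I `*` D) (on_cyl pos (fun t x => DF t x ord0 i))) ->
  ae_time T (fun t => H1 (F t) (DF t)) ->
  L2H1 (fun s x => cutoff t s * F s x) (fun s x => cutoff t s *: DF s x).
Proof.
move=> Fi DFi hF; have mc : measurable_fun (I `*` D) (fun p => cutoff t p.1).
  apply: (measurable_fun_pr1 mI); apply: measurable_indic; exact: itvoo_measurable.
have c1' p : `|cutoff t p| <= 1.
  by rewrite /cutoff indicE; case: (_ \in _); rewrite ?normr1 ?normr0.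
split.
- apply/(L2TP ch oOm); exact: (sqi_Mb mID Fi mc (fun p _ => c1' p.1)).
- move=> i; apply/(L2TP ch oOm).
  apply: eq_sqi (sqi_Mb mID (DFi i) mc (fun p _ => c1' p.1)) => p _.
  by rewrite /on_cyl mxE.
- move: hF; rewrite /ae_time; apply: filterS => s h sT.
  exact: (H1Z ch oOm bOm _ (h sT)).
Qed.

Lemma LinfT_cutoff (F : R -> 'rV[R]_n -> R) t :
  {ae lebT, forall p, (I `*` D) p -> `|on_cyl pos F p| <= 1} ->
  LinfT leb pos Om T (fun s x => cutoff t s * F s x).
Proof.
move=> h; exists 1; apply: filterS h => p h Dp; rewrite /cutoff indicE.
by case: (_ \in _); rewrite ?mul1r ?mul0r ?normr0//; exact: h.
Qed.

Context {a1 b1 a2 b2 : R -> 'rV[R]_n -> R} {u1 u2 : R -> 'rV[R]_n -> 'rV[R]_m}.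
Context {a0 b0 : 'rV[R]_n -> R}.
Local Notation weak := (weak_solution leb pos Om T lambda theta kappa1 kappa2 P Wel sig a0 b0).
Local Notation class := (solution_class leb pos Om T).
Hypotheses (w1 : weak a1 b1 u1) (cl1 : class a1 b1 u1).
Hypotheses (w2 : weak a2 b2 u2) (cl2 : class a2 b2 u2).

Let a t x := a1 t x - a2 t x.
Let b t x := b1 t x - b2 t x.

Lemma weak_solution_diff :
  [/\ forall t, 0 <= t <= T -> {ae leb, forall x, D x -> a1 t (pos x) = a2 t (pos x)},
      forall t, 0 <= t <= T -> {ae leb, forall x, D x -> b1 t (pos x) = b2 t (pos x)} &
      exists Du1 Du2, [/\ ae_time T (fun t => H1v leb pos Om (u1 t) (Du1 t)),
        ae_time T (fun t => H1v leb pos Om (u2 t) (Du2 t)) &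
        ae_time T (fun t => {ae leb, forall x, D x -> P (Du1 t (pos x) - Du2 t (pos x)) = 0})]].
Proof.
have [Da1 [Db1 [DM1 [Du1 [M1 [bt1 [i1 [ha1 hb1 hM1 hu1 hbt1] ae1 [e11 e12 e13 e14]]]]]]]] := w1.
have [Da2 [Db2 [DM2 [Du2 [M2 [bt2 [i2 [ha2 hb2 hM2 hu2 hbt2] ae2 [e21 e22 e23 e24]]]]]]]] := w2.
have [[hla1 hlb1] _ hLu1 _] := cl1.
have [[hla2 hlb2] _ hLu2 _] := cl2.
have q4 : (0 : R) < 4^-1 by rewrite invr_gt0.
have wa : wcont (leb := leb) (pos := pos) (Om := Om) (T := T) a.
  exact: (wcontB ch oOm (holder_wcont ch oOm T0 q4 hla1) (holder_wcont ch oOm T0 q4 hla2)).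
have wb : wcont (leb := leb) (pos := pos) (Om := Om) (T := T) b.
  exact: (wcontB ch oOm (holder_wcont ch oOm T0 q4 hlb1) (holder_wcont ch oOm T0 q4 hlb2)).
have L2B F1 F2 : L2T leb pos Om T F1 -> L2T leb pos Om T F2 ->
    sqi lebT (I `*` D) (on_cyl pos (fun t x => F1 t x - F2 t x)).
  by move=> /(L2TP ch oOm) h1 /(L2TP ch oOm) h2; exact: (sqiB mID h1 h2).
have L2H1B F1 DF1 F2 DF2 : L2H1 F1 DF1 -> L2H1 F2 DF2 ->
    [/\ sqi lebT (I `*` D) (on_cyl pos (fun t x => F1 t x - F2 t x)),
     forall i, sqi lebT (I `*` D) (on_cyl pos (fun t x => (DF1 t x - DF2 t x) ord0 i)) &
     ae_time T (fun t => H1 (fun x => F1 t x - F2 t x) (fun x => DF1 t x - DF2 t x))].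
  move=> [h1 h2 h3] [h4 h5 h6]; split; first exact: L2B.
    move=> i; apply: eq_sqi (L2B _ _ (h2 i) (h5 i)) => p _.
    by rewrite /on_cyl !mxE.
  move: h3 h6; rewrite /ae_time; apply: filterS2 => t k1 k2 tT.
  exact: (H1B ch oOm bOm (k1 tT) (k2 tT)).
have [aS DaS haH] := L2H1B _ _ _ _ ha1 ha2.
have [bS DbS hbH] := L2H1B _ _ _ _ hb1 hb2.
have [MS GS hMH] := L2H1B _ _ _ _ hM1 hM2.
set Da := fun t x => Da1 t x - Da2 t x in DaS haH.
set Db := fun t x => Db1 t x - Db2 t x in DbS hbH.
set G := fun t x => DM1 t x - DM2 t x in GS hMH.
set M := fun t x => M1 t x - M2 t x in MS hMH.
pose bt t x := bt1 t x - bt2 t x.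
have hbt : dt_weak leb pos Om T b bt by exact: dt_weakB.
have [u1S Du1S] := Linf_sqi ch oOm bOm T0 hu1 hLu1.
have [u2S Du2S] := Linf_sqi ch oOm bOm T0 hu2 hLu2.
pose u t x := u1 t x - u2 t x; pose Du t x := Du1 t x - Du2 t x.
have uS k : sqi lebT (I `*` D) (on_cyl pos (fun t x => u t x ord0 k)).
  by apply: eq_sqi (sqiB mID (u1S k) (u2S k)) => p _; rewrite /on_cyl !mxE.
have DuS k i : sqi lebT (I `*` D) (on_cyl pos (fun t x => Du t x k i)).
  by apply: eq_sqi (sqiB mID (Du1S k i) (Du2S k i)) => p _; rewrite /on_cyl !mxE.
have huH : ae_time T (fun t => H1v leb pos Om (u t) (Du t)).
  have [_ _ h1] := hu1; have [_ _ h2] := hu2.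
  move: h1 h2; rewrite /ae_time; apply: filterS2 => t k1 k2 tT k.
  have := H1B ch oOm bOm (k1 tT k) (k2 tT k).
  apply: (eq_H1 ch oOm) => x _; split; first by rewrite !mxE.
  by rewrite linearB.
pose q (p : mR * X) := P (Du p.1 (pos p.2)) - (a p.1 (pos p.2) + b p.1 (pos p.2)) *: dl.
have qS i j : sqi lebT (I `*` D) (fun p => q p i j).
  have PS := sqi_P qe mID (F := fun p : mR * X => Du p.1 (pos p.2)) DuS i j.
  have dS := sqiZ mID (dl i j) (sqiD mID aS bS).
  by apply: eq_sqi (sqiB mID PS dS) => p _; rewrite !mxE mulrC.
have Ei : intg lebT (I `*` D) (fun p => bf (q p) (q p)) by exact: (intg_bf qe mID qS qS).
have E0 : {ae lebT, forall p, (I `*` D) p -> 0 <= bf (q p) (q p)}.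
  by apply: aeW => p _; exact: (qe_ge0 qe).
have bdd : {ae lebT, forall p, (I `*` D) p ->
    `|on_cyl pos a p| <= 1 /\ `|on_cyl pos b p| <= 1}.
  move: ae1 ae2; rewrite /ae_cyl; apply: filterS2 => p h1 h2 Dp.
  apply: order_parameters_bounded.
    by have [/andP[/ltW -> /ltW ->] /andP[/ltW -> /ltW ->]] := h1 Dp.
  by have [/andP[/ltW -> /ltW ->] /andP[/ltW -> /ltW ->]] := h2 Dp.
have bC : {ae lebT, forall p, (I `*` D) p -> `|on_cyl pos b p| <= 1}.
  by apply: filterS bdd => p h /h[].
have b00 : {ae leb, forall x, D x -> b 0 (pos x) = 0}.
  move: i1 i2; rewrite /ae_dom; apply: filterS2 => x h1 h2 Dx.
  by rewrite /b; have [_ ->] := h1 Dx; have [_ ->] := h2 Dx; rewrite subrr.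
have eq1 xi xit Dxi : test_xi leb pos Om T xi xit Dxi ->
  int_cyl leb pos Om T (fun t x => - a t x * xit t x + lambda * frob (G t x) (Dxi t x)) = 0.
  move=> txi; have [I1 z1] := e11 _ _ _ txi; have [I2 z2] := e21 _ _ _ txi.
  rewrite -[RHS](subrr 0) -{1}z1 -z2 /int_cyl -(RintB mID I1 I2).
  apply: eq_Rint => p _; rewrite /on_cyl !frob_row /a.
  have -> : \sum_j G p.1 (pos p.2) ord0 j * Dxi p.1 (pos p.2) ord0 j =
     \sum_j DM1 p.1 (pos p.2) ord0 j * Dxi p.1 (pos p.2) ord0 j -
     \sum_j DM2 p.1 (pos p.2) ord0 j * Dxi p.1 (pos p.2) ord0 j.
    by rewrite -sumrB; apply: eq_bigr => j _; rewrite !mxE mulrBl.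
  by ring.
have aC : {ae lebT, forall p, (I `*` D) p -> `|on_cyl pos a p| <= 1}.
  by apply: filterS bdd => p h /h[].
have sDa : intg lebT (I `*` D) (fun p => \sum_i on_cyl pos (fun t x => Da t x ord0 i) p ^+ 2).
  by apply: (intg_sum mID) => i; exact: (DaS i).2.
have btb : intg lebT (I `*` D) (fun p => on_cyl pos bt p * on_cyl pos b p).
  have [_ bti _] := hbt; apply: (ae_intg mID (intg_norm bti)).
    by apply: measurable_funM; [exact: intg_measurable bti|exact: bS.1].
  apply: filterS bC => p h Dp; rewrite normrM -[leRHS]mulr1.
  by rewrite ler_wpM2l//; exact: h.
have ineq t : 0 < t <= T ->
  \int[lebT]_(p in It t `*` D) (on_cyl pos bt p * on_cyl pos b p + bf (q p) (q p) +
    lambda * (\sum_i on_cyl pos (fun t x => Da t x ord0 i) p ^+ 2)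
    - 2 * kappa1 * on_cyl pos a p ^+ 2 - 2 * kappa2 * on_cyl pos b p ^+ 2) <=
  \int[lebT]_(p in It t `*` D) (on_cyl pos M p * on_cyl pos a p).
  move=> /andP[t0 tT].
  have [j1 j2 j3] := e12 _ _ (L2H1_cutoff t aS DaS haH) (LinfT_cutoff t aC).
  have [k1 k2 k3] := e22 _ _ (L2H1_cutoff t aS DaS haH) (LinfT_cutoff t aC).
  have [j4 j5] := e13 _ _ (L2H1_cutoff t bS DbS hbH) (LinfT_cutoff t bC).
  have [k4 k5] := e23 _ _ (L2H1_cutoff t bS DbS hbH) (LinfT_cutoff t bC).
  pose v s x := cutoff t s *: u s x; pose Dv s x := cutoff t s *: Du s x.
  have hv : L2H1v leb pos Om T v Dv.
    move=> k; have hk : ae_time T (fun s => H1 (fun x => u s x ord0 k) (fun x => row k (Du s x))).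
      by move: huH; rewrite /ae_time; apply: filterS => s h sT; exact: h.
    have DSk i : sqi lebT (I `*` D) (on_cyl pos (fun s x => row k (Du s x) ord0 i)).
      by apply: eq_sqi (DuS k i) => p _; rewrite /on_cyl [RHS]mxE.
    have [h1 h2 h3] := L2H1_cutoff t (uS k) DSk hk.
    split.
    - move/(L2TP ch oOm): h1 => h1; apply/(L2TP ch oOm).
      by apply: eq_sqi h1 => p _; rewrite /on_cyl [RHS]mxE.
    - move=> i; move/(L2TP ch oOm): (h2 i) => h; apply/(L2TP ch oOm).
      apply: eq_sqi h => p _; rewrite /on_cyl [LHS]mxE [X in _ * X]mxE [RHS]mxE.
      by rewrite [RHS]mxE.
    - move: h3; rewrite /ae_time; apply: filterS => s h sT.
      apply: (eq_H1 ch oOm) (h sT) => x _; split; first by rewrite [RHS]mxE.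
      by rewrite /Dv linearZ.
  have [j6 j7] := e14 _ _ hv; have [k6 k7] := e24 _ _ hv.
  have n1 := intgB mID j2 k2; have n2 := intgB mID j4 k4; have n3 := intgB mID j6 k6.
  have n4 := intgD mID n1 n2; have n5 := intgD mID n4 n3.
  have mA : measurable (It t `*` setT : set (mR * X)).
    by apply: measurableX => //; exact: itvoo_measurable.
  have IA : (I `*` D) `&` (It t `*` setT) = It t `*` D.
    apply/seteqP; split => [[s x] [[/= ? ?] [? _]]//|[s x] [/= st Dx]].
    split; split => //; exact: It_sub tT _ st.
  rewrite -!(Rint_indic_sub _ IA).
  pose LB p := on_cyl pos bt p * on_cyl pos b p + bf (q p) (q p) +
    lambda * (\sum_i on_cyl pos (fun t x => Da t x ord0 i) p ^+ 2)
    - 2 * kappa1 * on_cyl pos a p ^+ 2 - 2 * kappa2 * on_cyl pos b p ^+ 2.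
  have LBi : intg lebT (I `*` D) LB.
    apply: (intgB mID); last exact: (intgZ mID _ bS.2).
    apply: (intgB mID); last exact: (intgZ mID _ aS.2).
    apply: (intgD mID); last exact: (intgZ mID _ sDa).
    exact: (intgD mID btb Ei).
  have cE (p : mR * X) : \1_(It t `*` [set: X]) p = cutoff t p.1 :> R.
    rewrite /cutoff !indicE; congr (_%:R); congr nat_of_bool.
    by apply/idP/idP => /set_mem h; apply/mem_set; [case: h|split].
  have -> : \int[lebT]_(p in I `*` D) (\1_(It t `*` setT) p * (on_cyl pos M p * on_cyl pos a p)) =
    \int[lebT]_(p in I `*` D) on_cyl pos (fun s x => M1 s x * (cutoff t s * a s x)) p -
    \int[lebT]_(p in I `*` D) on_cyl pos (fun s x => M2 s x * (cutoff t s * a s x)) p.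
    rewrite -(RintB mID j1 k1); apply: eq_Rint => p _.
    by rewrite cE /on_cyl /M /a; ring.
  move: j3 k3; rewrite /int_cyl /cyl /dom => -> ->.
  rewrite -(RintB mID j2 k2).
  have z1 := RintB mID j4 k4; have z2 := RintB mID j6 k6.
  move: j5 k5 j7 k7; rewrite /int_cyl /cyl /dom => y1 y2 y3 y4.
  rewrite y1 y2 subrr in z1; rewrite y3 y4 subrr in z2.
  have tot := RintD mID n4 n3; rewrite z2 addr0 in tot.
  have tot' := RintD mID n1 n2; rewrite z1 addr0 in tot'.
  rewrite -tot' -tot.
  apply: (le_Rint_ae mID (intg_indic mID mA LBi) n5).
  move: ae1 ae2; rewrite /ae_cyl; apply: filterS2 => p g1 g2 Dp.
  have [s1 r1] := g1 Dp; have [s2 r2] := g2 Dp.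
  rewrite cE /on_cyl /=.
  set s := p.1; set x := pos p.2.
  pose q1 := P (Du1 s x) - e0 - (a1 s x + b1 s x) *: dl.
  pose q2 := P (Du2 s x) - e0 - (a2 s x + b2 s x) *: dl.
  have e4 : frob (eWel P Wel (a1 s x + b1 s x) (P (Du1 s x)) - sig) (P (Dv s x)) -
      frob (eWel P Wel (a2 s x + b2 s x) (P (Du2 s x)) - sig) (P (Dv s x)) =
      cutoff t s * bf q1 (P (Du s x)) - cutoff t s * bf q2 (P (Du s x)).
    rewrite !frobBl !(qe_eWel qe) -!(bfZr qe) -!(qe_PZ qe) opprB addrA subrK.
    by [].
  rewrite e4 !(qe_dWel qe) -/q1 -/q2 !frobZr.
  have c0' : 0 <= cutoff t s by rewrite /cutoff indicE; case: (_ \in _).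
  have qE : q p = q1 - q2.
    rewrite /q /q1 /q2 -/s -/x (qe_PB qe) /a /b.
    apply/matrixP => i j; rewrite !mxE; ring.
  apply: energy_density_le c0' (ltW th0) (ltW lam0) (frob_ge0 (Db s x)) _ _ _ _ _.
  - rewrite -frobBl frob_row; apply: eq_bigr => i _; by rewrite expr2.
  - by rewrite -frobBl.
  - exact: gent_monotone.
  - exact: gent_monotone.
  - rewrite qE -(bfBl qe).
    have -> : bf q1 dl - bf q2 dl = bf (q1 - q2) dl by rewrite (bfBl qe).
    rewrite -(bfZr qe) -(bfBr qe) -qE; congr (bf _ _).
have [za zb zE] := energy_zero ch oOm bOm T0 lam0 (ltW k10) (ltW k20) wa wb aS bS MS GS DaS
  hMH haH eq1 b00 bC hbt Ei E0 ineq.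
split.
- move=> t tT; apply: filterS (za t tT) => x + Dx => /(_ Dx) /eqP.
  by rewrite /a subr_eq0 => /eqP.
- move=> t tT; apply: filterS (zb t tT) => x + Dx => /(_ Dx) /eqP.
  by rewrite /b subr_eq0 => /eqP.
exists Du1, Du2; split; [by case: hu1|by case: hu2|].
rewrite /ae_time; apply: filterS (ae_slices zE) => t ht tT.
have tT' : 0 <= t <= T by case/andP: tT => /ltW -> /ltW ->.
apply: filterS3 ht (za t tT') (zb t tT') => x hx ax bx Dx.
apply: (qe_eq0 qe); have := hx (conj _ Dx).
have ea : a t (pos x) = 0 by exact: ax.
have eb : b t (pos x) = 0 by exact: bx.
have -> : q (t, x) = P (Du t (pos x)) by rewrite /q /= ea eb addr0 scale0r subr0.
by apply; apply/itvooP.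
Qed.

End Uniqueness.

(** * Rigidity *)

Section LocalToGlobal.
Context {R : realType} {n : nat} {dX : measure_display} {X : measurableType dX}.
Context {leb : {sigma_finite_measure set X -> \bar R}} {pos : X -> 'rV[R]_n}.
Context {tr : 'I_n -> R -> X -> X}.
Hypothesis ch : chart leb pos tr.
Implicit Types (U Om : set 'rV[R]_n) (v : X -> R).

Lemma ae_tr i h (P : X -> Prop) : {ae leb, forall x, P x} ->
  {ae leb, forall x, P (tr i h x)}.
Proof.
move=> [N [mN N0 hN]]; exists (tr i h @^-1` N); split.
- rewrite -[X in measurable X]setTI; exact: (tr_measurable ch i h).
- by rewrite (ch_inv ch).
- by move=> x /= hx; apply: hN.
Qed.

Lemma ae_open_local U (P : X -> Prop) :
  (forall p, U p -> exists V, [/\ open V, V p & {ae leb, forall x, V (pos x) -> P x}]) ->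
  {ae leb, forall x, U (pos x) -> P x}.
Proof.
move=> h; pose B (ab : 'rV[rat]_n * 'rV[rat]_n) : set 'rV[R]_n :=
  box (\row_i ratr (ab.1 ord0 i)) (\row_i ratr (ab.2 ord0 i)).
pose Q k x := match @unpickle ('rV[rat]_n * 'rV[rat]_n)%type k with
  | Some ab => {ae leb, forall x, B ab (pos x) -> P x} -> B ab (pos x) -> P x
  | None => True end.
have /ae_foralln : forall k, {ae leb, forall x, Q k x}.
  move=> k; rewrite /Q; case: unpickle => [ab|]; last exact: aeW.
  case: (pselect {ae leb, forall x, B ab (pos x) -> P x}) => hB.
    by apply: filterS hB => x hx _.
  by apply: aeW => x /hB.
apply: filterS => x Qx Ux; have [V [oV Vp aeV]] := h _ Ux.
have [ab [h1 h2]] := rat_box oV Vp.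
have := Qx (pickle ab); rewrite /Q pickleK; apply => //.
by apply: filterS aeV => y hy By; apply/hy/h2/box_cbox.
Qed.

Lemma open_not_negligible U p : open U -> U p ->
  {ae leb, forall x, ~ U (pos x)} -> False.
Proof.
move=> oU Up [N [mN N0 hN]]; have [ab [h1 h2]] := rat_box oU Up.
have := ch_pos ch (a := \row_i ratr (ab.1 ord0 i)) (b := \row_i ratr (ab.2 ord0 i)).
rewrite ltNge -N0 => /(_ _)/negP; apply.
  by move=> i; have /andP[h3 h4] := h1 i; exact: lt_trans h4.
apply: le_measure; rewrite ?inE//; first by apply: (ch_open ch); exact: box_open.
by move=> x /box_cbox /h2 Ux; apply: hN => /=; apply.
Qed.

Lemma connected_const Om v : Om !=set0 -> connected Om ->
  (forall p, Om p -> exists U c, [/\ open U, U p, U `<=` Om &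
     {ae leb, forall x, U (pos x) -> v x = c}]) ->
  exists c, {ae leb, forall x, Om (pos x) -> v x = c}.
Proof.
move=> [p0 Op0] cOm loc; have [U0 [c0 [oU0 U0p U0Om ae0]]] := loc _ Op0.
exists c0; pose A : set 'rV[R]_n := [set p | exists U, [/\ open U, U p, U `<=` Om &
  {ae leb, forall x, U (pos x) -> v x = c0}]].
have oA : open A.
  rewrite openE => p [U [oU Up UOm aeU]]; rewrite /interior.
  apply: filterS (open_nbhs_nbhs (conj oU Up)) => q Uq.
  by exists U.
pose A' := Om `\` A.
have oA' : open A'.
  rewrite openE => p [Op nAp]; have [U [c [oU Up UOm aeU]]] := loc _ Op.
  rewrite /interior; apply: filterS (open_nbhs_nbhs (conj oU Up)) => q Uq.
  split; first exact: UOm.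
  move=> [U' [oU' U'q _ aeU']]; apply: nAp; exists U; split => //.
  suff <- : c = c0 by [].
  apply: contrapT => cc0; apply: (@open_not_negligible (U `&` U') q).
  - exact: openI.
  - by [].
  - apply: filterS2 aeU aeU' => x hx hx' [Ux Ux'].
    by apply: cc0; rewrite -(hx Ux) -(hx' Ux').
have AOm : A = Om.
  apply: cOm.
  - by exists p0; exists U0; split.
  - exists A => //; apply/seteqP; split => [p [U [oU Up UOm aeU]]|p []//].
    by split; [exact: UOm|exists U].
  - exists (~` A'); first exact: open_closedC.
    apply/seteqP; split => [p Ap|p [Op nA']].
      have [U [_ Up UOm _]] := Ap; split; first exact: UOm.
      by move=> [_].
    by apply: contrapT => nA; apply: nA'.
rewrite -AOm; apply: ae_open_local => p [U [oU Up UOm aeU]].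
by exists U; split.
Qed.

End LocalToGlobal.

Section TranslationInvariance.
Context {R : realType} {n : nat} {dX : measure_display} {X : measurableType dX}.
Context {leb : {sigma_finite_measure set X -> \bar R}} {pos : X -> 'rV[R]_n}.
Context {tr : 'I_n -> R -> X -> X}.
Hypothesis ch : chart leb pos tr.
Context {Om : set 'rV[R]_n}.
Hypothesis oOm : open Om.
Local Notation D := (pos @^-1` Om).
Local Notation wder := (@wder R n dX X leb pos Om).
Implicit Types (v w : X -> R).

Let mD : measurable D. Proof. exact: (dom_measurable ch oOm). Qed.

Definition tinv i v := forall O del, line_nbhd Om i O del ->
  forall h, 0 <= h <= del -> {ae leb, forall x, O (pos x) -> v (tr i h x) = v x}.

Let trD i O del h x : line_nbhd Om i O del -> 0 <= h <= del -> O (pos x) ->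
  D (tr i h x) /\ D x.
Proof.
move=> [_ d0 hO] hh Ox; split; first by rewrite /= (ch_tr ch); exact: hO.
by have := hO _ 0 Ox; rewrite scale0r addr0; apply; rewrite lexx ltW.
Qed.

Lemma wder_cst_tr i v g c : intg leb D v -> intg leb D g -> wder i v g ->
  {ae leb, forall x, D x -> g x = c} ->
  forall O del, line_nbhd Om i O del -> forall h, 0 <= h <= del ->
  {ae leb, forall x, O (pos x) -> v (tr i h x) = v x + h * c}.
Proof.
move=> vi gi vg gc O del nb h hh; have [oO d0 hO] := nb.
have vi' := (intg_patch _ mD).1 vi.
have [ci _] := Rint_ae_eq mD gi (measurable_cst c) gc.
have ci' := (intg_patch _ mD).1 ci.
have wc : wder i (v \_ D) (cst c \_ D).
  apply: (@eq_wder R n dX X leb pos Om i v (cst c)).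
    by move=> x Dx; rewrite !patchE mem_set.
  move=> phi tphi; rewrite (vg phi tphi); congr (- _).
  have [C _ hC] := test_fun_bounded tphi.
  have mphi : measurable_fun D (fun x => phi (pos x)).
    have cphi := C1_continuous (test_fun_C1 tphi).
    exact/measurable_funTS/(pos_cont_measurable ch).
  have hC' x : D x -> `|phi (pos x)| <= C by move=> _; exact: hC.
  have [//||_ -> //] := Rint_ae_eq mD (g := fun x => cst c x * phi (pos x)) (intg_Mb mD gi mphi hC').
    by apply: measurable_funM.
  by apply: filterS gc => x + Dx => /(_ Dx) ->.
have := dq_ftc ch oOm oO d0 hO vi' ci' wc hh.
apply: filterS => x + Ox => /(_ Ox); have [D1 D2] := trD nb hh Ox.
rewrite !patchE !mem_set// => ->; congr (_ + _).
have /andP[h0 hd] := hh.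
transitivity (\int[@lebesgue_measure R]_(s in `]0, h[) (cst c s)).
  apply: eq_Rint => s /itvooP /andP[s0 sh]; rewrite patchE mem_set//.
  have /(trD nb) : 0 <= s <= del by rewrite ltW//= (le_trans (ltW sh)).
  by move=> /(_ _ Ox) [].
rewrite (Rintegral_cst (lebesgue_measure : {measure set (measurableTypeR R) -> \bar R}) (itvoo_measurable 0 h)).
rewrite /= lebesgue_measure_itv /= lte_fin; case: ltP => h'; first by rewrite sube0 mulrC.
have -> : h = 0 by apply/eqP; rewrite eq_le h0 h'.
by rewrite mul0r mulr0.
Qed.

(* Used for [w = d_2 u_1 = - d_1 u_2] when the symmetrised gradient of [u]
   vanishes: [u_1] is invariant along the first axis and [u_2] along the second,
   so [w] is invariant along both, hence constant. *)
Lemma wder_tinv i j v w : intg leb D v -> intg leb D w -> wder j v w ->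
  tinv i v -> tinv i w.
Proof.
move=> vi wi vw iv O del nb h hh; have [oO d0 hO] := nb.
have vi' := (intg_patch _ mD).1 vi; have wi' := (intg_patch _ mD).1 wi.
have mO : measurable (pos @^-1` O) by exact: (dom_measurable ch oO).
have OD x : O (pos x) -> D x by move=> Ox; have [] := trD nb hh Ox.
have itr k : intg leb setT k -> intg leb (pos @^-1` O) (fun x => k (tr i h x)).
  by move=> ki; exact: (intgS measurableT mO (@subsetT _ _) (intg_tr ch i h ki)).
have iO k : intg leb setT k -> intg leb (pos @^-1` O) k.
  by move=> ki; exact: (intgS measurableT mO (@subsetT _ _) ki).
have E (k : X -> R) (psi : 'rV[R]_n -> R) : (forall x, ~ O x -> psi x = 0) ->
    \int[leb]_(x in pos @^-1` O) ((k \_ D) x * psi (pos x)) =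
    \int[leb]_(x in D) (k x * psi (pos x)).
  move=> psi0; rewrite [LHS]Rintegral_mkcond [RHS]Rintegral_mkcond.
  apply: eq_Rint => x _; rewrite !patchE; case: ifPn => [/set_mem Ox|/negP nO].
    by rewrite mem_set//; exact: OD.
  by case: ifP => // _; rewrite psi0 ?mulr0// => /mem_set.
have := @flcv _ _ _ _ leb pos (ch_open ch) (ch_gen ch) O
  (fun x => (w \_ D) (tr i h x) - (w \_ D) x) oO (intgB mO (itr _ wi') (iO _ wi')).
move=> H; have {H} : {ae leb, forall x, O (pos x) ->
    (w \_ D) (tr i h x) - (w \_ D) x = 0}.
  apply: H => phi tphi.
  have [C _ hC] := test_fun_bounded tphi.
  have [C' _ hC'] := test_derive_bounded (delta_mx ord0 j) tphi.
  have cphi := C1_continuous (test_fun_C1 tphi).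
  have [df /(_ (delta_mx ord0 j)) cdphi] := test_fun_C1 tphi.
  pose psi x : R := 'D_(delta_mx ord0 j) phi x.
  have psi0 x : ~ O x -> psi x = 0 by exact: (test_derive_out tphi).
  have phi0 x : ~ O x -> phi x = 0 by exact: (test_fun_out tphi).
  have B (k : X -> R) f (K : R) : continuous f -> (forall x, `|f x| <= K) ->
      intg leb (pos @^-1` O) k -> intg leb (pos @^-1` O) (fun x => k x * f (pos x)).
    move=> cf hK ki; apply: (intg_Mb mO ki (C := K)) => //.
    exact/measurable_funTS/(pos_cont_measurable ch).
  rewrite (_ : \int[leb]_(x in _) _ = \int[leb]_(x in pos @^-1` O)
      ((w \_ D) (tr i h x) * phi (pos x) - (w \_ D) x * phi (pos x))); last first.
    by apply: eq_Rint => x _; rewrite mulrBl.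
  rewrite (RintB mO (B _ _ _ cphi hC (itr _ wi')) (B _ _ _ cphi hC (iO _ wi'))).
  rewrite (shift_Rint ch oOm hO wi' tphi hh) E//.
  have tphi' := shift_test hO tphi hh.
  have tphiD : test_fun Om phi.
    have [d1 d2 [K [cK KO K0]]] := tphi; split => //; exists K; split => // x /KO Ox.
    by have := hO _ 0 Ox; rewrite scale0r addr0; apply; rewrite lexx ltW.
  have wd : wder j (v \_ D) (w \_ D).
    by apply: eq_wder vw => x Dx; rewrite !patchE mem_set.
  have := wd _ tphi'; have := vw _ tphiD.
  rewrite -/psi => e1 e2.
  have {}e1 := congr1 -%R e1; have {}e2 := congr1 -%R e2; rewrite !opprK in e1 e2.
  rewrite -e1 -e2 opprK addrC; apply/eqP; rewrite subr_eq0; apply/eqP.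
  rewrite -(E v psi psi0).
  transitivity (\int[leb]_(x in pos @^-1` O) ((v \_ D) (tr i h x) * psi (pos x))).
    apply: esym; apply: (Rint_ae_eq mO _ _ _).2.
    - by apply: (B _ _ C') => //; exact: itr.
    - by apply: intg_measurable; apply: (B _ _ C') => //; exact: iO.
    - apply: filterS (iv O del nb h hh) => x + Ox => /(_ Ox) e.
      by have [D1 D2] := trD nb hh Ox; rewrite !patchE !mem_set// e.
  rewrite (shift_Rint_out ch oOm hO vi' cdphi hC' psi0 hh); apply: eq_Rint => x _.
  by have [_ ->] := @C1_translate _ _ phi ((- h) *: delta_mx ord0 i) (test_fun_C1 tphi).
apply: filterS => x + Ox => /(_ Ox) /eqP.
have [D1 D2] := trD nb hh Ox; rewrite !patchE !mem_set//.
by rewrite subr_eq0 => /eqP.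
Qed.

End TranslationInvariance.

Lemma open_shift {R : realType} {V : normedModType R} (O : set V) w : open O ->
  open [set q | O (q - w)].
Proof.
move=> oO; have /continuousP : continuous (fun q : V => q - w).
  by move=> q; apply: cvgD; [exact: cvg_id|exact: cvg_cst].
by apply.
Qed.

Section LocallyConstant.
Context {R : realType} {n : nat} {dX : measure_display} {X : measurableType dX}.
Context {leb : {sigma_finite_measure set X -> \bar R}} {pos : X -> 'rV[R]_n}.
Context {tr : 'I_n -> R -> X -> X}.
Hypothesis ch : chart leb pos tr.
Context {Om : set 'rV[R]_n}.
Hypotheses (Om0 : Om !=set0) (oOm : open Om) (cOm : connected Om).
Local Notation D := (pos @^-1` Om).

Context {add : X -> X -> X} {neg : X -> X}.
Hypothesis madd : measurable_fun setT (fun p : X * X => add p.1 p.2).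
Hypothesis pos_add : forall h x, pos (add h x) = pos x + pos h.
Hypothesis pos_neg : forall x, pos (neg x) = - pos x.
Hypothesis addC : forall h x, add h x = add x h.
Hypothesis addNK : forall h x, add h (add (neg h) x) = x.
Hypothesis ae_add : forall h (P : X -> Prop), {ae leb, forall x, P x} ->
  {ae leb, forall x, P (add h x)}.

Let mD : measurable D. Proof. exact: (dom_measurable ch oOm). Qed.

Definition all_tinv (v : X -> R) := forall (O : set 'rV[R]_n) (del : R),
  open O -> 0 < del -> (forall x h : 'rV[R]_n, O x -> (forall i, 0 <= h ord0 i <= del) -> Om (x + h)) ->
  forall h, (forall i, 0 <= pos h ord0 i <= del) ->
  {ae leb, forall x, O (pos x) -> v (add h x) = v x}.

Lemma all_tinv_const v : measurable_fun D v -> all_tinv v ->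
  exists c, {ae leb, forall x, D x -> v x = c}.
Proof.
move=> mv iv; apply: (connected_const ch Om0 cOm) => p Op.
have [r r0 hr] : exists2 r : R, 0 < r & forall q : 'rV[R]_n, (forall i, `|q ord0 i - p ord0 i| < 4 * r) -> Om q.
  have /nbhs_ballP[e e0 he] := open_nbhs_nbhs (conj oOm Op).
  exists (e / 4); first by rewrite divr_gt0.
  move=> q hq; apply: he; rewrite -ball_normE/= distrC.
  rewrite [X in X < _]/Num.norm/= mx_normrE; apply: bigmax_lt => // -[i j] _.
  by rewrite /= !mxE ord1; have := hq j; rewrite mulrCA divff ?mulr1.
pose O : set 'rV[R]_n := box (\row_i (p ord0 i - 3 * r)) (\row_i (p ord0 i - r)).
pose H : set X := pos @^-1` box (\row_i 0) (\row_i (4 * r)).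
have oO : open O by exact: box_open.
have r4 : 0 < 4 * r by lra.
have OH (x h : 'rV[R]_n) : O x -> (forall i, 0 <= h ord0 i <= 4 * r) -> Om (x + h).
  move=> Ox hh; apply: hr => i; have := Ox i; have := hh i; rewrite !mxE => h1 h2.
  by rewrite ltr_norml; apply/andP; split; lra.
have mO : measurable (pos @^-1` O) by exact: (ch_open ch).
have mH : measurable H by apply: (ch_open ch); exact: box_open.
have mvD := (measurable_restrictT _ mD).1 mv.
have A0 : {ae leb, forall h, H h -> {ae leb, forall x, O (pos x) ->
    (v \_ D) (add h x) - (v \_ D) x = 0}}.
  apply: aeW => h Hh.
  have hh i : 0 <= pos h ord0 i <= 4 * r.
    by have := Hh i; rewrite !mxE => /andP[/ltW -> /ltW ->].
  apply: filterS (iv O _ oO r4 OH h hh) => x + Ox => /(_ Ox).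
  have D1 : D (add h x) by rewrite /= pos_add; exact: OH.
  have D2 : D x by have := OH _ 0 Ox; rewrite addr0; apply => i; rewrite mxE lexx ltW.
  by rewrite !patchE !mem_set// => ->; rewrite subrr.
have mA : measurable_fun ((pos @^-1` O) `*` H)
    (fun q : X * X => (v \_ D) (add q.2 q.1) - (v \_ D) q.1).
  apply: measurable_funTS; apply: measurable_funB.
    apply: (measurableT_comp mvD).
    rewrite (_ : (fun q : X * X => _) = fun q => add q.1 q.2).
      exact: madd.
    by apply/funext => q; exact: addC.
  exact: (measurableT_comp mvD).
have sw := ae_swap (A := fun q : X * X => (v \_ D) (add q.2 q.1) - (v \_ D) q.1) mO mH mA A0.
have [x0 [Ox0 hx0]] : exists x0, O (pos x0) /\ {ae leb, forall h, H h ->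
    (v \_ D) (add h x0) - (v \_ D) x0 = 0}.
  apply: contrapT => no; apply: (@open_not_negligible _ _ _ _ _ _ _ ch O (\row_i (p ord0 i - 2 * r))) => //.
    by move=> i; rewrite !mxE; apply/andP; split; lra.
  by apply: filterS sw => x hx Ox; apply: no; exists x; split => //; exact: hx.
exists [set q | box (\row_i 0) (\row_i (4 * r)) (q - pos x0)], ((v \_ D) x0); split.
- exact/open_shift/box_open.
- by move=> i; have := Ox0 i; rewrite !mxE => h; apply/andP; split; lra.
- move=> q /= hq; apply: hr => i; have := Ox0 i; have := hq i; rewrite !mxE => h1 h2.
  by rewrite ltr_norml; apply/andP; split; lra.
apply: filterS (ae_add (neg x0) hx0) => x hx /= xU.
have Hx : H (add (neg x0) x) by rewrite /H /= pos_add pos_neg.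
have := hx Hx; rewrite addC addNK => /eqP; rewrite subr_eq0 => /eqP <-.
rewrite patchE mem_set//=.
apply: hr => i; have := Ox0 i; have := xU i; rewrite !mxE => h1 h2.
by rewrite ltr_norml; apply/andP; split; lra.
Qed.

End LocallyConstant.

Section Lines.
Context {R : realType} {Om : set 'rV[R]_1}.
Hypotheses (Om0 : Om !=set0) (oOm : open Om) (cOm : connected Om).
Local Notation leb := (@lebesgue_measure R).
Local Notation mR := (measurableTypeR R).
Local Notation D := (@pos1 R @^-1` Om).

Lemma tinv_const1 (v : mR -> R) : measurable_fun D v ->
  (forall i, @tinv R 1 _ mR leb (@pos1 R) (@tr1 R) Om i v) ->
  exists c, {ae leb, forall x, D x -> v x = c}.
Proof.
move=> mv iv.
apply: (@all_tinv_const R 1 _ mR leb _ _ (@chart1 R) _ Om0 oOm cOm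
  (fun h x => h + x) (fun x => - x)) => //.
- by apply: measurable_funD.
- by move=> h x; apply/rowP => i; rewrite !mxE addrC.
- by move=> x; apply/rowP => i; rewrite !mxE.
- by move=> h x; rewrite addrC.
- by move=> h x; rewrite addNKr.
- move=> h P /(ae_tr (@chart1 R) ord0 h); apply: filterS => x.
  by rewrite /tr1 addrC.
- move=> O del oO d0 hO h hh.
  have := iv ord0 O del; rewrite /tinv => /(_ _ (h : R)); rewrite /tr1.
  have hh0 : 0 <= h <= del by have := hh ord0; rewrite mxE.
  move=> /(_ _ hh0) H; have : line_nbhd Om ord0 O del.
    split => // x s Ox hs; apply: hO => // i; rewrite !mxE !ord1 eqxx /=.
    by rewrite mulr1.
  move=> /H; apply: filterS => x; by rewrite addrC.
Qed.

End Lines.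

Section Planes.
Context {R : realType} {Om : set 'rV[R]_2}.
Hypotheses (Om0 : Om !=set0) (oOm : open Om) (cOm : connected Om).
Local Notation leb := (@lebesgue2 R).
Local Notation mR := (measurableTypeR R).
Local Notation D := (@pos2 R @^-1` Om).
Local Notation tinv := (@tinv R 2 _ (mR * mR)%type leb (@pos2 R) (@tr2 R) Om).

Lemma tr2_tr2 (h x : mR * mR) : tr2 ord_max h.2 (tr2 ord0 h.1 x) = (h.1 + x.1, h.2 + x.2).
Proof. by rewrite /tr2 /= /tr1 !(addrC _ h.1) !(addrC _ h.2). Qed.

Lemma tinv_const2 (v : mR * mR -> R) : measurable_fun D v ->
  (forall i, tinv i v) ->
  exists c, {ae leb, forall x, D x -> v x = c}.
Proof.
move=> mv iv.
apply: (@all_tinv_const R 2 _ (mR * mR)%type leb _ _ (@chart2 R) _ Om0 oOm cOm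
  (fun h x => (h.1 + x.1, h.2 + x.2)) (fun x => (- x.1, - x.2))) => //.
- apply: measurable_fun_pair; apply: measurable_funD.
  + exact: (measurableT_comp measurable_fst measurable_fst).
  + exact: (measurableT_comp measurable_fst measurable_snd).
  + exact: (measurableT_comp measurable_snd measurable_fst).
  + exact: (measurableT_comp measurable_snd measurable_snd).
- by move=> h x; apply/rowP => i; rewrite !mxE /=; case: ifP => _; rewrite addrC.
- by move=> x; apply/rowP => i; rewrite !mxE; case: ifP.
- by move=> h x; rewrite addrC [h.2 + _]addrC.
- by move=> h [x y] /=; rewrite !addNKr.
- move=> h P /(ae_tr (@chart2 R) ord_max h.2)/(ae_tr (@chart2 R) ord0 h.1).
  by apply: filterS => x; rewrite tr2_tr2.
- move=> O del oO d0 hO h hh.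
  have h0 : 0 <= h.1 <= del by have := hh ord0; rewrite mxE.
  have h1 : 0 <= h.2 <= del by have := hh ord_max; rewrite mxE.
  pose e0 : 'rV[R]_2 := delta_mx ord0 ord0.
  pose O' : set 'rV[R]_2 := [set y | O (y - h.1 *: e0)].
  have nb0 : line_nbhd Om ord0 O del.
    split => // x s Ox hs; apply: hO => // i; rewrite !mxE /=.
    by case: (i == ord0); rewrite /= ?mulr1 ?mulr0// lexx ltW.
  have nb1 : line_nbhd Om ord_max O' del.
    split => //.
      exact: open_shift.
    move=> x s Ox hs; rewrite -[x](subrK (h.1 *: e0)) -addrA; apply: hO => // i.
    rewrite !mxE /=; case: (unliftP ord0 i) => [j ->|->].
      by rewrite (ord1 j) /= !(mulr0, mulr1) add0r.
    by rewrite /= !(mulr0, mulr1) addr0.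
  have H0 := iv ord0 O del nb0 h.1 h0.
  have H1 := ae_tr (@chart2 R) ord0 h.1 (iv ord_max O' del nb1 h.2 h1).
  apply: filterS2 H0 H1 => x; rewrite tr2_tr2 => H0 H1 Ox.
  rewrite H1 ?H0//; rewrite /O' /= (ch_tr (@chart2 R)) addrK.
  exact: Ox.
Qed.

End Planes.

Definition rigid {R : realType} {m n : nat} {dX : measure_display}
    {X : measurableType dX} (leb : {sigma_finite_measure set X -> \bar R})
    (pos : X -> 'rV[R]_n) (Om : set 'rV[R]_n)
    (P : 'M[R]_(m, n) -> 'M[R]_(m, n)) := forall u Du,
  H1v leb pos Om u Du -> ae_dom leb pos Om (fun x => P (Du x) = 0) ->
  exists A c, P A = 0 /\ ae_dom leb pos Om (fun x => u x = c + x *m A^T).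

Section Gradients.
Context {R : realType} {n : nat} {dX : measure_display} {X : measurableType dX}.
Context {leb : {sigma_finite_measure set X -> \bar R}} {pos : X -> 'rV[R]_n}.
Context {tr : 'I_n -> R -> X -> X}.
Hypothesis ch : chart leb pos tr.
Context {Om : set 'rV[R]_n}.
Hypotheses (oOm : open Om) (bOm : bounded_set Om).
Local Notation D := (pos @^-1` Om).
Local Notation H1 := (H1 leb pos Om).
Local Notation tinv := (@tinv R n _ X leb pos tr Om).

Let mD : measurable D. Proof. exact: (dom_measurable ch oOm). Qed.
Let fD := dom_fin ch oOm bOm.

Lemma line_nbhd_sub i O del x h : line_nbhd Om i O del -> 0 <= h <= del ->
  O (pos x) -> D (tr i h x) /\ D x.
Proof.
move=> [_ d0 hO] hh Ox; split; first by rewrite /= (ch_tr ch); exact: hO.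
by have := hO _ 0 Ox; rewrite scale0r addr0; apply; rewrite lexx ltW.
Qed.

Lemma H1_intg u Du i : H1 u Du ->
  intg leb D (fun x => u (pos x)) /\ intg leb D (fun x => Du (pos x) ord0 i).
Proof.
move=> [/(L2P ch oOm) u2 /(_ i)/(L2P ch oOm) d2 _].
by split; [exact: (sqi_intg mD fD u2)|exact: (sqi_intg mD fD d2)].
Qed.

Lemma H1_cst_tr u Du i c : H1 u Du ->
  {ae leb, forall x, D x -> Du (pos x) ord0 i = c} ->
  forall O del, line_nbhd Om i O del -> forall h, 0 <= h <= del ->
  {ae leb, forall x, O (pos x) -> u (pos (tr i h x)) = u (pos x) + h * c}.
Proof.
move=> hu hc; have [ui di] := H1_intg i hu.
exact: (wder_cst_tr ch oOm ui di (H1_wder i hu) hc).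
Qed.

Lemma H1_tinv u Du i : H1 u Du ->
  {ae leb, forall x, D x -> Du (pos x) ord0 i = 0} -> tinv i (fun x => u (pos x)).
Proof.
move=> hu h0 O del nb h hh; apply: filterS (H1_cst_tr hu h0 nb hh) => x + Ox.
by move=> /(_ Ox) ->; rewrite mulr0 addr0.
Qed.

Lemma tinv_ae i (f : R -> R) v w : {ae leb, forall x, D x -> w x = f (v x)} ->
  tinv i v -> tinv i w.
Proof.
move=> vw iv O del nb h hh.
apply: filterS3 vw (ae_tr ch i h vw) (iv O del nb h hh) => x h1 h2 h3 Ox.
by have [D1 D2] := line_nbhd_sub nb hh Ox; rewrite h1// h2// h3.
Qed.

End Gradients.

Section Rigidity1.
Context {R : realType} {Om : set 'rV[R]_1}.
Hypotheses (Om0 : Om !=set0) (oOm : open Om) (cOm : connected Om) (bOm : bounded_set Om).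
Local Notation leb := (@lebesgue_measure R).

#[local] Instance leb1_filter7 : Filter (nbhs (almost_everywhere leb)) :=
  ae_filter_ringOfSetsType leb.

Lemma rigid_symp1 : rigid leb (@pos1 R) Om (@symp R 1).
Proof.
move=> u Du hu.
rewrite -[ae_dom _ _ _ _]/({ae leb, forall x, (@pos1 R @^-1` Om) x -> symp (Du (pos1 x)) = 0}) => P0.
have i0 : forall i, @tinv R 1 _ _ leb (@pos1 R) (@tr1 R) Om i (fun x => u (pos1 x) ord0 ord0).
  move=> i; apply: (H1_tinv (@chart1 R) oOm bOm (hu ord0)).
  apply: filterS P0 => x + Dx => /(_ Dx)/matrixP/(_ ord0 ord0).
  by rewrite (ord1 i) !mxE; lra.
have [/(L2P (@chart1 R) oOm)[mu _] _ _] := hu ord0.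
have [c hc] := tinv_const1 Om0 oOm cOm mu i0.
exists 0, (\row_i c); split; first by rewrite /symp trmx0 addr0 scaler0.
apply: filterS hc => x + Dx => /(_ Dx) h.
by apply/rowP => i; rewrite trmx0 mulmx0 addr0 !mxE (ord1 i).
Qed.

End Rigidity1.

Section Rigidity2.
Context {R : realType} {Om : set 'rV[R]_2}.
Hypotheses (Om0 : Om !=set0) (oOm : open Om) (cOm : connected Om) (bOm : bounded_set Om).
Local Notation leb := (@lebesgue2 R).
Local Notation mR := (measurableTypeR R).
Local Notation D := (@pos2 R @^-1` Om).
Local Notation tinv := (@tinv R 2 _ (mR * mR)%type leb (@pos2 R) (@tr2 R) Om).
Let ch := @chart2 R.
#[local] Instance leb2_filter : Filter (nbhs (almost_everywhere leb)) :=
  ae_filter_ringOfSetsType leb.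

Lemma rigid_id2 : rigid leb (@pos2 R) Om (@id 'M[R]_(1, 2)).
Proof.
move=> u Du hu.
rewrite -[ae_dom _ _ _ _]/({ae leb, forall x, D x -> Du (pos2 x) = 0}) => P0.
have i0 : forall i, tinv i (fun x => u (pos2 x) ord0 ord0).
  move=> i; apply: (H1_tinv ch oOm bOm (hu ord0)).
  by apply: filterS P0 => x + Dx => /(_ Dx) ->; rewrite !mxE.
have [/(L2P ch oOm)[mu _] _ _] := hu ord0.
have [c hc] := tinv_const2 Om0 oOm cOm mu i0.
exists 0, (\row_i c); split => //.
apply: filterS hc => x + Dx => /(_ Dx) h.
by apply/rowP => i; rewrite trmx0 mulmx0 addr0 !mxE (ord1 i).
Qed.

Lemma tr2_pos i j h x : @pos2 R (tr2 i h x) ord0 j = pos2 x ord0 j + h * (j == i)%:R.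
Proof. by rewrite (ch_tr ch) !mxE eqxx. Qed.

Lemma affine_const i j u Du c : i != j -> H1 leb (@pos2 R) Om u Du ->
  {ae leb, forall x, D x -> Du (pos2 x) ord0 i = 0} ->
  {ae leb, forall x, D x -> Du (pos2 x) ord0 j = c} ->
  exists k, {ae leb, forall x, D x -> u (pos2 x) = k + c * pos2 x ord0 j}.
Proof.
move=> ij hu di dj.
have it l : tinv l (fun x => u (pos2 x) - c * pos2 x ord0 j).
  have [->|lj] := eqVneq l j.
    move=> O del nb h hh; apply: filterS (H1_cst_tr ch oOm bOm hu dj nb hh) => x + Ox.
    by move=> /(_ Ox) ->; rewrite tr2_pos eqxx mulr1; ring.
  have -> : l = i.
    move: ij lj; case: i {di} => -[|[|//]] ?; case: j {dj} => -[|[|//]] ?; case: l => -[|[|//]] ?;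
      rewrite -!val_eqE//= => _ _; exact: val_inj.
  move=> O del nb h hh; apply: filterS (H1_tinv ch oOm bOm hu di nb hh) => x + Ox.
  by move=> /(_ Ox) ->; rewrite tr2_pos eq_sym (negbTE ij) mulr0 addr0.
have [/(L2P ch oOm)[mu _] _ _] := hu.
have mv : measurable_fun D (fun x => u (pos2 x) - c * pos2 x ord0 j).
  apply: measurable_funB => //; apply: measurable_funM => //.
  have cj : continuous (fun p : 'rV[R]_2 => p ord0 j) by exact: coord_continuous.
  exact: (measurable_funTS (pos_cont_measurable ch cj)).
have [k hk] := tinv_const2 Om0 oOm cOm mv it.
by exists k; apply: filterS hk => x + Dx => /(_ Dx) <-; rewrite subrK.
Qed.

Lemma rigid_symp2 : rigid leb (@pos2 R) Om (@symp R 2).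
Proof.
move=> u Du hu.
rewrite -[ae_dom _ _ _ _]/({ae leb, forall x, D x -> symp (Du (pos2 x)) = 0}) => P0.
pose o1 : 'I_2 := ord_max.
have E i j : {ae leb, forall x, D x -> Du (pos2 x) i j = - Du (pos2 x) j i}.
  apply: filterS P0 => x + Dx => /(_ Dx)/matrixP/(_ i j).
  by rewrite !mxE; lra.
have Ed i : {ae leb, forall x, D x -> row i (Du (pos2 x)) ord0 i = 0}.
  by apply: filterS (E i i) => x + Dx => /(_ Dx); rewrite mxE; lra.
have [i1 _] := H1_intg ch oOm bOm ord0 (hu ord0).
have [_ w1] := H1_intg ch oOm bOm o1 (hu ord0).
have [i2 _] := H1_intg ch oOm bOm ord0 (hu o1).
have [_ w2] := H1_intg ch oOm bOm ord0 (hu o1).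
have it0 := wder_tinv ch oOm i1 w1 (H1_wder o1 (hu ord0)) (H1_tinv ch oOm bOm (hu ord0) (Ed ord0)).
have it1 := wder_tinv ch oOm i2 w2 (H1_wder ord0 (hu o1)) (H1_tinv ch oOm bOm (hu o1) (Ed o1)).
have [c hc] : exists c, {ae leb, forall x, D x -> row ord0 (Du (pos2 x)) ord0 o1 = c}.
  apply: (tinv_const2 Om0 oOm cOm (intg_measurable w1)) => l.
  have [->//|l0] := eqVneq l ord0.
  have -> : l = o1 by move: l l0 => [[|[|//]] ?] // _; exact: val_inj.
  apply: (tinv_ae ch (f := -%R) _ it1).
  by apply: filterS (E ord0 o1) => x + Dx => /(_ Dx); rewrite !mxE.
have hc' : {ae leb, forall x, D x -> row o1 (Du (pos2 x)) ord0 ord0 = - c}.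
  apply: filterS2 hc (E o1 ord0) => x h1 h2 Dx.
  by rewrite mxE h2// -(h1 Dx) mxE.
have [k1 hk1] := affine_const (i := ord0) (j := o1) isT (hu ord0) (Ed ord0) hc.
have [k2 hk2] := affine_const (i := o1) (j := ord0) isT (hu o1) (Ed o1) hc'.
pose A : 'M[R]_2 := \matrix_(i, j) (c * ((j : nat)%:R - (i : nat)%:R)).
exists A, (\row_i (if i == ord0 then k1 else k2)); split.
  by apply/matrixP => i j; rewrite !mxE; ring.
apply: filterS2 hk1 hk2 => x h1 h2 Dx; apply/rowP => j; rewrite !mxE big_ord_recl big_ord1.
rewrite /A !mxE; move: j => [[|[|//]] lj].
  rewrite (_ : Ordinal lj = ord0); last exact: val_inj.
  by transitivity (k1 + c * pos2 x ord0 o1); [exact: h1|rewrite !mxE lift0 /=; ring].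
rewrite (_ : Ordinal lj = o1); last exact: val_inj.
by transitivity (k2 + - c * pos2 x ord0 ord0); [exact: h2|rewrite !mxE lift0 /=; ring].
Qed.

End Rigidity2.

Section Uniqueness.
Context {R : realType} {m k : nat} {dX : measure_display} {X : measurableType dX}.
Context {leb : {sigma_finite_measure set X -> \bar R}} {pos : X -> 'rV[R]_k.+1}.
Context {tr : 'I_k.+1 -> R -> X -> X}.
Hypothesis ch : chart leb pos tr.
Context {Om : set 'rV[R]_k.+1}.
Hypothesis lOm : lipschitz_domain Om.
Context {T lambda theta kappa1 kappa2 : R}.
Hypotheses (T0 : 0 < T) (lam0 : 0 < lambda) (th0 : 0 < theta)
  (k10 : 0 < kappa1) (k20 : 0 < kappa2).
Context {P : 'M[R]_(m, k.+1) -> 'M[R]_(m, k.+1)} {Wel : R -> 'M[R]_(m, k.+1) -> R}.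
Context {bf : 'M[R]_(m, k.+1) -> 'M[R]_(m, k.+1) -> R} {e0 dl : 'M[R]_(m, k.+1)} {c0 c1 : R}.

Local Notation leb1 := (@lebesgue_measure R).
#[local] Instance leb1_filter8 : Filter (nbhs (almost_everywhere leb1)) :=
  ae_filter_ringOfSetsType leb1.

Lemma unique_of_rigid sig : quadratic_energy P Wel bf e0 dl c0 c1 ->
  rigid leb pos Om P ->
  unique_weak_solution leb pos Om T lambda theta kappa1 kappa2 P Wel sig.
Proof.
have [_ oOm _ bOm _] := lOm.
move=> qe rg a0 b0 _ a1 b1 u1 a2 b2 u2 w1 cl1 w2 cl2.
have [ha hb [Du1 [Du2 [h1 h2 h3]]]] :=
  weak_solution_diff ch oOm bOm T0 lam0 th0 k10 k20 qe w1 cl1 w2 cl2.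
split.
  move=> t ht; apply: filterS2 (ha t ht) (hb t ht) => x h h' Dx.
  by split; [exact: h|exact: h'].
move: h1 h2 h3; rewrite /ae_time => h1 h2 h3.
apply: filterS3 h1 h2 h3 => t h1 h2 h3 tT.
have hd : H1v leb pos Om (fun x => u1 t x - u2 t x) (fun x => Du1 t x - Du2 t x).
  move=> l; have := H1B ch oOm bOm (h1 tT l) (h2 tT l).
  apply: (eq_H1 ch oOm) => x _; split; first by rewrite !mxE.
  by apply/rowP => i; rewrite !mxE.
exact: (rg _ _ hd (h3 tT)).
Qed.

End Uniqueness.

(** * The relaxed energies *)

Import VectorInternalTheory.

Section GeneralizedEigenvalue.
Context {R : realType} {V : vectType R} {f g : V -> V -> R}.
Hypothesis fl : forall k x y z, f (k *: x + y) z = k * f x z + f y z.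
Hypothesis gl : forall k x y z, g (k *: x + y) z = k * g x z + g y z.
Hypothesis fC : forall x y, f x y = f y x.
Hypothesis gC : forall x y, g x y = g y x.
Hypothesis g0 : forall x, x != 0 -> 0 < g x x.
Local Notation n := (dim V).

Let quad_cont (h : V -> V -> R) :
  (forall k x y z, h (k *: x + y) z = k * h x z + h y z) ->
  (forall x y, h x y = h y x) -> continuous (fun v : 'rV[R]_n => h (r2v v) (r2v v)).
Proof.
move=> hl hC.
have h0 z : h 0 z = 0 by have := hl 1 0 0 z; rewrite scaler0 add0r mul1r; lra.
have hZ k x z : h (k *: x) z = k * h x z by have := hl k x 0 z; rewrite addr0 h0 addr0.
have hs (J : Type) (s : seq J) (F : J -> V) z :
    h (\sum_(j <- s) F j) z = \sum_(j <- s) h (F j) z.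
  elim: s => [|j s IH]; first by rewrite !big_nil h0.
  by rewrite !big_cons -[F j]scale1r hl mul1r IH scale1r.
pose b i : V := r2v (delta_mx ord0 i : 'rV[R]_n).
have E v : r2v v = \sum_i v ord0 i *: b i.
  by rewrite {1}[v]row_sum_delta linear_sum; apply: eq_bigr => i _; rewrite linearZ.
have cs (J : Type) (s : seq J) (F : J -> 'rV[R]_n -> R) :
    (forall j, continuous (F j)) -> continuous (fun v => \sum_(j <- s) F j v).
  move=> cF; elim: s => [|j s IH].
    rewrite (_ : (fun v => _) = fun=> 0); last by apply/funext => v; rewrite big_nil.
    exact: cst_continuous.
  rewrite (_ : (fun v => _) = fun v => F j v + \sum_(l <- s) F l v); last first.
    by apply/funext => v; rewrite big_cons.
  by move=> v; exact: (cvgD (cF j v) (IH v)).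
rewrite (_ : (fun v => _) = fun v : 'rV[R]_n =>
    \sum_i \sum_j v ord0 i * (v ord0 j * h (b j) (b i))); last first.
  apply/funext => v; rewrite E hs; apply: eq_bigr => i _.
  by rewrite hZ hC hs mulr_sumr; apply: eq_bigr => j _; rewrite hZ.
apply: (cs _ _ (fun i v => \sum_j v ord0 i * (v ord0 j * h (b j) (b i)))) => i.
apply: (cs _ _ (fun j v => v ord0 i * (v ord0 j * h (b j) (b i)))) => j v.
exact: (cvgM (@coord_continuous _ _ _ ord0 i v)
  (cvgM (@coord_continuous _ _ _ ord0 j v) (cvg_cst _))).
Qed.

Lemma max_generalized_eigenvalue : (exists x : V, x != 0) -> exists M x,
  [/\ x != 0, forall y, f x y = M * g x y & forall y, f y y <= M * g y y].
Proof.
move=> [x0 x00].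
have f0 z : f 0 z = 0 by have := fl 1 0 0 z; rewrite scaler0 add0r mul1r; lra.
have gg0 z : g 0 z = 0 by have := gl 1 0 0 z; rewrite scaler0 add0r mul1r; lra.
have fZ k x z : f (k *: x) z = k * f x z by have := fl k x 0 z; rewrite addr0 f0 addr0.
have gZ k x z : g (k *: x) z = k * g x z by have := gl k x 0 z; rewrite addr0 gg0 addr0.
have fZ2 k x : f (k *: x) (k *: x) = k ^+ 2 * f x x by rewrite fZ fC fZ mulrA expr2.
have gZ2 k x : g (k *: x) (k *: x) = k ^+ 2 * g x x by rewrite gZ gC gZ mulrA expr2.
pose K : set 'rV[R]_n := [set v | `|v| = 1].
have r2v0 (v : 'rV[R]_n) : v != 0 -> r2v v != 0.
  by apply: contraNneq => h; apply/eqP/r2v_inj; rewrite h linear0.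
have K0 v : K v -> r2v v != 0.
  by move=> Kv; apply: r2v0; rewrite -normr_eq0 Kv oner_eq0.
have nrm (y : V) : y != 0 -> exists v k, [/\ K v, k != 0 & y = k *: r2v v].
  move=> y0; have v0 : `|v2r y| != 0.
    rewrite normr_eq0; apply: contra y0 => /eqP h; apply/eqP.
    by rewrite -[y]v2rK h linear0.
  exists (`|v2r y|^-1 *: v2r y), `|v2r y|; split => //.
    by rewrite /K /= normrZ normfV normr_id mulVf.
  have e : r2v (v2r y) = y := v2rK y.
  have -> : r2v (`|v2r y|^-1 *: v2r y) = `|v2r y|^-1 *: r2v (v2r y) by exact: linearZ.
  by rewrite scalerA mulfV// scale1r e.
have cK : compact K.
  apply: bounded_closed_compact.
    by exists 1; split => // t t1 v Kv; rewrite /= Kv ltW.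
  rewrite (_ : K = (fun v : 'rV[R]_n => `|v|) @^-1` [set 1]) //.
  apply: (@closed_comp _ _ (fun v : 'rV[R]_n => `|v|)); last exact: closed_eq.
  by move=> v _; exact: norm_continuous.
pose q (v : 'rV[R]_n) := f (r2v v) (r2v v) / g (r2v v) (r2v v).
have cq : {within K, continuous q}.
  apply: continuous_in_subspaceT => v /set_mem Kv.
  have gv : g (r2v v) (r2v v) != 0 by rewrite gt_eqF// g0// K0.
  exact: (cvgM (quad_cont fl fC (x := v)) (cvgV gv (quad_cont gl gC (x := v)))).
have K1 : K !=set0 by have [v [k [Kv _ _]]] := nrm _ x00; exists v.
have [v /set_mem Kv vmax] := EVT_max_rV K1 cK cq.
have le y : f y y <= q v * g y y.
  have [->|y0] := eqVneq y 0; first by rewrite f0 gg0 mulr0.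
  have [w [k [Kw k0 ->]]] := nrm _ y0; rewrite fZ2 gZ2 mulrCA.
  rewrite ler_wpM2l ?sqr_ge0// -ler_pdivrMr ?g0 ?K0//.
  by apply: vmax; exact/mem_set.
exists (q v), (r2v v); split => //; first exact: K0.
move=> y; set x := r2v v; set M := q v.
have Mx : M * g x x = f x x by rewrite /M /q divfK// gt_eqF// g0// K0.
pose B := M * g x y - f x y; pose C := M * g y y - f y y.
have h t : 0 <= 2 * t * B + t ^+ 2 * C.
  have := le (t *: y + x); rewrite !(fl, gl) !(fC _ (t *: y + x)) !(gC _ (t *: y + x)).
  rewrite !(fl, gl) -/M (fC y x) (gC y x); have := Mx.
  by rewrite /B /C => Mx'; rewrite -subr_ge0; nra.
have C0 : 0 <= C by rewrite subr_ge0.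
suff : B = 0 by move/eqP; rewrite subr_eq0 => /eqP.
have hB := h (- B / (C + 1)).
have C1 : 0 < C + 1 by lra.
apply/eqP; rewrite -sqrf_eq0 eq_le sqr_ge0 andbT.
have E : 2 * (- B / (C + 1)) * B + (- B / (C + 1)) ^+ 2 * C =
    - (B ^+ 2 * ((C + 2) / (C + 1) ^+ 2)).
  by field; rewrite gt_eqF.
move: hB; rewrite E oppr_ge0 => hB.
have pos : 0 < (C + 2) / (C + 1) ^+ 2.
  by rewrite divr_gt0 ?exprn_gt0//; lra.
by move: hB; rewrite pmulr_lle0.
Qed.

End GeneralizedEigenvalue.

Lemma det22 {R : comPzRingType} (A : 'M[R]_2) :
  \det A = A ord0 ord0 * A ord_max ord_max - A ord0 ord_max * A ord_max ord0.
Proof.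
rewrite (expand_det_row _ ord0) big_ord_recl big_ord1 /cofactor !det_mx11 !mxE /=.
have -> : lift ord0 ord0 = ord_max :> 'I_2 by exact: val_inj.
have -> : lift ord_max ord0 = ord0 :> 'I_2 by exact: val_inj.
by rewrite expr0 mul1r expr1 mulN1r mulrN.
Qed.

Section SymmetricTensors.
Context {R : realType}.
Implicit Types (x y z : Sym2 R) (k : R).

Lemma sym2vP (A : 'M[R]_2) : reflect (A^T = A) (A \in sym2v R).
Proof. have h : linfun (@trmx R 2 2) A = A^T by exact: lfunE.
by rewrite /sym2v -{1}h; exact: fixedSpaceP. Qed.

Lemma vsval_sym x : (vsval x)^T = vsval x.
Proof. exact/sym2vP/subvsP. Qed.

Lemma dot2_coord x y : dot2 x y =
  vsval x ord0 ord0 * vsval y ord0 ord0 + vsval x ord_max ord_max * vsval y ord_max ord_max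
  + 2 * (vsval x ord0 ord_max * vsval y ord0 ord_max).
Proof.
have sx := congr1 (fun A : 'M[R]_2 => A ord0 ord_max) (vsval_sym x); have sy := congr1 (fun A : 'M[R]_2 => A ord0 ord_max) (vsval_sym y).
rewrite !mxE in sx sy.
rewrite /dot2 frobE !big_ord_recl !big_ord0.
have -> : lift ord0 ord0 = ord_max :> 'I_2 by exact: val_inj.
by rewrite sx sy; ring.
Qed.

Lemma dot2C x y : dot2 x y = dot2 y x.
Proof. by rewrite !dot2_coord; ring. Qed.

Lemma dot2_lin k x y z : dot2 (k *: x + y) z = k * dot2 x z + dot2 y z.
Proof. by rewrite !dot2_coord linearP !mxE; ring. Qed.

Lemma dot2Zl k x z : dot2 (k *: x) z = k * dot2 x z.
Proof. by rewrite !dot2_coord linearZ !mxE; ring. Qed.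

Lemma dot2Bl x y z : dot2 (x - y) z = dot2 x z - dot2 y z.
Proof. by rewrite !dot2_coord linearB !mxE; ring. Qed.

Lemma dot2Br x y z : dot2 z (x - y) = dot2 z x - dot2 z y.
Proof. by rewrite !(dot2C z) dot2Bl. Qed.

Lemma dot2_gt0 x : x != 0 -> 0 < dot2 x x.
Proof.
move=> x0; rewrite lt_neqAle frob_ge0 andbT eq_sym; apply: contra x0 => /eqP.
rewrite dot2_coord => h.
set a := vsval x ord0 ord0 in h; set b := vsval x ord_max ord_max in h.
set c := vsval x ord0 ord_max in h.
have a0 : a = 0 by nra.
have b0 : b = 0 by nra.
have cc : c = 0 by nra.
have sx := congr1 (fun A : 'M[R]_2 => A ord0 ord_max) (vsval_sym x); rewrite mxE -/c in sx.
apply/eqP/val_inj/matrixP => i j; rewrite [in RHS]linear0 mxE.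
have o (l : 'I_2) : l = ord0 \/ l = ord_max.
  by case: l => [[|[|//]] hl]; [left|right]; exact: val_inj.
by case: (o i) => ->; case: (o j) => ->; rewrite ?sx.
Qed.

Lemma dot2_nondeg x : (forall y, dot2 x y = 0) -> x = 0.
Proof.
move=> h; apply/eqP/negPn/negP => /dot2_gt0.
by rewrite h ltxx.
Qed.

Lemma T2E x : vsval (T2 x) = vsval x - (\tr (vsval x))%:M.
Proof.
pose t (y : Sym2 R) := vsproj (sym2v R) (vsval y - (\tr (vsval y))%:M).
have tl : linear t.
  move=> k y z; rewrite /t -linearP; congr (vsproj _ _).
  have -> : vsval (k *: y + z) = k *: vsval y + vsval z by exact: linearP.
  rewrite mxtraceD mxtraceZ; apply/matrixP => i j; rewrite !mxE.
  by case: (i == j); rewrite ?mulr1n ?mulr0n; ring.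
pose tL : {linear Sym2 R -> Sym2 R} := HB.pack t
  (GRing.isLinear.Build R (Sym2 R) (Sym2 R) *:%R t tl).
rewrite (_ : T2 x = t x); last exact: (lfunE tL x).
rewrite /t vsprojK//; apply/sym2vP.
by rewrite linearB /= tr_scalar_mx vsval_sym.
Qed.

Lemma dot2_T2 x y : dot2 (T2 x) y =
  dot2 x y - (vsval x ord0 ord0 + vsval x ord_max ord_max) *
             (vsval y ord0 ord0 + vsval y ord_max ord_max).
Proof.
rewrite !dot2_coord T2E !mxE /= /mxtrace !big_ord_recl !big_ord0.
have -> : lift ord0 ord0 = ord_max :> 'I_2 by exact: val_inj.
by rewrite !mulr0n !mulr1n; ring.
Qed.

Lemma T2_sym x y : dot2 (T2 x) y = dot2 x (T2 y).
Proof. by rewrite [RHS]dot2C !dot2_T2 dot2C; ring. Qed.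

Lemma det_dot2 x : - \det (vsval x) = 2^-1 * dot2 (T2 x) x.
Proof.
rewrite dot2_T2 dot2_coord det22.
have sx := congr1 (fun A : 'M[R]_2 => A ord0 ord_max) (vsval_sym x); rewrite mxE in sx.
by rewrite sx; field.
Qed.

End SymmetricTensors.

Section BetaStar.
Context {R : realType}.
Variable alpha : 'End(Sym2 R).
Hypothesis ap : sym_posdef alpha.
Implicit Types (x y z : Sym2 R) (b d : R).

Let aC x y : dot2 (alpha x) y = dot2 x (alpha y). Proof. by case: ap. Qed.
Let a0 x : x != 0 -> 0 < dot2 (alpha x) x. Proof. by case: ap => _; exact. Qed.

Lemma dot2_0l x : dot2 (0 : Sym2 R) x = 0.
Proof. by rewrite -(scale0r (0 : Sym2 R)) dot2Zl mul0r. Qed.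

Lemma dot2_0r x : dot2 x (0 : Sym2 R) = 0.
Proof. by rewrite dot2C dot2_0l. Qed.

Lemma dot2_selfadj_sub (f : 'End(Sym2 R)) x y :
  (forall x y, dot2 (f x) y = dot2 x (f y)) ->
  dot2 (f (x - y)) (x - y) = dot2 (f x) x - 2 * dot2 (f y) x + dot2 (f y) y.
Proof.
move=> fC; have -> : f (x - y) = f x - f y by exact: linearB.
have e : dot2 (f x) y = dot2 (f y) x by rewrite fC dot2C.
by rewrite (dot2Bl (f x)) (dot2Br x y (f x)) (dot2Br x y (f y)) e; ring.
Qed.

Lemma posdef_lker0 (f : 'End(Sym2 R)) : (forall x, x != 0 -> 0 < dot2 (f x) x) -> lker f == 0%VS.
Proof.
move=> f0; apply/lker0P => x y fxy; apply/eqP; rewrite -subr_eq0.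
have fB : f (x - y) = f x - f y by exact: linearB.
by apply/negPn/negP => /f0; rewrite fB fxy subrr dot2_0l ltxx.
Qed.

(* Without a square root, [inv_sqrt alpha] would be the default value [0], and
   then [gamma alpha] would be [0^-1 = 0]. *)
Lemma inv_sqrt_spec : 0 < gamma alpha ->
  sym_posdef (inv_sqrt alpha) /\ (inv_sqrt alpha \o inv_sqrt alpha = alpha^-1)%VF.
Proof.
rewrite /gamma /inv_sqrt invr_gt0; case: xgetP => [S -> //|_].
rewrite /largest_eigenvalue; set E := [set _ | _] => h; exfalso; move: h.
have E0 l : E l -> l = 0.
  rewrite /E /= => El; apply/eqP/negPn/negP => l0; move: El; rewrite /passmx.leigenvalue.
  move=> /negP; apply; apply/lker0P => x y.
  rewrite !lfunE /= !lfunE /= !lfunE /= !lfunE /=.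
  by rewrite !sub0r => /oppr_inj/(scalerI l0); rewrite ?lfunE.
have [e|/set0P[l El]] := eqVneq E set0; first by rewrite e sup0 ltxx.
rewrite ltNge => /negP; apply; apply: ge_sup; first by exists l.
by move=> x /E0 ->.
Qed.

Lemma posdef_sub_T2 b : 0 <= b < gamma alpha ->
  forall x, x != 0 -> 0 < dot2 (alpha x - b *: T2 x) x.
Proof.
move=> /andP[b0 bg].
have [] := inv_sqrt_spec (le_lt_trans b0 bg).
move: bg; rewrite /gamma; set S := inv_sqrt alpha => bg [SC S0] SS.
have aK : cancel alpha alpha^-1%VF by apply/lker0_lfunK/posdef_lker0.
have aVK : cancel alpha^-1%VF alpha by apply/lker0_lfunVK/posdef_lker0.
have SS' x : S (S x) = alpha^-1%VF x by rewrite -SS lfunE.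
have Sinj x y : S x = S y -> x = y.
  by move=> h; rewrite -[x]aVK -[y]aVK -!SS' h.
have SaS x : S (alpha (S x)) = x by apply: Sinj; rewrite SS' aK.
have Tlin k x y z : dot2 (T2 (k *: x + y)) z = k * dot2 (T2 x) z + dot2 (T2 y) z.
  by rewrite linearP dot2_lin.
have alin k x y z : dot2 (alpha (k *: x + y)) z = k * dot2 (alpha x) z + dot2 (alpha y) z.
  by rewrite linearP dot2_lin.
have TC x y : dot2 (T2 x) y = dot2 (T2 y) x by rewrite T2_sym dot2C.
have aC' x y : dot2 (alpha x) y = dot2 (alpha y) x by rewrite aC dot2C.
move=> x x0.
have [M [v [v0 hM leM]]] := max_generalized_eigenvalue Tlin alin TC aC' a0 (ex_intro _ x x0).
pose E := [set l | passmx.leigenvalue (S \o T2 \o S)%VF l].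
have EM : E M.
  have v0' : alpha v != 0 by apply: contra v0 => /eqP h; rewrite -[v]aK h linear0.
  have Tv : T2 v = M *: alpha v.
    apply/eqP; rewrite -subr_eq0; apply/eqP; apply: dot2_nondeg => y.
    by rewrite dot2Bl dot2Zl hM subrr.
  apply/negP => /lker0P inj; move/negP: v0; apply; apply/eqP.
  rewrite -[v]aK -SS'; suff -> : S (alpha v) = 0 by rewrite linear0.
  apply: inj; rewrite linear0.
  rewrite !lfunE /= !lfunE /= !lfunE /= !lfunE /= SS' aK Tv linearZ /= subrr //.
have Eub : ubound E M.
  move=> l; rewrite /E /= /passmx.leigenvalue => hl.
  have [z z0 hz] : exists2 z, z != 0 & S (T2 (S z)) = l *: z.
    apply: contrapT => no; move/negP: hl; apply; apply/lker0P => y y' hy.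
    apply/eqP; rewrite -subr_eq0; apply/negPn/negP => yy'; apply: no; exists (y - y') => //.
    move: hy => /eqP; rewrite -subr_eq0 -linearB /= => /eqP.
    rewrite !lfunE /= !lfunE /= !lfunE /= !lfunE /= => /eqP; rewrite subr_eq0.
    by move=> /eqP.
  have := leM (S z).
  rewrite -[X in _ <= _ * X]SC SaS -[X in X <= _]SC hz dot2Zl.
  by rewrite ler_pM2r// dot2_gt0.
have Mle : M <= largest_eigenvalue (S \o T2 \o S)%VF.
  by apply: ub_le_sup => //; exists M.
move: bg Mle; set L := largest_eigenvalue _ => bg Mle.
have L0 : 0 < L by rewrite -invr_gt0; exact: le_lt_trans bg.
have bL : b * L < 1 by rewrite -ltr_pdivlMr// div1r.
rewrite dot2Bl dot2Zl subr_gt0.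
have ax := a0 x0.
apply: (@le_lt_trans _ _ (b * (L * dot2 (alpha x) x))).
  rewrite ler_wpM2l// (le_trans (leM x))// ler_wpM2r// ltW//.
by rewrite mulrA -[ltRHS]mul1r ltr_pM2r.
Qed.

Variables (e1T e2T : Sym2 R).
Hypothesis det0 : \det (vsval (e2T - e1T)) <= 0.
Local Notation gs := (gamma_star alpha alpha).
Local Notation phi0 := (phi0 alpha alpha e1T e2T).
Local Notation phi := (phi alpha alpha e1T e2T).
Local Notation regime0 := (regime0 alpha alpha e1T e2T).

Let gsE : gs = gamma alpha. Proof. by rewrite /gamma_star minxx. Qed.

Let c := alpha (e2T - e1T).

Lemma alpha_E b d x : alpha_ alpha alpha b d x = alpha x - b *: T2 x.
Proof.
by rewrite /alpha_ !lfunE /= !lfunE /= !lfunE /= -scalerDl subrK scale1r.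
Qed.

Lemma alpha_lker0 b d : 0 <= b < gs -> lker (alpha_ alpha alpha b d) == 0%VS.
Proof.
rewrite gsE => hb; apply: posdef_lker0 => x x0; rewrite alpha_E.
exact: posdef_sub_T2.
Qed.

Lemma evec_eq e : evec alpha alpha e1T e2T e = c.
Proof. have E x y : alpha (x - y) = alpha x - alpha y by exact: linearB.
by rewrite /evec /c !E opprB addrA addrNK. Qed.

(* [phi0] is half the quadratic form of [T2] at [(alpha - b T2)^-1 c]. *)
Let X b d := (alpha_ alpha alpha b d)^-1%VF c.

Lemma X_spec b d : 0 <= b < gs -> alpha (X b d) - b *: T2 (X b d) = c.
Proof.
by move=> hb; rewrite -(alpha_E b d) /X lker0_lfunVK// alpha_lker0.
Qed.

Lemma phi0E b d e : phi0 b d e = 2^-1 * dot2 (T2 (X b d)) (X b d).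
Proof. by rewrite /Defs.phi0 evec_eq det_dot2. Qed.

Lemma T2_increment x x' b b' : b != b' ->
  alpha x - b *: T2 x = alpha x' - b' *: T2 x' ->
  2^-1 * dot2 (T2 x') x' - 2^-1 * dot2 (T2 x) x = 2^-1 * (b' - b)^-1 *
    (dot2 (alpha (x' - x) - b *: T2 (x' - x)) (x' - x) +
     dot2 (alpha (x' - x) - b' *: T2 (x' - x)) (x' - x)).
Proof.
move=> bb hx.
have E k y z : dot2 (alpha y - k *: T2 y) z = dot2 (alpha y) z - k * dot2 (T2 y) z.
  by rewrite dot2Bl dot2Zl.
have h z : dot2 (alpha x) z - b * dot2 (T2 x) z = dot2 (alpha x') z - b' * dot2 (T2 x') z.
  by rewrite -!E hx.
have := h x; have := h x'.
rewrite !E (dot2_selfadj_sub _ _ aC) (dot2_selfadj_sub _ _ T2_sym).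
have -> : dot2 (alpha x') x = dot2 (alpha x) x' by rewrite aC dot2C.
have -> : dot2 (T2 x') x = dot2 (T2 x) x' by rewrite T2_sym dot2C.
move: (dot2 (alpha x) x) (dot2 (alpha x) x') (dot2 (alpha x') x') => a11 a12 a22.
move: (dot2 (T2 x) x) (dot2 (T2 x) x') (dot2 (T2 x') x') => t11 t12 t22 h2 h1.
have k0 : b' - b != 0 by rewrite subr_eq0 eq_sym.
apply: (mulfI k0).
rewrite (_ : (b' - b) * (2^-1 / (b' - b) * _) = 2^-1 * ((b' - b) * (b' - b)^-1) *
  ((a22 - 2 * a12 + a11 - b * (t22 - 2 * t12 + t11)) +
   (a22 - 2 * a12 + a11 - b' * (t22 - 2 * t12 + t11)))); last by ring.
rewrite mulfV// mulr1.
have -> : a22 = a12 - b * t12 + b' * t22 by rewrite h2 subrK.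
have -> : a12 = a11 - b * t11 + b' * t12 by rewrite h1 subrK.
by field.
Qed.

Lemma phi0_increment b b' d d' e : 0 <= b -> b < b' -> b' < gs ->
  let y := X b' d' - X b d in
  phi0 b' d' e - phi0 b d e = 2^-1 * (b' - b)^-1 *
    (dot2 (alpha y - b *: T2 y) y + dot2 (alpha y - b' *: T2 y) y).
Proof.
move=> b0 bb' b'g.
have hx := X_spec d (introT andP (conj b0 (lt_trans bb' b'g))).
have hx' := X_spec d' (introT andP (conj (le_trans b0 (ltW bb')) b'g)).
rewrite !phi0E; apply: T2_increment; first by rewrite lt_eqF.
by rewrite hx hx'.
Qed.

Lemma phi0_nondecreasing b b' d e : 0 <= b -> b <= b' -> b' < gs ->
  phi0 b d e <= phi0 b' d e.
Proof.
move=> b0; rewrite le_eqVlt => /predU1P[->//|bb'] b'g.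
rewrite -subr_ge0 (phi0_increment d d e b0 bb' b'g).
apply: mulr_ge0; first by rewrite mulr_ge0 ?invr_ge0 ?subr_ge0 ?(ltW bb').
have p z b1 : 0 <= b1 < gs -> 0 <= dot2 (alpha z - b1 *: T2 z) z.
  rewrite gsE => hb; have [->|z0] := eqVneq z 0; first by rewrite dot2_0r.
  by rewrite ltW// posdef_sub_T2.
by apply: addr_ge0; apply: p; rewrite ?b0 ?(lt_trans bb')// (le_trans b0)// ltW.
Qed.

Lemma phi0_0 d e : 0 < gs -> phi0 0 d e = - \det (vsval (e2T - e1T)).
Proof.
move=> g0; rewrite /Defs.phi0 evec_eq.
have := X_spec d (b := 0); rewrite lexx g0 => /(_ isT).
rewrite scale0r subr0 => h.
have /lker0P ainj := posdef_lker0 a0.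
by have := ainj _ _ h; rewrite /X => ->.
Qed.

Lemma phi0_flat b d e : 0 < b < gs -> phi0 b d e = phi0 0 d e ->
  forall b' d' e', 0 <= b' < gs -> phi0 b' d' e' = phi0 0 d e.
Proof.
move=> /andP[b0 bg] E b' d' e' hb'; have g0 := lt_trans b0 bg.
have h0 : 0 <= (0 : R) < gs by rewrite lexx.
have hb : 0 <= b < gs by rewrite ltW.
pose y := X b d - X 0 d.
have p z b1 : 0 <= b1 < gs -> z != 0 -> 0 < dot2 (alpha z - b1 *: T2 z) z.
  by rewrite gsE => hb1 z0; exact: posdef_sub_T2.
have y0 : y = 0.
  apply/eqP/negPn/negP => y0.
  have := phi0_increment d d e (lexx 0) b0 bg; rewrite E subrr => /esym/eqP.
  rewrite mulf_eq0 gt_eqF/=; last by rewrite mulr_gt0 ?invr_gt0 ?subr_gt0.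
  by rewrite gt_eqF// addr_gt0 ?p.
have xx : X b d = X 0 d by apply/eqP; rewrite -subr_eq0 -/y y0.
have e0 := X_spec d h0; have eb := X_spec d hb.
have T0 : T2 (X 0 d) = 0.
  move: eb; rewrite xx -e0 scale0r subr0 => /eqP; rewrite subr_eq addrC -subr_eq subrr.
  by rewrite eq_sym scaler_eq0 gt_eqF//= => /eqP.
have eX : X b' d' = X 0 d.
  have /lker0P ainj := alpha_lker0 d' hb'; apply: ainj.
  have -> : alpha_ alpha alpha b' d' (X b' d') = c by rewrite alpha_E; exact: X_spec.
  by rewrite alpha_E T0 scaler0 subr0 -e0 scale0r subr0.
by rewrite !phi0E eX.
Qed.

Lemma phi_lt_gs b d e : b < gs -> phi b d e = (phi0 b d e)%:E.
Proof. by move=> bg; rewrite /Defs.phi lt_eqF. Qed.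

Lemma phi_gs_ge b d e : 0 <= b < gs -> (phi b d e <= phi gs d e)%E.
Proof.
move=> /andP[b0 bg]; rewrite phi_lt_gs// /Defs.phi eqxx.
have cv : cvg ((phi0 x d e)%:E @[x --> gs^'-]).
  suff : cvg (((fun x : R => (phi0 x d e)%:E) \o -%R) x @[x --> (- gs)^'+]).
    by move=> /cvg_ex[l hl]; apply/cvg_ex; exists l; apply/cvg_at_leftNP.
  apply: nonincreasing_at_right_is_cvge; near=> z => t t' /=.
  rewrite !in_itv/= => /andP[t1 t2] /andP[t'1 t'2] tt'.
  rewrite lee_fin; apply: phi0_nondecreasing.
  - rewrite oppr_ge0 (le_trans (ltW t'2))//.
    near: z; apply: nbhs_right_le; rewrite oppr_lt0; exact: le_lt_trans bg.
  - by rewrite lerN2.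
  - by rewrite ltrNl.
apply: lime_ge => //; near=> t; rewrite lee_fin; apply: phi0_nondecreasing => //.
by near: t; exact: nbhs_left_ge.
Unshelve. all: by end_near. Qed.

(* [phi] is nondecreasing on [0, gs] and nonnegative at [0]; if it vanishes both
   at [0] and at some positive point, it vanishes identically (Regime 0). *)
Lemma beta_star_eq0 d e : beta_star alpha alpha e1T e2T d e = 0.
Proof.
rewrite /beta_star; case: asboolP => // nr0.
have gs0 : 0 <= gs.
  rewrite leNgt; apply/negP => g0; apply: nr0 => b /andP[b0 bg].
  by have := lt_le_trans g0 (le_trans b0 bg); rewrite ltxx.
case: ifP => // p0.
move: gs0; rewrite le_eqVlt => /predU1P[g0|g0].
  case: ifP => // _; rewrite /beta_II; case: xgetP => // b _ [+ _].
  by rewrite -g0 => hb; apply/eqP; rewrite eq_le andbC.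
have ph0 : phi 0 d e = 0%E.
  rewrite phi_lt_gs// phi0_0//; apply/eqP; rewrite eqe oppr_eq0.
  rewrite eq_le det0/= leNgt; apply/negP => h; move: p0.
  by rewrite phi_lt_gs// phi0_0// lte_fin oppr_gt0 h.
have -> : (0 <= phi gs d e)%E by rewrite -ph0; apply: phi_gs_ge; rewrite lexx.
rewrite /beta_II; case: xgetP => // b _ [/andP[b0 bg] pb].
apply/eqP/negPn/negP => bn0; apply: nr0.
have {bn0 b0} b0 : 0 < b by rewrite lt_neqAle eq_sym bn0.
have flat b1 : 0 < b1 < gs -> phi b1 d e = 0%E -> forall b', 0 <= b' < gs -> phi b' d e = 0%E.
  move=> hb1 pb1 b' hb'; have /andP[_ b1g] := hb1; have /andP[_ b'g] := hb'.
  have E : phi0 b1 d e = phi0 0 d e.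
    by move: pb1 ph0; rewrite (phi_lt_gs d e b1g) (phi_lt_gs d e g0) => -[->] [->].
  by rewrite (phi_lt_gs d e b'g) (phi0_flat hb1 E d e hb') -(phi_lt_gs d e g0).
have {flat} flat b' : 0 <= b' < gs -> phi b' d e = 0%E.
  move: bg; rewrite le_eqVlt => /predU1P[E|bg]; last by apply: (flat b) => //; rewrite b0 bg.
  move=> hb'; have /andP[b'0 b'g] := hb'; apply/eqP; rewrite eq_le; apply/andP; split.
    by rewrite -pb E; exact: phi_gs_ge.
  by rewrite -ph0 !phi_lt_gs// lee_fin phi0_nondecreasing.
move=> b' /andP[b'0]; rewrite le_eqVlt => /predU1P[->|b'g]; last by apply: flat; rewrite b'0.
rewrite /Defs.phi eqxx; apply: cvg_lim => //; apply: (@cvg_near_cst _ _ _ _ (at_left gs)).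
near=> t; rewrite -phi_lt_gs; last by near: t; exact: nbhs_left_lt.
apply: flat; apply/andP; split; last by near: t; exact: nbhs_left_lt.
by near: t; exact: nbhs_left_ge.
Unshelve. all: by end_near. Qed.

End BetaStar.

Section Symp.
Context {R : realType} {n : nat}.
Implicit Types A B : 'M[R]_n.

Lemma symp_lin k A B : symp (k *: A + B) = k *: symp A + symp B.
Proof. by rewrite /symp; apply/matrixP => i j; rewrite !mxE; ring. Qed.

Lemma symp_tr A : (symp A)^T = symp A.
Proof. by apply/matrixP => i j; rewrite !mxE addrC. Qed.

Lemma symp_id A : A^T = A -> symp A = A.
Proof. by move=> h; rewrite /symp h; apply/matrixP => i j; rewrite !mxE; field. Qed.

End Symp.

Lemma quadratic_What1 {R : realType} (alpha e1T e2T w1 w2 : R) : 0 < alpha ->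
  quadratic_energy (@symp R 1)
    (fun d e => What1 alpha alpha e1T e2T w1 w2 d (e ord0 ord0))
    (fun x y => alpha * x ord0 ord0 * y ord0 ord0)
    (const_mx e2T) (const_mx (e1T - e2T)) w2 (w1 - w2).
Proof.
move=> a0; split.
- exact: symp_lin.
- by move=> A; exact/symp_id/symp_tr.
- by move=> k x y z; rewrite !mxE; ring.
- by move=> x y; rewrite mulrAC.
- by move=> x; rewrite -mulrA -expr2 mulr_ge0 ?sqr_ge0// ltW.
- move=> A /eqP; rewrite -mulrA mulf_eq0 gt_eqF//= mulf_eq0 orbb => /eqP h.
  by apply/matrixP => i j; rewrite !ord1 h mxE.
- move=> d A; rewrite /What1 !mxE; move: (symp A ord0 ord0) => s.
  have -> : (1 - d) * alpha + d * alpha = alpha by ring.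
  by field; rewrite gt_eqF.
Qed.

Section Energy3.
Context {R : realType}.
Implicit Types x y z : 'cV[R]_2.

Lemma posdef_unitmx (alpha : 'M[R]_2) : posdef alpha -> alpha \in unitmx.
Proof.
move=> ap; rewrite unitmxE unitfE; apply/det0P => -[v v0 va].
have vT0 : v^T != 0 by apply: contra v0 => /eqP h; rewrite -[v]trmxK h trmx0.
have := ap _ vT0; rewrite /frob trmx_mul trmxK -mxtrace_tr !trmx_mul !trmxK mulmxA.
by rewrite va mul0mx mxtrace0 ltxx.
Qed.

Lemma quadratic_What3 (alpha : 'M[R]_2) (f1T f2T : 'cV[R]_2) (w1 w2 : R) :
  posdef alpha ->
  quadratic_energy (@id 'M[R]_(1, 2))
    (fun d (f : 'M[R]_(1, 2)) => What3 alpha alpha f1T f2T w1 w2 d f^T)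
    (fun x y : 'M[R]_(1, 2) => 2^-1 * (frob (alpha *m x^T) y^T + frob (alpha *m y^T) x^T))
    f2T^T (f1T - f2T)^T w2 (w1 - w2).
Proof.
move=> ap; have au := posdef_unitmx ap.
have frobC (x y : 'cV[R]_2) : frob x y = frob y x.
  by rewrite !frobE; apply: eq_bigr => j _; apply: eq_bigr => i _; rewrite mulrC.
have frobDl k (x y z : 'cV[R]_2) : frob (k *: x + y) z = k * frob x z + frob y z.
  rewrite !frobE mulr_sumr -big_split; apply: eq_bigr => j _ /=.
  by rewrite mulr_sumr -big_split; apply: eq_bigr => i _ /=; rewrite !mxE; ring.
split => //.
- move=> k x y z; rewrite linearP /= mulmxDr -scalemxAr frobDl.
  by rewrite (frobC _ (k *: x^T + y^T)) frobDl !(frobC _ (alpha *m z^T)); ring.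
- by move=> x y; rewrite addrC.
- move=> x; have [->|x0] := eqVneq x^T 0.
    by rewrite mulmx0 /frob !mulmx0 mxtrace0 addr0 mulr0.
  by rewrite mulr_ge0 ?invr_ge0 ?addr_ge0 ?ltW ?ap.
- move=> A h; apply/eqP/negPn/negP => A0.
  have AT0 : A^T != 0 by apply: contra A0 => /eqP h'; rewrite -[A]trmxK h' trmx0.
  by move: h (ap _ AT0) => /=; lra.
- move=> d A; rewrite /What3.
  have -> : (1 - d) *: alpha + d *: alpha = alpha by rewrite -scalerDl subrK scale1r.
  have E x : invmx alpha *m (alpha *m x) = x by rewrite mulmxA mulVmx// mul1mx.
  rewrite -mulmxBr.
  have -> : alpha *m A^T - (1 - d) *: (alpha *m (f2T - f1T)) =
      alpha *m (A^T - (1 - d) *: (f2T - f1T)) by rewrite [RHS]mulmxBr -scalemxAr.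
  have -> : alpha *m A^T + d *: (alpha *m (f2T - f1T)) =
      alpha *m (A^T + d *: (f2T - f1T)) by rewrite [RHS]mulmxDr -scalemxAr.
  rewrite !E.
  set s := (A - f2T^T - d *: (f1T - f2T)^T)^T.
  have -> : A^T - (1 - d) *: (f2T - f1T) - f1T = s.
    by apply/matrixP => i j; rewrite !mxE; ring.
  have -> : A^T + d *: (f2T - f1T) - f2T = s.
    by apply/matrixP => i j; rewrite !mxE; ring.
  by move: (frob _ _) => q; field.
Qed.

End Energy3.

Section Energy2.
Context {R : realType}.

Lemma What2_equal_moduli (alpha : 'End(Sym2 R)) (e1T e2T : Sym2 R) (w1 w2 d : R) e :
  sym_posdef alpha -> \det (vsval (e2T - e1T)) <= 0 ->
  What2 alpha alpha e1T e2T w1 w2 d e =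
  2^-1 * dot2 (alpha (e - e2T - d *: (e1T - e2T))) (e - e2T - d *: (e1T - e2T))
  + (w2 + (w1 - w2) * d).
Proof.
move=> ap hdet; have [_ a0] := ap.
rewrite /What2 /eps1_star /eps2_star beta_star_eq0// !mul0r addr0.
have aE x : alpha_ alpha alpha 0 d x = alpha x by rewrite alpha_E scale0r subr0.
have l0 : lker (alpha_ alpha alpha 0 d) == 0%VS.
  by apply: posdef_lker0 => x x0; rewrite aE; exact: a0.
have K x : (alpha_ alpha alpha 0 d)^-1%VF (alpha x) = x by rewrite -aE lker0_lfunK.
have bE x : (alpha - 0 *: T2) x = alpha x by rewrite scale0r subr0.
have aB x y : alpha (x - y) = alpha x - alpha y by exact: linearB.
have aZ k x y : alpha (x + k *: y) = alpha x + k *: alpha y by rewrite addrC linearP addrC.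
rewrite !bE -aB -scaleNr -!aZ !K /Wphase2.
set s := e - e2T - d *: (e1T - e2T).
have -> : e + - (1 - d) *: (e2T - e1T) - e1T = s.
  apply/val_inj; rewrite /s !(linearB, linearD, linearZ) /=; apply/matrixP => i j.
  by rewrite !mxE; ring.
have -> : e + d *: (e2T - e1T) - e2T = s.
  apply/val_inj; rewrite /s !(linearB, linearD, linearZ) /=; apply/matrixP => i j.
  by rewrite !mxE; ring.
by move: (dot2 _ _) => q; ring.
Qed.

Lemma quadratic_What2 (alpha : 'End(Sym2 R)) (e1T e2T : Sym2 R) (w1 w2 : R) :
  sym_posdef alpha -> \det (vsval (e2T - e1T)) <= 0 ->
  quadratic_energy (@symp R 2)
    (fun d e => What2 alpha alpha e1T e2T w1 w2 d (vsproj (sym2v R) e))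
    (fun x y => dot2 (alpha (vsproj (sym2v R) x)) (vsproj (sym2v R) y))
    (vsval e2T) (vsval (e1T - e2T)) w2 (w1 - w2).
Proof.
move=> ap hdet; have [aC a0] := ap; split.
- exact: symp_lin.
- by move=> A; exact/symp_id/symp_tr.
- by move=> k x y z; rewrite !linearP /= dot2_lin.
- by move=> x y; rewrite aC dot2C.
- move=> x; have [->|x0] := eqVneq (vsproj (sym2v R) x) 0; first by rewrite dot2_0r.
  by rewrite ltW// a0.
- move=> A h; have hA : symp A \in sym2v R by apply/sym2vP; exact: symp_tr.
  rewrite -(vsprojK hA); have [->|x0] := eqVneq (vsproj (sym2v R) (symp A)) 0.
    by rewrite linear0.
  by have := a0 _ x0; rewrite h ltxx.
- move=> d A; rewrite What2_equal_moduli//.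
  have -> // : vsproj (sym2v R) (symp A - vsval e2T - d *: vsval (e1T - e2T)) =
    vsproj (sym2v R) (symp A) - e2T - d *: (e1T - e2T).
  have pB x y : vsproj (sym2v R) (x - y) = vsproj _ x - vsproj _ y by exact: linearB.
  have pZ k x : vsproj (sym2v R) (k *: x) = k *: vsproj _ x by exact: linearZ.
  by move: (symp A) => B; rewrite !pB pZ !vsvalK.
Qed.

End Energy2.

Theorem theorem6 (R : realType) (Tf lambda theta kappa1 kappa2 : R)
    (Tf_gt0 : 0 < Tf) (lambda_gt0 : 0 < lambda) (theta_gt0 : 0 < theta)
    (kappa1_gt0 : 0 < kappa1) (kappa2_gt0 : 0 < kappa2) :
  [/\ (* D = 1 *)
      forall (Omega : set 'rV[R]_1) (sigma_ext : 'M[R]_1)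
        (alpha1 alpha2 e1T e2T w1 w2 : R),
        lipschitz_domain Omega ->
        0 < alpha1 -> 0 < alpha2 -> 0 <= w1 -> 0 <= w2 ->
        alpha1 = alpha2 ->
        unique_weak_solution lebesgue_measure (@pos1 R) Omega Tf
          lambda theta kappa1 kappa2 (@symp R 1)
          (fun d e => What1 alpha1 alpha2 e1T e2T w1 w2 d (e ord0 ord0))
          sigma_ext,
      (* D = 2 *)
      forall (Omega : set 'rV[R]_2) (sigma_ext : 'M[R]_2)
        (alpha1 alpha2 : 'End(Sym2 R)) (e1T e2T : Sym2 R) (w1 w2 : R),
        lipschitz_domain Omega -> sigma_ext^T = sigma_ext ->
        sym_posdef alpha1 -> sym_posdef alpha2 -> 0 <= w1 -> 0 <= w2 ->
        alpha1 = alpha2 ->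
        \det (vsval (e2T - e1T)) <= 0 ->
        condC1 alpha1 alpha2 e1T e2T ->
        condC2 alpha1 alpha2 e1T e2T ->
        unique_weak_solution (@lebesgue2 R)
          (@pos2 R) Omega Tf
          lambda theta kappa1 kappa2 (@symp R 2)
          (fun d e => What2 alpha1 alpha2 e1T e2T w1 w2 d
                        (vsproj (sym2v R) e))
          sigma_ext &
      (* D = 3, scalar setting, on the cross-section Omega *)
      forall (Omega : set 'rV[R]_2) (sigma_ext : 'M[R]_3)
        (alpha1 alpha2 : 'M[R]_2) (f1T f2T : 'cV[R]_2) (w1 w2 : R),
        lipschitz_domain Omega -> sigma_ext^T = sigma_ext ->
        posdef alpha1 -> posdef alpha2 -> 0 <= w1 -> 0 <= w2 ->
        alpha1 = alpha2 ->
        unique_weak_solution (@lebesgue2 R)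
          (@pos2 R) Omega Tf
          lambda theta kappa1 kappa2 (@id 'M[R]_(1, 2))
          (fun d f => What3 alpha1 alpha2 f1T f2T w1 w2 d f^T)
          (\row_(j < 2) sigma_ext ord_max (lift ord_max j))].
Proof.
split.
- move=> Om sig alpha1 alpha2 e1T e2T w1 w2 lOm a0 _ _ _ <-.
  have [Om0 oOm cOm bOm _] := lOm.
  apply: (unique_of_rigid (@chart1 R) lOm) => //; first exact: quadratic_What1.
  exact: rigid_symp1.
- move=> Om sig alpha1 alpha2 e1T e2T w1 w2 lOm _ a0 _ _ _ <- hdet _ _.
  have [Om0 oOm cOm bOm _] := lOm.
  apply: (unique_of_rigid (@chart2 R) lOm) => //; first exact: quadratic_What2.
  exact: rigid_symp2.
- move=> Om sig alpha1 alpha2 f1T f2T w1 w2 lOm _ a0 _ _ _ <-.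
  have [Om0 oOm cOm bOm _] := lOm.
  apply: (unique_of_rigid (@chart2 R) lOm) => //; first exact: quadratic_What3.
  exact: rigid_id2.
Qed.
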